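(* Let $M^2$ be a closed surface immersed in the unit sphere $\mathbb{S}^N$ with parallel mean curvature vector. Assume that $\tilde S$ is constant and equal to one of the values $$0,\quad \tfrac43 c,\quad \tfrac53 c,\quad \tfrac95 c,\quad\dots,\quad \frac{2(s-1)(s+2)}{s(s+1)}\,c,\quad\dots\qquad (s=1,2,3,\dots).$$ Then, after passing to the orientable double cover if necessary, $M$ is one of the following: (1) $K=1+H^2$, and in this case $M$ is totally umbilical in $\mathbb{S}^N$; (2) $K=\frac{2(1+H^2)}{s(s+1)}$ for some $s\in\{2,3,4,\dots\}$, and then $M$ is obtained from Calabi's $2$-sphere $$\Psi_s: S^2\!\left(\tfrac{2c}{s(s+1)}\right)\to \mathbb{S}^{2s}(c)\subset \mathbb{S}^N,$$ where the last inclusion is totally umbilical.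
   Context: $\mathbb{S}^N$ is the unit sphere in $\mathbb{R}^{N+1}$. A closed surface is a compact connected smooth $2$-manifold without boundary, here with a smooth immersion into $\mathbb{S}^N$ and the induced Riemannian metric $g$; $K$ is its Gaussian curvature. $h$ is the second fundamental form, $\mathbf{H}=\frac12\operatorname{tr}_g h$ the mean curvature vector field, $H=|\mathbf{H}|$. ''Parallel mean curvature vector'' means $\nabla^\perp\mathbf{H}=0$ for the normal connection; then $H$ is constant. Set $c=1+H^2$, $\tilde h=h-\mathbf{H}g$ (traceless second fundamental form), $\tilde S=|\tilde h|^2=|h|^2-2H^2$; the Gauss equation reads $2K=2c-\tilde S$. $S^2(\kappa)$ denotes the $2$-sphere with a metric of constant curvature $\kappa$, and $\mathbb{S}^{m}(c)$ denotes the round $m$-sphere of constant sectional curvature $c$ (radius $1/\sqrt c$ in $\mathbb{R}^{m+1}$). Calabi's $2$-sphere $\Psi_s:S^2(\frac{2c}{s(s+1)})\to\mathbb{S}^{2s}(c)$ is the isometric minimal immersion whose image is not contained in any hyperplane of $\mathbb{R}^{2s+1}$; it is unique up to rigid motion and its $2s+1$ components are a suitably normalized basis of the spherical harmonics of order $s$. ''$M$ is obtained from $\Psi_s$'' means that its immersion coincides, up to rigid motion, with $\Psi_s$ followed by the totally umbilical inclusion. *)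

(* Defs.v *)
From HB Require Import structures.
From mathcomp Require Import all_boot all_order all_algebra.
From mathcomp Require Import all_classical all_reals all_analysis.

Set Implicit Arguments.
Unset Strict Implicit.
Unset Printing Implicit Defensive.

Import Order.TTheory GRing.Theory Num.Theory.
Import numFieldNormedType.Exports.

Local Open Scope classical_set_scope.
Local Open Scope ring_scope.

(* The library norm on 'rV[R]_n is the sup norm; it is used here only for the
   topology and for derivatives. Lengths and angles come from [dot]. *)
Definition dot (R : realType) (m : nat) (u v : 'rV[R]_m) : R :=
  \sum_(k < m) u 0 k * v 0 k.

(* The round sphere S^n(k) of sectional curvature k > 0, of radius k^(-1/2). *)
Definition sphere (R : realType) (n : nat) (k : R) : set 'rV[R]_n.+1 :=
  [set x | dot x x = k^-1].
Arguments sphere {R} n k.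

Definition partial (R : realType) (n : nat) (V : normedModType R) (i : 'I_n)
    (F : 'rV[R]_n -> V) : 'rV[R]_n -> V :=
  fun x => 'D_(delta_mx 0 i) F x.

(* C^oo on an open set: the iterated partial derivatives of every order exist
   and are differentiable. *)
Definition smooth_on (R : realType) (n : nat) (V : normedModType R)
    (U : set 'rV[R]_n) (F : 'rV[R]_n -> V) : Prop :=
  forall (s : seq 'I_n) (x : 'rV[R]_n), U x ->
    differentiable (foldr (fun i G => partial i G) F s) x.

(* Local geometry of an immersed patch X : U -> R^m, U open in R^n, at a point
   of U. In the definitions that involve [normal_part], X takes its values in a
   round sphere centred at the origin, and normality refers to that sphere. *)
Section Patch.
Context {R : realType} {n m : nat}.
Implicit Types (X : 'rV[R]_n -> 'rV[R]_m) (x : 'rV[R]_n).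

Definition immersive_at X x : Prop :=
  row_free (\matrix_(i < n) partial i X x).

Definition metric X x : 'M[R]_n :=
  \matrix_(i < n, j < n) dot (partial i X x) (partial j X x).

Definition imetric X x : 'M[R]_n := invmx (metric X x).

(* Orthogonal projection of v onto the orthogonal complement of
   span (d_1 X, ..., d_n X, X), that is, onto the normal space of the patch
   inside the sphere. *)
Definition normal_part X x (v : 'rV[R]_m) : 'rV[R]_m :=
  v - \sum_(k < n) \sum_(l < n)
        (imetric X x k l * dot v (partial k X x)) *: partial l X x
    - (dot v (X x) / dot (X x) (X x)) *: X x.

Definition sff X x (i j : 'I_n) : 'rV[R]_m :=
  normal_part X x (partial i (partial j X) x).

Definition mean_curv_vec X x : 'rV[R]_m :=
  n%:R^-1 *: \sum_(i < n) \sum_(j < n) imetric X x i j *: sff X x i j.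

Definition mean_curv X x : R :=
  Num.sqrt (dot (mean_curv_vec X x) (mean_curv_vec X x)).

Definition normal_connection X (xi : 'rV[R]_n -> 'rV[R]_m) (i : 'I_n) x :
  'rV[R]_m := normal_part X x (partial i xi x).

Definition parallel_mean_curv X x : Prop :=
  forall i : 'I_n, normal_connection X (mean_curv_vec X) i x = 0.

Definition traceless_sff X x (i j : 'I_n) : 'rV[R]_m :=
  sff X x i j - metric X x i j *: mean_curv_vec X x.

Definition traceless_S X x : R :=
  \sum_(i < n) \sum_(j < n) \sum_(k < n) \sum_(l < n)
    imetric X x i k * imetric X x j l *
    dot (traceless_sff X x i j) (traceless_sff X x k l).

Definition umbilical_at X x : Prop :=
  forall i j : 'I_n, traceless_sff X x i j = 0.

Definition christoffel X (k i j : 'I_n) x : R :=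
  2^-1 * \sum_(l < n) imetric X x k l *
    (partial i (fun y => metric X y j l : R) x
     + partial j (fun y => metric X y i l : R) x
     - partial l (fun y => metric X y i j : R) x).

(* The components of the curvature tensor:
   R(d_i, d_j) d_k = \sum_l (riemann X l i j k) d_l. *)
Definition riemann X (l i j k : 'I_n) x : R :=
  partial i (christoffel X l j k) x - partial j (christoffel X l i k) x
  + \sum_(p < n) (christoffel X l i p x * christoffel X p j k x
                  - christoffel X l j p x * christoffel X p i k x).

End Patch.

(* K = <R(d_1, d_2) d_2, d_1> / det g. *)
Definition gauss_curv (R : realType) (m : nat) (X : 'rV[R]_2 -> 'rV[R]_m)
    (x : 'rV[R]_2) : R :=
  (\sum_(l < 2) riemann X l ord0 ord_max ord_max x * metric X x l ord0)
  / \det (metric X x).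

Record chart (R : realType) (M : topologicalType) := Chart {
  chart_dom : set M;
  chart_img : set 'rV[R]_2;
  coord : M -> 'rV[R]_2;
  param : 'rV[R]_2 -> M;
  chart_dom_open : open chart_dom;
  chart_img_open : open chart_img;
  coord_img : forall p, chart_dom p -> chart_img (coord p);
  param_dom : forall x, chart_img x -> chart_dom (param x);
  coordK : forall p, chart_dom p -> param (coord p) = p;
  paramK : forall x, chart_img x -> coord (param x) = x;
  coord_continuous : {within chart_dom, continuous coord};
  param_continuous : {within chart_img, continuous param}
}.

(* The points of the image of [a] that [a] parametrizes inside the domain of
   [b], that is, the domain of the transition map coord b \o param a. *)
Definition overlap (R : realType) (M : topologicalType) (a b : chart R M) :
    set 'rV[R]_2 :=
  chart_img a `&` param a @^-1` chart_dom b.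

Definition compatible (R : realType) (M : topologicalType) (a b : chart R M) :
    Prop :=
  smooth_on (overlap a b) (coord b \o param a) /\
  smooth_on (overlap b a) (coord a \o param b).

(* Second countability is implied by compactness and the existence of charts. *)
Record closed_surface (R : realType) := ClosedSurface {
  surface_space :> topologicalType;
  atlas : set (chart R surface_space);
  surface_nonempty : [set: surface_space] !=set0;
  surface_hausdorff : hausdorff_space surface_space;
  surface_compact : compact [set: surface_space];
  surface_connected : connected [set: surface_space];
  atlas_cover : forall p, exists2 a, atlas a & chart_dom a p;
  atlas_compatible : forall a b, atlas a -> atlas b -> compatible a b
}.

Section Surface.
Context {R : realType}.
Implicit Types (M : closed_surface R).

Definition orientable M : Prop :=
  exists B : set (chart R M),
    [/\ forall p, exists2 b, B b & chart_dom b p,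
        forall a b, atlas a -> B b -> compatible a b &
        forall a b, B a -> B b -> forall x, overlap a b x ->
          0 < \det (jacobian (coord b \o param a) x)].

(* Smoothness on an open subset V of M of a map into another surface. *)
Definition smooth_map_on M M' (V : set M) (phi : M -> M') : Prop :=
  {within V, continuous phi} /\
  forall a b, @atlas R M a -> @atlas R M' b ->
    smooth_on
      (chart_img a `&` param a @^-1` (V `&` phi @^-1` chart_dom b))
      (coord b \o phi \o param a).

(* A two-sheeted smooth covering: near every point there is an open set V whose
   preimage is the disjoint union of the images of two smooth sections over V,
   both of them open. *)
Definition double_covering M' M (pi : M' -> M) : Prop :=
  smooth_map_on setT pi /\
  forall p : M, exists (V : set M) (sigma : bool -> M -> M'),
    [/\ open V, V p,
        forall b, [/\ open (sigma b @` V), smooth_map_on V (sigma b) &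
                      forall q, V q -> pi (sigma b q) = q],
        pi @^-1` V = sigma true @` V `|` sigma false @` V &
        sigma true @` V `&` sigma false @` V = set0].

(* A pointwise property of the map f : M -> R^m, read in every chart. *)
Definition everywhere M (m : nat) (f : M -> 'rV[R]_m)
    (P : ('rV[R]_2 -> 'rV[R]_m) -> 'rV[R]_2 -> Prop) : Prop :=
  forall a, @atlas R M a -> forall x, chart_img a x -> P (f \o param a) x.

Definition smooth_into M (m : nat) (f : M -> 'rV[R]_m) : Prop :=
  forall a, @atlas R M a -> smooth_on (chart_img a) (f \o param a).

Definition sphere_immersion M (N : nat) (f : M -> 'rV[R]_N.+1) : Prop :=
  [/\ forall p, sphere N 1 (f p), smooth_into f &
      everywhere f (fun X x => immersive_at X x)].

(* An isometry of M, with the metric induced by f, onto the round S^2(k). *)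
Definition isometry_onto_sphere M (m : nat) (f : M -> 'rV[R]_m) (k : R)
    (theta : M -> 'rV[R]_3) : Prop :=
  [/\ set_bij [set: M] (sphere 2 k) theta, smooth_into theta &
      forall a, @atlas R M a -> forall x, chart_img a x ->
        metric (theta \o param a) x = metric (f \o param a) x].

End Surface.

Section RoundSpheres.
Context {R : realType}.

(* Local parametrizations of S^n(k). Maps defined on S^n(k) are tested on all
   of them; the values of such a map off the sphere are irrelevant. *)
Definition sphere_patch (n : nat) (k : R) (U : set 'rV[R]_n)
    (X : 'rV[R]_n -> 'rV[R]_n.+1) : Prop :=
  [/\ open U, smooth_on U X &
      forall x, U x -> sphere n k (X x) /\ immersive_at X x].

Definition isometric_immersion (n m : nat) (k c : R)
    (F : 'rV[R]_n.+1 -> 'rV[R]_m.+1) : Prop :=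
  (forall y, sphere n k y -> sphere m c (F y)) /\
  forall U X, sphere_patch k U X ->
    smooth_on U (F \o X) /\
    forall x, U x -> metric (F \o X) x = metric X x.

Definition minimal (n m : nat) (k : R) (F : 'rV[R]_n.+1 -> 'rV[R]_m.+1) :
    Prop :=
  forall U X, sphere_patch k U X ->
    forall x, U x -> mean_curv_vec (F \o X) x = 0.

Definition totally_umbilical (n m : nat) (k : R)
    (F : 'rV[R]_n.+1 -> 'rV[R]_m.+1) : Prop :=
  forall U X, sphere_patch k U X -> forall x, U x -> umbilical_at (F \o X) x.

Definition in_no_hyperplane (n m : nat) (k : R)
    (F : 'rV[R]_n.+1 -> 'rV[R]_m.+1) : Prop :=
  forall (v : 'rV[R]_m.+1) (d : R), v != 0 ->
    ~ (forall y, sphere n k y -> dot (F y) v = d).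

Definition calabi_curv (s : nat) (c : R) : R := 2 * c / (s%:R * (s%:R + 1)).

Definition calabi_sphere (s : nat) (c : R)
    (Psi : 'rV[R]_3 -> 'rV[R]_(2 * s).+1) : Prop :=
  [/\ isometric_immersion (calabi_curv s c) c Psi,
      minimal (calabi_curv s c) Psi &
      in_no_hyperplane (calabi_curv s c) Psi].

Definition umbilical_inclusion (m N : nat) (c : R)
    (iota : 'rV[R]_m.+1 -> 'rV[R]_N.+1) : Prop :=
  [/\ isometric_immersion c 1 iota, totally_umbilical c iota &
      {in sphere m c &, injective iota}].

Definition obtained_from_calabi (M : closed_surface R) (N : nat)
    (f : M -> 'rV[R]_N.+1) (s : nat) (c : R) : Prop :=
  exists (theta : M -> 'rV[R]_3) (Psi : 'rV[R]_3 -> 'rV[R]_(2 * s).+1)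
         (iota : 'rV[R]_(2 * s).+1 -> 'rV[R]_N.+1) (A : 'M[R]_N.+1),
    [/\ isometry_onto_sphere f (calabi_curv s c) theta,
        calabi_sphere c Psi, umbilical_inclusion c iota,
        A *m A^T = 1%:M &
        forall p : M, f p = iota (Psi (theta p)) *m A].

Definition classified (M : closed_surface R) (N : nat)
    (f : M -> 'rV[R]_N.+1) : Prop :=
  everywhere f (fun X x =>
    gauss_curv X x = 1 + mean_curv X x ^+ 2 /\ umbilical_at X x)
  \/
  exists (s : nat) (c : R),
    [/\ (2 <= s)%N,
        everywhere f (fun X x => c = 1 + mean_curv X x ^+ 2),
        everywhere f (fun X x => gauss_curv X x =
          2 * (1 + mean_curv X x ^+ 2) / (s%:R * (s%:R + 1))) &
        obtained_from_calabi f s c].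

End RoundSpheres.

(* Main.v *)
(* Write Z = (e_1 - i e_2) / 2 for a local orthonormal frame, and eth u = Z u + m k u for a quantity u
   of weight m, where k encodes the connection; the commutator of eth and its conjugate is the weight
   times K / 2.

   Local part. With H the mean curvature vector, the weight-two quantity w = <H, eth^2 f> is killed by
   the conjugate of eth and, as K > 0, it vanishes; then y = (f - H) / c is minimal in a sphere of
   curvature c and v = f - y is constant. The ladder f_0 = y, f_(j+1) = eth f_j satisfies
   ethb f_(j+1) = - l_j f_j with l_j = c / 2 - K j (j + 1) / 4. The prescribed value of the traceless
   second fundamental form says that l_s = 0, so that f_(s+1) = 0; all scalar products of the f_j and
   their conjugates follow, and they span a constant space of dimension 2 s + 1. The infinitesimal
   rotation which turns the j-th osculating plane by the angle j is again a ladder, of spin one: it is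
   the position vector of a local isometry of M into a round sphere S of curvature K.

   Global part. Inverse local isometries S -> M extend to a uniform radius, so they can be developed
   along stereographic coordinates and glue to a local isometry of S onto M. Its deck transformations
   are orthogonal and have no fixed point unless trivial, so they are 1 or -1. If only 1 occurs, M is a
   round sphere; otherwise M is a projective plane, not orientable, covered twice by S. In both
   cases f factors through S, and the projection on the (2 s + 1)-dimensional space is Calabi's map. *)
From HB Require Import structures.
From mathcomp Require Import all_boot all_order all_algebra.
From mathcomp Require Import all_classical all_reals all_analysis.
From mathcomp Require Import ring lra zify complex.
Require Import Defs.
Set Implicit Arguments.
Unset Strict Implicit.
Unset Printing Implicit Defensive.
Import Order.TTheory GRing.Theory Num.Theory.
Import numFieldNormedType.Exports.
Local Open Scope classical_set_scope.
Local Open Scope ring_scope.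

(** * Smooth maps *)

(** Two vanishing results that are usually drawn from the genus are obtained locally. Constancy of
    |eth^2 f| makes the Ricci identity exchange [w] with its conjugate, which leads to |eth w|^2 + K
    |w|^2 = 0. For isotropy, a product of ladder vectors killed by the conjugate of eth is 0: enough
    applications of eth push it past the top of the ladder, and the conjugate of eth undoes each of
    them up to a positive factor.

    Frames replace complex coordinates, so no isothermal coordinates have to be constructed. The
    ring of functions has zero divisors: only invertible factors are cancelled, and all other
    vanishing comes from sums of squares.

    The data glue unevenly. The constants c and v and the projection onto the (2 s + 1)-dimensional
    space are determined by any open piece of M, hence are global by connectedness. The local
    isometry into the round sphere is determined only up to an orthogonal matrix and may have
    monodromy on M; this is why its inverse is developed, from the simply connected side. *)

Section Smooth.
Variables (R : realType) (n : nat).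
Implicit Types (W : set 'rV[R]_n) (x : 'rV[R]_n).

Lemma partial_near (V : normedModType R) (F G : 'rV[R]_n -> V) i x :
  (\near x, F x = G x) -> partial i F x = partial i G x.
Proof. by move=> FG; rewrite /partial; apply: near_eq_derive. Qed.

Lemma differentiable_near (V : normedModType R) (F G : 'rV[R]_n -> V) x :
  (\near x, F x = G x) -> differentiable F x -> differentiable G x.
Proof.
move=> FG dF; have [cd /eqaddoP o] := (diff_locallyP _ _).1 dF.
have Fx : F x = G x := nbhs_singleton FG.
have o' : G \o shift x = cst (G x) + ('d F x : _ -> V) +o_ (0 : 'rV[R]_n) id.
  have FG' : \forall h \near (0 : 'rV[R]_n), F (h + x) = G (h + x).
    by move: FG; rewrite (near_shift 0 x) subr0.
  apply/eqaddoP => e e0; apply: filterS2 FG' (o e e0) => h e1.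
  by rewrite !fctE /= e1 Fx.
have e := diff_unique cd o'.
by apply/diff_locallyP; rewrite e.
Qed.

Lemma foldr_partial_rcons (V : normedModType R) (F : 'rV[R]_n -> V) s i :
  foldr (fun i G => partial i G) F (rcons s i) =
  foldr (fun i G => partial i G) (partial i F) s.
Proof. by rewrite foldr_rcons. Qed.

(** Coinduction: to prove smoothness it suffices to exhibit a class of differentiable functions
    stable under partial derivatives. Stability is asked only up to equality on [W], because the
    formulas for derivatives hold only there. *)
Lemma smooth_coind (V : normedModType R) W (P : ('rV[R]_n -> V) -> Prop) :
  open W ->
  (forall F, P F -> (forall x, W x -> differentiable F x) /\
     forall i, exists2 G, P G & forall x, W x -> partial i F x = G x) ->
  forall F, P F -> smooth_on W F.
Proof.
move=> oW hP; suff main s : forall F G, P G -> (forall x, W x -> F x = G x) ->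
    forall x, W x -> differentiable (foldr (fun i G => partial i G) F s) x.
  by move=> F PF s; apply: (main s F F).
(* The innermost derivative is peeled off first, so that the induction hypothesis applies to
   [partial i F], which merely agrees on [W] with a member of [P]. *)
elim/last_ind: s => [|s i IH] F G PG FG.
  move=> x Wx; apply: differentiable_near ((hP _ PG).1 x Wx).
  near=> y; apply/esym/FG; near: y; exact: open_nbhs_nbhs.
have [_ /(_ i)[G' PG' e]] := hP _ PG.
rewrite foldr_partial_rcons; apply: (IH _ G') => // x Wx.
rewrite -e//; apply: partial_near; near=> y; apply: FG; near: y; exact: open_nbhs_nbhs.
Unshelve. all: by end_near. Qed.

Lemma smooth_on_differentiable (V : normedModType R) W (F : 'rV[R]_n -> V) x :
  smooth_on W F -> W x -> differentiable F x.
Proof. by move=> sF Wx; exact: (sF [::] x Wx). Qed.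

Lemma smooth_on_partial (V : normedModType R) W (F : 'rV[R]_n -> V) i :
  smooth_on W F -> smooth_on W (partial i F).
Proof. by move=> sF s x Wx; rewrite -foldr_partial_rcons; exact: sF. Qed.

Lemma smooth_on_ext (V : normedModType R) W (F G : 'rV[R]_n -> V) :
  open W -> (forall x, W x -> F x = G x) -> smooth_on W F -> smooth_on W G.
Proof.
move=> oW FG sF; pose P (H : 'rV[R]_n -> V) := exists2 H', smooth_on W H' & forall x, W x -> H' x = H x.
apply: (smooth_coind (P := P)) => //; last by exists F.
move=> H [H' sH' e]; have near_e x : W x -> \near x, H' x = H x.
  by move=> Wx; near=> y; apply: e; near: y; exact: open_nbhs_nbhs.
split=> [x Wx|i].
  by apply: differentiable_near (smooth_on_differentiable sH' Wx); exact: near_e.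
exists (partial i H'); last first.
  by move=> x Wx; apply/esym/partial_near; exact: near_e.
by exists (partial i H') => //; exact: smooth_on_partial.
Unshelve. all: by end_near. Qed.

Lemma smooth_on_sub (V : normedModType R) W W' (F : 'rV[R]_n -> V) :
  W' `<=` W -> smooth_on W F -> smooth_on W' F.
Proof. by move=> WW' sF s x /WW'; exact: sF. Qed.

Lemma smooth_on_local (V : normedModType R) W (F : 'rV[R]_n -> V) :
  (forall x, W x -> exists2 U, open_nbhs x U & smooth_on U F) -> smooth_on W F.
Proof. by move=> h s x /h[U [oU Ux]]; apply. Qed.

Lemma partialE (V : normedModType R) (F : 'rV[R]_n -> V) i x :
  differentiable F x -> partial i F x = 'd F x (delta_mx 0 i).
Proof. by move=> dF; rewrite /partial deriveE. Qed.

Lemma partial_cst (V : normedModType R) (v : V) i x : partial i (fun=> v) x = 0.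
Proof. exact: derive_cst. Qed.

Lemma smooth_on_cst (V : normedModType R) W (v : V) : open W -> smooth_on W (fun=> v).
Proof.
move=> oW; apply: (smooth_coind (P := fun F => exists v, F = fun=> v)) => //; last by exists v.
move=> _ [u ->]; split=> [x _|i]; first exact: differentiable_cst.
by exists (fun=> 0); [exists 0|move=> x _; rewrite partial_cst].
Qed.

Lemma partialD (V : normedModType R) (F G : 'rV[R]_n -> V) i x :
  differentiable F x -> differentiable G x ->
  partial i (fun y => F y + G y) x = partial i F x + partial i G x.
Proof. by move=> dF dG; rewrite /partial deriveD//; exact: diff_derivable. Qed.

Lemma partialN (V : normedModType R) (F : 'rV[R]_n -> V) i x :
  differentiable F x -> partial i (fun y => - F y) x = - partial i F x.
Proof. by move=> dF; rewrite /partial deriveN//; exact: diff_derivable. Qed.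

Lemma partialB (V : normedModType R) (F G : 'rV[R]_n -> V) i x :
  differentiable F x -> differentiable G x ->
  partial i (fun y => F y - G y) x = partial i F x - partial i G x.
Proof. by move=> dF dG; rewrite /partial deriveB//; exact: diff_derivable. Qed.

Lemma partialM (u v : 'rV[R]_n -> R) i x :
  differentiable u x -> differentiable v x ->
  partial i (fun y => u y * v y) x = partial i u x * v x + u x * partial i v x.
Proof.
move=> du dv; rewrite /partial deriveM; [|exact: diff_derivable..].
by rewrite addrC /GRing.scale /= [v x * _]mulrC.
Qed.

Lemma partial_coord (m : nat) (F : 'rV[R]_n -> 'rV[R]_m) i k x :
  differentiable F x -> partial i (fun y => F y 0 k) x = partial i F x 0 k.
Proof.
move=> dF; rewrite /partial derive_mx ?mxE//; exact: diff_derivable.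
Qed.

Lemma smooth_onD (V : normedModType R) W (F G : 'rV[R]_n -> V) : open W ->
  smooth_on W F -> smooth_on W G -> smooth_on W (fun y => F y + G y).
Proof.
move=> oW sF sG; pose P (H : 'rV[R]_n -> V) := exists F' G', [/\ smooth_on W F', smooth_on W G' &
  H = fun y => F' y + G' y].
apply: (smooth_coind (P := P)) => //; last by exists F, G.
move=> _ [F' [G' [sF' sG' ->]]]; split=> [x Wx|i].
  by apply: differentiableD; exact: smooth_on_differentiable Wx.
exists (fun y => partial i F' y + partial i G' y).
  by exists (partial i F'), (partial i G'); split=> //; exact: smooth_on_partial.
by move=> x Wx; apply: partialD; exact: smooth_on_differentiable Wx.
Qed.

Lemma smooth_on_sum (V : normedModType R) W (J : Type) (r : seq J) (F : J -> 'rV[R]_n -> V) :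
  open W -> (forall j, smooth_on W (F j)) -> smooth_on W (fun y => \sum_(j <- r) F j y).
Proof.
move=> oW sF; elim: r => [|j r IH].
  by apply: smooth_on_ext (smooth_on_cst 0 oW) => // x _; rewrite big_nil.
by apply: smooth_on_ext (smooth_onD oW (sF j) IH) => // x _; rewrite big_cons.
Qed.

(** Single products are not stable under differentiation; by the Leibniz rule finite sums of them
    are. *)
Let sumprod W (H : 'rV[R]_n -> R) := exists r : seq (('rV[R]_n -> R) * ('rV[R]_n -> R)),
  (forall p, List.In p r -> smooth_on W p.1 /\ smooth_on W p.2) /\
  H = fun y => \sum_(p <- r) p.1 y * p.2 y.

Lemma smooth_onM W (u v : 'rV[R]_n -> R) : open W ->
  smooth_on W u -> smooth_on W v -> smooth_on W (fun y => u y * v y).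
Proof.
move=> oW su sv; apply: (smooth_coind (P := sumprod W)) => //; last first.
  exists [:: (u, v)]; split=> [p /= [<-|//]|]; first by [].
  by apply/funext => y; rewrite big_seq1.
move=> _ [r [hr ->]]; split=> [x Wx|i].
  elim: r hr => [|p r IH] hr.
    have -> : (fun y => \sum_(q <- [::]) q.1 y * q.2 y) = cst 0 :> ('rV[R]_n -> R).
      by apply/funext => y; rewrite big_nil.
    exact: differentiable_cst.
  have -> : (fun y => \sum_(q <- p :: r) q.1 y * q.2 y) =
      (p.1 * p.2) + (fun y => \sum_(q <- r) q.1 y * q.2 y) :> ('rV[R]_n -> R).
    by apply/funext => y; rewrite big_cons.
  apply: differentiableD; last by apply: IH => q qr; apply: hr; right.
  have [s1 s2] := hr p (or_introl erefl).
  by apply: differentiableM; exact: smooth_on_differentiable Wx.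
exists (fun y => \sum_(p <- flatten [seq [:: (partial i p.1, p.2); (p.1, partial i p.2)] | p <- r])
   p.1 y * p.2 y).
  eexists; split; last by [].
  elim: r hr => [//|p r IH] hr q /=.
  have [s1 s2] := hr p (or_introl erefl).
  case=> [<-|[<-|]]; try by split=> //=; exact: smooth_on_partial.
  by apply: IH => t tr; apply: hr; right.
move=> x Wx; elim: r hr => [|p r IH] hr.
  rewrite /= big_nil; under [X in partial i X]eq_fun do rewrite big_nil.
  exact: partial_cst.
under [X in partial i X]eq_fun do rewrite big_cons.
have [s1 s2] := hr p (or_introl erefl).
have hr' q : List.In q r -> smooth_on W q.1 /\ smooth_on W q.2 by move=> qr; apply: hr; right.
have dr : differentiable (fun y => \sum_(q <- r) q.1 y * q.2 y) x.
  elim: r hr' {IH hr} => [|q r IH] hr.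
    have -> : (fun y => \sum_(q <- [::]) q.1 y * q.2 y) = cst 0 :> ('rV[R]_n -> R).
      by apply/funext => y; rewrite big_nil.
    exact: differentiable_cst.
  have -> : (fun y => \sum_(p <- q :: r) p.1 y * p.2 y) =
      (q.1 * q.2) + (fun y => \sum_(q <- r) q.1 y * q.2 y) :> ('rV[R]_n -> R).
    by apply/funext => y; rewrite big_cons.
  apply: differentiableD; last by apply: IH => t qr; apply: hr; right.
  have [t1 t2] := hr q (or_introl erefl).
  by apply: differentiableM; exact: smooth_on_differentiable Wx.
rewrite partialD//; last first.
  by apply: differentiableM; exact: smooth_on_differentiable Wx.
rewrite partialM; [|exact: smooth_on_differentiable Wx..].
by rewrite IH//= !big_cons addrA.
Qed.

End Smooth.

Section SmoothMore.
Variables (R : realType) (n : nat).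
Implicit Types (W : set 'rV[R]_n) (x : 'rV[R]_n).

Lemma smooth_onZ W (r : R) (u : 'rV[R]_n -> R) : open W ->
  smooth_on W u -> smooth_on W (fun y => r * u y).
Proof. by move=> oW su; apply: smooth_onM => //; exact: smooth_on_cst. Qed.

Lemma smooth_onN W (u : 'rV[R]_n -> R) : open W ->
  smooth_on W u -> smooth_on W (fun y => - u y).
Proof.
move=> oW su; apply: smooth_on_ext (smooth_onZ (-1) oW su) => // x _.
by rewrite mulN1r.
Qed.

Lemma smooth_onB W (u v : 'rV[R]_n -> R) : open W ->
  smooth_on W u -> smooth_on W v -> smooth_on W (fun y => u y - v y).
Proof. by move=> oW su sv; apply: smooth_onD => //; exact: smooth_onN. Qed.

Lemma differentiable_row (m : nat) (F : 'rV[R]_n -> 'rV[R]_m) x :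
  (forall k, differentiable (fun y => F y 0 k) x) -> differentiable F x.
Proof.
move=> dF.
have -> : F = \sum_(k < m) (fun y => F y 0 k *: delta_mx 0 k).
  by apply/funext => y; rewrite fct_sumE [LHS]row_sum_delta.
by apply: differentiable_sum => k; exact: differentiableZl.
Qed.

Lemma smooth_on_coord (m : nat) W (F : 'rV[R]_n -> 'rV[R]_m) : open W ->
  smooth_on W F <-> forall k, smooth_on W (fun y => F y 0 k).
Proof.
move=> oW; split=> [sF k|sF].
  pose P (u : 'rV[R]_n -> R) := exists2 G : 'rV[R]_n -> 'rV[R]_m,
    smooth_on W G & u = fun y => G y 0 k.
  apply: (smooth_coind (P := P)) => //; last by exists F.
  move=> _ [G sG ->]; have dG x : W x -> differentiable G x.
    by move=> Wx; exact: smooth_on_differentiable Wx.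
  split=> [x Wx|i].
    by apply: (differentiable_comp (g := fun M : 'rV[R]_m => M 0 k)) (dG _ Wx) (differentiable_coord _ _ _).
  exists (fun y => partial i G y 0 k); first by exists (partial i G) => //; exact: smooth_on_partial.
  by move=> x Wx; rewrite partial_coord//; exact: dG.
pose P (G : 'rV[R]_n -> 'rV[R]_m) := forall k, smooth_on W (fun y => G y 0 k).
apply: (smooth_coind (P := P)) => // G PG; split=> [x Wx|i].
  by apply: differentiable_row => k; exact: smooth_on_differentiable Wx.
exists (partial i G) => // k.
apply: smooth_on_ext (smooth_on_partial i (PG k)) => // x Wx.
rewrite partial_coord//; apply: differentiable_row => k'.
exact: smooth_on_differentiable Wx.
Qed.

Lemma smooth_on_id W k : open W -> smooth_on W (fun y : 'rV[R]_n => y 0 k).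
Proof.
move=> oW; pose P (u : 'rV[R]_n -> R) := (exists r, u = cst r) \/ exists k, u = fun y => y 0 k.
apply: (smooth_coind (P := P)) => //; last by right; exists k.
move=> _ [[r ->]|[j ->]]; (split=> [x Wx|i]).
- exact: differentiable_cst.
- by exists (cst 0); [left; exists 0|move=> x _; exact: partial_cst].
- exact: differentiable_coord.
- exists (cst ((delta_mx 0 i : 'rV[R]_n) 0 j)); first by left; eexists.
  move=> x _; rewrite (partial_coord (F := id))//; congr (_ 0 j).
  by rewrite /partial derive_id.
Qed.

Lemma smooth_on_idfun W : open W -> smooth_on W (id : 'rV[R]_n -> 'rV[R]_n).
Proof. by move=> oW; apply/(smooth_on_coord _ oW) => k; exact: smooth_on_id. Qed.

End SmoothMore.

Lemma In_cat (T : Type) (t : T) (r1 r2 : seq T) :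
  List.In t (r1 ++ r2) -> List.In t r1 \/ List.In t r2.
Proof.
elim: r1 => [|z r1 IH] /=; first by right.
by case=> [->|/IH[?|?]]; [left; left|left; right|right].
Qed.

Section SmoothComp.
Variables (R : realType) (n : nat).
Implicit Types (W : set 'rV[R]_n) (x : 'rV[R]_n).

Lemma diff_partial (V : normedModType R) (F : 'rV[R]_n -> V) x (v : 'rV[R]_n) :
  differentiable F x -> 'd F x v = \sum_j v 0 j *: partial j F x.
Proof.
move=> dF; rewrite {1}(row_sum_delta v) linear_sum.
by apply: eq_bigr => j _; rewrite (partialE j dF); exact: linearZ.
Qed.

Lemma differentiable_comp_partial (p : nat) (V : normedModType R) (g : 'rV[R]_n -> V)
    (tau : 'rV[R]_p -> 'rV[R]_n) (x : 'rV[R]_p) (i : 'I_p) :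
  differentiable tau x -> differentiable g (tau x) ->
  partial i (g \o tau) x = \sum_j partial i tau x 0 j *: partial j g (tau x).
Proof.
move=> dt dg; rewrite partialE; last exact: differentiable_comp.
by rewrite diff_comp //= -(partialE i dt) diff_partial.
Qed.

Lemma smooth_on_comp (p m : nat) (W' : set 'rV[R]_p) W (tau : 'rV[R]_p -> 'rV[R]_n)
    (g : 'rV[R]_n -> 'rV[R]_m) :
  open W' -> open W -> (forall y, W' y -> W (tau y)) ->
  smooth_on W' tau -> smooth_on W g -> smooth_on W' (g \o tau).
Proof.
move=> oW' oW tW st sg; apply/(smooth_on_coord _ oW') => k.
(* The chain rule stays within this class: differentiating [q.1 \o tau] yields derivatives of [q.1]
   at [tau], and the derivatives of [tau] are absorbed by the coefficient [q.2]. *)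
pose P (u : 'rV[R]_p -> R) := exists r : seq (('rV[R]_n -> R) * ('rV[R]_p -> R)),
  (forall q, List.In q r -> smooth_on W q.1 /\ smooth_on W' q.2) /\
  u = fun y => \sum_(q <- r) q.2 y * q.1 (tau y).
apply: (smooth_coind (P := P)) => //; last first.
  exists [:: (fun y => g y 0 k, cst 1)]; split.
    move=> q /= [<-|//]; split; last exact: smooth_on_cst.
    by move/smooth_on_coord: sg; exact.
  by apply/funext => y; rewrite big_seq1 /= mul1r.
move=> _ [r [hr ->]].
have dtau (x : 'rV[R]_p) : W' x -> differentiable tau x.
  by move=> Wx; exact: smooth_on_differentiable Wx.
have dq q (x : 'rV[R]_p) : List.In q r -> W' x -> differentiable (q.1 \o tau) x.
  move=> /hr[s1 _] Wx; apply: differentiable_comp; first exact: dtau.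
  exact: smooth_on_differentiable s1 (tW _ Wx).
split=> [x Wx|i].
  elim: r hr dq => [|q r IH] hr dq.
    have -> : (fun y => \sum_(q <- [::]) q.2 y * q.1 (tau y)) = cst 0 :> ('rV[R]_p -> R).
      by apply/funext => y; rewrite big_nil.
    exact: differentiable_cst.
  have -> : (fun y => \sum_(q <- q :: r) q.2 y * q.1 (tau y)) =
      (q.2 * (q.1 \o tau)) + (fun y => \sum_(q <- r) q.2 y * q.1 (tau y)) :> ('rV[R]_p -> R).
    by apply/funext => y; rewrite big_cons.
  apply: differentiableD; last first.
    by apply: IH => [t tr|t y tr]; [apply: hr|apply: dq]; right.
  have [s1 s2] := hr q (or_introl erefl).
  by apply: differentiableM; [exact: smooth_on_differentiable Wx|apply: dq; [left|]].
pose expand (q : ('rV[R]_n -> R) * ('rV[R]_p -> R)) := (q.1, partial i q.2) ::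
  [seq (partial j q.1, fun y => q.2 y * partial i tau y 0 j) | j <- enum 'I_n].
exists (fun y => \sum_(q <- flatten [seq expand q | q <- r]) q.2 y * q.1 (tau y)).
  eexists; split; last by [].
  elim: r hr {dq} => [//|q r IH] hr t /=.
  have [s1 s2] := hr q (or_introl erefl).
  case=> [<- /=|]; first by split=> //; exact: smooth_on_partial.
  move=> tin; case: (In_cat tin) => {tin}; last by apply: IH => t' tr; apply: hr; right.
  elim: (enum 'I_n) => [//|j e IHe] /= [<- /=|]; last exact: IHe.
  split; first exact: smooth_on_partial.
  apply: smooth_onM => //.
  by have /smooth_on_coord := smooth_on_partial i st; exact.
move=> x Wx; elim: r hr dq => [|q r IH] hr dq.
  rewrite /= big_nil; under [X in partial i X]eq_fun do rewrite big_nil.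
  exact: partial_cst.
under [X in partial i X]eq_fun do rewrite big_cons.
have [s1 s2] := hr q (or_introl erefl).
have hr' t : List.In t r -> smooth_on W t.1 /\ smooth_on W' t.2 by move=> qr; apply: hr; right.
have dq' t y : List.In t r -> W' y -> differentiable (t.1 \o tau) y.
  by move=> qr; apply: dq; right.
have dr : differentiable (fun y => \sum_(q <- r) q.2 y * q.1 (tau y)) x.
  elim: r hr' dq' {IH hr dq} => [|t r IH] hr dq.
    have -> : (fun y => \sum_(q <- [::]) q.2 y * q.1 (tau y)) = cst 0 :> ('rV[R]_p -> R).
      by apply/funext => y; rewrite big_nil.
    exact: differentiable_cst.
  have -> : (fun y => \sum_(q <- t :: r) q.2 y * q.1 (tau y)) =
      (t.2 * (t.1 \o tau)) + (fun y => \sum_(q <- r) q.2 y * q.1 (tau y)) :> ('rV[R]_p -> R).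
    by apply/funext => y; rewrite big_cons.
  apply: differentiableD; last first.
    by apply: IH => [t' tr|t' y tr]; [apply: hr|apply: dq]; right.
  have [t1 t2] := hr t (or_introl erefl).
  by apply: differentiableM; [exact: smooth_on_differentiable Wx|apply: dq; [left|]].
have d2 : differentiable q.2 x by exact: smooth_on_differentiable Wx.
have d1 : differentiable (q.1 \o tau) x by apply: dq => //; left.
rewrite partialD//; last exact: (differentiableM d2 d1).
rewrite (partialM (v := q.1 \o tau))// IH//= !big_cons big_cat /= addrA; congr (_ + _ + _).
rewrite differentiable_comp_partial; [|exact: dtau|]; last first.
  exact: smooth_on_differentiable s1 (tW _ Wx).
rewrite big_map big_enum mulr_sumr; apply: eq_bigr => j _ /=.
by rewrite /GRing.scale /= mulrA.
Qed.

Lemma smooth_on_inv W (u : 'rV[R]_n -> R) : open W -> (forall x, W x -> u x != 0) ->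
  smooth_on W u -> smooth_on W (fun y => (u y)^-1).
Proof.
(* Quotients of a smooth function by a power of [u] are stable under differentiation. *)
move=> oW u0 su; pose P (v : 'rV[R]_n -> R) :=
  exists (a : 'rV[R]_n -> R) (m : nat), smooth_on W a /\ v = fun y => a y * ((u y)^-1) ^+ m.
apply: (smooth_coind (P := P)) => //; last first.
  exists (cst 1), 1%N; split; first exact: smooth_on_cst.
  by apply/funext => y; rewrite mul1r.
move=> _ [a [m [sa ->]]].
have dV x : W x -> differentiable (fun y => (u y)^-1) x.
  by move=> Wx; apply: differentiableV; [exact: smooth_on_differentiable Wx|exact: u0].
have dX x k : W x -> differentiable (fun y => ((u y)^-1) ^+ k) x.
  move=> /dV dx; elim: k => [|k IH]; first exact: differentiable_cst.
  have -> : (fun y => ((u y)^-1) ^+ k.+1) =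
      (fun y => (u y)^-1) * (fun y => ((u y)^-1) ^+ k) :> ('rV[R]_n -> R).
    by apply/funext => y; rewrite exprS.
  exact: differentiableM.
have pV x i : W x -> partial i (fun y => (u y)^-1) x = - partial i u x * (u x)^-1 ^+ 2.
  move=> Wx; rewrite /partial deriveV ?u0//; last first.
    by apply: diff_derivable; exact: smooth_on_differentiable Wx.
  by rewrite /GRing.scale /= exprVn mulNr mulNr mulrC.
have pX x k i : W x -> partial i (fun y => ((u y)^-1) ^+ k) x =
    - k%:R * partial i u x * (u x)^-1 ^+ k.+1.
  move=> Wx; elim: k => [|k IH].
    by rewrite oppr0 !mul0r; under [X in partial i X]eq_fun do rewrite expr0; exact: partial_cst.
  under [X in partial i X]eq_fun do rewrite exprS.
  rewrite partialM ?pV ?IH//; [|exact: dV|exact: dX].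
  by rewrite -natr1 !exprS; ring.
split=> [x Wx|i].
  by apply: (differentiableM (f := a)); [exact: smooth_on_differentiable Wx|exact: dX].
exists (fun y => (partial i a y * u y - m%:R * a y * partial i u y) * (u y)^-1 ^+ m.+1).
  exists (fun y => partial i a y * u y - m%:R * a y * partial i u y), m.+1; split=> //.
  apply: smooth_onB => //; apply: smooth_onM => //; try exact: smooth_on_partial.
  exact: smooth_onZ.
move=> x Wx; rewrite partialM; [|exact: smooth_on_differentiable Wx|exact: dX].
have e : u x * (u x)^-1 = 1 by rewrite mulfV ?u0.
rewrite pX// mulrBl -[partial i a x * _ * _]mulrA exprS [u x * _]mulrA e; ring.
Qed.

Lemma smooth_on_sqrt W (u : 'rV[R]_n -> R) : open W -> (forall x, W x -> 0 < u x) ->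
  smooth_on W u -> smooth_on W (fun y => Num.sqrt (u y)).
Proof.
(* Since the derivative of sqrt u is (u' / 2u) sqrt u, smooth multiples of sqrt u form a stable
   class. *)
move=> oW u0 su; pose P (v : 'rV[R]_n -> R) :=
  exists2 a : 'rV[R]_n -> R, smooth_on W a & v = fun y => a y * Num.sqrt (u y).
apply: (smooth_coind (P := P)) => //; last first.
  exists (cst 1); first exact: smooth_on_cst.
  by apply/funext => y; rewrite mul1r.
move=> _ [a sa ->].
have sD x : W x -> differentiable (Num.sqrt : R -> R) (u x).
  by move=> Wx; apply/derivable1_diffP; have [] := is_derive1_sqrt (u0 x Wx).
have uD x : W x -> differentiable u x by move=> Wx; exact: smooth_on_differentiable Wx.
have dS x : W x -> differentiable (fun y => Num.sqrt (u y)) x.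
  by move=> Wx; exact: (differentiable_comp (uD x Wx) (sD x Wx)).
have pS x i : W x -> partial i (fun y => Num.sqrt (u y)) x =
    partial i u x * (2^-1 * (u x)^-1) * Num.sqrt (u x).
  move=> Wx; rewrite partialE; last exact: dS.
  rewrite (diff_comp (uD x Wx) (sD x Wx)) /= -(partialE i (uD x Wx)).
  rewrite (diff1E (sD x Wx)) /GRing.scale /= derive1E derive_sqrt ?u0//.
  rewrite -mulrA; congr (_ * _).
  have s0 : Num.sqrt (u x) != 0 by rewrite gt_eqF// sqrtr_gt0 u0.
  set r := Num.sqrt (u x) in s0 *.
  have -> : u x = r ^+ 2 by rewrite sqr_sqrtr// ltW// u0.
  by field; rewrite s0.
split=> [x Wx|i].
  by apply: (differentiableM (f := a)); [exact: smooth_on_differentiable Wx|exact: dS].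
exists (fun y => (partial i a y + a y * (partial i u y * (2^-1 * (u y)^-1))) * Num.sqrt (u y)).
  exists (fun y => partial i a y + a y * (partial i u y * (2^-1 * (u y)^-1))) => //.
  apply: smooth_onD => //; first exact: smooth_on_partial.
  do 2 (apply: smooth_onM => //); first exact: smooth_on_partial.
  apply: smooth_onZ => //; apply: smooth_on_inv => // x Wx.
  by rewrite gt_eqF// u0.
move=> x Wx; rewrite partialM; [|exact: smooth_on_differentiable Wx|exact: dS].
by rewrite pS//; ring.
Qed.

End SmoothComp.

(** * Mean value theorem along segments and symmetry of second derivatives *)

Section Schwarz.
Variables (R : realType) (n : nat).

Lemma derivable_line (V : normedModType R) (F : 'rV[R]_n -> V) (x v : 'rV[R]_n) (t : R) :
  differentiable F (x + t *: v) ->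
  is_derive t 1 (fun r : R => F (x + r *: v)) ('D_v F (x + t *: v)).
Proof.
move=> dF; have dl : differentiable (fun r : R => x + r *: v) t.
  by apply: differentiableD => //; exact: differentiableZl.
have e : (fun r : R => F (x + r *: v)) = F \o (fun r : R => x + r *: v) by [].
rewrite e; apply: DeriveDef.
  by apply/derivable1_diffP; exact: differentiable_comp.
rewrite deriveE; last exact: differentiable_comp.
rewrite diff_comp //= deriveE//; congr ('d _ _ _).
rewrite -deriveE//.
have -> : (fun r : R => x + r *: v) = cst x + (fun r : R => r *: v) by [].
rewrite deriveD; [|exact: derivable_cst|apply: diff_derivable; exact: differentiableZl].
rewrite derive_cst add0r deriveE; last exact: differentiableZl.
by rewrite diffZl// diff_val scale1r.
Qed.

Lemma MVT_line (u : 'rV[R]_n -> R) (x v : 'rV[R]_n) (h : R) : 0 < h ->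
  (forall t, 0 <= t <= h -> differentiable u (x + t *: v)) ->
  exists2 t, 0 < t < h & u (x + h *: v) - u x = h * 'D_v u (x + t *: v).
Proof.
move=> h0 du.
have [||t /[!in_itv]/= th e] := @MVT R (fun t => u (x + t *: v))
  (fun t => 'D_v u (x + t *: v)) 0 h h0.
- move=> t; rewrite in_itv/= => /andP[t0 th]; apply: derivable_line.
  by apply: du; rewrite !ltW.
- apply: derivable_within_continuous => t; rewrite in_itv/= => tt.
  by have [] := derivable_line (du t tt).
exists t => //; move: e; rewrite scale0r addr0 subr0 => ->; ring.
Qed.

End Schwarz.

Section Schwarz2.
Variables (R : realType) (n : nat).

Lemma coord_norm_le (x : 'rV[R]_n) k : `|x 0 k| <= `|x|.
Proof.
change (`|x 0 k| <= mx_norm x); rewrite mx_normrE.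
exact: (le_bigmax _ (fun i => `|x i.1 i.2|) (0, k)).
Qed.

Lemma norm_le_coord (x : 'rV[R]_n) r : 0 <= r -> (forall k, `|x 0 k| <= r) -> `|x| <= r.
Proof.
move=> r0 xr; change (mx_norm x <= r).
have [->//|/mx_norm_neq0[[i k] /= ->]] := eqVneq (mx_norm x) 0.
by rewrite (ord1 i).
Qed.

Lemma norm_delta_mx (i : 'I_n) : `|delta_mx 0 i : 'rV[R]_n| <= 1.
Proof.
by apply: norm_le_coord => // k; rewrite mxE; case: (_ && _); rewrite ?normr1 ?normr0.
Qed.

Let quot_eq (A B C D hh p q : R) : hh != 0 -> A - B - (C - D) = hh * p ->
  A - C - (B - D) = hh * q -> p = q.
Proof. by move=> h0 e1 e2; apply: (mulfI h0); rewrite -e1 -e2; ring. Qed.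

Let close_eq (a b : R) : (forall e, 0 < e -> `|a - b| <= e) -> a = b.
Proof.
move=> h; apply/eqP; rewrite -subr_eq0 -normr_le0; apply/ler_addgt0Pl => e e0.
by rewrite addr0 h.
Qed.

Let dist_half (a b c e : R) : `|a - c| < e / 2 -> `|a - b| < e / 2 -> `|b - c| <= e.
Proof. by rewrite !ltr_distl ler_norml; lra. Qed.

Lemma partial_shift (V : normedModType R) (F : 'rV[R]_n -> V) (v x : 'rV[R]_n) i :
  partial i (fun y => F (y + v)) x = partial i F (x + v).
Proof.
rewrite /partial /derive.
suff -> : (fun h : R => h^-1 *: (((fun y => F (y + v)) \o shift x) (h *: delta_mx 0 i) - F (x + v)))
  = (fun h : R => h^-1 *: ((F \o shift (x + v)) (h *: delta_mx 0 i) - F (x + v))) by [].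
by apply/funext => h /=; rewrite addrA.
Qed.

(** The second difference of [u] over a small square is symmetric in i and j, and two uses of the
    mean value theorem equate it with h^2 times either mixed derivative at some point of the square.
    Continuity of both derivatives at [x] concludes. *)
Lemma partialC (W : set 'rV[R]_n) (u : 'rV[R]_n -> R) i j x : open W ->
  smooth_on W u -> W x -> partial i (partial j u) x = partial j (partial i u) x.
Proof.
move=> oW su Wx; apply: close_eq => e e0.
have near_ij (a b : 'I_n) : \forall y \near x,
    `|(partial a (partial b u) y : R) - (partial a (partial b u) x : R)| < e / 2.
  have dc := differentiable_continuous
    (smooth_on_differentiable (smooth_on_partial a (smooth_on_partial b su)) Wx).
  by have /cvgrPdistC_lt := dc; apply; rewrite divr_gt0.
have Wnear : \forall y \near x, W y by exact: open_nbhs_nbhs.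
have : nbhs x (fun y => W y /\
    `|(partial i (partial j u) y : R) - (partial i (partial j u) x : R)| < e / 2 /\
    `|(partial j (partial i u) y : R) - (partial j (partial i u) x : R)| < e / 2).
  exact: filterI Wnear (filterI (near_ij i j) (near_ij j i)).
move=> /nbhs_ballP[d /= d0 hd].
(* A third of the radius keeps all the corners, at distance at most 2h from [x], inside the ball. *)
pose h := d / 3; have h0 : 0 < h by rewrite divr_gt0.
pose ei : 'rV[R]_n := delta_mx 0 i; pose ej : 'rV[R]_n := delta_mx 0 j.
have inb (a b : R) : 0 <= a <= h -> 0 <= b <= h -> ball x d (x + a *: ei + b *: ej).
  move=> /andP[a0 ah] /andP[b0 bh]; rewrite -ball_normE /=.
  rewrite -addrA opprD addrA subrr add0r normrN.
  apply: le_lt_trans (ler_normD _ _) _; rewrite !normrZ (ger0_norm a0) (ger0_norm b0).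
  have := norm_delta_mx i; have := norm_delta_mx j; rewrite -/ei -/ej.
  set p := `|ej|; set q := `|ei| => p1 q1.
  have : a * q <= h by apply: le_trans ah; rewrite ler_piMr.
  have : b * p <= h by apply: le_trans bh; rewrite ler_piMr.
  rewrite /h; lra.
have second (a b : 'I_n) : (forall r t, 0 <= r <= h -> 0 <= t <= h ->
     ball x d (x + r *: delta_mx 0 a + t *: delta_mx 0 b)) ->
   exists2 y, ball x d y & u (x + h *: delta_mx 0 a + h *: delta_mx 0 b)
     - u (x + h *: delta_mx 0 a) - (u (x + h *: delta_mx 0 b) - u x)
     = h * h * partial b (partial a u) y.
  move=> inab; pose v y := u (y + h *: delta_mx 0 b) - u y.
  have h1 : 0 <= h <= h by rewrite lexx ltW.
  have dv t : 0 <= t <= h -> differentiable v (x + t *: delta_mx 0 a).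
    move=> th; apply: differentiableB.
      have e1 : (fun y => u (y + h *: delta_mx 0 b)) = u \o (shift (h *: delta_mx 0 b)) by [].
      rewrite e1; apply: differentiable_comp; first exact: differentiableD.
      by apply: smooth_on_differentiable su _; exact: (hd _ (inab _ _ th h1)).1.
    apply: smooth_on_differentiable su _.
    by have := (hd _ (inab t 0 th _)).1; rewrite scale0r addr0 lexx ltW//; apply.
  have [t /andP[t0 t1] e1] := MVT_line h0 dv.
  have th : 0 <= t <= h by rewrite !ltW.
  have [r /andP[r0 r1] e2] := @MVT_line R n (partial a u) (x + t *: delta_mx 0 a) (delta_mx 0 b) h h0
    (fun r hr => smooth_on_differentiable (smooth_on_partial a su) (hd _ (inab _ _ th hr)).1).
  exists (x + t *: delta_mx 0 a + r *: delta_mx 0 b); first by apply: inab; rewrite ?ltW// !ltW.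
  have -> : u (x + h *: delta_mx 0 a + h *: delta_mx 0 b)
     - u (x + h *: delta_mx 0 a) - (u (x + h *: delta_mx 0 b) - u x) =
     v (x + h *: delta_mx 0 a) - v x by [].
  rewrite e1 -mulrA; congr (_ * _); rewrite -e2 /v.
  have du y : W y -> differentiable u y by exact: smooth_on_differentiable.
  rewrite -/(partial a _ _) partialB.
  - by rewrite (partial_shift u).
  - have e3 : (fun y => u (y + h *: delta_mx 0 b)) = u \o (shift (h *: delta_mx 0 b)) by [].
    rewrite e3; apply: differentiable_comp; first exact: differentiableD.
    by apply: du; exact: (hd _ (inab _ _ th h1)).1.
  - by apply: du; have := (hd _ (inab t 0 th _)).1; rewrite scale0r addr0 lexx ltW//; apply.
have [y yd ey] := second i j inb.
(* The same second difference, with the two directions exchanged. *)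
have [z zd ez] : exists2 y, ball x d y & u (x + h *: delta_mx 0 i + h *: delta_mx 0 j)
     - u (x + h *: delta_mx 0 j) - (u (x + h *: delta_mx 0 i) - u x)
     = h * h * partial i (partial j u) y.
  have [|y2 y2d ey2] := second j i; last first.
    exists y2; first exact: y2d.
    rewrite (_ : x + h *: delta_mx 0 i + h *: delta_mx 0 j =
      x + h *: delta_mx 0 j + h *: delta_mx 0 i); first exact: ey2.
    exact: addrAC.
  by move=> r t hr ht; rewrite addrAC; exact: inb.
have hh0 : h * h != 0 by rewrite mulf_neq0// gt_eqF.
have yz := quot_eq hh0 ey ez.
have [_ [_ hy]] := hd _ yd; have [_ [hz _]] := hd _ zd.
by rewrite -yz in hz; exact: (dist_half hy hz).
Qed.

Lemma partial0_cst (W : set 'rV[R]_n) (F : 'rV[R]_n -> R) x y :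
  (forall z, W z -> differentiable F z) ->
  (forall i z, W z -> partial i F z = 0) ->
  (forall t : R, 0 <= t <= 1 -> W (x + t *: (y - x))) -> F y = F x.
Proof.
move=> dF pF seg; have [t t01] := @MVT_line R n F x (y - x) 1 ltr01
  (fun t ht => dF _ (seg t ht)).
have /seg Wt : 0 <= t <= 1 by move/andP: t01 => [? ?]; rewrite !ltW.
rewrite mul1r scale1r [x + _]addrC subrK deriveE; last exact: dF.
rewrite (diff_partial _ (dF _ Wt)) big1; first by move=> /eqP; rewrite subr_eq0 => /eqP.
by move=> i _; rewrite pF// scaler0.
Qed.

End Schwarz2.

Section SmoothMatrix.
Variables (R : realType) (n : nat).
Implicit Types (W : set 'rV[R]_n).

Lemma smooth_on_prod W (J : Type) (r : seq J) (F : J -> 'rV[R]_n -> R) : open W ->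
  (forall j, smooth_on W (F j)) -> smooth_on W (fun y => \prod_(j <- r) F j y).
Proof.
move=> oW sF; elim: r => [|j r IH].
  by apply: smooth_on_ext (smooth_on_cst (1 : R) oW) => // x _; rewrite big_nil.
by apply: smooth_on_ext (smooth_onM oW (sF j) IH) => // x _; rewrite big_cons.
Qed.

Lemma smooth_on_det m W (F : 'rV[R]_n -> 'M[R]_m) : open W ->
  (forall i j, smooth_on W (fun x => F x i j)) -> smooth_on W (fun x => \det (F x)).
Proof.
move=> oW sF; rewrite /determinant; apply: smooth_on_sum => // s.
by apply: smooth_onZ => //; exact: smooth_on_prod.
Qed.

Lemma smooth_on_invmx m W (F : 'rV[R]_n -> 'M[R]_m) i j : open W ->
  (forall x, W x -> F x \in unitmx) ->
  (forall i j, smooth_on W (fun x => F x i j)) ->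
  smooth_on W (fun x => invmx (F x) i j).
Proof.
move=> oW uF sF.
apply: (@smooth_on_ext _ _ _ W (fun x => (\det (F x))^-1 * cofactor (F x) j i)) => //.
  by move=> x Wx; rewrite /invmx uF// !mxE.
apply: smooth_onM => //.
  apply: smooth_on_inv => //; last exact: smooth_on_det.
  by move=> x /uF; rewrite unitmxE unitfE.
rewrite /cofactor; apply: smooth_onZ => //.
case: m F i j uF sF => [|m] F i j uF sF; first by case: i.
apply: smooth_on_det => // a b.
by apply: smooth_on_ext (sF (lift j a) (lift i b)) => // x _; rewrite !mxE.
Qed.

End SmoothMatrix.

(** * The inverse function theorem *)

Section InverseFunction.
Variables (R : realType) (n : nat).
Implicit Types (W : set 'rV[R]_n).

(** Row convention: the differential is right multiplication by this matrix, so the chain rule puts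
    the inner map on the left. *)
Definition jmx m (phi : 'rV[R]_n -> 'rV[R]_m) x : 'M[R]_(n, m) :=
  \matrix_(i < n) partial i phi x.

Lemma jmxE m (phi : 'rV[R]_n -> 'rV[R]_m) x i j : jmx phi x i j = partial i phi x 0 j.
Proof. by rewrite !mxE. Qed.

Lemma diff_jmx m (phi : 'rV[R]_n -> 'rV[R]_m) x v : differentiable phi x ->
  'd phi x v = v *m jmx phi x.
Proof.
move=> dp; rewrite diff_partial//; apply/rowP => k; rewrite summxE !mxE.
by apply: eq_bigr => j _; rewrite !mxE.
Qed.

Lemma lipschitz_partial (B : set 'rV[R]_n) (u : 'rV[R]_n -> R) (q : R) :
  (forall x, B x -> differentiable u x) ->
  (forall x i, B x -> `|partial i u x : R| <= q) ->
  forall x y, (forall t : R, 0 <= t <= 1 -> B (x + t *: (y - x))) ->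
  `|u y - u x| <= n%:R * q * `|y - x|.
Proof.
move=> du pq x y seg; have [t t01] := @MVT_line R n u x (y - x) 1 ltr01
  (fun t ht => du _ (seg t ht)).
have /seg Wt : 0 <= t <= 1 by move/andP: t01 => [? ?]; rewrite !ltW.
rewrite mul1r scale1r [x + _]addrC subrK => ->.
rewrite deriveE; last exact: du.
rewrite (diff_partial _ (du _ Wt)); apply: le_trans (ler_norm_sum _ _ _) _.
have -> : n%:R * q * `|y - x| = \sum_(j < n) (q * `|y - x|).
  by rewrite sumr_const card_ord -mulrA mulr_natl.
apply: ler_sum => j _; rewrite normrM mulrC ler_pM//; [exact: pq|exact: coord_norm_le].
Qed.

Lemma ball_segment (x0 x y : 'rV[R]_n) r (t : R) : ball x0 r x -> ball x0 r y ->
  0 <= t <= 1 -> ball x0 r (x + t *: (y - x)).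
Proof.
rewrite -!ball_normE /= => hx hy /andP[t0 t1].
have -> : x0 - (x + t *: (y - x)) = (1 - t) *: (x0 - x) + t *: (x0 - y).
  by apply/rowP => k; rewrite !mxE; ring.
apply: le_lt_trans (ler_normD _ _) _; rewrite !normrZ (ger0_norm t0).
rewrite (@ger0_norm _ (1 - t)) ?subr_ge0//.
have [->|t0'] := eqVneq t 0; first by rewrite subr0 mul1r mul0r addr0.
have {}t0 : 0 < t by rewrite lt_def t0'.
have : (1 - t) * `|x0 - x| <= (1 - t) * r by rewrite ler_wpM2l ?subr_ge0// ltW.
have : t * `|x0 - y| < t * r by rewrite ltr_pM2l.
set a := t * `|_|; set b := (1 - t) * `|_|; lra.
Qed.

Lemma smooth_on_continuous m W (phi : 'rV[R]_n -> 'rV[R]_m) x :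
  smooth_on W phi -> W x -> {for x, continuous phi}.
Proof. by move=> sp Wx; exact: differentiable_continuous (smooth_on_differentiable sp Wx). Qed.

Lemma smooth_on_jmx m W (phi : 'rV[R]_n -> 'rV[R]_m) i j : open W -> smooth_on W phi ->
  smooth_on W (fun x => jmx phi x i j).
Proof.
move=> oW sp; apply: (@smooth_on_ext _ _ _ W (fun x => partial i phi x 0 j)) => //.
  by move=> x _; rewrite !mxE.
by have /smooth_on_coord := smooth_on_partial i sp; exact.
Qed.

Lemma differentiable_bigsum (J : Type) (r : seq J) (F : J -> 'rV[R]_n -> R) x :
  (forall j, differentiable (F j) x) -> differentiable (fun y => \sum_(j <- r) F j y) x.
Proof.
move=> dF; elim: r => [|j r IH].
  have -> : (fun y => \sum_(j <- [::]) F j y) = cst 0 :> ('rV[R]_n -> R).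
    by apply/funext => y; rewrite big_nil.
  exact: differentiable_cst.
have -> : (fun y => \sum_(j <- j :: r) F j y) = fun y => F j y + \sum_(j <- r) F j y.
  by apply/funext => y; rewrite big_cons.
exact: (differentiableD (dF j) IH).
Qed.

Lemma partial_sum (J : Type) (r : seq J) (F : J -> 'rV[R]_n -> R) i x :
  (forall j, differentiable (F j) x) ->
  partial i (fun y => \sum_(j <- r) F j y) x = \sum_(j <- r) partial i (F j) x.
Proof.
move=> dF; elim: r => [|j r IH].
  have -> : (fun y => \sum_(j <- [::]) F j y) = cst 0 :> ('rV[R]_n -> R).
    by apply/funext => y; rewrite big_nil.
  by rewrite big_nil partial_cst.
have -> : (fun y => \sum_(j <- j :: r) F j y) = fun y => F j y + \sum_(j <- r) F j y.
  by apply/funext => y; rewrite big_cons.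
by rewrite partialD// ?IH ?big_cons//; exact: differentiable_bigsum.
Qed.

Lemma partialZ (r : R) (u : 'rV[R]_n -> R) i x : differentiable u x ->
  partial i (fun y => r * u y) x = r * partial i u x.
Proof.
move=> du; rewrite (partialM i (differentiable_cst r x) du).
by rewrite partial_cst mul0r add0r.
Qed.

Lemma partial_id i k (x : 'rV[R]_n) : partial i (fun y => y 0 k) x = (i == k)%:R :> R.
Proof.
by rewrite (partial_coord (F := id))// /partial derive_id mxE eqxx eq_sym.
Qed.

Lemma norm_mulmx m (A : 'M[R]_(m, n)) (v : 'rV[R]_m) :
  `|v *m A| <= (\sum_i \sum_j `|A i j|) * `|v|.
Proof.
apply: norm_le_coord => [|k]; first by rewrite mulr_ge0// sumr_ge0// => i _; rewrite sumr_ge0.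
rewrite mxE mulr_suml; apply: le_trans (ler_norm_sum _ _ _) _; apply: ler_sum => i _.
rewrite normrM mulrC ler_pM// ?coord_norm_le// (bigD1 k)//= lerDl sumr_ge0//.
Qed.

Lemma differentiable_mulmxr m (A : 'M[R]_(n, m)) x :
  differentiable (mulmxr A : 'rV[R]_n -> 'rV[R]_m) x.
Proof.
apply: differentiable_row => k.
have -> : (fun y : 'rV[R]_n => mulmxr A y 0 k) = fun y => \sum_j y 0 j * A j k.
  by apply/funext => y; rewrite mxE.
apply: differentiable_bigsum => j.
apply: (differentiableM (f := fun y : 'rV[R]_n => y 0 j) (g := cst (A j k))).
  exact: differentiable_coord.
exact: differentiable_cst.
Qed.

Lemma diff_eps m (F : 'rV[R]_n -> 'rV[R]_m) x (L : 'M[R]_(n, m)) :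
  (forall eps, 0 < eps -> \forall h \near (0 : 'rV[R]_n),
     `|F (h + x) - F x - h *m L| <= eps * `|h|) ->
  differentiable F x /\ forall h, 'd F x h = h *m L.
Proof.
move=> hF.
have cL : continuous (mulmxr L : 'rV[R]_n -> 'rV[R]_m).
  by move=> v; apply: differentiable_continuous; exact: differentiable_mulmxr.
have o : F \o shift x = cst (F x) + (mulmxr L : 'rV[R]_n -> 'rV[R]_m) +o_ (0 : 'rV[R]_n) id.
  apply/eqaddoP => e e0; apply: filterS (hF e e0) => h.
  by rewrite !fctE /= opprD addrA.
have e := diff_unique cL o; split; last by move=> h; rewrite e.
by apply/diff_locallyP; rewrite e.
Qed.

Lemma diff_epsP m (F : 'rV[R]_n -> 'rV[R]_m) x : differentiable F x ->
  forall eps, 0 < eps -> \forall h \near (0 : 'rV[R]_n),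
     `|F (h + x) - F x - h *m jmx F x| <= eps * `|h|.
Proof.
move=> dF e e0; have [_ /eqaddoP/(_ e e0)] := (diff_locallyP _ _).1 dF.
by apply: filterS => h; rewrite !fctE /= opprD addrA diff_jmx.
Qed.

(* A contraction of a closed ball has a fixed point: minimise [|e x + w - x|]. *)
Lemma ball_fixed_point (e : 'rV[R]_n -> 'rV[R]_n) (x0 w : 'rV[R]_n) (r : R) :
  0 < r ->
  (forall x, `|x0 - x| <= r -> differentiable e x) ->
  (forall x y, `|x0 - x| <= r -> `|x0 - y| <= r -> `|e x - e y| <= 2^-1 * `|x - y|) ->
  `|e x0 + w - x0| < r / 2 ->
  exists2 p, `|x0 - p| < r & e p + w = p.
Proof.
move=> r0 ce le hw; pose B : set 'rV[R]_n := [set x | `|x0 - x| <= r].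
have maps x : B x -> `|x0 - (e x + w)| < r.
  move=> Bx; have -> : x0 - (e x + w) = - ((e x - e x0) + (e x0 + w - x0)).
    by apply/rowP => k; rewrite !mxE; ring.
  rewrite normrN; apply: le_lt_trans (ler_normD _ _) _.
  have B0 : `|x0 - x0| <= r by rewrite subrr normr0 ltW.
  have := le _ _ Bx B0; rewrite (distrC x) => h1.
  have h2 : 2^-1 * `|x0 - x| <= 2^-1 * r by rewrite ler_wpM2l// invr_ge0.
  move: hw h1 h2; set a := `|_|; set b := `|_|; set c := `|x0 - x|; lra.
have cB : compact B.
  apply: bounded_closed_compact.
    exists (`|x0| + r); split; first exact: num_real.
    move=> M hM x Bx; apply: le_trans (ltW hM).
    have -> : x = x0 - (x0 - x) by rewrite opprB addrC subrK.
    by apply: le_trans (ler_normB _ _) _; rewrite lerD2l.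
  have -> : B = closed_ball_ (fun x : 'rV[R]_n => `|x|) x0 r by [].
  by rewrite -closed_ballE//; exact: closed_ball_closed.
have B0 : B !=set0 by exists x0; rewrite /B /= subrr normr0 ltW.
pose F (x : 'rV[R]_n) : 'rV[R]_n := e x + w - x.
have [|p /set_mem Bp hp] := EVT_min_rV (f := fun x => `|F x|) B0 cB.
  apply: continuous_in_subspaceT => x /set_mem Bx.
  have c1 : {for x, continuous F}.
    apply: differentiable_continuous; apply: (@differentiableB _ _ _ (fun x => e x + w) id).
      by apply: (@differentiableD _ _ _ e (cst w)); [exact: ce|exact: differentiable_cst].
    exact: ex_diff.
  exact: (cvg_norm c1).
have hq : e p + w = p.
  have Bq : B (e p + w) by exact: ltW (maps _ Bp).
  have := hp _ (mem_set Bq); have := le _ _ Bq Bp; rewrite /F.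
  have -> : e (e p + w) + w - (e p + w) = e (e p + w) - e p.
    by apply/rowP => k; rewrite !mxE; ring.
  move=> h1 h2; have h3 := le_trans h2 h1.
  apply/eqP; rewrite -subr_eq0 -normr_le0.
  by move: h3; set a := `|_|; lra.
by exists p => //; rewrite -hq; exact: maps.
Qed.

(** A vector [v] of the kernel would satisfy |v| <= |v| / 2. *)
Lemma invertible_near1 (A : 'M[R]_n) :
  (forall v : 'rV[R]_n, `|v - v *m A| <= 2^-1 * `|v|) -> A \in unitmx.
Proof.
move=> hA; rewrite -row_free_unit -kermx_eq0; apply/rowV0P => v /sub_kermxP vA.
have := hA v; rewrite vA subr0 => h.
apply/eqP; rewrite -normr_le0; move: h; set a := `|v|; lra.
Qed.

(* Inverse function theorem: [phi x = w] is the fixed point equation of the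
   contraction [x |-> x - phi x A + w A] with A the inverse Jacobian at [x0]. *)
Lemma inverse_function W (phi : 'rV[R]_n -> 'rV[R]_n) x0 :
  open W -> W x0 -> smooth_on W phi -> jmx phi x0 \in unitmx ->
  exists (U V : set 'rV[R]_n) (psi : 'rV[R]_n -> 'rV[R]_n),
    [/\ open U, open V, U x0, V (phi x0) &
    [/\ U `<=` W, forall x, U x -> V (phi x) /\ psi (phi x) = x,
        forall y, V y -> U (psi y) /\ phi (psi y) = y & smooth_on V psi]].
Proof.
move=> oW Wx0 sphi uA; set A := invmx (jmx phi x0).
pose g x := phi x *m A; pose e x := x - g x.
have dphi x : W x -> differentiable phi x by exact: smooth_on_differentiable.
pose K := \sum_i \sum_j `|A i j|.
have K0 : 0 <= K by rewrite sumr_ge0// => i _; rewrite sumr_ge0.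
have norm_A v : `|v *m A| <= K * `|v| := norm_mulmx _ _.
clearbody K.
have AI : injective (mulmxr A : 'rV[R]_n -> _).
  by apply: can_inj (mulmxr (jmx phi x0)) _ => v /=; rewrite -mulmxA mulVmx// mulmx1.
have eE x k : e x 0 k = x 0 k - \sum_j A j k * phi x 0 j.
  by rewrite !mxE; congr (_ - _); apply: eq_bigr => j _; rewrite mulrC.
have sphik j : smooth_on W (fun x => phi x 0 j) by have /smooth_on_coord := sphi; exact.
have dphik j x : W x -> differentiable (fun x => phi x 0 j) x.
  by move=> Wx; exact: smooth_on_differentiable Wx.
have se k : smooth_on W (fun x => e x 0 k).
  apply: (@smooth_on_ext _ _ _ W (fun x => x 0 k - \sum_j A j k * phi x 0 j)) => //.
  apply: smooth_onB => //; first exact: smooth_on_id.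
  by apply: smooth_on_sum => // j; exact: smooth_onZ.
have de x k : W x -> differentiable (fun x => e x 0 k) x.
  by move=> Wx; exact: smooth_on_differentiable Wx.
have pe x k i : W x -> partial i (fun x => e x 0 k) x = (1%:M - jmx phi x *m A) i k.
  move=> Wx; rewrite (_ : (fun x => e x 0 k) = (fun x => x 0 k - \sum_j A j k * phi x 0 j)); last first.
    exact/funext.
  have dA j : differentiable (fun x => A j k * phi x 0 j) x.
    exact: (differentiableZ (A j k) (dphik j x Wx)).
  rewrite partialB; [|exact: differentiable_coord|exact: differentiable_bigsum].
  rewrite partial_id partial_sum// !mxE; congr (_ - _); apply: eq_bigr => j _.
  by rewrite (partialZ _ _ (dphik j x Wx)) jmxE mulrC (partial_coord _ _ (dphi x Wx)).
(* In the sup norm a bound q on all partial derivatives gives the Lipschitz constant n q, here at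
   most 1/2; the successor keeps the denominator nonzero in dimension 0. *)
pose q : R := (2 * n.+1%:R)^-1.
have q0 : 0 < q by rewrite invr_gt0 mulr_gt0.
have nq : n%:R * q <= 2^-1.
  rewrite /q invfM mulrCA ler_piMr ?invr_ge0// ler_pdivrMr// mul1r ler_nat//.
have [r0 r0_gt0 hr0] : exists2 r0 : R, 0 < r0 & forall x, ball x0 r0 x -> W x /\
    forall p : 'I_n * 'I_n, `|partial p.1 (fun x => e x 0 p.2) x : R| <= q.
  have : \forall x \near x0, W x /\ forall p : 'I_n * 'I_n,
      `|partial p.1 (fun x => e x 0 p.2) x : R| <= q.
    apply: filterI; first exact: open_nbhs_nbhs.
    apply: (@filter_forall _ _
      (fun (p : 'I_n * 'I_n) x => `|partial p.1 (fun x => e x 0 p.2) x : R| <= q)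
      (nbhs x0) (nbhs_filter x0)) => -[i k] /=.
    have c := differentiable_continuous (smooth_on_differentiable (smooth_on_partial i (se k)) Wx0).
    have /cvgrPdistC_lt/(_ q q0) := c; apply: filterS => x; rewrite [X in _ - X]pe//.
    by rewrite mulmxV// subrr mxE subr0 => /ltW.
  by move=> /nbhs_ballP[r0 /= r00 h]; exists r0.
have lip x y : ball x0 r0 x -> ball x0 r0 y -> `|e x - e y| <= 2^-1 * `|x - y|.
  move=> bx bY; apply: norm_le_coord; first by rewrite mulr_ge0 ?invr_ge0.
  move=> k; have -> : (e x - e y) 0 k = e x 0 k - e y 0 k by rewrite [LHS]mxE [X in _ + X]mxE.
  have := @lipschitz_partial (ball x0 r0) (fun x => e x 0 k) q
    (fun z bz => de z k (hr0 z bz).1) (fun z i bz => (hr0 z bz).2 (i, k)) y x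
    (fun t ht => ball_segment bY bx ht).
  by move=> h; apply: le_trans h _; rewrite ler_wpM2r.
have ux x : ball x0 r0 x -> jmx phi x \in unitmx.
  move=> bx; have : jmx phi x *m A \in unitmx; last by rewrite unitmx_mul => /andP[].
  apply: invertible_near1 => v; have -> : v - v *m (jmx phi x *m A) = v *m (1%:M - jmx phi x *m A).
    by rewrite mulmxBr mulmx1.
  apply: norm_le_coord => [|k]; first by rewrite mulr_ge0 ?invr_ge0.
  rewrite mxE; apply: le_trans (ler_norm_sum _ _ _) _.
  apply: le_trans (_ : n%:R * q * `|v| <= _); last by rewrite ler_wpM2r.
  have -> : n%:R * q * `|v| = \sum_(j < n) (q * `|v|).
    by rewrite sumr_const card_ord -mulrA mulr_natl.
  apply: ler_sum => j _; rewrite normrM mulrC ler_pM ?coord_norm_le//.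
  by have [Wx /(_ (j, k)) /=] := hr0 _ bx; rewrite pe.
(* Halving the radius puts the closed ball of the fixed point argument inside the open ball where
   the estimates hold. *)
pose r := r0 / 2; have r_gt0 : 0 < r by rewrite divr_gt0.
have r_lt x : `|x0 - x| <= r -> ball x0 r0 x.
  move=> h; rewrite -ball_normE /=; apply: le_lt_trans h _.
  by rewrite ltr_pdivrMr// ltr_pMr// ltr1n.
pose V := [set v | `|v *m A - g x0| < r / 2].
pose U := [set x | `|x0 - x| < r] `&` phi @^-1` V.
have oV : open V.
  rewrite openE => v /= Vv; pose d := r / 2 - `|v *m A - g x0|.
  have d0 : 0 < d by rewrite subr_gt0.
  apply/nbhs_ballP; exists (d / (K + 1)) => /=; first by rewrite divr_gt0// ltr_wpDl.
  move=> w; rewrite -ball_normE => vw'.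
  have vw : `|v - w| * (K + 1) < d by rewrite -ltr_pdivlMr// ltr_wpDl.
  rewrite /V /=.
  have -> : w *m A - g x0 = (v *m A - g x0) - (v - w) *m A by rewrite mulmxBl opprB [RHS]addrC addrA subrK.
  apply: le_lt_trans (ler_normB _ _) _; rewrite -ltrBrDl -/d.
  apply: le_lt_trans (norm_A _) _; apply: le_lt_trans vw.
  by rewrite mulrDr mulr1 mulrC lerDl.
have oU : open U.
  rewrite openE => x [/= x_r Vx]; apply: filterI; last first.
    apply: (smooth_on_continuous sphi); first by have [] := hr0 _ (r_lt _ (ltW x_r)).
    exact: open_nbhs_nbhs.
  apply/nbhs_ballP; exists (r - `|x0 - x|) => /=; first by rewrite subr_gt0.
  move=> y; rewrite -ball_normE /= ltrBrDl; apply: le_lt_trans.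
  by rewrite -{1}(subrK x x0) -addrA ler_normD.
have Vphi0 : V (phi x0) by rewrite /V /= subrr normr0 divr_gt0.
have sol v : V v -> exists x, `|x0 - x| < r /\ phi x = v.
  move=> Vv; have [x /r_lt bx|||p p_r hp] := @ball_fixed_point e x0 (v *m A) r r_gt0.
  - apply: differentiable_row => k.
    by apply: de; have [] := hr0 _ bx.
  - by move=> x y /r_lt bx /r_lt bY; exact: lip.
  - by rewrite /e addrAC [x0 - _]addrC addrK addrC.
  exists p; split=> //; apply: AI => /=.
  by rewrite -/(g p); move: hp; rewrite /e -addrA => /eqP; rewrite eq_sym addrC -subr_eq0 opprD addrCA subrr addr0 oppr_eq0 addrC subr_eq0 => /eqP.
have inj x y : ball x0 r0 x -> ball x0 r0 y -> phi x = phi y -> x = y.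
  move=> bx bY pxy; have := lip _ _ bx bY; rewrite /e /g pxy opprB addrA subrK.
  move=> h; apply/eqP; rewrite -subr_eq0 -normr_le0.
  by move: h; set a := `|_|; lra.
pose psi v : 'rV[R]_n := get [set x | `|x0 - x| < r /\ phi x = v].
have psiP v : V v -> `|x0 - psi v| < r /\ phi (psi v) = v.
  by move=> /sol h; exact: (getPex h).
have psi_ball v : V v -> ball x0 r0 (psi v) by move=> /psiP[h _]; apply: r_lt; exact: ltW.
have psi_lip v w : V v -> V w -> `|psi v - psi w| <= 2 * K * `|v - w|.
  move=> Vv Vw; have h1 := lip _ _ (psi_ball v Vv) (psi_ball w Vw).
  have h2 := norm_A (v - w).
  have e1 : psi v - psi w = (e (psi v) - e (psi w)) + (v - w) *m A.
    rewrite /e /g (psiP v Vv).2 (psiP w Vw).2 mulmxBl.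
    by apply/rowP => k; rewrite !mxE; ring.
  have : `|psi v - psi w| <= 2^-1 * `|psi v - psi w| + K * `|v - w|.
    by rewrite {1}e1; apply: le_trans (ler_normD _ _) _; exact: lerD.
  by move: (`|_|) => a; rewrite -mulrA; move: (K * _) => b; lra.
have dpsi v : V v -> differentiable psi v /\ jmx psi v = invmx (jmx phi (psi v)).
  move=> Vv; set x := psi v; set D := jmx phi x.
  have uD : D \in unitmx by exact: ux (psi_ball v Vv).
  have [Wx _] := hr0 _ (psi_ball v Vv).
  pose K' := \sum_i \sum_j `|invmx D i j|.
  have K'0 : 0 <= K' by rewrite sumr_ge0// => i _; rewrite sumr_ge0.
  have norm_D w : `|w *m invmx D| <= K' * `|w| := norm_mulmx _ _.
  clearbody K'.
  have KK0 : 0 <= K' * (2 * K) by rewrite mulr_ge0// mulr_ge0.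
  have [dps dE] : differentiable psi v /\ forall h, 'd psi v h = h *m invmx D.
    apply: diff_eps => eps eps0.
    pose eps' := eps / (K' * (2 * K) + 1).
    have den : 0 < K' * (2 * K) + 1 by rewrite ltr_wpDl.
    have eps'0 : 0 < eps' by rewrite divr_gt0.
    have /nbhs_ballP[d /= d0 hd] := diff_epsP (dphi _ Wx) eps'0.
    have Vh : \forall h \near (0 : 'rV[R]_n), V (h + v).
      have : \forall y \near v, V y by exact: open_nbhs_nbhs.
      by rewrite (near_shift 0 v) subr0.
    near=> h.
    have Vhv : V (h + v) by near: h.
    pose k := psi (h + v) - x.
    have k_le : `|k| <= 2 * K * `|h|.
      by rewrite /k -{2}(addrK v h); exact: psi_lip.
    have k_small : ball (0 : 'rV[R]_n) d k.
      rewrite -ball_normE /= sub0r normrN; apply: le_lt_trans k_le _.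
      have : `|h| < d / (2 * K + 1).
        near: h; apply/nbhs_ballP; exists (d / (2 * K + 1)) => /=.
          by rewrite divr_gt0// ltr_wpDl// mulr_ge0.
        by move=> z; rewrite -ball_normE /= sub0r normrN.
      rewrite ltr_pdivlMr ?ltr_wpDl ?mulr_ge0// mulrDr mulr1; apply: le_lt_trans.
      by rewrite mulrC lerDl.
    have := hd _ k_small; rewrite /k subrK (psiP _ Vhv).2 /x (psiP _ Vv).2 addrK -/x -/k -/D.
    move=> h1; have -> : k - h *m invmx D = - ((h - k *m D) *m invmx D).
      by rewrite mulmxBl -mulmxA mulmxV// mulmx1 opprB.
    rewrite normrN; apply: le_trans (norm_D _) _.
    have h2 : `|h - k *m D| <= eps' * (2 * K * `|h|).
      by apply: le_trans h1 _; rewrite ler_wpM2l// ltW.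
    apply: le_trans (_ : K' * (eps' * (2 * K * `|h|)) <= _); first by rewrite ler_wpM2l.
    have -> : K' * (eps' * (2 * K * `|h|)) = eps' * (K' * (2 * K)) * `|h| by ring.
    rewrite ler_wpM2r// /eps' mulrAC ler_pdivrMr//.
    by rewrite ler_wpM2l ?(ltW eps0)// lerDl.
  split=> //; apply/row_matrixP => i; rewrite !rowE -dE.
  by rewrite diff_jmx.
have sg : smooth_on V psi.
  apply/(smooth_on_coord _ oV) => k.
  (* The Jacobian of [psi] is the inverse Jacobian of [phi] evaluated at [psi], so functions of the
     form [a \o psi] are stable under differentiation. *)
  pose P (u : 'rV[R]_n -> R) := exists2 a : 'rV[R]_n -> R, smooth_on U a & u = a \o psi.
  have U_ball x : U x -> ball x0 r0 x by move=> [/ltW/r_lt].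
  have Upsi v : V v -> U (psi v).
    by move=> Vv; have [h1 h2] := psiP _ Vv; split=> //; rewrite /= h2.
  apply: (smooth_coind (P := P)) => //; last first.
    by exists (fun x => x 0 k) => //; exact: smooth_on_id.
  move=> _ [a sa ->]; split=> [v Vv|i].
    apply: differentiable_comp; first exact: (dpsi v Vv).1.
    by apply: smooth_on_differentiable sa _; exact: Upsi.
  exists ((fun x => \sum_j invmx (jmx phi x) i j * partial j a x) \o psi).
    exists (fun x => \sum_j invmx (jmx phi x) i j * partial j a x) => //.
    apply: smooth_on_sum => // j; apply: smooth_onM => //; last exact: smooth_on_partial.
    apply: smooth_on_invmx; [exact: oU|by move=> x /U_ball; exact: ux|move=> i' j'].
    apply: smooth_on_jmx => //; apply: smooth_on_sub sphi.
    by move=> x /U_ball/hr0[].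
  move=> v Vv; rewrite differentiable_comp_partial; [|exact: (dpsi v Vv).1|]; last first.
    by apply: smooth_on_differentiable sa _; exact: Upsi.
  by apply: eq_bigr => j _; rewrite -(dpsi v Vv).2 jmxE.
exists U, V, psi; split=> //; first by split; rewrite //= subrr normr0.
split=> //.
- by move=> x [/ltW/r_lt/hr0[]].
- move=> x [/ltW/r_lt bx Vx]; split=> //; apply: inj => //; first exact: psi_ball.
  exact: (psiP _ Vx).2.
- by move=> v Vv; have [h1 h2] := psiP _ Vv; split=> //; split=> //; rewrite /= h2.
Unshelve. all: by end_near. Qed.

End InverseFunction.

(** * Spin-weighted derivatives *)

(* The functions of a surface patch: [cj] is complex conjugation, [dZ] and [dZb] are the derivations
   along Z and its conjugate, [ci] is the imaginary unit, and [cj_pos] is the only trace of positivity. *)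
Record framed_ring (R : realType) := FramedRing {
  frc :> comPzRingType;
  cst : {rmorphism R -> frc};
  cj : {rmorphism frc -> frc};
  dZ : {additive frc -> frc};
  dZb : {additive frc -> frc};
  kap : frc;
  ci : frc;
  ciM : ci * ci = -1;
  dZ_ci : dZ ci = 0;
  cjK : involutive cj;
  cj_cst : forall r, cj (cst r) = cst r;
  dZM : forall u v, dZ (u * v) = dZ u * v + u * dZ v;
  dZ_cst : forall r, dZ (cst r) = 0;
  cj_ci : cj ci = - ci;
  cj_dZ : forall u, cj (dZ u) = dZb (cj u);
  dZ_comm : forall u, dZ (dZb u) - dZb (dZ u) = - cj kap * dZ u + kap * dZb u;
  cj_pos : forall (I : finType) (u : I -> frc),
    \sum_i u i * cj (u i) = 0 -> forall i, u i = 0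
}.

Section Eth.
Variables (R : realType) (A : framed_ring R).
Implicit Types (u v w : A) (m n p : int).

(** [eth] raises the weight by one and [ethb] lowers it. The weight is an explicit argument, since
    an element of the ring does not record it. *)
Definition eth m u := dZ A u + m%:~R * kap A * u.
Definition ethb m u := dZb A u - m%:~R * cj A (kap A) * u.
(* Half of the Gaussian curvature. *)
Definition ccurv := dZb A (kap A) + dZ A (cj A (kap A)) - 2 * kap A * cj A (kap A).

Lemma cj_dZb u : cj A (dZb A u) = dZ A (cj A u).
Proof. by rewrite -[u in LHS](@cjK R A) -cj_dZ cjK. Qed.

Lemma dZbM u v : dZb A (u * v) = dZb A u * v + u * dZb A v.
Proof.
by rewrite -[u * v](@cjK R A) -cj_dZ rmorphM dZM rmorphD !rmorphM !cj_dZ !cjK.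
Qed.

Lemma dZb_cst r : dZb A (cst A r) = 0.
Proof. by rewrite -(@cj_cst R A) -cj_dZ dZ_cst rmorph0. Qed.

Lemma cj_int m : cj A m%:~R = m%:~R.
Proof. exact: rmorph_int. Qed.

Lemma cst_int m : cst A m%:~R = m%:~R.
Proof. exact: rmorph_int. Qed.

Lemma dZ_int m : dZ A m%:~R = 0.
Proof. by rewrite -cst_int dZ_cst. Qed.

Lemma dZb_int m : dZb A m%:~R = 0.
Proof. by rewrite -cst_int dZb_cst. Qed.

Lemma cj_eth m u : cj A (eth m u) = ethb (- m) (cj A u).
Proof. rewrite /eth /ethb rmorphD !rmorphM cj_dZ cj_int rmorphN; ring. Qed.

Lemma cj_ethb m u : cj A (ethb m u) = eth (- m) (cj A u).
Proof. rewrite /eth /ethb rmorphB !rmorphM cj_dZb cj_int cjK rmorphN; ring. Qed.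

Lemma eth0 m : eth m 0 = 0.
Proof. by rewrite /eth raddf0 mulr0 addr0. Qed.

Lemma ethb0 m : ethb m 0 = 0.
Proof. by rewrite /ethb raddf0 mulr0 subr0. Qed.

Lemma ethD m u v : eth m (u + v) = eth m u + eth m v.
Proof. rewrite /eth raddfD /=; ring. Qed.

Lemma ethbD m u v : ethb m (u + v) = ethb m u + ethb m v.
Proof. rewrite /ethb raddfD /=; ring. Qed.

(** The weight of the product is a variable with an equation because integer sums seldom match
    syntactically; the equation is left to [lia] or to computation. *)
Lemma ethM m n p u v : p = m + n -> eth p (u * v) = eth m u * v + u * eth n v.
Proof. by move=> ->; rewrite /eth dZM rmorphD /=; ring. Qed.

Lemma ethbM m n p u v : p = m + n -> ethb p (u * v) = ethb m u * v + u * ethb n v.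
Proof. by move=> ->; rewrite /ethb dZbM rmorphD /=; ring. Qed.

Lemma eth_cst r : eth 0 (cst A r) = 0.
Proof. by rewrite /eth dZ_cst !mul0r addr0. Qed.

Lemma ethb_cst r : ethb 0 (cst A r) = 0.
Proof. by rewrite /ethb dZb_cst !mul0r subr0. Qed.

Lemma ethZ m r u : eth m (cst A r * u) = cst A r * eth m u.
Proof. by rewrite (ethM (m := 0) (n := m)) ?add0r// eth_cst mul0r add0r. Qed.

Lemma ethbZ m r u : ethb m (cst A r * u) = cst A r * ethb m u.
Proof. by rewrite (ethbM (m := 0) (n := m)) ?add0r// ethb_cst mul0r add0r. Qed.

Lemma eth_ci m u : eth m (ci A * u) = ci A * eth m u.
Proof. rewrite /eth dZM dZ_ci; ring. Qed.

Lemma ethb_ci m u : ethb m (ci A * u) = ci A * ethb m u.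
Proof.
rewrite /ethb dZbM; have -> : dZb A (ci A) = 0; last by ring.
by rewrite -[ci A](@cjK R A) cj_ci -cj_dZ raddfN dZ_ci oppr0 rmorph0.
Qed.

Lemma ethN m u : eth m (- u) = - eth m u.
Proof. rewrite /eth raddfN /=; ring. Qed.

Lemma ethbN m u : ethb m (- u) = - ethb m u.
Proof. rewrite /ethb raddfN /=; ring. Qed.

Lemma ethB m u v : eth m (u - v) = eth m u - eth m v.
Proof. by rewrite ethD ethN. Qed.

Lemma ethbB m u v : ethb m (u - v) = ethb m u - ethb m v.
Proof. by rewrite ethbD ethbN. Qed.

Lemma eth_sum m (I : finType) (P : pred I) (F : I -> A) :
  eth m (\sum_(i | P i) F i) = \sum_(i | P i) eth m (F i).
Proof. exact: (big_morph (eth m) (ethD m) (eth0 m)). Qed.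

Lemma ethb_sum m (I : finType) (P : pred I) (F : I -> A) :
  ethb m (\sum_(i | P i) F i) = \sum_(i | P i) ethb m (F i).
Proof. exact: (big_morph (ethb m) (ethbD m) (ethb0 m)). Qed.

Lemma eth_comm m p q u : p = m + 1 -> q = m - 1 ->
  ethb p (eth m u) = eth q (ethb m u) + m%:~R * ccurv * u.
Proof.
move=> -> ->; rewrite /eth /ethb /ccurv !raddfD !raddfN /= !dZM !dZbM dZ_int dZb_int.
have /eqP := dZ_comm (f := A) u; rewrite subr_eq => /eqP ->.
ring.
Qed.

(** Nonzero constants are invertible; this is the cancellation used in place of integrality. *)
Lemma cst_eq0 r u : r != 0 -> cst A r * u = 0 -> u = 0.
Proof.
move=> r0 ru; rewrite -[u]mul1r -(rmorph1 (cst A)) -(mulVf r0) rmorphM -mulrA.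
by rewrite ru mulr0.
Qed.

Lemma double_eq0 u : u + u = 0 -> u = 0.
Proof.
move=> uu; apply: (@cst_eq0 2); rewrite ?pnatr_eq0//.
by rewrite rmorph_nat mulr2n mulrDl mul1r.
Qed.

Variable I : finType.
Implicit Types (x y z t : I -> A).

(** Bilinear rather than Hermitian, so a nonzero vector may be isotropic; the Hermitian product is
    [dt x (vcj y)]. *)
Definition dt x y : A := \sum_i x i * y i.
Definition veth m x : I -> A := fun i => eth m (x i).
Definition vethb m x : I -> A := fun i => ethb m (x i).
Definition vcj x : I -> A := fun i => cj A (x i).

Lemma dtC x y : dt x y = dt y x.
Proof. by apply: eq_bigr => i _; rewrite mulrC. Qed.

Lemma dt0l x y : (forall i, x i = 0) -> dt x y = 0.
Proof. by move=> h; rewrite /dt big1// => i _; rewrite h mul0r. Qed.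

Lemma dt_lin1 x a z y : (forall i, x i = a * z i) -> dt x y = a * dt z y.
Proof.
by move=> h; rewrite /dt mulr_sumr; apply: eq_bigr => i _; rewrite h mulrA.
Qed.

Lemma dt_lin1r x a z y : (forall i, x i = a * z i) -> dt y x = a * dt y z.
Proof. by move=> h; rewrite dtC (dt_lin1 _ h) dtC. Qed.

Lemma dt_lin2 x a b z t y : (forall i, x i = a * z i + b * t i) ->
  dt x y = a * dt z y + b * dt t y.
Proof.
move=> h; rewrite /dt !mulr_sumr -big_split; apply: eq_bigr => i _ /=.
rewrite h; ring.
Qed.

Lemma eth_dt m n p x y : p = m + n ->
  eth p (dt x y) = dt (veth m x) y + dt x (veth n y).
Proof.
move=> e; rewrite /dt eth_sum -big_split; apply: eq_bigr => i _.
by rewrite (ethM _ _ e).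
Qed.

Lemma ethb_dt m n p x y : p = m + n ->
  ethb p (dt x y) = dt (vethb m x) y + dt x (vethb n y).
Proof.
move=> e; rewrite /dt ethb_sum -big_split; apply: eq_bigr => i _.
by rewrite (ethbM _ _ e).
Qed.

Lemma cj_dt x y : cj A (dt x y) = dt (vcj x) (vcj y).
Proof. by rewrite /dt rmorph_sum; apply: eq_bigr => i _; rewrite rmorphM. Qed.

Lemma vcjK x : vcj (vcj x) = x.
Proof. by apply/funext => i; rewrite /vcj cjK. Qed.

Lemma vcj_veth m x : vcj (veth m x) = vethb (- m) (vcj x).
Proof. by apply/funext => i; rewrite /vcj /veth cj_eth. Qed.

Lemma vcj_vethb m x : vcj (vethb m x) = veth (- m) (vcj x).
Proof. by apply/funext => i; rewrite /vcj /vethb cj_ethb. Qed.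

Lemma dt_pos x : dt x (vcj x) = 0 -> forall i, x i = 0.
Proof. exact: cj_pos. Qed.

End Eth.

(** * Ladders: norms, termination, isotropy, orthogonality *)

Section Ladder.
Variables (R : realType) (A : framed_ring R) (I : finType).
Variables (f : nat -> I -> A) (l a : nat -> R) (k : R).
Local Notation fb j := (vcj (f j)).
Hypothesis f_up : forall j, veth j%:Z (f j) = f j.+1.
Hypothesis f_down : forall j i, ethb j.+1%:Z (f j.+1 i) = - cst A (l j) * f j i.
Hypothesis f_real : forall i, cj A (f 0%N i) = f 0%N i.
Hypothesis f_norm : dt (f 0%N) (f 0%N) = cst A (a 0%N).
Hypothesis a_rec : forall j, a j.+1 = l j * a j.

Lemma fb0 : fb 0 = f 0%N.
Proof. by apply/funext => i; rewrite /vcj f_real. Qed.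

Lemma fb_up j : vethb (- j%:Z) (fb j) = fb j.+1.
Proof. by rewrite -f_up vcj_veth. Qed.

Lemma fb_down j i : eth (- j.+1%:Z) (fb j.+1 i) = - cst A (l j) * fb j i.
Proof.
by rewrite /vcj -cj_ethb f_down rmorphM rmorphN cj_cst.
Qed.

(** The two claims feed each other: [ethb] applied to the vanishing product gives the next norm by
    the recursion, and [eth] applied to that constant norm gives the next vanishing product. *)
Lemma ladder_norm j :
  dt (f j) (fb j) = cst A (a j) /\ dt (f j.+1) (fb j) = 0.
Proof.
elim: j => [|j [IH1 IH2]].
  rewrite fb0; split=> //.
  have := eth_cst A (a 0%N); rewrite -f_norm (eth_dt (m := 0) (n := 0)) ?addr0//.
  by rewrite f_up [X in _ + X]dtC => /double_eq0.
have h : dt (f j.+1) (fb j.+1) = cst A (a j.+1).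
  have : ethb 1 (dt (f j.+1) (fb j)) = 0 by rewrite IH2 ethb0.
  rewrite (ethb_dt (m := j.+1%:Z) (n := - j%:Z)); last by lia.
  rewrite fb_up (dt_lin1 (a := - cst A (l j)) (z := f j)); last by move=> i; rewrite -f_down.
  by rewrite IH1 mulNr addrC => /eqP; rewrite subr_eq0 => /eqP ->; rewrite a_rec rmorphM.
split=> //.
have := eth_cst A (a j.+1); rewrite -h (eth_dt (m := j.+1%:Z) (n := - j.+1%:Z)); last by lia.
rewrite f_up (dt_lin1r (x := veth _ _) (a := - cst A (l j)) (z := fb j)); last first.
  by move=> i; rewrite -fb_down.
by rewrite IH2 mulr0 addr0.
Qed.

Variable s : nat.
Hypothesis l_s : l s = 0.

(** The squared norm of [f s.+1] is l_s a_s = 0, and positivity makes the vector itself vanish. *)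
Lemma ladder_top j i : (s < j)%N -> f j i = 0.
Proof.
elim: j i => [//|j IH] i; rewrite ltnS leq_eqVlt => /predU1P[<-|sj].
  by apply: dt_pos; rewrite (ladder_norm s.+1).1 a_rec l_s mul0r rmorph0.
by rewrite -f_up /veth IH// eth0.
Qed.

Fixpoint iter_eth (m : int) (N : nat) (q : A) : A :=
  if N is N'.+1 then eth (m + N'%:Z) (iter_eth m N' q) else q.

Hypothesis k_gt0 : 0 < k.
Hypothesis k_curv : ccurv A = cst A k.

(** Moving [ethb] to the right past each [eth] leaves the current weight times k; the weights m,
    ..., m + N accumulate, and at the end [ethb] meets [q]. *)
Lemma ethb_iter_eth (m : nat) N q : ethb m%:Z q = 0 ->
  ethb (m%:Z + N.+1%:Z) (iter_eth m N.+1 q) =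
  (\sum_(i < N.+1) (m + i)%N)%:R * cst A k * iter_eth m N q.
Proof.
move=> q0; elim: N => [|N IH]; rewrite [iter_eth m _.+1 q]/=.
  rewrite (eth_comm (q := m%:Z - 1)); [|by lia|by lia].
  by rewrite addr0 q0 eth0 add0r big_ord1 /= addn0 k_curv.
rewrite (eth_comm (q := m%:Z + N%:Z)); [|by lia|by lia].
rewrite IH -!mulrA -(rmorph_nat (cst A)) !ethZ k_curv.
rewrite [in RHS]big_ord_recr [in RHS]/= natrD -/(iter_eth m N.+1 q).
by rewrite !rmorph_nat mulrDl; congr (_ + _); rewrite -PoszD.
Qed.

(** Applying [ethb] to a vanishing iterate returns a positive multiple of the previous one;
    positivity of the weight [m] and of the curvature is essential. *)
Lemma iter_eth_eq0 (m : nat) N q : (0 < m)%N -> ethb m%:Z q = 0 ->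
  iter_eth m N q = 0 -> q = 0.
Proof.
move=> m0 q0; elim: N => [//|N IH] e; apply: IH.
have := ethb_iter_eth N q0; rewrite e ethb0.
rewrite -(rmorph_nat (cst A)) -rmorphM => /esym; apply: cst_eq0.
rewrite mulf_neq0 ?gt_eqF// ltr0n big_ord_recl /= addn0.
by rewrite addn_gt0 m0.
Qed.

(** By the Leibniz rule every term of the iterate is a product of two ladder vectors whose indices
    sum to m + N > 2s, so one of them lies above the top. *)
Lemma iter_eth_dt N m i j : (i + j = m)%N -> (2 * s < m + N)%N ->
  iter_eth m N (dt (f i) (f j)) = 0.
Proof.
have iterS p M q : iter_eth p M.+1 q = iter_eth (p + 1) M (eth p q).
  elim: M => [|M IHM] /=; first by rewrite addr0.
  by rewrite /= in IHM; rewrite IHM; congr eth; lia.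
have iterD p M u v : iter_eth p M (u + v) = iter_eth p M u + iter_eth p M v.
  by elim: M => //= M ->; rewrite ethD.
elim: N m i j => [|N IH] m i j e.
  rewrite addn0 => h /=; have [si|/negP] := boolP (s < i)%N.
    by apply: dt0l => t; exact: ladder_top.
  by move=> ?; rewrite dtC; apply: dt0l => t; apply: ladder_top; lia.
move=> h; rewrite iterS (eth_dt (m := i%:Z) (n := j%:Z)); last by lia.
rewrite !f_up iterD; have -> : m%:Z + 1 = m.+1%:Z by lia.
by rewrite !IH ?addr0//; lia.
Qed.

(** Induction on the total index. One product of each total index is killed by [ethb] thanks to the
    smaller ones, hence vanishes by [iter_eth_eq0]; the others equal it up to sign. *)
Lemma ladder_isotropic m i j : (0 < m)%N -> (i + j = m)%N -> dt (f i) (f j) = 0.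
Proof.
elim: m i j => [//|[|m] IH] i j _ e.
  have h : dt (f 1%N) (f 0%N) = 0 by have := (ladder_norm 0).2; rewrite fb0.
  by move: e; case: i => [|[|i]]; case: j => [|[|j]]//= _; rewrite // dtC.
(* Both terms of [ethb] of this product lower the total index to m + 1, where the induction
   hypothesis holds. *)
have top : dt (f m.+1) (f 1%N) = 0.
  apply: (@iter_eth_eq0 m.+2 (2 * s).+1) => //; last first.
    by apply: iter_eth_dt; lia.
  rewrite (ethb_dt (m := m.+1%:Z) (n := 1)); last by lia.
  rewrite (dt_lin1 (a := - cst A (l m)) (z := f m)); last by move=> t; rewrite -f_down.
  rewrite IH// ?addn1// mulr0 add0r dtC.
  rewrite (dt_lin1 (a := - cst A (l 0%N)) (z := f 0%N)); last by move=> t; rewrite -f_down.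
  by rewrite IH// mulr0.
(* Differentiating the vanishing products of total index m + 1 moves one unit of index across at the
   cost of a sign. *)
have alt p q : (p + q = m.+1)%N -> dt (f p.+1) (f q) = - dt (f p) (f q.+1).
  move=> pq; have : eth m.+1%:Z (dt (f p) (f q)) = 0 by rewrite IH// eth0.
  rewrite (eth_dt (m := p%:Z) (n := q%:Z)); last by lia.
  by rewrite !f_up => /eqP; rewrite addr_eq0 => /eqP.
have down p : (p <= m.+1)%N -> dt (f (m.+1 - p)) (f p.+1) = 0.
  elim: p => [|p IHp] pm; first by rewrite subn0.
  have := alt (m.+1 - p.+1)%N p.+1; rewrite subnK// => /(_ erefl).
  rewrite -subSn// subSS IHp; last by lia.
  by move=> /esym/eqP; rewrite oppr_eq0 => /eqP.
case: j e => [|j] e.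
  have -> : i = m.+2 by lia.
  by rewrite alt ?addn0// top oppr0.
have -> : i = (m.+1 - j)%N by lia.
by apply: down; lia.
Qed.

(** Isotropy is the case where the smaller index is 0, since [f 0] is real; [ethb] then raises the
    index of the conjugate factor one step at a time. *)
Lemma ladder_orthogonal i j : i != j -> dt (f i) (fb j) = 0.
Proof.
suff main i' j' : (j' < i')%N -> dt (f i') (fb j') = 0.
  case: ltngtP => // ij _; last exact: main.
  by rewrite -[LHS](@cjK R A) cj_dt vcjK dtC main// rmorph0.
elim: j' i' => [|j' IH] i' ij.
  by rewrite fb0; apply: (@ladder_isotropic i'); rewrite ?addn0.
case: i' ij => // i' ij.
have := ethb0 A (i'.+1%:Z - j'%:Z); rewrite -(IH i'.+1 (ltnW ij)).
rewrite (ethb_dt (m := i'.+1%:Z) (n := - j'%:Z)) // fb_up.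
rewrite (dt_lin1 (a := - cst A (l i')) (z := f i')); last by move=> t; rewrite -f_down.
by rewrite IH// mulr0 add0r.
Qed.

End Ladder.

(** * Parallel mean curvature: Codazzi, Ricci and Gauss equations, pseudo-umbilicity *)

Section ParallelMeanCurvature.
Variables (R : realType) (A : framed_ring R) (I : finType).
Variables (f h : I -> A) (h2 sg : R).
Local Notation f1 := (veth 0 f).
Local Notation fb1 := (vcj f1).
Local Notation f2 := (veth 1 f1).
Local Notation fb2 := (vcj f2).
Local Notation half := (cst A 2^-1).
Hypothesis f_real : forall i, cj A (f i) = f i.
Hypothesis f_unit : dt f f = 1.
Hypothesis f_conformal : dt f1 f1 = 0.
Hypothesis f_isometric : dt f1 fb1 = half.
(** Beltrami's formula: the Laplacian of f, which is 4 [ethb] [eth] f, equals 2H - 2f in the unit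
    sphere. *)
Hypothesis hE : forall i, ethb 1 (f1 i) = half * h i + - half * f i.
(** The derivative of H has no normal part, so it is expanded on f1, fb1 and f; the factors 2 come
    from the dual basis, since <f1, fb1> = 1/2. *)
Hypothesis h_parallel : forall i, eth 0 (h i) =
  2 * dt (veth 0 h) fb1 * f1 i + 2 * dt (veth 0 h) f1 * fb1 i + dt (veth 0 h) f * f i.

Let half2 : 2 * half = 1 :> A.
Proof. by rewrite -(rmorph_nat (cst A)) -rmorphM mulfV ?pnatr_eq0// rmorph1. Qed.

Let half2' (u : A) : half * (2 * u) = u.
Proof. by rewrite mulrA [half * 2]mulrC half2 mul1r. Qed.

Let halfI (u : A) : half * u = 0 -> u = 0.
Proof. by apply: cst_eq0; rewrite invr_eq0 pnatr_eq0. Qed.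

Let vcjf : vcj f = f.
Proof. by apply/funext => i; rewrite /vcj f_real. Qed.

Let fb1E : fb1 = vethb 0 f.
Proof. by rewrite vcj_veth vcjf oppr0. Qed.

Let hE' i : h i = 2 * ethb 1 (f1 i) + f i.
Proof.
rewrite hE; transitivity (2 * half * (h i - f i) + f i); last by ring.
by rewrite half2 mul1r subrK.
Qed.

Let h_real i : cj A (h i) = h i.
Proof.
suff e : cj A (ethb 1 (f1 i)) = ethb 1 (f1 i).
  by rewrite hE' rmorphD rmorphM f_real e rmorph_nat.
rewrite cj_ethb /veth cj_eth f_real (eth_comm (p := 1) (q := -1) (m := 0))//.
by rewrite !oppr0 !mul0r addr0.
Qed.

Let vcjh : vcj h = h.
Proof. by apply/funext => i; rewrite /vcj h_real. Qed.

Let dt_half x y : dt (vethb 1 f1) y = half * dt h y + - half * dt f y /\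
   dt x (vethb 1 f1) = half * dt x h + - half * dt x f.
Proof.
have e : forall z, dt (vethb 1 f1) z = half * dt h z + - half * dt f z.
  by move=> z; apply: dt_lin2 => i; rewrite -hE.
by split; rewrite // dtC e ![dt _ x]dtC.
Qed.

Let eth_fb1 : veth (- 1) fb1 = vethb 1 f1.
Proof.
rewrite -[LHS]vcjK vcj_veth vcjK opprK; apply/funext => i; rewrite /vcj.
by rewrite /vethb hE rmorphD !rmorphM rmorphN !cj_cst h_real f_real.
Qed.

Let f1f : dt f1 f = 0.
Proof.
have : eth 0 (dt f f) = 0 by rewrite f_unit -(rmorph1 (cst A)) eth_cst.
by rewrite (eth_dt (m := 0) (n := 0)) ?addr0// [X in _ + X]dtC => /double_eq0.
Qed.

Let hf : dt h f = 0.
Proof.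
have : ethb 1 (dt f1 f) = 0 by rewrite f1f ethb0.
rewrite (ethb_dt (m := 1) (n := 0)) // -fb1E f_isometric.
rewrite (dt_half f f).1 f_unit mulr1 addrNK.
exact: halfI.
Qed.

Let hf1 : dt h f1 = 0.
Proof.
have : ethb 2 (dt f1 f1) = 0 by rewrite f_conformal ethb0.
rewrite (ethb_dt (m := 1) (n := 1)) // [X in _ + X]dtC => /double_eq0.
by rewrite (dt_half f f1).1 [dt f f1]dtC f1f mulr0 addr0 => /halfI.
Qed.

Let hfb1 : dt h fb1 = 0.
Proof. by rewrite -vcjh -cj_dt hf1 rmorph0. Qed.

Let f2f1 : dt f2 f1 = 0.
Proof.
have : eth 2 (dt f1 f1) = 0 by rewrite f_conformal eth0.
by rewrite (eth_dt (m := 1) (n := 1)) // [X in _ + X]dtC => /double_eq0.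
Qed.

Let f2fb1 : dt f2 fb1 = 0.
Proof.
have : eth 0 (dt f1 fb1) = 0 by rewrite f_isometric eth_cst.
rewrite (eth_dt (m := 1) (n := -1)) // eth_fb1 (dt_half f1 f1).2.
by rewrite [dt f1 h]dtC hf1 f1f !mulr0 !addr0.
Qed.

Let f2f : dt f2 f = 0.
Proof.
have : eth 1 (dt f1 f) = 0 by rewrite f1f eth0.
by rewrite (eth_dt (m := 1) (n := 0)) // f_conformal addr0.
Qed.

Lemma dt_mean_parallel : dZ A (dt h h) = 0 /\ dZb A (dt h h) = 0.
Proof.
have e : dZ A (dt h h) = 0.
  have -> : dZ A (dt h h) = eth 0 (dt h h) by rewrite /eth !mul0r addr0.
  rewrite (eth_dt (m := 0) (n := 0)) // [X in _ + X]dtC.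
  suff -> : dt (veth 0 h) h = 0 by rewrite addr0.
  rewrite {1}/dt (eq_bigr _ (fun i _ => congr1 (fun x => x * h i) (h_parallel i))).
  under eq_bigr do rewrite !mulrDl -!mulrA.
  rewrite !big_split /= -!mulr_sumr -!/(dt _ _).
  by rewrite ![dt _ h]dtC hf1 hfb1 hf !mulr0 !addr0.
by split=> //; rewrite -[dt h h]cjK -cj_dZ cj_dt vcjh e rmorph0.
Qed.

Hypothesis h_norm : dt h h = cst A h2.
Hypothesis f2_norm : dt f2 fb2 = cst A sg.

Let w := dt h f2.

Let dh i : eth 0 (h i) = - cst A h2 * f1 i + (- 2 * w) * fb1 i.
Proof.
have e0 : dt (veth 0 h) f = 0.
  have : eth 0 (dt h f) = 0 by rewrite hf eth0.
  by rewrite (eth_dt (m := 0) (n := 0)) // hf1 addr0.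
have e1 : dt (veth 0 h) f1 = - w.
  have : eth 1 (dt h f1) = 0 by rewrite hf1 eth0.
  by rewrite (eth_dt (m := 0) (n := 1)) // => /eqP; rewrite addr_eq0 => /eqP.
have e2 : dt (veth 0 h) fb1 = - (half * cst A h2).
  have : eth (-1) (dt h fb1) = 0 by rewrite hfb1 eth0.
  rewrite (eth_dt (m := 0) (n := -1)) // eth_fb1 (dt_half h h).2 h_norm hf mulr0 addr0.
  by move=> /eqP; rewrite addr_eq0 => /eqP.
rewrite h_parallel e0 e1 e2.
transitivity (- (2 * half) * cst A h2 * f1 i + (- 2 * w) * fb1 i); first by ring.
by rewrite half2 mulN1r.
Qed.

Let dbh i : ethb 0 (h i) = - cst A h2 * fb1 i + (- 2 * cj A w) * f1 i.
Proof.
rewrite -[h i]h_real -[X in ethb X _](opprK) -cj_eth oppr0 dh.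
by rewrite rmorphD !rmorphM !rmorphN rmorph_nat cj_cst {2}/vcj cjK.
Qed.

Let dbf2 i : ethb 2 (f2 i) =
  (- half * cst A h2 - half + ccurv A) * f1 i + (- w) * fb1 i.
Proof.
rewrite {1}/veth (eth_comm (q := 0)) // hE ethD -rmorphN !ethZ dh rmorphN /=.
change (eth 0 (f i)) with (f1 i).
transitivity ((- half * cst A h2 - half + ccurv A) * f1 i + - (2 * half) * w * fb1 i).
  by ring.
by rewrite half2 mulN1r.
Qed.

(** The derivatives [ethb] h and [ethb] f2 are both tangent, hence orthogonal to f2 and to h
    respectively. *)
Let dbw : ethb 2 w = 0.
Proof.
rewrite (ethb_dt (m := 0) (n := 2)) // (dt_lin2 (x := vethb _ _) _ dbh).
rewrite ![dt _ f2]dtC f2fb1 f2f1 [dt h _]dtC (dt_lin2 (x := vethb _ _) _ dbf2).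
by rewrite ![dt _ h]dtC hf1 hfb1 !mulr0 !addr0.
Qed.

(** Ricci equation: [eth] and [ethb] commute on the weight-zero h, and both sides are computed from
    the explicit first derivatives. *)
Let ricci i : w * fb2 i = cj A w * f2 i.
Proof.
have := eth_comm (A := A) (m := 0) (p := 1) (q := -1) (h i) erefl erefl.
rewrite dh dbh !ethbD !ethD !mul0r addr0.
rewrite -[- cst A h2]rmorphN ethbZ ethZ.
have e1 : ethb 1 (f1 i) = eth (-1) (fb1 i) by rewrite -/(vethb 1 f1 i) -eth_fb1.
have -> : ethb 1 (- 2 * w * fb1 i) = - 2 * w * fb2 i.
  rewrite (ethbM (m := 2) (n := -1)) //.
  rewrite (ethbM (m := 0) (n := 2)) // dbw mulr0 addr0.
  have -> : ethb 0 (- 2 : A) = 0.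
    by rewrite -(rmorph_nat (cst A)) -rmorphN ethb_cst.
  by rewrite !mul0r add0r {2}/vcj /veth cj_eth.
have -> : eth (-1) (- 2 * cj A w * f1 i) = - 2 * cj A w * f2 i.
  rewrite (ethM (m := -2) (n := 1)) //.
  rewrite (ethM (m := 0) (n := -2)) //.
  have -> : eth (-2) (cj A w) = 0 by rewrite -[RHS](rmorph0 (cj A)) -dbw cj_ethb.
  have -> : eth 0 (- 2 : A) = 0.
    by rewrite -(rmorph_nat (cst A)) -rmorphN eth_cst.
  by rewrite !(mul0r, mulr0, add0r).
rewrite e1 => /addrI; rewrite -!mulrA !mulNr => /oppr_inj e.
by rewrite -[LHS]half2' e half2'.
Qed.

(** Gauss equation, read off by applying [ethb] to <f2, fb1> = 0. *)
Lemma ccurvE : ccurv A = cst A (2^-1 * (1 + h2) - 2 * sg).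
Proof.
have : ethb 1 (dt f2 fb1) = 0 by rewrite f2fb1 ethb0.
rewrite (ethb_dt (m := 2) (n := -1)) //.
rewrite (dt_lin2 (x := vethb _ _) _ dbf2) f_isometric.
have -> : dt fb1 fb1 = 0 by rewrite -cj_dt f_conformal rmorph0.
have -> : vethb (-1) fb1 = fb2 by rewrite [in RHS]vcj_veth.
rewrite f2_norm mulr0 addr0 rmorphB !rmorphM rmorphD rmorph1 rmorph_nat.
move=> e; transitivity (2 * half * ccurv A); first by rewrite half2 mul1r.
transitivity (2 * half * (half * (1 + cst A h2)) - 2 * cst A sg); last first.
  by rewrite half2 mul1r.
apply/eqP; rewrite -subr_eq0; apply/eqP; rewrite -[RHS](mulr0 2) -e; ring.
Qed.

Hypothesis curv_gt0 : 0 < 2^-1 * (1 + h2) - 2 * sg.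

(** If f2 = 0 this is clear. Otherwise [ricci] paired with f2 gives conj(w) p = sg w, where p = <f2,
    f2> is also killed by [ethb]. This forces conj(w) [eth] w = 0, whose [ethb] derivative is |eth
    w|^2 + 2k|w|^2 = 0 with k > 0 half of the curvature. *)
Lemma pseudo_umbilical : w = 0.
Proof.
have [sg0|sg0] := eqVneq sg 0.
  rewrite /w dtC; apply: dt0l; apply: dt_pos.
  by rewrite f2_norm sg0 rmorph0.
pose p := dt f2 f2.
have wp : cj A w * p = w * cst A sg.
  rewrite -f2_norm /p /dt !mulr_sumr; apply: eq_bigr => i _.
  by rewrite mulrA -ricci; ring.
have dbp : ethb 4 p = 0.
  rewrite (ethb_dt (m := 2) (n := 2)) // [X in _ + X]dtC.
  rewrite (dt_lin2 (x := vethb _ _) _ dbf2) ![dt _ f2]dtC f2f1 f2fb1.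
  by rewrite !mulr0 !addr0.
have e1 : ethb (-2) (cj A w) * p = 0.
  have : ethb 2 (cj A w * p) = 0 by rewrite wp mulrC ethbZ dbw mulr0.
  by rewrite (ethbM (m := -2) (n := 4)) // dbp mulr0 addr0.
(* For the conjugate statement: multiplying by sg turns [w] into [cj A w * p], and [p] annihilates
   the derivative of [cj A w] by [e1]. *)
have e2 : cj A w * eth 2 w = 0.
  rewrite -[LHS](@cjK R A) rmorphM cjK cj_eth.
  suff -> : w * ethb (- 2) (cj A w) = 0 by rewrite rmorph0.
  apply: (cst_eq0 sg0); rewrite mulrA [cst A sg * w]mulrC -wp.
  by rewrite mulrAC -mulrA e1 mulr0.
have : ethb 1 (cj A w * eth 2 w) = 0 by rewrite e2 ethb0.
rewrite (ethbM (m := -2) (n := 3)) // (eth_comm (q := 1)) // dbw eth0 add0r ccurvE.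
set k := 2^-1 * _ - _ => e3.
(* A family of two elements whose sum of squared moduli is the vanishing expression, in the form
   that [cj_pos] expects. *)
pose v b := if b then eth 2 w else cst A (Num.sqrt (2 * k)) * w.
have := @cj_pos R A bool v.
rewrite big_bool /= rmorphM cj_cst cj_eth.
have -> : cst A (Num.sqrt (2 * k)) * w * (cst A (Num.sqrt (2 * k)) * cj A w) =
   cst A (2 * k) * (w * cj A w).
  rewrite -[in RHS](@sqr_sqrtr _ (2 * k)) ?mulr_ge0 ?(ltW curv_gt0)// rmorphXn; ring.
rewrite rmorphM rmorph_nat => /(_ _ false) /= h0.
apply: (@cst_eq0 _ _ (Num.sqrt (2 * k))); first by rewrite gt_eqF// sqrtr_gt0 mulr_gt0.
apply: h0; rewrite -e3; ring.
Qed.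

Let c := 1 + h2.
Hypothesis c_gt0 : 0 < c.
Definition ladder_base : I -> A := fun i => cst A c^-1 * (f i - h i).

(** With w = 0 the derivative of h is - h2 f1, so f - h has derivative c f1. Hence the base has the
    same derivative as f, and their difference is constant. *)
Lemma ladder_base_spec : [/\ forall i, cj A (ladder_base i) = ladder_base i,
  veth 0 ladder_base = f1, dt ladder_base ladder_base = cst A c^-1,
  forall i, ethb 1 (f1 i) = - cst A (c / 2) * ladder_base i &
  (forall i, dZ A (f i - ladder_base i) = 0 /\ dZb A (f i - ladder_base i) = 0) ].
Proof.
have c0 : c != 0 by rewrite gt_eqF.
have cc : cst A c^-1 * cst A c = 1 by rewrite -rmorphM mulVf// rmorph1.
have e1 : veth 0 ladder_base = f1.
  apply/funext => i; rewrite {1}/veth /ladder_base ethZ ethD.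
  have -> : eth 0 (- h i) = - eth 0 (h i) by rewrite /eth raddfN mulrN opprD.
  rewrite dh pseudo_umbilical mulr0 mul0r addr0 -/(f1 i).
  rewrite -[RHS]mul1r -cc /c rmorphD rmorph1; ring.
split => //.
- by move=> i; rewrite /ladder_base rmorphM cj_cst rmorphB f_real h_real.
- rewrite (dt_lin1 (a := cst A c^-1) (z := fun i => f i - h i)) //.
  rewrite (dt_lin1r (a := cst A c^-1) (z := fun i => f i - h i)) //.
  have -> : dt (fun i => f i - h i) (fun i => f i - h i) = cst A c.
    transitivity (dt f f - dt h f - dt f h + dt h h).
      rewrite /dt -!sumrB -big_split; apply: eq_bigr => i _ /=; ring.
    by rewrite f_unit [dt f h]dtC hf h_norm !subr0 /c rmorphD rmorph1.
  by rewrite cc mulr1.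
- move=> i; rewrite hE /ladder_base rmorphM.
  transitivity (cst A c^-1 * cst A c * (half * (h i - f i))); last by ring.
  by rewrite cc; ring.
- move=> i; have e : dZ A (f i - ladder_base i) = 0.
    rewrite raddfB /= -(subr0 (dZ A (f i))).
    have -> : dZ A (f i) - 0 = f1 i by rewrite /veth /eth !mul0r addr0 subr0.
    have -> : dZ A (ladder_base i) = f1 i by rewrite -e1 /veth /eth !mul0r addr0.
    by rewrite subrr.
  split=> //; rewrite -[f i - _]cjK -cj_dZ -[RHS](rmorph0 (cj A)) -e; congr (cj A (dZ A _)).
  by rewrite rmorphB /ladder_base rmorphM cj_cst rmorphB f_real h_real.
Qed.

End ParallelMeanCurvature.

(** All scalar products of the vectors and their conjugates depend only on [s], [l] and [a]; this is
    what lets two ladders with the same constants be matched by a constant linear map. *)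
Record closed_ladder (R : realType) (A : framed_ring R) (I : finType)
    (s : nat) (l a : nat -> R) (f : nat -> I -> A) : Prop := ClosedLadder {
  cl_up : forall j, veth j%:Z (f j) = f j.+1;
  cl_down : forall j i, ethb j.+1%:Z (f j.+1 i) = - cst A (l j) * f j i;
  cl_real : forall i, cj A (f 0%N i) = f 0%N i;
  cl_rec : forall j, a j.+1 = l j * a j;
  cl_neq0 : forall j, (j <= s)%N -> a j != 0;
  cl_end : l s = 0;
  cl_top : forall j i, (s < j)%N -> f j i = 0;
  cl_iso : forall i j, (0 < i + j)%N -> dt (f i) (f j) = 0;
  cl_orth : forall i j, dt (f i) (vcj (f j)) = if i == j then cst A (a i) else 0
}.

Section BuildLadder.
Variables (R : realType) (A : framed_ring R) (I : finType).
Variables (k : R) (k_gt0 : 0 < k) (k_curv : ccurv A = cst A k).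

Lemma closed_ladderI (s : nat) (l a : nat -> R) (f : nat -> I -> A) :
  (forall j, veth j%:Z (f j) = f j.+1) ->
  (forall j i, ethb j.+1%:Z (f j.+1 i) = - cst A (l j) * f j i) ->
  (forall i, cj A (f 0%N i) = f 0%N i) ->
  dt (f 0%N) (f 0%N) = cst A (a 0%N) ->
  (forall j, a j.+1 = l j * a j) -> (forall j, (j <= s)%N -> a j != 0) ->
  l s = 0 -> closed_ladder s l a f.
Proof.
move=> up down real norm rec neq0 ls; split=> //.
- by move=> j i; exact: (ladder_top up down real norm rec ls).
- by move=> i j; move/(ladder_isotropic up down real norm rec ls k_gt0 k_curv); apply.
- move=> i j; case: eqVneq => [->|ij]; first exact: (ladder_norm up down real norm rec j).1.
  exact: (ladder_orthogonal up down real norm rec ls k_gt0 k_curv).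
Qed.

Fixpoint ladder_seq (f0 : I -> A) (j : nat) : I -> A :=
  if j is j'.+1 then veth j'%:Z (ladder_seq f0 j') else f0.

(** Passing [ethb] through one more [eth] costs the weight j + 1 times k, which is exactly the
    recursion imposed on [l]. *)
Lemma ladder_seq_down (l : nat -> R) (f0 : I -> A) :
  (forall j, l j.+1 = l j - j.+1%:R * k) ->
  (forall i, ethb 1 (eth 0 (f0 i)) = - cst A (l 0%N) * f0 i) ->
  forall j i, ethb j.+1%:Z (ladder_seq f0 j.+1 i) = - cst A (l j) * ladder_seq f0 j i.
Proof.
move=> lrec h0; elim=> [|j IH] i; first exact: h0.
rewrite [ladder_seq _ _]/= {1}/veth (eth_comm (q := j%:Z)); [|by lia|by lia].
rewrite IH -rmorphN ethZ k_curv lrec /= rmorphN rmorphB rmorphM rmorph_nat.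
change (eth j (ladder_seq f0 j i)) with (veth j (ladder_seq f0 j) i).
ring.
Qed.

End BuildLadder.

(** * Constant intertwiners between ladders with the same constants *)

Section Intertwiner.
Variables (R : realType) (A : framed_ring R) (s : nat) (l a : nat -> R).

Section Two.
Variables (I I' : finType) (f : nat -> I -> A) (g : nat -> I' -> A).
Hypotheses (hf : closed_ladder s l a f) (hg : closed_ladder s l a g).
Local Notation ia j := (cst A (a j)^-1).

(** The vectors f_0, f_j and conj f_j are orthogonal for the Hermitian product; this tensor sends
    them to g_0, g_j and conj g_j. For g = f it is the orthogonal projection onto their span. *)
Definition intertwiner (i : I) (i' : I') : A :=
  ia 0%N * (f 0%N i * g 0%N i') +
  \sum_(j < s) ia j.+1 * (f j.+1 i * cj A (g j.+1 i') + cj A (f j.+1 i) * g j.+1 i').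

Lemma cj_intertwiner i i' : cj A (intertwiner i i') = intertwiner i i'.
Proof.
rewrite /intertwiner rmorphD !rmorphM cj_cst (cl_real hf) (cl_real hg) rmorph_sum.
congr (_ + _); apply: eq_bigr => j _.
by rewrite rmorphM cj_cst rmorphD !rmorphM !cjK addrC.
Qed.

Lemma cl_cj_down j i : eth (- j.+1%:Z) (cj A (f j.+1 i)) = - cst A (l j) * cj A (f j i).
Proof. by rewrite -cj_ethb (cl_down hf) rmorphM rmorphN cj_cst. Qed.

Lemma cl_cj_up j i : ethb (- j%:Z) (cj A (f j i)) = cj A (f j.+1 i).
Proof. by rewrite -cj_eth -(cl_up hf). Qed.

Lemma cl_upE j i : eth j%:Z (f j i) = f j.+1 i.
Proof. by rewrite -(cl_up hf). Qed.

Lemma ia_rec j : (j < s)%N -> ia j.+1 * cst A (l j) = ia j.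
Proof.
move=> js; rewrite -rmorphM (cl_rec hf) invfM mulrAC mulVf ?mul1r//.
have := cl_neq0 hf js; rewrite (cl_rec hf).
by apply: contra_neq => ->; rewrite mul0r.
Qed.

End Two.

Section TwoBis.
Variables (I I' : finType) (f : nat -> I -> A) (g : nat -> I' -> A).
Hypotheses (hf : closed_ladder s l a f) (hg : closed_ladder s l a g).
Local Notation ia j := (cst A (a j)^-1).
Local Notation B := (intertwiner f g).

Let T i i' j := ia j * (f j.+1 i * cj A (g j i')).
Let T' i i' j := ia j * (cj A (f j i) * g j.+1 i').

(** The factor l_j produced by lowering turns the reciprocal norm of index j + 1 into that of index
    j, so each derivative is a difference of consecutive terms. *)
Lemma eth_tens i i' (j : 'I_s) :
  eth 0 (ia j.+1 * (f j.+1 i * cj A (g j.+1 i'))) = T i i' j.+1 - T i i' j /\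
  eth 0 (ia j.+1 * (cj A (f j.+1 i) * g j.+1 i')) = T' i i' j.+1 - T' i i' j.
Proof.
rewrite !ethZ /T /T' -!(ia_rec hf (ltn_ord j)); split.
  rewrite (ethM (m := j.+1%:Z) (n := - j.+1%:Z)); last by lia.
  rewrite (cl_upE hf) (cl_cj_down hg); ring.
rewrite (ethM (m := - j.+1%:Z) (n := j.+1%:Z)); last by lia.
rewrite (cl_upE hg) (cl_cj_down hf); ring.
Qed.

(** The sum telescopes: its top vanishes because the ladders stop at s, and its bottom cancels the
    derivative of the f_0 g_0 term. *)
Lemma eth_intertwiner i i' : eth 0 (B i i') = 0.
Proof.
rewrite ethD ethZ (ethM (m := 0) (n := 0)) // eth_sum.
under eq_bigr do rewrite mulrDr ethD (eth_tens _ _ _).1 (eth_tens _ _ _).2.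
rewrite big_split /= -!(big_mkord xpredT (fun j => _ j.+1 - _ j)) !telescope_sumr//.
rewrite /T /T' !(cl_top hf _ (ltnSn s)) !(cl_top hg _ (ltnSn s)) (cl_upE hf) (cl_upE hg).
rewrite (cl_real hf) (cl_real hg); ring.
Qed.

Lemma dZ_intertwiner i i' : dZ A (B i i') = 0 /\ dZb A (B i i') = 0.
Proof.
have e : dZ A (B i i') = 0.
  by rewrite -(eth_intertwiner i i') /eth !mul0r addr0.
by split=> //; rewrite -cj_intertwiner// -cj_dZ e rmorph0.
Qed.

Lemma dt_intertwiner (x : I -> A) i' :
  \sum_i x i * B i i' = ia 0%N * dt x (f 0%N) * g 0%N i' +
  \sum_(j < s) ia j.+1 * (dt x (f j.+1) * cj A (g j.+1 i') +
                         dt x (vcj (f j.+1)) * g j.+1 i').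
Proof.
rewrite /intertwiner; under eq_bigr do rewrite mulrDr mulr_sumr.
rewrite big_split exchange_big /=; congr (_ + _).
  by rewrite /dt mulr_sumr mulr_suml; apply: eq_bigr => i _; ring.
apply: eq_bigr => j _; rewrite /dt !mulr_suml -big_split mulr_sumr.
by apply: eq_bigr => i _ /=; rewrite /vcj; ring.
Qed.

Let iaa j : (j <= s)%N -> ia j * cst A (a j) = 1.
Proof. by move=> js; rewrite -rmorphM mulVf ?rmorph1// (cl_neq0 hf). Qed.

Let ff0 : vcj (f 0%N) = f 0%N.
Proof. by apply/funext => i; rewrite /vcj (cl_real hf). Qed.

Let orth2 i j : (0 < i + j)%N -> dt (vcj (f i)) (vcj (f j)) = 0.
Proof. by move=> ij; rewrite -cj_dt (cl_iso hf)// rmorph0. Qed.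

Lemma intertwiner0 i' : \sum_i f 0%N i * B i i' = g 0%N i'.
Proof.
rewrite dt_intertwiner big1 => [|j _]; last first.
  by rewrite (cl_iso hf)// -ff0 orth2// !mul0r addr0 mulr0.
by rewrite -{2}ff0 (cl_orth hf) eqxx iaa// mul1r addr0.
Qed.

Lemma intertwinerS (n : 'I_s) i' : \sum_i f n.+1 i * B i i' = g n.+1 i'.
Proof.
rewrite dt_intertwiner (cl_iso hf)// mulr0 mul0r add0r (bigD1 n)//= big1 => [|j jn].
  by rewrite (cl_iso hf)// (cl_orth hf) eqxx mul0r add0r mulrA iaa// mul1r addr0.
rewrite (cl_iso hf)// (cl_orth hf) mul0r add0r eqSS eq_sym.
by rewrite (inj_eq val_inj) (negbTE jn) mul0r mulr0.
Qed.

Lemma intertwiner_cj (n : 'I_s) i' : \sum_i cj A (f n.+1 i) * B i i' = cj A (g n.+1 i').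
Proof.
rewrite -(intertwinerS n i') rmorph_sum; apply: eq_bigr => i _.
by rewrite rmorphM cj_intertwiner.
Qed.

End TwoBis.

Lemma intertwiner_comp (I I' I'' : finType) (f : nat -> I -> A) (g : nat -> I' -> A)
    (h : nat -> I'' -> A) :
  closed_ladder s l a f -> closed_ladder s l a g -> closed_ladder s l a h ->
  forall i i'', \sum_i' intertwiner f g i i' * intertwiner g h i' i'' =
                intertwiner f h i i''.
Proof.
move=> hf hg hh i i''; rewrite {1 3}/intertwiner.
under eq_bigr do rewrite mulrDl mulr_suml.
rewrite big_split exchange_big /=; congr (_ + _).
  rewrite -[h 0%N i''](intertwiner0 _ hg) !mulr_sumr; apply: eq_bigr => i' _; ring.
apply: eq_bigr => j _.
rewrite -[cj A (h _ _)](intertwiner_cj hg hh) -[h j.+1 i''](intertwinerS _ hg) !mulr_sumr -big_split mulr_sumr.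
apply: eq_bigr => i' _ /=; ring.
Qed.

Lemma intertwinerC (I I' : finType) (f : nat -> I -> A) (g : nat -> I' -> A) i i' :
  intertwiner f g i i' = intertwiner g f i' i.
Proof.
rewrite /intertwiner [f 0%N i * _]mulrC; congr (_ + _); apply: eq_bigr => j _.
by rewrite addrC [cj A _ * _]mulrC [f _ _ * _]mulrC.
Qed.

Lemma intertwiner_trace (I : finType) (f : nat -> I -> A) :
  closed_ladder s l a f -> \sum_i intertwiner f f i i = (2 * s).+1%:R.
Proof.
move=> hf; have iaa j : (j <= s)%N -> cst A (a j)^-1 * cst A (a j) = 1.
  by move=> js; rewrite -rmorphM mulVf ?rmorph1// (cl_neq0 hf).
rewrite /intertwiner big_split exchange_big /=.
have -> : \sum_i cst A (a 0%N)^-1 * (f 0%N i * f 0%N i) = 1.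
  rewrite -mulr_sumr -(iaa 0%N)//; congr (_ * _).
  have := cl_orth hf 0 0; rewrite eqxx => <-.
  by apply: eq_bigr => i _; rewrite /vcj (cl_real hf).
rewrite (eq_bigr (fun=> 2)) ?sumr_const ?card_ord ?mulnS; last first.
  move=> j _; rewrite -mulr_sumr big_split /= -/(dt (f j.+1) (vcj (f j.+1))).
  rewrite (eq_bigr (fun i => f j.+1 i * cj A (f j.+1 i))) => [|i _]; last by rewrite mulrC.
  rewrite -/(dt (f j.+1) (vcj (f j.+1))) (cl_orth hf) eqxx mulrDr iaa//; ring.
by rewrite -[(2 * s).+1]add1n natrD natrM mulr_natr.
Qed.

(** A constant vector whose product with f_0 is constant is orthogonal to f_1, f_2, ... by
    successive differentiation. Lowering f_1 then gives orthogonality to f_0 itself, which needs l_0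
    != 0, that is s > 0. *)
Lemma intertwiner_perp (I I' : finType) (f : nat -> I -> A) (g : nat -> I' -> A)
    (v : I -> R) : (0 < s)%N -> closed_ladder s l a f ->
  dZ A (dt (f 0%N) (fun i => cst A (v i))) = 0 ->
  forall i', \sum_i cst A (v i) * intertwiner f g i i' = 0.
Proof.
move=> s0 hf dv i'; set cv := fun i => cst A (v i).
have ev0 : veth 0 cv = fun=> 0 by apply/funext => i; rewrite /veth /cv eth_cst.
have evb0 : vethb 0 cv = fun=> 0 by apply/funext => i; rewrite /vethb /cv ethb_cst.
have fv j : dt (f j.+1) cv = 0.
  elim: j => [|j IH].
    have : eth 0 (dt (f 0%N) cv) = 0 by rewrite /eth dv !mul0r addr0.
    rewrite (eth_dt (m := 0) (n := 0)) // ev0 (cl_up hf) [X in _ + X]dtC.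
    by rewrite [X in _ + X]dt0l// addr0.
  have : eth j.+1%:Z (dt (f j.+1) cv) = 0 by rewrite IH eth0.
  rewrite (eth_dt (m := j.+1%:Z) (n := 0)) ?addr0// ev0 (cl_up hf) [X in _ + X]dtC.
  by rewrite [X in _ + X]dt0l// addr0.
have l0 : l 0%N != 0.
  by have := cl_neq0 hf s0; rewrite (cl_rec hf); apply: contra_neq => ->; rewrite mul0r.
have f0v : dt (f 0%N) cv = 0.
  apply: (cst_eq0 (r := - l 0%N)); rewrite ?oppr_eq0// rmorphN.
  have : ethb 1 (dt (f 1%N) cv) = 0 by rewrite fv ethb0.
  rewrite (ethb_dt (m := 1) (n := 0)) // evb0 [X in _ + X]dtC [X in _ + X]dt0l// addr0.
  by rewrite (dt_lin1 (x := vethb _ _) _ (cl_down hf 0)).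
have fbv j : dt cv (vcj (f j.+1)) = 0.
  rewrite dtC -[LHS](@cjK R A) cj_dt vcjK.
  have -> : vcj cv = cv by apply/funext => i; rewrite /vcj /cv cj_cst.
  by rewrite fv rmorph0.
rewrite dt_intertwiner dtC f0v mulr0 mul0r add0r big1// => j _.
by rewrite fbv dtC fv !mul0r addr0 mulr0.
Qed.

End Intertwiner.

(* The infinitesimal rotation of the osculating flag that fixes [f 0] and turns
   the j-th osculating plane by the angle j. It is itself a ladder of spin 1,
   that is, the position vector of a surface isometric to a round sphere. *)
Section Rotation.
Variables (R : realType) (A : framed_ring R) (s : nat) (l a : nat -> R) (k : R).
Variables (I : finType) (f : nat -> I -> A).
Hypothesis s_gt0 : (0 < s)%N.
Hypothesis k_gt0 : 0 < k.
Hypothesis k_curv : ccurv A = cst A k.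
Hypothesis l_rec : forall j, l j.+1 = l j - j.+1%:R * k.
Hypothesis hf : closed_ladder s l a f.
Local Notation ia j := (cst A (a j)^-1).
Implicit Types p : I * I.

Let T p j := ia j * (f j.+1 p.1 * cj A (f j p.2)).
Let S p j := ia j * (f j.+2 p.1 * cj A (f j p.2)).
Let Q p j := ia j * (f j p.1 * cj A (f j p.2)).
Let sw p := (p.2, p.1).

(** Exchanging the two indices conjugates [Q], so this is a real skew matrix, stored as a vector
    indexed by pairs so that the ladder machinery applies to it. *)
Definition rotation p : A :=
  ci A * (\sum_(j < s) j.+1%:R * Q p j.+1 - \sum_(j < s) j.+1%:R * Q (sw p) j.+1).

Let rotation1 p := ci A * (\sum_(j < s) T (sw p) j - \sum_(j < s) T p j).

Let ia_recl j : (j < s)%N -> ia j.+1 * cst A (l j) = ia j.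
Proof. exact: ia_rec hf _. Qed.

Let ethQ p (j : 'I_s) : eth 0 (Q p j.+1) = T p j.+1 - T p j.
Proof.
rewrite ethZ /T -(ia_recl (ltn_ord j)).
rewrite (ethM (m := j.+1%:Z) (n := - j.+1%:Z)); last by lia.
rewrite (cl_upE hf) (cl_cj_down hf); ring.
Qed.

(** Abel summation: the weights j + 1 in front of telescoping differences are what leaves a plain
    sum. *)
Let abel (t : nat -> A) n :
  \sum_(j < n) j.+1%:R * (t j.+1 - t j) = n%:R * t n - \sum_(j < n) t j.
Proof.
elim: n => [|n IH]; first by rewrite !big_ord0 mul0r subr0.
rewrite !big_ord_recr /= IH -natr1; ring.
Qed.

Let Ttop p : T p s = 0.
Proof. by rewrite /T (cl_top hf _ (ltnSn s)) mul0r mulr0. Qed.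

Let eth_sumQ p : eth 0 (\sum_(j < s) j.+1%:R * Q p j.+1) = - \sum_(j < s) T p j.
Proof.
rewrite eth_sum (eq_bigr (fun j : 'I_s => j.+1%:R * (T p j.+1 - T p j))).
  by rewrite abel Ttop mulr0 add0r.
by move=> j _; rewrite -(rmorph_nat (cst A)) ethZ ethQ.
Qed.

Lemma eth_rotation p : eth 0 (rotation p) = rotation1 p.
Proof. rewrite /rotation eth_ci ethB !eth_sumQ /rotation1; ring. Qed.

Let ethb_sumT p : ethb 1 (\sum_(j < s) T p j) =
  - cst A (l 0%N) * Q p 0 + cst A k * \sum_(j < s) j.+1%:R * Q p j.+1.
Proof.
(* For the truncated sum there is a boundary term with factor l_n; it disappears at n = s, where l_s
   = 0. *)
have aux n : (n <= s)%N -> ethb 1 (\sum_(j < n) T p j) =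
    cst A (l n) * Q p n - cst A (l 0%N) * Q p 0
    + cst A k * \sum_(j < n) j.+1%:R * Q p j.+1.
  elim: n => [|n IH] ns; first by rewrite !big_ord0 ethb0; ring.
  rewrite !big_ord_recr ethbD IH ?(ltnW ns)// l_rec rmorphB rmorphM rmorph_nat.
  have -> : ethb 1 (T p (Ordinal ns)) = cst A (l n) * (Q p n.+1 - Q p n).
    rewrite /T ethbZ (ethbM (m := n.+1%:Z) (n := - n%:Z)); last by rewrite /=; lia.
    rewrite (cl_down hf) (cl_cj_up hf) /Q /= -(ia_recl ns); ring.
  rewrite /=; ring.
by rewrite aux// (cl_end hf) rmorph0; ring.
Qed.

Lemma ethb_rotation1 p : ethb 1 (rotation1 p) = - cst A k * rotation p.
Proof.
rewrite /rotation1 ethb_ci ethbB !ethb_sumT /rotation.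
have -> : Q (sw p) 0 = Q p 0 by rewrite /Q !(cl_real hf) /= [f _ _ * _]mulrC.
ring.
Qed.

Let cj_sumQ p : cj A (\sum_(j < s) j.+1%:R * Q p j.+1) =
  \sum_(j < s) j.+1%:R * Q (sw p) j.+1.
Proof.
rewrite rmorph_sum; apply: eq_bigr => j _.
by rewrite !rmorphM rmorph_nat cj_cst cjK /= [cj A _ * _]mulrC.
Qed.

Lemma cj_rotation p : cj A (rotation p) = rotation p.
Proof.
have e : sw (sw p) = p by case: p.
rewrite /rotation rmorphM cj_ci rmorphB cj_sumQ -[in X in _ * (_ - X)]cj_sumQ cjK.
rewrite mulNr -mulrN opprB; congr (_ * _).
Qed.

Lemma sum_pair_mul (u v x y : I -> A) :
  \sum_p (u p.1 * v p.2) * (x p.1 * y p.2) = dt u x * dt v y.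
Proof.
rewrite -(pair_bigA _ (fun i j => (u i * v j) * (x i * y j))) /= /dt mulr_suml.
by apply: eq_bigr => i _; rewrite mulr_sumr; apply: eq_bigr => j _; ring.
Qed.

(** The j-th plane carries the eigenvalues i j and - i j, and so contributes 2 j^2 to the squared
    norm. *)
Definition rotation_norm : R := \sum_(j < s) (2 * j.+1%:R ^+ 2).

Lemma rotation_norm_gt0 : 0 < rotation_norm.
Proof.
rewrite /rotation_norm; case: s s_gt0 => // n _; rewrite big_ord_recl.
by rewrite ltr_wpDr ?sumr_ge0//= => [i _|]; rewrite ?mulr_ge0 ?mulr_gt0 ?exprn_ge0 ?exprn_gt0.
Qed.

Lemma dt_rotation : dt rotation rotation = cst A rotation_norm.
Proof.
pose q (i j : 'I_s) p := (Q p i.+1 - Q (sw p) i.+1) * (Q p j.+1 - Q (sw p) j.+1).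
have qE i j : \sum_p q i j p = if i == j then - 2 else 0.
  pose g i : I -> A := f i; pose b i : I -> A := vcj (f i).
  transitivity (ia i.+1 * ia j.+1 * (
     (\sum_p (g i.+1 p.1 * b i.+1 p.2) * (g j.+1 p.1 * b j.+1 p.2)
     - \sum_p (g i.+1 p.1 * b i.+1 p.2) * (b j.+1 p.1 * g j.+1 p.2))
     + (\sum_p (b i.+1 p.1 * g i.+1 p.2) * (b j.+1 p.1 * g j.+1 p.2)
     - \sum_p (b i.+1 p.1 * g i.+1 p.2) * (g j.+1 p.1 * b j.+1 p.2)))).
    rewrite -!sumrB -big_split mulr_sumr; apply: eq_bigr => p _.
    rewrite /q /Q /g /b /vcj /=; ring.
  rewrite !sum_pair_mul /g /b !(cl_iso hf)// !mul0r !(cl_orth hf).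
  rewrite ![dt (vcj _) (f _)]dtC !(cl_orth hf) eqSS [(j.+1 == _)]eq_sym eqSS.
  rewrite -!val_eqE /=; case: eqP => [ij|_]; last by ring.
  have -> : j = i by apply: val_inj.
  have iai : ia i.+1 * cst A (a i.+1) = 1.
    by rewrite -rmorphM mulVf ?rmorph1// (cl_neq0 hf).
  transitivity (- 2 * (ia i.+1 * cst A (a i.+1)) ^+ 2); first by ring.
  by rewrite iai expr1n mulr1.
transitivity (- \sum_i \sum_(j < s) (i : 'I_s).+1%:R * j.+1%:R * \sum_p q i j p).
  transitivity (- \sum_p \sum_i \sum_(j < s) (i : 'I_s).+1%:R * j.+1%:R * q i j p).
    rewrite -sumrN; apply: eq_bigr => p _; rewrite /rotation.
    rewrite -sumrB (eq_bigr (fun j : 'I_s => j.+1%:R * (Q p j.+1 - Q (sw p) j.+1))); last first.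
      by move=> j _; rewrite mulrBr.
    pose z := \sum_(j < s) j.+1%:R * (Q p j.+1 - Q (sw p) j.+1).
    transitivity ((ci A * ci A) * (z * z)); first by rewrite /z; ring.
    rewrite ciM mulN1r; congr (- _); rewrite {1}/z mulr_suml; apply: eq_bigr => i _.
    rewrite mulr_sumr; apply: eq_bigr => j _; rewrite /q; ring.
  congr (- _); rewrite exchange_big; apply: eq_bigr => i _.
  by rewrite exchange_big; apply: eq_bigr => j _; rewrite mulr_sumr.
rewrite /rotation_norm rmorph_sum -sumrN; apply: eq_bigr => i _.
under eq_bigr do rewrite qE.
rewrite (bigD1 i)//= big1 => [|j ji]; last by rewrite eq_sym (negbTE ji) mulr0.
rewrite eqxx addr0 rmorphM rmorphXn !rmorph_nat; ring.
Qed.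

End Rotation.

(** * The ring of smooth complex functions *)

Notation i0 := (ord0 : 'I_2).
Notation i1 := (ord_max : 'I_2).

Lemma sum2E (V : nmodType) (F : 'I_2 -> V) : \sum_i F i = F i0 + F i1.
Proof. by rewrite big_ord_recr big_ord_recr big_ord0 /= add0r; congr (F _ + F _); apply: val_inj. Qed.

Lemma sum22E (V : nmodType) (F : 'I_2 -> 'I_2 -> V) :
  \sum_i \sum_j F i j = F i0 i0 + F i0 i1 + (F i1 i0 + F i1 i1).
Proof. by rewrite !sum2E. Qed.

Lemma ord2 (i : 'I_2) : i = i0 \/ i = i1.
Proof. by case: i => [[|[|//]] hi]; [left|right]; exact: val_inj. Qed.

(* Smooth complex functions on an open set [W] of the plane, extended by zero. *)
Section SmoothRing.
Variables (R : realType) (W : set 'rV[R]_2) (oW : open W).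
Local Notation C := (R[i]).

Definition csmooth_pred (u : 'rV[R]_2 -> C) : Prop :=
  [/\ smooth_on W (fun x => complex.Re (u x)), smooth_on W (fun x => complex.Im (u x)) &
      forall x, ~ W x -> u x = 0].

(** The proof of openness is a parameter of the type because the ring operations and the derivations
    need it to produce smooth functions. *)
Record csmooth (oW' : open W) := CSmooth {
  cval :> 'rV[R]_2 -> C;
  csmoothP : `[< csmooth_pred cval >]
}.

HB.instance Definition _ := [isSub of csmooth oW for @cval oW].
HB.instance Definition _ := [Choice of csmooth oW by <:].
Local Notation A := (csmooth oW).
Implicit Types u v : A.

(** The extension by zero turns agreement on [W] into equality, so the ring laws hold on the nose
    and without a quotient. *)
Lemma csmooth_eq u v : (forall x, W x -> u x = v x) -> u = v.
Proof.
move=> uv; apply/val_inj/funext => x /=; have [/uv//|nWx] := pselect (W x).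
by have [/asboolP[_ _ ->]//] := (csmoothP u); have [/asboolP[_ _ ->]//] := (csmoothP v).
Qed.

Lemma csmooth_Re u : smooth_on W (fun x => complex.Re (u x)).
Proof. by case/asboolP: (csmoothP u). Qed.

Lemma csmooth_Im u : smooth_on W (fun x => complex.Im (u x)).
Proof. by case/asboolP: (csmoothP u). Qed.

Definition cmk (a b : 'rV[R]_2 -> R) : 'rV[R]_2 -> C :=
  fun x => if `[< W x >] then Complex (a x) (b x) else 0.

Lemma cmkP a b : smooth_on W a -> smooth_on W b -> `[< csmooth_pred (cmk a b) >].
Proof.
move=> sa sb; apply/asboolP; split.
- by apply: smooth_on_ext sa => // x Wx; rewrite /cmk asboolT.
- by apply: smooth_on_ext sb => // x Wx; rewrite /cmk asboolT.
- by move=> x Wx; rewrite /cmk asboolF.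
Qed.

Definition cmk_csmooth a b (sa : smooth_on W a) (sb : smooth_on W b) : A :=
  CSmooth oW (cmkP sa sb).

Lemma cmkE a b (sa : smooth_on W a) (sb : smooth_on W b) x : W x ->
  cmk_csmooth sa sb x = Complex (a x) (b x).
Proof. by move=> Wx; rewrite /= /cmk asboolT. Qed.

Let s0 : smooth_on W (fun=> 0 : R). Proof. exact: smooth_on_cst. Qed.
Let s1 : smooth_on W (fun=> 1 : R). Proof. exact: smooth_on_cst. Qed.

Definition csm0 : A := cmk_csmooth s0 s0.
Definition csm1 : A := cmk_csmooth s1 s0.
Definition csm_opp u : A :=
  cmk_csmooth (smooth_onN oW (csmooth_Re u)) (smooth_onN oW (csmooth_Im u)).
Definition csm_add u v : A :=
  cmk_csmooth (smooth_onD oW (csmooth_Re u) (csmooth_Re v))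
              (smooth_onD oW (csmooth_Im u) (csmooth_Im v)).
Definition csm_mul u v : A :=
  cmk_csmooth
    (smooth_onB oW (smooth_onM oW (csmooth_Re u) (csmooth_Re v))
                   (smooth_onM oW (csmooth_Im u) (csmooth_Im v)))
    (smooth_onD oW (smooth_onM oW (csmooth_Re u) (csmooth_Im v))
                   (smooth_onM oW (csmooth_Im u) (csmooth_Re v))).

Let oppE u x : W x -> csm_opp u x = - u x.
Proof. by move=> Wx; rewrite cmkE//; case: (u x). Qed.
Let addE u v x : W x -> csm_add u v x = u x + v x.
Proof. by move=> Wx; rewrite cmkE//; case: (u x) => ? ?; case: (v x). Qed.
Let mulE u v x : W x -> csm_mul u v x = u x * v x.
Proof. by move=> Wx; rewrite cmkE//; case: (u x) => ? ?; case: (v x). Qed.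
Let zeroE x : W x -> csm0 x = 0. Proof. exact: cmkE. Qed.
Let oneE x : W x -> csm1 x = 1. Proof. exact: cmkE. Qed.

Let addA : associative csm_add.
Proof. by move=> u v w; apply: csmooth_eq => x Wx; rewrite !addE// addrA. Qed.
Let addC : commutative csm_add.
Proof. by move=> u v; apply: csmooth_eq => x Wx; rewrite !addE// addrC. Qed.
Let add0 : left_id csm0 csm_add.
Proof. by move=> u; apply: csmooth_eq => x Wx; rewrite addE// zeroE// add0r. Qed.
Let addN : left_inverse csm0 csm_opp csm_add.
Proof. by move=> u; apply: csmooth_eq => x Wx; rewrite addE// oppE// zeroE// addNr. Qed.

HB.instance Definition _ := GRing.isZmodule.Build A addA addC add0 addN.

Let mulA : associative csm_mul.
Proof. by move=> u v w; apply: csmooth_eq => x Wx; rewrite !mulE// mulrA. Qed.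
Let mulC : commutative csm_mul.
Proof. by move=> u v; apply: csmooth_eq => x Wx; rewrite !mulE// mulrC. Qed.
Let mul1 : left_id csm1 csm_mul.
Proof. by move=> u; apply: csmooth_eq => x Wx; rewrite mulE// oneE// mul1r. Qed.
Let mulD : left_distributive csm_mul csm_add.
Proof. by move=> u v w; apply: csmooth_eq => x Wx; rewrite mulE// !addE// !mulE// mulrDl. Qed.

HB.instance Definition _ := GRing.Zmodule_isComPzRing.Build A mulA mulC mul1 mulD.

Lemma csmoothN u x : W x -> (- u) x = - u x. Proof. exact: oppE. Qed.
Lemma csmoothD u v x : W x -> (u + v) x = u x + v x. Proof. exact: addE. Qed.
Lemma csmoothB u v x : W x -> (u - v) x = u x - v x.
Proof. by move=> Wx; rewrite csmoothD// csmoothN. Qed.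
Lemma csmoothM u v x : W x -> (u * v) x = u x * v x. Proof. exact: mulE. Qed.
Lemma csmooth0 x : W x -> (0 : A) x = 0. Proof. exact: zeroE. Qed.
Lemma csmooth1 x : W x -> (1 : A) x = 1. Proof. exact: oneE. Qed.

Lemma csmooth_sum (J : Type) (r : seq J) (P : pred J) (F : J -> A) x : W x ->
  (\sum_(j <- r | P j) F j) x = \sum_(j <- r | P j) F j x.
Proof.
move=> Wx; elim: r => [|j r IH]; first by rewrite !big_nil csmooth0.
by rewrite !big_cons; case: ifP => _; rewrite ?csmoothD// IH.
Qed.

Definition csm_real (a : 'rV[R]_2 -> R) (sa : smooth_on W a) : A := cmk_csmooth sa s0.

Lemma csm_realE a (sa : smooth_on W a) x : W x -> csm_real sa x = (a x)%:C%C.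
Proof. exact: cmkE. Qed.

Definition csm_cst (r : R) : A := csm_real (smooth_on_cst r oW).

Let csm_cst_add : additive csm_cst.
Proof.
move=> r t; apply: csmooth_eq => x Wx; rewrite csmoothB// !csm_realE//.
by rewrite rmorphB.
Qed.
HB.instance Definition _ := GRing.isAdditive.Build R A csm_cst csm_cst_add.
Let csm_cst_mul : multiplicative csm_cst.
Proof.
split=> [r t|]; apply: csmooth_eq => x Wx; rewrite ?csmoothM ?csmooth1// !csm_realE//.
by rewrite rmorphM.
Qed.
HB.instance Definition _ := GRing.isMultiplicative.Build R A csm_cst csm_cst_mul.

Definition csm_cj u : A := cmk_csmooth (csmooth_Re u) (smooth_onN oW (csmooth_Im u)).

Lemma csm_cjE u x : W x -> csm_cj u x = (u x)^*%C.
Proof. by move=> Wx; rewrite cmkE//; case: (u x). Qed.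

Let csm_cj_add : additive csm_cj.
Proof.
move=> u v; apply: csmooth_eq => x Wx; rewrite csmoothB// !csm_cjE// csmoothB//.
by rewrite rmorphB.
Qed.
HB.instance Definition _ := GRing.isAdditive.Build A A csm_cj csm_cj_add.
Let csm_cj_mul : multiplicative csm_cj.
Proof.
split=> [u v|]; apply: csmooth_eq => x Wx; rewrite ?csmoothM ?csmooth1// !csm_cjE//.
  by rewrite csmoothM// rmorphM.
by rewrite csmooth1// rmorph1.
Qed.
HB.instance Definition _ := GRing.isMultiplicative.Build A A csm_cj csm_cj_mul.

Definition csm_d (i : 'I_2) u : A :=
  cmk_csmooth (smooth_on_partial i (csmooth_Re u)) (smooth_on_partial i (csmooth_Im u)).

Lemma csm_dE i u x : W x ->
  csm_d i u x = Complex (partial i (fun x => complex.Re (u x)) x) (partial i (fun x => complex.Im (u x)) x).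
Proof. by move=> Wx; rewrite cmkE. Qed.

Let near_W x : W x -> \near x, W x. Proof. by move=> Wx; exact: open_nbhs_nbhs. Qed.
Let dRe u x : W x -> differentiable (fun x => complex.Re (u x)) x.
Proof. by move=> Wx; exact: smooth_on_differentiable (csmooth_Re u) Wx. Qed.
Let dIm u x : W x -> differentiable (fun x => complex.Im (u x)) x.
Proof. by move=> Wx; exact: smooth_on_differentiable (csmooth_Im u) Wx. Qed.

Let csm_d_add i : additive (csm_d i).
Proof.
move=> u v; apply: csmooth_eq => x Wx; rewrite csmoothB// !csm_dE//.
rewrite (@partial_near _ _ _ _ (fun x => complex.Re (u x) - complex.Re (v x))); last first.
  by near=> y; rewrite csmoothB; [case: (u y); case: (v y)|near: y; exact: near_W].
rewrite [X in Complex _ X](@partial_near _ _ _ _ (fun x => complex.Im (u x) - complex.Im (v x))); last first.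
  by near=> y; rewrite csmoothB; [case: (u y); case: (v y)|near: y; exact: near_W].
by rewrite !partialB; [|exact: dIm|exact: dIm|exact: dRe|exact: dRe].
Unshelve. all: by end_near. Qed.
HB.instance Definition _ i := GRing.isAdditive.Build A A (csm_d i) (csm_d_add i).

Lemma csm_dM i u v : csm_d i (u * v) = csm_d i u * v + u * csm_d i v.
Proof.
apply: csmooth_eq => x Wx; rewrite csmoothD// !csmoothM// !csm_dE//.
rewrite (@partial_near _ _ _ _ (fun x => complex.Re (u x) * complex.Re (v x) - complex.Im (u x) * complex.Im (v x))); last first.
  by near=> y; rewrite csmoothM; [case: (u y); case: (v y)|near: y; exact: near_W].
rewrite [X in Complex _ X](@partial_near _ _ _ _ (fun x => complex.Re (u x) * complex.Im (v x) + complex.Im (u x) * complex.Re (v x))); last first.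
  by near=> y; rewrite csmoothM; [case: (u y); case: (v y)|near: y; exact: near_W].
have dM (a b : 'rV[R]_2 -> R) : differentiable a x -> differentiable b x ->
   differentiable (fun y => a y * b y) x by move=> da db; exact: (differentiableM da db).
rewrite partialB; [|by apply: dM; [exact: dRe|exact: dRe]|by apply: dM; [exact: dIm|exact: dIm]].
rewrite partialD; [|by apply: dM; [exact: dRe|exact: dIm]|by apply: dM; [exact: dIm|exact: dRe]].
rewrite !partialM; [|exact: dIm|exact: dRe|exact: dRe|exact: dIm|exact: dIm|exact: dIm|exact: dRe|exact: dRe].
case: (u x) => a b; case: (v x) => c d /=.
apply/eqP; rewrite eq_complex /=; apply/andP; split; apply/eqP; ring.
Unshelve. all: by end_near. Qed.

Lemma csm_dC i j u : csm_d i (csm_d j u) = csm_d j (csm_d i u).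
Proof.
apply: csmooth_eq => x Wx; rewrite !(csm_dE _ _ Wx).
have e (i' j' : 'I_2) : partial i' (fun x => complex.Re (csm_d j' u x)) x =
       partial i' (partial j' (fun x => complex.Re (u x))) x /\
   partial i' (fun x => complex.Im (csm_d j' u x)) x = partial i' (partial j' (fun x => complex.Im (u x))) x.
  by split; apply: partial_near; near=> y; rewrite csm_dE//; near: y; exact: near_W.
rewrite !(e i j).1 !(e i j).2 !(e j i).1 !(e j i).2.
by rewrite (partialC i j oW (csmooth_Re u) Wx) (partialC i j oW (csmooth_Im u) Wx).
Unshelve. all: by end_near. Qed.

Lemma csm_d_real i a (sa : smooth_on W a) : csm_d i (csm_real sa) = csm_real (smooth_on_partial i sa).
Proof.
apply: csmooth_eq => x Wx; rewrite csm_dE// csm_realE//; congr Complex.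
  by apply: partial_near; near=> y; rewrite csm_realE//; near: y; exact: near_W.
rewrite -[RHS](partial_cst (n := 2) (0 : R) i x); apply: partial_near.
by near=> y; rewrite csm_realE//; near: y; exact: near_W.
Unshelve. all: by end_near. Qed.

Lemma csm_d_cst i r : csm_d i (csm_cst r) = 0.
Proof.
by apply: csmooth_eq => x Wx; rewrite csm_d_real csm_realE// partial_cst csmooth0.
Qed.

Lemma csm_cj_d i u : csm_cj (csm_d i u) = csm_d i (csm_cj u).
Proof.
apply: csmooth_eq => x Wx; rewrite (csm_cjE _ Wx) !(csm_dE _ _ Wx) [LHS]/=; congr Complex.
  by apply: partial_near; near=> y; rewrite csm_cjE ; [case: (u y)|near: y; exact: near_W].
rewrite -partialN; last exact: dIm.
by apply: partial_near; near=> y; rewrite csm_cjE ; [case: (u y)|near: y; exact: near_W].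
Unshelve. all: by end_near. Qed.

Definition csm_i : A := cmk_csmooth s0 s1.

End SmoothRing.

(** * The framed ring attached to a complex vector field *)

Section FramedSmoothRing.
Variables (R : realType) (W : set 'rV[R]_2) (oW : open W).
Local Notation A := (csmooth oW).
Variables (z1 z2 di : A).
Hypothesis zz : (z1 * csm_cj z2 - csm_cj z1 * z2) * di = 1.
Implicit Types u v : A.

Lemma csm_iE x : W x -> csm_i oW x = Complex 0 1.
Proof. exact: cmkE. Qed.

Lemma csm_cjK : involutive (@csm_cj R W oW).
Proof. by move=> u; apply: csmooth_eq => x Wx; rewrite !csm_cjE// conjcK. Qed.

Lemma csm_cj_cst r : csm_cj (csm_cst oW r) = csm_cst oW r.
Proof.
apply: csmooth_eq => x Wx; rewrite csm_cjE// csm_realE// -[RHS]conjc_real.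
by [].
Qed.

Definition csm_Z u := z1 * csm_d i0 u + z2 * csm_d i1 u.
Definition csm_Zb u := csm_cj z1 * csm_d i0 u + csm_cj z2 * csm_d i1 u.

Let Z_add : additive csm_Z.
Proof. by move=> u v; rewrite /csm_Z !raddfB /=; ring. Qed.
HB.instance Definition _ := GRing.isAdditive.Build A A csm_Z Z_add.
Let Zb_add : additive csm_Zb.
Proof. by move=> u v; rewrite /csm_Zb !raddfB /=; ring. Qed.
HB.instance Definition _ := GRing.isAdditive.Build A A csm_Zb Zb_add.

Let c1 := csm_Z (csm_cj z1) - csm_Zb z1.
Let c2 := csm_Z (csm_cj z2) - csm_Zb z2.
(** Cramer's rule for [Z, Zb] = - conj(kap) Z + kap Zb, where (c1, c2) are the components of the
    bracket and [di] is the inverse determinant of the pair Z, Zb. *)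
Definition csm_kap := - (c1 * z2 - c2 * z1) * di.

Let cj_Z u : csm_cj (csm_Z u) = csm_Zb (csm_cj u).
Proof. by rewrite rmorphD !rmorphM /= !csm_cj_d. Qed.

Let cj_di : csm_cj di = - di.
Proof.
have h : (csm_cj z1 * z2 - z1 * csm_cj z2) * csm_cj di = 1.
  by have := congr1 (@csm_cj R W oW) zz; rewrite rmorphM rmorphB !rmorphM rmorph1 /= !csm_cjK.
rewrite -[LHS]mul1r -{1}zz mulrAC.
have -> : (z1 * csm_cj z2 - csm_cj z1 * z2) * csm_cj di = -1 by rewrite -h; ring.
by rewrite mulN1r.
Qed.

Let cj_c : csm_cj c1 = - c1 /\ csm_cj c2 = - c2.
Proof.
have e u : csm_cj (csm_Z (csm_cj u) - csm_Zb u) = - (csm_Z (csm_cj u) - csm_Zb u).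
  rewrite rmorphB /= cj_Z csm_cjK -[X in csm_cj (csm_Zb X)]csm_cjK -cj_Z csm_cjK; ring.
by split; exact: e.
Qed.

Let kapE : - csm_cj csm_kap * z1 + csm_kap * csm_cj z1 = c1 /\
  - csm_cj csm_kap * z2 + csm_kap * csm_cj z2 = c2.
Proof.
rewrite /csm_kap rmorphM rmorphN rmorphB !rmorphM /= cj_c.1 cj_c.2 cj_di.
split; rewrite -[RHS]mulr1 -zz; ring.
Qed.

Let Z_comm u : csm_Z (csm_Zb u) - csm_Zb (csm_Z u) =
  - csm_cj csm_kap * csm_Z u + csm_kap * csm_Zb u.
Proof.
transitivity (c1 * csm_d i0 u + c2 * csm_d i1 u); last first.
  by rewrite -kapE.1 -kapE.2 /csm_Z /csm_Zb; ring.
rewrite /c1 /c2 /csm_Z /csm_Zb !raddfD /= !csm_dM (csm_dC i1 i0); ring.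
Qed.

Let ciM_ : csm_i oW * csm_i oW = -1.
Proof.
by apply: csmooth_eq => x Wx; rewrite csmoothM// csm_iE// csmoothN// csmooth1// -expr2 sqr_i.
Qed.

Let dZ_ci_ : csm_Z (csm_i oW) = 0.
Proof.
rewrite /csm_Z; have e i : csm_d i (csm_i oW) = 0.
  apply: csmooth_eq => x Wx; rewrite (csm_dE _ _ Wx) csmooth0//.
  have Wn : \near x, W x by exact: open_nbhs_nbhs.
  rewrite (@partial_near _ _ _ _ (fun=> 0 : R)) ?partial_cst; last first.
    by near=> y; rewrite csm_iE//; near: y.
  rewrite (@partial_near _ _ _ _ (fun=> 1 : R)) ?partial_cst//.
  by near=> y; rewrite csm_iE//; near: y.
by rewrite !e !mulr0 addr0.
Unshelve. all: by end_near. Qed.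

Let dZM_ u v : csm_Z (u * v) = csm_Z u * v + u * csm_Z v.
Proof. by rewrite /csm_Z !csm_dM; ring. Qed.

Let dZ_cst_ r : csm_Z (csm_cst oW r) = 0.
Proof. by rewrite /csm_Z !csm_d_cst !mulr0 addr0. Qed.

Let cj_ci_ : csm_cj (csm_i oW) = - csm_i oW.
Proof.
apply: csmooth_eq => x Wx; rewrite csm_cjE// csm_iE// csmoothN// csm_iE//=.
by apply/eqP; rewrite eq_complex /= oppr0 !eqxx.
Qed.

Let cj_pos_ (I : finType) (u : I -> A) : \sum_i u i * csm_cj (u i) = 0 -> forall i, u i = 0.
Proof.
move=> h i; apply: csmooth_eq => x Wx; rewrite csmooth0//.
have := congr1 (fun v : A => v x) h.
rewrite csmooth_sum// csmooth0// => /eqP.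
rewrite psumr_eq0 => [/allP/(_ i)|j _]; last first.
  by rewrite csmoothM// csm_cjE// mul_conjC_ge0.
rewrite mem_index_enum => /(_ isT) /implyP/(_ isT).
by rewrite csmoothM// csm_cjE// mul_conjC_eq0 => /eqP.
Qed.

Definition framed_csmooth : framed_ring R :=
  @FramedRing R A (csm_cst oW) (@csm_cj R W oW) csm_Z csm_Zb csm_kap (csm_i oW)
    ciM_ dZ_ci_ csm_cjK csm_cj_cst dZM_ dZ_cst_ cj_ci_ cj_Z Z_comm cj_pos_.

End FramedSmoothRing.

Lemma imetric2E (R : realType) (g : 'M[R]_2) : \det g != 0 ->
  [/\ invmx g i0 i0 = g i1 i1 / \det g, invmx g i0 i1 = - g i0 i1 / \det g,
      invmx g i1 i0 = - g i1 i0 / \det g & invmx g i1 i1 = g i0 i0 / \det g].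
Proof.
move=> d0; have ug : g \in unitmx by rewrite unitmxE unitfE.
have e i j : invmx g i j = (\det g)^-1 * ((-1) ^+ (j + i) * g (lift j ord0) (lift i ord0)).
  by rewrite /invmx ug !mxE /cofactor det_mx11 !mxE.
have l0 : lift i0 (ord0 : 'I_1) = i1 by apply: val_inj.
have l1 : lift i1 (ord0 : 'I_1) = i0 by apply: val_inj.
rewrite !e !l0 !l1 /= !addn0 !add0n addnn expr0 expr1 -signr_odd odd_double expr0.
by split; ring.
Qed.

Lemma det2E (R : realType) (g : 'M[R]_2) : \det g = g i0 i0 * g i1 i1 - g i0 i1 * g i1 i0.
Proof.
rewrite (expand_det_row _ i0) sum2E /cofactor !det_mx11 !mxE.
have l0 : lift i0 (ord0 : 'I_1) = i1 by apply: val_inj.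
have l1 : lift i1 (ord0 : 'I_1) = i0 by apply: val_inj.
by rewrite l0 l1 /= !addn0 expr0 add0n expr1; ring.
Qed.

(** * Scalar products and the induced metric *)

Section Metric.
Variables (R : realType).

Lemma dotC m (u v : 'rV[R]_m) : dot u v = dot v u.
Proof. by apply: eq_bigr => i _; rewrite mulrC. Qed.

Lemma dotDl m (u v w : 'rV[R]_m) : dot (u + v) w = dot u w + dot v w.
Proof. by rewrite /dot -big_split; apply: eq_bigr => i _; rewrite mxE mulrDl. Qed.

Lemma dotDr m (u v w : 'rV[R]_m) : dot w (u + v) = dot w u + dot w v.
Proof. by rewrite dotC dotDl ![dot _ w]dotC. Qed.

Lemma dotZl m r (u v : 'rV[R]_m) : dot (r *: u) v = r * dot u v.
Proof. by rewrite /dot mulr_sumr; apply: eq_bigr => i _; rewrite mxE mulrA. Qed.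

Lemma dotZr m r (u v : 'rV[R]_m) : dot v (r *: u) = r * dot v u.
Proof. by rewrite dotC dotZl dotC. Qed.

Lemma dotNl m (u v : 'rV[R]_m) : dot (- u) v = - dot u v.
Proof. by rewrite -scaleN1r dotZl mulN1r. Qed.

Lemma dotNr m (u v : 'rV[R]_m) : dot v (- u) = - dot v u.
Proof. by rewrite dotC dotNl dotC. Qed.

Lemma dot0l m (v : 'rV[R]_m) : dot 0 v = 0.
Proof. by rewrite -(scale0r v) dotZl mul0r. Qed.

Lemma dot_suml m (J : finType) (F : J -> 'rV[R]_m) v :
  dot (\sum_j F j) v = \sum_j dot (F j) v.
Proof. by apply: (big_morph (fun u => dot u v)) => [x y|]; rewrite ?dotDl ?dot0l. Qed.

Lemma dot_ge0 m (u : 'rV[R]_m) : 0 <= dot u u.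
Proof. by rewrite /dot sumr_ge0// => i _; rewrite -expr2 sqr_ge0. Qed.

Lemma dot_eq0 m (u : 'rV[R]_m) : (dot u u == 0) = (u == 0).
Proof.
apply/eqP/eqP => [/eqP|->]; last by rewrite dot0l.
rewrite psumr_eq0 => [/allP h|i _]; last by rewrite -expr2 sqr_ge0.
apply/rowP => i; rewrite mxE; apply/eqP.
by have := h i; rewrite mem_index_enum mulf_eq0 orbb; apply.
Qed.

Lemma dot_mulmx m n (u : 'rV[R]_m) (v : 'rV[R]_n) (M : 'M[R]_(m, n)) :
  dot (u *m M) v = dot u (v *m M^T).
Proof.
rewrite /dot; under eq_bigr do rewrite mxE mulr_suml.
rewrite exchange_big; apply: eq_bigr => i _; rewrite mxE mulr_sumr.
by apply: eq_bigr => j _; rewrite mxE; ring.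
Qed.

Variables (n m : nat) (X : 'rV[R]_n -> 'rV[R]_m).

Lemma metricC x i j : metric X x i j = metric X x j i.
Proof. by rewrite !mxE dotC. Qed.

Lemma metric_jmx x : metric X x = jmx X x *m (jmx X x)^T.
Proof.
apply/matrixP => i j; rewrite !mxE /dot; apply: eq_bigr => k _.
by rewrite !mxE.
Qed.

Lemma immersive_jmx x : immersive_at X x = row_free (jmx X x) :> Prop.
Proof. by []. Qed.

Lemma immersive_dot x (a : 'rV[R]_n) : immersive_at X x -> a != 0 ->
  0 < dot (a *m jmx X x) (a *m jmx X x).
Proof.
rewrite immersive_jmx => rf a0; rewrite lt_def dot_ge0 dot_eq0 andbT.
apply: contra a0 => /eqP e; apply/eqP; apply: (row_free_inj rf).
by rewrite e mul0mx.
Qed.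

Lemma metric_dot x (a b : 'rV[R]_n) :
  dot (a *m jmx X x) (b *m jmx X x) = dot (a *m metric X x) b.
Proof. by rewrite metric_jmx mulmxA [RHS]dot_mulmx trmxK. Qed.

Lemma metric_unit x : immersive_at X x -> metric X x \in unitmx.
Proof.
move=> im; rewrite -row_free_unit -kermx_eq0; apply/rowV0P => v /sub_kermxP vg.
apply/eqP/negPn/negP => v0; have := immersive_dot im v0.
by rewrite metric_dot vg dot0l ltxx.
Qed.

End Metric.

Section Metric2.
Variables (R : realType) (m : nat) (X : 'rV[R]_2 -> 'rV[R]_m) (x : 'rV[R]_2).
Hypothesis im : immersive_at X x.

Lemma metric00_gt0 : 0 < metric X x i0 i0.
Proof.
have := immersive_dot im (a := delta_mx 0 i0); rewrite -rowE.
have -> : dot (row i0 (jmx X x)) (row i0 (jmx X x)) = metric X x i0 i0.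
  by rewrite mxE; congr dot; apply/rowP => k; rewrite !mxE.
apply; apply/eqP => /rowP/(_ i0); rewrite !mxE /= => /eqP; rewrite oner_eq0 //.
Qed.

Lemma metric_det_gt0 : 0 < \det (metric X x).
Proof.
(* This vector is orthogonal to the first coordinate field, and its squared length is g_00 det g. *)
pose a : 'rV[R]_2 := \row_j (if j == i0 then - metric X x i0 i1 else metric X x i0 i0).
have := immersive_dot im (a := a); rewrite metric_dot /dot.
have -> : \sum_(k < 2) (a *m metric X x) 0 k * a 0 k = metric X x i0 i0 * \det (metric X x).
  rewrite det2E sum2E.
  have e k : (a *m metric X x) 0 k = a 0 i0 * metric X x i0 k + a 0 i1 * metric X x i1 k.
    by rewrite mxE sum2E.
  have a0 : a 0 i0 = - metric X x i0 i1 by rewrite mxE.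
  have a1 : a 0 i1 = metric X x i0 i0 by rewrite mxE.
  rewrite !e a0 a1 (metricC X x i1 i0).
  by move: (metric X x i0 i0) (metric X x i0 i1) (metric X x i1 i1) => p q r; ring.
rewrite pmulr_rgt0 ?metric00_gt0//; apply.
apply/eqP => /rowP/(_ i1); rewrite !mxE /= => /eqP.
by have := metric00_gt0; rewrite mxE => /gt_eqF ->.
Qed.

End Metric2.

(** * The Gram-Schmidt frame of a surface patch *)

Section Frame.
Variables (R : realType) (m : nat) (X : 'rV[R]_2 -> 'rV[R]_m) (W : set 'rV[R]_2).
Hypotheses (oW : open W) (sX : smooth_on W X) (im : forall x, W x -> immersive_at X x).
Local Notation C := (R[i]).
Local Notation B := (csmooth oW).

Lemma smooth_on_metric i j : smooth_on W (fun x => metric X x i j : R).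
Proof.
apply: (@smooth_on_ext _ _ _ W (fun x => \sum_k partial i X x 0 k * partial j X x 0 k)) => //.
  by move=> x _; rewrite mxE.
apply: smooth_on_sum => // k; apply: smooth_onM => //.
  by have /smooth_on_coord := smooth_on_partial i sX; exact.
by have /smooth_on_coord := smooth_on_partial j sX; exact.
Qed.

Let rr x := Num.sqrt (metric X x i0 i0).
Let qq x := Num.sqrt (\det (metric X x)).

Let s_rr : smooth_on W rr.
Proof.
apply: smooth_on_sqrt => //; last exact: smooth_on_metric.
by move=> x /im; exact: metric00_gt0.
Qed.

Let s_qq : smooth_on W qq.
Proof.
apply: smooth_on_sqrt => //; last by apply: smooth_on_det => // i j; exact: smooth_on_metric.
by move=> x /im; exact: metric_det_gt0.
Qed.

Let rr_gt0 x : W x -> 0 < rr x.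
Proof. by move=> Wx; rewrite sqrtr_gt0 metric00_gt0//; exact: im. Qed.
Let qq_gt0 x : W x -> 0 < qq x.
Proof. by move=> Wx; rewrite sqrtr_gt0 metric_det_gt0//; exact: im. Qed.

Let s_irr : smooth_on W (fun x => (rr x)^-1).
Proof. by apply: smooth_on_inv => // x /rr_gt0/gt_eqF->. Qed.
Let s_iqq : smooth_on W (fun x => (qq x)^-1).
Proof. by apply: smooth_on_inv => // x /qq_gt0/gt_eqF->. Qed.

Let s_0 : smooth_on W (fun=> 0 : R). Proof. exact: smooth_on_cst. Qed.

(** Components of Z = (e_1 - i e_2) / 2, where e_1 = d_0 / r and e_2 = (r / q) (d_1 - (g_01 / r^2)
    d_0) come from Gram-Schmidt with r^2 = g_00 and q^2 = det g. The determinant of Z and its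
    conjugate is i / (2q), whence [frame_inv]. *)
Definition frame1 : B := cmk_csmooth oW (smooth_onZ 2^-1 oW s_irr)
  (smooth_onZ 2^-1 oW (smooth_onM oW (smooth_on_metric i0 i1) (smooth_onM oW s_irr s_iqq))).
Definition frame2 : B := cmk_csmooth oW s_0
  (smooth_onZ (- 2^-1) oW (smooth_onM oW s_rr s_iqq)).
Definition frame_inv : B := cmk_csmooth oW s_0 (smooth_onZ (- 2) oW s_qq).

Lemma frame_indep : (frame1 * csm_cj frame2 - csm_cj frame1 * frame2) * frame_inv = 1.
Proof.
apply: csmooth_eq => x Wx; rewrite csmooth1// csmoothM// csmoothB// !csmoothM// !csm_cjE//.
rewrite /frame1 /frame2 /frame_inv !cmkE//.
have r0 := rr_gt0 Wx; have q0 := qq_gt0 Wx.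
apply/eqP; rewrite eq_complex /=; move: (rr x) (qq x) (metric X x i0 i1 : R) r0 q0 => r q g r0 q0.
by apply/andP; split; apply/eqP; field; rewrite ?gt_eqF.
Qed.

Definition frame_ring : framed_ring R := framed_csmooth frame_indep.

Let frame_setup x : W x ->
  [/\ 0 < rr x, 0 < qq x, qq x ^+ 2 = \det (metric X x), rr x ^+ 2 = metric X x i0 i0 &
      metric X x i1 i1 = (qq x ^+ 2 + metric X x i0 i1 ^+ 2) / rr x ^+ 2].
Proof.
move=> Wx; have d0 := metric_det_gt0 (im Wx); have g0 := metric00_gt0 (im Wx).
have q2 : qq x ^+ 2 = \det (metric X x) by rewrite sqr_sqrtr// ltW.
have r2 : rr x ^+ 2 = metric X x i0 i0 by rewrite sqr_sqrtr// ltW.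
have dE : qq x ^+ 2 = rr x ^+ 2 * metric X x i1 i1 - metric X x i0 i1 ^+ 2.
  by rewrite q2 r2 det2E (metricC X x i1 i0) expr2.
split=> //; [exact: rr_gt0|exact: qq_gt0|].
by rewrite dE; field; rewrite gt_eqF// rr_gt0.
Qed.

Let c2 : (2 : C) = Complex (2 : R) 0.
Proof. by rewrite -[LHS]/(2%:R) -(rmorph_nat (real_complex R)). Qed.

Lemma imetricC x : W x -> imetric X x i0 i1 = imetric X x i1 i0.
Proof.
move=> Wx; have [_ -> -> _] := @imetric2E R (metric X x) (lt0r_neq0 (metric_det_gt0 (im Wx))).
by rewrite metricC.
Qed.

(** With its two companions: the inverse metric is 2 (Z x Zb + Zb x Z), which turns real
    contractions into complex ones. *)
Lemma imetric_frame00 x : W x ->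
  (imetric X x i0 i0)%:C%C = 2 * (frame1 x * (frame1 x)^*%C + (frame1 x)^*%C * frame1 x).
Proof.
move=> Wx; have [r0 q0 q2 r2 h11] := frame_setup Wx.
have [-> _ _ _] := @imetric2E R (metric X x) (lt0r_neq0 (metric_det_gt0 (im Wx))).
rewrite /frame1 /frame2 !cmkE// c2 -/(rr x) -/(qq x) -q2 h11.
move: (rr x) (qq x) (metric X x i0 i1 : R) r0 q0 => r q g r0 q0.
by apply/eqP; rewrite eq_complex /=; apply/andP; split; apply/eqP; field; rewrite ?gt_eqF.
Qed.

Lemma imetric_frame01 x : W x ->
  (imetric X x i0 i1)%:C%C = 2 * (frame1 x * (frame2 x)^*%C + (frame1 x)^*%C * frame2 x).
Proof.
move=> Wx; have [r0 q0 q2 r2 h11] := frame_setup Wx.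
have [_ -> _ _] := @imetric2E R (metric X x) (lt0r_neq0 (metric_det_gt0 (im Wx))).
rewrite /frame1 /frame2 !cmkE// c2 -/(rr x) -/(qq x) -q2.
move: (rr x) (qq x) (metric X x i0 i1 : R) r0 q0 => r q g r0 q0.
by apply/eqP; rewrite eq_complex /=; apply/andP; split; apply/eqP; field; rewrite ?gt_eqF.
Qed.

Lemma imetric_frame11 x : W x ->
  (imetric X x i1 i1)%:C%C = 2 * (frame2 x * (frame2 x)^*%C + (frame2 x)^*%C * frame2 x).
Proof.
move=> Wx; have [r0 q0 q2 r2 h11] := frame_setup Wx.
have [_ _ _ ->] := @imetric2E R (metric X x) (lt0r_neq0 (metric_det_gt0 (im Wx))).
rewrite /frame1 /frame2 !cmkE// c2 -/(rr x) -/(qq x) -q2 -r2.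
move: (rr x) (qq x) (metric X x i0 i1 : R) r0 q0 => r q g r0 q0.
by apply/eqP; rewrite eq_complex /=; apply/andP; split; apply/eqP; field; rewrite ?gt_eqF.
Qed.

(** Orthonormality of the frame in complex form: <Z, Z> = 0 and <Z, Zb> = 1/2. *)
Lemma frame_conformal x : W x ->
  frame1 x * frame1 x * (metric X x i0 i0)%:C%C + 2 * frame1 x * frame2 x * (metric X x i0 i1)%:C%C
  + frame2 x * frame2 x * (metric X x i1 i1)%:C%C = 0 /\
  frame1 x * (frame1 x)^*%C * (metric X x i0 i0)%:C%C +
  (frame1 x * (frame2 x)^*%C + (frame1 x)^*%C * frame2 x) * (metric X x i0 i1)%:C%C
  + frame2 x * (frame2 x)^*%C * (metric X x i1 i1)%:C%C = (2^-1)%:C%C.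
Proof.
move=> Wx; have [r0 q0 q2 r2 h11] := frame_setup Wx.
rewrite c2 /frame1 /frame2 !cmkE// -/(rr x) -/(qq x) -r2 h11.
move: (rr x) (qq x) (metric X x i0 i1 : R) r0 q0 => r q g r0 q0.
by split; apply/eqP; rewrite eq_complex /=; apply/andP; split; apply/eqP; field; rewrite ?gt_eqF.
Qed.

End Frame.

(** * Polynomial identities between real tensors and the complex frame *)

Section RealComplex.
Variable R : realType.
Implicit Types a b : R.
Lemma realCD a b : (a + b)%:C%C = a%:C%C + b%:C%C :> R[i]. Proof. exact: rmorphD. Qed.
Lemma realCB a b : (a - b)%:C%C = a%:C%C - b%:C%C :> R[i]. Proof. exact: rmorphB. Qed.
Lemma realCM a b : (a * b)%:C%C = a%:C%C * b%:C%C :> R[i]. Proof. exact: rmorphM. Qed.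
Lemma realC_sum (J : finType) (F : J -> R) : (\sum_j F j)%:C%C = \sum_j (F j)%:C%C :> R[i].
Proof. exact: rmorph_sum. Qed.

Definition bil (a b : 'I_2 -> R[i]) (S : 'I_2 -> 'I_2 -> R[i]) : R[i] :=
  a i0 * b i0 * S i0 i0 + a i0 * b i1 * S i0 i1 + a i1 * b i0 * S i1 i0 + a i1 * b i1 * S i1 i1.

Lemma conj_bil (a b : 'I_2 -> R[i]) (S : 'I_2 -> 'I_2 -> R) :
  (bil a b (fun i j => (S i j)%:C))^*%C =
  bil (fun i => (a i)^*%C) (fun i => (b i)^*%C) (fun i j => (S i j)%:C%C).
Proof.
rewrite /bil; case: (a i0) (a i1) (b i0) (b i1) => [? ?] [? ?] [? ?] [? ?].
by apply/eqP; rewrite eq_complex /=; apply/andP; split; apply/eqP; ring.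
Qed.

Lemma csmooth_bil (W : set 'rV[R]_2) (oW : open W) (a b : 'I_2 -> csmooth oW)
    (u : 'I_2 -> 'I_2 -> csmooth oW) x : W x ->
  (a i0 * (b i0 * u i0 i0 + b i1 * u i0 i1) + a i1 * (b i0 * u i1 i0 + b i1 * u i1 i1)) x =
  bil (fun i => a i x) (fun i => b i x) (fun i j => u i j x).
Proof. by move=> Wx; rewrite !(csmoothD, csmoothM)// /bil !mulrDr !mulrA addrA. Qed.

Section Pure.
Variables (a b : R[i]) (g00 g01 g11 : R).
Hypotheses (e00 : g00%:C%C = 2 * (a * a^*%C + a^*%C * a))
  (e01 : g01%:C%C = 2 * (a * b^*%C + a^*%C * b)) (e11 : g11%:C%C = 2 * (b * b^*%C + b^*%C * b)).

(** This identity and the next two are stated over bare variables, so that [ring] never has to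
    inspect expressions built from the patch. *)
Lemma normal_part_pure (p q e0 e1 u y d k : R) :
  u%:C%C - ((1 + 1) * (a^*%C * e0%:C%C + b^*%C * e1%:C%C) * (a * p%:C%C + b * q%:C%C) +
            (1 + 1) * (a * e0%:C%C + b * e1%:C%C) * (a^*%C * p%:C%C + b^*%C * q%:C%C))
  - k%:C%C * d%:C%C * y%:C%C =
  (u - (g00 * e0 * p + g01 * e0 * q + (g01 * e1 * p + g11 * e1 * q)) - k * d * y)%:C%C.
Proof. by rewrite !(realCB, realCM, realCD) e00 e01 e11; ring. Qed.

Lemma mean_curv_pure (p q r : R) :
  2 * (a * a^*%C * p%:C%C + a * b^*%C * q%:C%C + b * a^*%C * q%:C%C + b * b^*%C * r%:C%C) =
  (2%:R^-1 * (g00 * p + g01 * q + (g01 * q + g11 * r)))%:C%C.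
Proof.
have c2 : (2%:R^-1 : R)%:C%C = 2^-1 :> R[i] by rewrite fmorphV rmorph_nat.
by rewrite !(realCB, realCM, realCD) c2 e00 e01 e11; field.
Qed.

Lemma traceless_pure (s00 s01 s10 s11 : R) :
  (g00 * g00 * (s00 * s00) + g00 * g01 * (s00 * s01) + (g01 * g00 * (s00 * s10) + g01 * g01 * (s00 * s11))
  + (g00 * g01 * (s01 * s00) + g00 * g11 * (s01 * s01) + (g01 * g01 * (s01 * s10) + g01 * g11 * (s01 * s11)))
  + (g01 * g00 * (s10 * s00) + g01 * g01 * (s10 * s01) + (g11 * g00 * (s10 * s10) + g11 * g01 * (s10 * s11))
  + (g01 * g01 * (s11 * s00) + g01 * g11 * (s11 * s01) + (g11 * g01 * (s11 * s10) + g11 * g11 * (s11 * s11)))))%:C%C =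
  let S i j := (if j == i0 then if i == i0 then s00 else s01 else if i == i0 then s10 else s11)%:C%C in
  let z i := if i == i0 then a else b in let zb i := if i == i0 then a^*%C else b^*%C in
  4 * (bil z z S * bil zb zb S + bil z zb S * bil zb z S + bil zb z S * bil z zb S + bil zb zb S * bil z z S).
Proof. by rewrite !(realCB, realCM, realCD) e00 e01 e11 /bil /=; ring. Qed.

End Pure.

End RealComplex.

Lemma partialC_row (R : realType) n m (X : 'rV[R]_n -> 'rV[R]_m) (W : set 'rV[R]_n) i j x :
  open W -> smooth_on W X -> W x ->
  partial i (partial j X) x = partial j (partial i X) x.
Proof.
move=> oW sX Wx; apply/rowP => k.
have e i' j' : partial i' (partial j' X) x 0 k = partial i' (partial j' (fun y => X y 0 k)) x.
  rewrite -partial_coord; last exact: smooth_on_differentiable (smooth_on_partial j' sX) Wx.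
  have near_W : \near x, W x by exact: open_nbhs_nbhs.
  apply: partial_near; near=> y; rewrite partial_coord//.
  by apply: smooth_on_differentiable sX _; near: y.
have sXk := (smooth_on_coord X oW).1 sX k.
have E := partialC i j oW sXk Wx.
apply: etrans (e i j) _.
apply: etrans E _.
exact: esym (e j i).
Unshelve. all: by end_near. Qed.

(** * The second fundamental form read in the frame *)

Section FrameLink.
Variables (R : realType) (m : nat) (X : 'rV[R]_2 -> 'rV[R]_m) (W : set 'rV[R]_2).
Hypotheses (oW : open W) (sX : smooth_on W X) (im : forall x, W x -> immersive_at X x).
Variable kk : R.
Hypotheses (kk_gt0 : 0 < kk) (sph : forall x, W x -> dot (X x) (X x) = kk^-1).
Local Notation C := (R[i]).
Local Notation A := (frame_ring oW sX im).
Local Notation B := (csmooth oW).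

Definition vec (n : nat) (F : 'rV[R]_2 -> 'rV[R]_n) (sF : smooth_on W F) (k : 'I_n) : A :=
  csm_real oW ((smooth_on_coord F oW).1 sF k).

Lemma vecE n (F : 'rV[R]_2 -> 'rV[R]_n) (sF : smooth_on W F) k x : W x -> (vec sF k : B) x = (F x 0 k)%:C%C.
Proof. by move=> Wx; rewrite csm_realE. Qed.

Lemma cj_vec n (F : 'rV[R]_2 -> 'rV[R]_n) (sF : smooth_on W F) k : cj A (vec sF k) = vec sF k.
Proof.
apply: csmooth_eq => x Wx; change ((csm_cj (vec sF k : B)) x = (vec sF k : B) x).
by rewrite csm_cjE// vecE// conjc_real.
Qed.

Lemma csm_d_vec n (F : 'rV[R]_2 -> 'rV[R]_n) (sF : smooth_on W F) k i :
  csm_d i (vec sF k : B) = vec (smooth_on_partial i sF) k.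
Proof.
apply: csmooth_eq => x Wx; rewrite csm_d_real csm_realE// vecE//; congr (_%:C%C).
by apply: partial_coord; exact: smooth_on_differentiable sF Wx.
Qed.

Lemma cjE (u : A) x : W x -> (cj A u : B) x = ((u : B) x)^*%C.
Proof. exact: csm_cjE. Qed.

Lemma cstE r x : W x -> (cst A r : B) x = r%:C%C.
Proof. exact: csm_realE. Qed.

Definition zz (i : 'I_2) : A := if i == i0 then frame1 oW sX im else frame2 oW sX im.

Lemma eth_vec n (F : 'rV[R]_2 -> 'rV[R]_n) (sF : smooth_on W F) k :
  eth 0 (vec sF k) = zz i0 * vec (smooth_on_partial i0 sF) k + zz i1 * vec (smooth_on_partial i1 sF) k.
Proof.
have -> : eth 0 (vec sF k) = dZ A (vec sF k) by rewrite /eth !mul0r addr0.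
by rewrite -(csm_d_vec sF k i0) -(csm_d_vec sF k i1).
Qed.

Lemma ethb_vec n (F : 'rV[R]_2 -> 'rV[R]_n) (sF : smooth_on W F) k :
  ethb 0 (vec sF k) = cj A (zz i0) * vec (smooth_on_partial i0 sF) k
                    + cj A (zz i1) * vec (smooth_on_partial i1 sF) k.
Proof.
rewrite -[vec sF k]cj_vec -[0]opprK -cj_eth oppr0 eth_vec.
by rewrite rmorphD !rmorphM !cj_vec.
Qed.

Lemma dt_vec n (F G : 'rV[R]_2 -> 'rV[R]_n) (sF : smooth_on W F) (sG : smooth_on W G) x : W x ->
  (dt (vec sF) (vec sG) : B) x = (dot (F x) (G x))%:C%C.
Proof.
move=> Wx; rewrite csmooth_sum// /dot rmorph_sum; apply: eq_bigr => k _.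
change ((vec sF k * vec sG k : B) x = (F x 0 k * G x 0 k)%:C%C).
by rewrite csmoothM// !vecE// rmorphM.
Qed.

Local Notation f := (vec sX).
Local Notation f1 := (veth 0 f).
Local Notation fb1 := (vcj f1).
Local Notation P i := (vec (smooth_on_partial i sX)).
Local Notation half := (cst A 2^-1).

Let f1E k : f1 k = zz i0 * P i0 k + zz i1 * P i1 k.
Proof. by rewrite /veth eth_vec. Qed.

Let fb1E k : fb1 k = cj A (zz i0) * P i0 k + cj A (zz i1) * P i1 k.
Proof. by rewrite /vcj f1E rmorphD !rmorphM !cj_vec. Qed.

Let PP x i j : W x -> (dt (P i) (P j) : B) x = (metric X x i j)%:C%C.
Proof. by move=> Wx; rewrite dt_vec// mxE. Qed.

Let z0E : zz i0 = frame1 oW sX im. Proof. by []. Qed.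
Let z1E : zz i1 = frame2 oW sX im. Proof. by []. Qed.

Lemma vec_norm : dt f f = cst A kk^-1.
Proof.
by apply: csmooth_eq => x Wx; rewrite dt_vec// [RHS]csm_realE// sph.
Qed.

Lemma vec_conformal : dt f1 f1 = 0.
Proof.
rewrite (dt_lin2 _ f1E) ![dt (P _) f1]dtC !(dt_lin2 _ f1E).
rewrite [dt (P i1) (P i0)]dtC.
apply: csmooth_eq => x Wx; rewrite csmooth0// -(frame_conformal oW sX im Wx).1.
rewrite !(csmoothD, csmoothM)// !PP// z0E z1E.
set p := (metric X x i0 i0)%:C%C; set q := (metric X x i0 i1)%:C%C; set r := (metric X x i1 i1)%:C%C.
move: (frame1 oW sX im x) (frame2 oW sX im x) p q r => a b p q r; ring.
Qed.

Lemma vec_isometric : dt f1 fb1 = half.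
Proof.
rewrite (dt_lin2 _ f1E) ![dt (P _) fb1]dtC !(dt_lin2 _ fb1E).
rewrite [dt (P i1) (P i0)]dtC.
apply: csmooth_eq => x Wx; rewrite [RHS]csm_realE// -(frame_conformal oW sX im Wx).2.
rewrite !(csmoothD, csmoothM)// !cjE// !PP// z0E z1E.
set p := (metric X x i0 i0)%:C%C; set q := (metric X x i0 i1)%:C%C; set r := (metric X x i1 i1)%:C%C.
by move: (frame1 oW sX im x) (frame2 oW sX im x) p q r => a b p q r; ring.
Qed.

(* Complex linear extension of [normal_part]. *)
Definition np (v : 'I_m -> A) : 'I_m -> A := fun k =>
  v k - (2 * dt v fb1 * f1 k + 2 * dt v f1 * fb1 k) - cst A kk * dt v f * f k.

Lemma np_vec F (sF : smooth_on W F) k x : W x ->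
  (np (vec sF) k : B) x = (normal_part X x (F x) 0 k)%:C%C.
Proof.
move=> Wx; pose e i : R := dot (F x) (partial i X x).
have -> : normal_part X x (F x) 0 k = F x 0 k -
    (imetric X x i0 i0 * e i0 * partial i0 X x 0 k + imetric X x i0 i1 * e i0 * partial i1 X x 0 k
     + (imetric X x i1 i0 * e i1 * partial i0 X x 0 k + imetric X x i1 i1 * e i1 * partial i1 X x 0 k))
     - kk * dot (F x) (X x) * X x 0 k.
  have -> : normal_part X x (F x) 0 k = F x 0 k
      - \sum_i \sum_j (imetric X x i j * e i * partial j X x 0 k) - kk * dot (F x) (X x) * X x 0 k.
    rewrite /normal_part sph// invrK !mxE summxE; congr (_ - _ - _); last by ring.
    by apply: eq_bigr => i _; rewrite summxE; apply: eq_bigr => j _; rewrite !mxE.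
  by rewrite sum22E.
have dtP i : (dt (vec sF) (P i) : B) x = (e i)%:C%C by rewrite dt_vec.
rewrite /np dtC (dt_lin2 _ fb1E) [dt _ f1]dtC (dt_lin2 _ f1E) f1E fb1E.
rewrite ![dt (P _) _]dtC.
rewrite !(csmoothB, csmoothD, csmoothM)// !cjE// !dtP !dt_vec// !vecE//.
rewrite cstE// csmooth1// z0E z1E.
have e00 := imetric_frame00 oW sX im Wx; have e01 := imetric_frame01 oW sX im Wx.
have e11 := imetric_frame11 oW sX im Wx; have e10 := imetricC im Wx.
rewrite -e10; exact: normal_part_pure.
Qed.

Lemma np_lin2 (v u t : 'I_m -> A) (a b : A) :
  (forall k, v k = a * u k + b * t k) -> forall k, np v k = a * np u k + b * np t k.
Proof.
move=> h k; rewrite /np h !(dt_lin2 _ h); ring.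
Qed.

Lemma normal_part_partial i x : W x -> normal_part X x (partial i X x) = 0.
Proof.
move=> Wx.
have xx : dot (partial i X x) (X x) = 0.
  have e : partial i (fun x => dot (X x) (X x)) x = 0.
    rewrite -[RHS](partial_cst (n := 2) (kk^-1) i x); apply: partial_near.
    by near=> y; apply: sph; near: y; exact: open_nbhs_nbhs.
  have dX j : differentiable (fun x => X x 0 j) x.
    by apply: smooth_on_differentiable Wx; exact: (smooth_on_coord X oW).1.
  rewrite /dot partial_sum in e; last by move=> j; exact: (differentiableM (dX j) (dX j)).
  move: e; under eq_bigr do rewrite partialM//.
  rewrite big_split /= => e; have : dot (partial i X x) (X x) + dot (partial i X x) (X x) = 0.
    rewrite -[RHS]e /dot; congr (_ + _); apply: eq_bigr => j _.
      by rewrite partial_coord//; exact: smooth_on_differentiable sX Wx.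
    by rewrite partial_coord 1?mulrC//; exact: smooth_on_differentiable sX Wx.
  by lra.
rewrite /normal_part xx mul0r scale0r subr0; apply/eqP; rewrite subr_eq0; apply/eqP.
have e l : \sum_k imetric X x k l * metric X x i k = (i == l)%:R.
  have := mulmxV (metric_unit (im Wx)) => /matrixP/(_ i l); rewrite !mxE => <-.
  by apply: eq_bigr => k _; rewrite mulrC.
rewrite exchange_big /= (bigD1 i)//= [X in _ + X]big1 ?addr0 => [|l li].
  rewrite -scaler_suml (eq_bigr (fun k => imetric X x k i * metric X x i k)).
    by rewrite e eqxx scale1r.
  by move=> k _; rewrite mxE.
rewrite -scaler_suml (eq_bigr (fun k => imetric X x k l * metric X x i k)).
  by rewrite e eq_sym (negbTE li) scale0r.
by move=> k _; rewrite mxE.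
Unshelve. all: by end_near. Qed.

Lemma np_partial i k : np (P i) k = 0.
Proof.
by apply: csmooth_eq => x Wx; rewrite np_vec// normal_part_partial// mxE csmooth0.
Qed.

Local Notation L := (vethb 1 f1).
Local Notation f2 := (veth 1 f1).
Local Notation PP2 i j := (vec (smooth_on_partial j (smooth_on_partial i sX))).

Let vcjf : vcj f = f.
Proof. by apply/funext => i; rewrite /vcj cj_vec. Qed.

Let f1f : dt f1 f = 0.
Proof.
have := eth_cst A kk^-1; rewrite -vec_norm (eth_dt (m := 0) (n := 0)) ?addr0//.
by rewrite [X in _ + X]dtC => /double_eq0.
Qed.

Let Lreal : vcj L = L.
Proof.
have fb1' : fb1 = vethb 0 f by rewrite vcj_veth vcjf oppr0.
rewrite vcj_vethb fb1'; apply/funext => k; rewrite /vethb /veth.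
by rewrite (eth_comm (p := 1) (q := -1))// !mul0r addr0.
Qed.

Let Lf1 : dt L f1 = 0.
Proof.
have := congr1 (ethb 2) vec_conformal; rewrite ethb0 (ethb_dt (m := 1) (n := 1))//.
by rewrite [X in _ + X]dtC => /double_eq0.
Qed.

Let Lfb1 : dt L fb1 = 0.
Proof. by rewrite -Lreal -cj_dt Lf1 rmorph0. Qed.

Let Lf : dt L f = - half.
Proof.
have := congr1 (ethb 1) f1f; rewrite ethb0 (ethb_dt (m := 1) (n := 0))//.
have -> : vethb 0 f = fb1 by rewrite vcj_veth vcjf oppr0.
by rewrite vec_isometric => /eqP; rewrite addr_eq0 => /eqP.
Qed.

Lemma np_laplace k : np L k = L k + cst A kk * half * f k.
Proof. by rewrite /np Lf1 Lfb1 Lf; ring. Qed.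

(** Differentiating the relations for <f1, f1>, <f1, fb1> and <f1, f> shows that f2 is already
    normal. *)
Lemma np_hopf k : np f2 k = f2 k.
Proof.
have f2f1 : dt f2 f1 = 0.
  have := congr1 (eth 2) vec_conformal; rewrite eth0 (eth_dt (m := 1) (n := 1))//.
  by rewrite [X in _ + X]dtC => /double_eq0.
have f2fb1 : dt f2 fb1 = 0.
  have := eth_cst A 2^-1; rewrite -vec_isometric (eth_dt (m := 1) (n := -1))//.
  have -> : veth (-1) fb1 = L by rewrite -[RHS]Lreal vcj_vethb.
  by rewrite [X in _ + X]dtC Lf1 addr0.
have f2f : dt f2 f = 0.
  have := congr1 (eth 1) f1f; rewrite eth0 (eth_dt (m := 1) (n := 0))//.
  by rewrite vec_conformal addr0.
by rewrite /np f2f1 f2fb1 f2f; ring.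
Qed.

Let half2 : 2 * half = 1 :> A.
Proof. by rewrite -(rmorph_nat (cst A)) -rmorphM mulfV ?pnatr_eq0// rmorph1. Qed.

(** First derivatives of the patch are tangent, so the normal part of a second-order expression sees
    only its leading coefficients, contracted with the second fundamental form. *)
Let np_second (a b c : 'I_2 -> A) (v : 'I_m -> A) :
  (forall k, v k = (c i0 * P i0 k + c i1 * P i1 k)
      + (a i0 * (b i0 * PP2 i0 i0 k + b i1 * PP2 i0 i1 k)
        + a i1 * (b i0 * PP2 i1 i0 k + b i1 * PP2 i1 i1 k))) ->
  forall k x, W x -> (np v k : B) x =
    bil (fun i => (a i : B) x) (fun i => (b i : B) x) (fun i j => (sff X x j i 0 k)%:C%C).
Proof.
move=> h k x Wx.
pose u k := c i0 * P i0 k + c i1 * P i1 k.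
pose w i k := b i0 * PP2 i i0 k + b i1 * PP2 i i1 k.
pose w' k := a i0 * w i0 k + a i1 * w i1 k.
have e1 k' : v k' = 1 * u k' + 1 * w' k' by rewrite h !mul1r.
have npu : np u k = 0.
  by rewrite (np_lin2 (fun k => erefl (u k))) !np_partial !mulr0 addr0.
have npw i : np (w i) k = b i0 * np (PP2 i i0) k + b i1 * np (PP2 i i1) k by exact: np_lin2.
have npw' : np w' k = a i0 * np (w i0) k + a i1 * np (w i1) k by exact: np_lin2.
rewrite (np_lin2 e1) npu mulr0 add0r mul1r npw' !npw.
have npPP i j : (np (PP2 i j) k : B) x = (sff X x j i 0 k)%:C%C by exact: np_vec.
rewrite (csmooth_bil a b (fun i j => np (PP2 i j) k) Wx) /bil.
by rewrite (npPP i0 i0) (npPP i0 i1) (npPP i1 i0) (npPP i1 i1).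
Qed.

Let z i x : C := if i == i0 then frame1 oW sX im x else frame2 oW sX im x.

Let LE k : L k = (ethb 1 (zz i0) * P i0 k + ethb 1 (zz i1) * P i1 k)
  + (zz i0 * (cj A (zz i0) * PP2 i0 i0 k + cj A (zz i1) * PP2 i0 i1 k)
    + zz i1 * (cj A (zz i0) * PP2 i1 i0 k + cj A (zz i1) * PP2 i1 i1 k)).
Proof.
rewrite {1}/vethb {1}/veth eth_vec ethbD !(ethbM (m := 1) (n := 0) (p := 1))// !ethb_vec.
by rewrite addrACA.
Qed.

Let npL := np_second (a := zz) (b := fun j => cj A (zz j)) (c := fun i => ethb 1 (zz i)) LE.

Let f2E k : f2 k = (eth 1 (zz i0) * P i0 k + eth 1 (zz i1) * P i1 k)
  + (zz i0 * (zz i0 * PP2 i0 i0 k + zz i1 * PP2 i0 i1 k)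
    + zz i1 * (zz i0 * PP2 i1 i0 k + zz i1 * PP2 i1 i1 k)).
Proof.
rewrite {1 2}/veth eth_vec ethD !(ethM (m := 1) (n := 0) (p := 1))// !eth_vec.
by rewrite addrACA.
Qed.

Let npf2 := np_second (a := zz) (b := zz) (c := fun i => eth 1 (zz i)) f2E.

Let sum4E (F : 'I_2 -> 'I_2 -> 'I_2 -> 'I_2 -> R) :
  \sum_i \sum_j \sum_k \sum_l F i j k l =
  F i0 i0 i0 i0 + F i0 i0 i0 i1 + (F i0 i0 i1 i0 + F i0 i0 i1 i1)
  + (F i0 i1 i0 i0 + F i0 i1 i0 i1 + (F i0 i1 i1 i0 + F i0 i1 i1 i1))
  + (F i1 i0 i0 i0 + F i1 i0 i0 i1 + (F i1 i0 i1 i0 + F i1 i0 i1 i1)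
  + (F i1 i1 i0 i0 + F i1 i1 i0 i1 + (F i1 i1 i1 i0 + F i1 i1 i1 i1))).
Proof. by rewrite !sum2E. Qed.

Lemma sffC i j x : W x -> sff X x i j = sff X x j i.
Proof. by move=> Wx; rewrite /sff (partialC_row i j oW sX Wx). Qed.

Let two_x x : W x -> (2 : B) x = 2.
Proof. by move=> Wx; rewrite csmoothD// csmooth1. Qed.

(** The frame form of the inverse metric makes H, half the trace, equal to twice the (Z, Zb)
    component, which is the normal part of the Laplacian term; [np_laplace] makes that explicit. *)
Lemma mean_curv_vecE k x : W x ->
  (2 * L k + cst A kk * f k : B) x = (mean_curv_vec X x 0 k)%:C%C.
Proof.
move=> Wx; have -> : 2 * L k + cst A kk * f k = 2 * np L k.
  rewrite np_laplace; transitivity (2 * L k + (2 * half) * (cst A kk * f k)); last by ring.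
  by rewrite half2 mul1r.
rewrite csmoothM// (npL k Wx) two_x//.
have -> : mean_curv_vec X x 0 k = 2%:R^-1 * (imetric X x i0 i0 * sff X x i0 i0 0 k +
   imetric X x i0 i1 * sff X x i0 i1 0 k + (imetric X x i1 i0 * sff X x i1 i0 0 k +
   imetric X x i1 i1 * sff X x i1 i1 0 k)).
  rewrite /mean_curv_vec mxE summxE -(sum22E (fun i j => imetric X x i j * sff X x i j 0 k)).
  congr (_ * _); apply: eq_bigr => i _.
  by rewrite summxE; apply: eq_bigr => j _; rewrite !mxE.
have e00 := imetric_frame00 oW sX im Wx; have e01 := imetric_frame01 oW sX im Wx.
have e11 := imetric_frame11 oW sX im Wx; move: e00 e01 e11.
rewrite -(imetricC im Wx) (sffC i1 i0 Wx) => e00 e01 e11.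
apply: etrans _ (mean_curv_pure e00 e01 e11 (sff X x i0 i0 0 k) (sff X x i0 i1 0 k) (sff X x i1 i1 0 k)).
rewrite /bil (sffC i1 i0 Wx) !cjE// z0E z1E.
Qed.

Lemma smooth_on_mean_curv_vec : smooth_on W (mean_curv_vec X).
Proof.
apply/(smooth_on_coord _ oW) => k.
apply: (smooth_on_ext (F := fun x => complex.Re ((2 * L k + cst A kk * f k : B) x))) => //.
  by move=> x Wx; rewrite mean_curv_vecE.
exact: csmooth_Re.
Qed.

Local Notation h := (vec smooth_on_mean_curv_vec).

Lemma mean_curv_vec_frame k : h k = 2 * L k + cst A kk * f k.
Proof. by apply: csmooth_eq => x Wx; rewrite vecE// mean_curv_vecE. Qed.

Lemma np_mean_curv_vec : (forall x, W x -> parallel_mean_curv X x) ->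
  forall k, np (veth 0 h) k = 0.
Proof.
move=> par k; have e i : np (vec (smooth_on_partial i smooth_on_mean_curv_vec)) k = 0.
  apply: csmooth_eq => x Wx; rewrite np_vec//.
  by have := par x Wx i; rewrite /normal_connection => ->; rewrite mxE csmooth0.
by rewrite (np_lin2 (fun k => eth_vec _ k)) !e !mulr0 addr0.
Qed.

Local Notation T x i j k := ((traceless_sff X x i j 0 k)%:C%C : C).

Let TE x i j k : T x i j k = (sff X x i j 0 k)%:C%C - (metric X x i j)%:C%C * (mean_curv_vec X x 0 k)%:C%C.
Proof.
have -> : traceless_sff X x i j 0 k = sff X x i j 0 k - metric X x i j * mean_curv_vec X x 0 k.
  by rewrite /traceless_sff !mxE.
by rewrite -realCM -realCB.
Qed.

Let bil_pure (a b g g' g'' h s00 s01 s10 s11 : C) :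
  a * a * (s00 - g * h) + a * b * (s10 - g' * h) + b * a * (s01 - g' * h) + b * b * (s11 - g'' * h)
  - (a * a * s00 + a * b * s10 + b * a * s01 + b * b * s11) =
  (a * a * g + 2 * a * b * g' + b * b * g'') * - h.
Proof. by ring. Qed.

Let bil_pure' (a b a' b' g g' g'' h s00 s01 s10 s11 : C) :
  a * a' * (s00 - g * h) + a * b' * (s10 - g' * h) + b * a' * (s01 - g' * h) + b * b' * (s11 - g'' * h) =
  a * a' * s00 + a * b' * s10 + b * a' * s01 + b * b' * s11 -
  (a * a' * g + (a * b' + a' * b) * g' + b * b' * g'') * h.
Proof. by ring. Qed.

(** Subtracting H g changes nothing here because <Z, Z> = 0, whereas it removes the whole mixed
    component: the traceless form amounts to f2 and its conjugate. *)
Let T_ZZ x k : W x -> bil (z^~ x) (z^~ x) (fun i j => T x j i k) = (f2 k : B) x.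
Proof.
move=> Wx; rewrite -np_hopf (npf2 k Wx).
have [e _] := frame_conformal oW sX im Wx.
rewrite /bil (TE x i0 i0 k) (TE x i0 i1 k) (TE x i1 i0 k) (TE x i1 i1 k) (metricC X x i1 i0).
apply/eqP; rewrite -subr_eq0; apply/eqP.
rewrite -[RHS](mul0r (- (mean_curv_vec X x 0 k)%:C%C)) -[X in _ = X * _]e z0E z1E.
exact: bil_pure.
Qed.

Let T_ZZb x k : W x -> bil (z^~ x) (fun j => (z j x)^*%C) (fun i j => T x j i k) = 0.
Proof.
move=> Wx; have := npL k Wx; rewrite np_laplace.
have -> : L k + cst A kk * half * f k = half * h k.
  rewrite mean_curv_vec_frame; transitivity ((2 * half) * L k + cst A kk * half * f k); last by ring.
  by rewrite half2 mul1r.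
rewrite csmoothM// cstE// vecE//.
have [_ e] := frame_conformal oW sX im Wx; rewrite -e => /eqP; rewrite eq_sym -subr_eq0 => /eqP E.
rewrite -[RHS]E /bil (TE x i0 i0 k) (TE x i0 i1 k) (TE x i1 i0 k) (TE x i1 i1 k) (metricC X x i1 i0).
rewrite !cjE// z0E z1E; exact: bil_pure'.
Qed.

Let T_ZbZb x k : W x ->
  bil (fun j => (z j x)^*%C) (fun j => (z j x)^*%C) (fun i j => T x j i k) = (vcj f2 k : B) x.
Proof. by move=> Wx; rewrite cjE// -T_ZZ// conj_bil. Qed.

Let T_ZbZ x k : W x -> bil (fun j => (z j x)^*%C) (z^~ x) (fun i j => T x j i k) = 0.
Proof.
move=> Wx; have := congr1 (@conjc R) (T_ZZb k Wx); rewrite conj_bil conjc0 /bil.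
by rewrite !conjcK.
Qed.

(** Each of the two inverse metrics contributes a factor 2, and the components (Z, Z) and (Zb, Zb)
    contribute |f2|^2 each. *)
Lemma traceless_S_frame x : W x -> (traceless_S X x)%:C%C = 8 * (dt f2 (vcj f2) : B) x.
Proof.
move=> Wx; have -> : traceless_S X x = \sum_k \sum_i \sum_j \sum_i' \sum_j'
    imetric X x i i' * imetric X x j j' * (traceless_sff X x i j 0 k * traceless_sff X x i' j' 0 k).
  rewrite /traceless_S /dot [RHS]exchange_big; apply: eq_bigr => i _.
  rewrite [RHS]exchange_big; apply: eq_bigr => j _; rewrite [RHS]exchange_big; apply: eq_bigr => i' _.
  by rewrite [RHS]exchange_big; apply: eq_bigr => j' _; rewrite mulr_sumr.
rewrite csmooth_sum// mulr_sumr realC_sum; apply: eq_bigr => k _; rewrite csmoothM//.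
have e00 := imetric_frame00 oW sX im Wx; have e01 := imetric_frame01 oW sX im Wx.
have e11 := imetric_frame11 oW sX im Wx.
have E : 8 * ((f2 k : B) x * (vcj f2 k : B) x) =
  4 * ((f2 k : B) x * (vcj f2 k : B) x + 0 * 0 + 0 * 0 + (vcj f2 k : B) x * (f2 k : B) x) by ring.
rewrite E -{1}(T_ZZb k Wx) -{1}(T_ZbZ k Wx) -{1}(T_ZbZ k Wx) -{1}(T_ZZb k Wx).
rewrite -!T_ZZ// -!T_ZbZb// sum4E -(imetricC im Wx).
apply: etrans (traceless_pure e00 e01 e11 _ _ _ _) _.
by rewrite /bil.
Qed.

Lemma umbilical_frame x : W x -> (forall k, f2 k = 0) -> umbilical_at X x.
Proof.
move=> Wx f20 i j; apply/rowP => k; rewrite [RHS]mxE.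
suff H : T x i0 i0 k = 0 /\ T x i0 i1 k = 0 /\ T x i1 i0 k = 0 /\ T x i1 i1 k = 0.
  have : T x i j k = 0 by case: (ord2 i) => ->; case: (ord2 j) => ->; case: H => ? [? []].
  by move=> /(congr1 (@complex.Re R)).
have d := congr1 (fun u : B => u x) (frame_indep oW sX im).
rewrite csmooth1// csmoothM// csmoothB// !csmoothM// !csm_cjE// in d.
have e1 := T_ZZ k Wx; have e2 := T_ZZb k Wx; have e3 := T_ZbZ k Wx; have e4 := T_ZbZb k Wx.
have f2b0 : vcj f2 k = 0 by rewrite /vcj f20 rmorph0.
move: e1 e2 e3 e4 d; rewrite f2b0 f20 csmooth0// /bil.
have -> : z i0 x = frame1 oW sX im x by []. have -> : z i1 x = frame2 oW sX im x by [].
move: (T x i0 i0 k) (T x i0 i1 k) (T x i1 i0 k) (T x i1 i1 k) (frame_inv oW sX im x).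
move: (frame1 oW sX im x) (frame2 oW sX im x) => a b; move: (a^*%C) (b^*%C) => a' b' p q r t D.
move=> e1 e2 e3 e4 d.
have dn : forall u : C, (a * b' - a' * b) * (a * b' - a' * b) * u = 0 -> u = 0.
  move=> u hu; rewrite -[u]mul1r -[1]mulr1 -{1}d -d.
  transitivity (D * D * ((a * b' - a' * b) * (a * b' - a' * b) * u)); first by ring.
  by rewrite hu mulr0.
have lin (c1 c2 c3 c4 u : C) : (a * b' - a' * b) * (a * b' - a' * b) * u =
   c1 * 0 + c2 * 0 + c3 * 0 + c4 * 0 -> u = 0 by rewrite !mulr0 !addr0; exact: dn.
split; [|split; [|split]].
(* The coefficients invert the change from coordinate fields to (Z, Zb) in both slots of the
   tensor. *)
- apply: (lin (b' * b') (- b' * b) (- b * b') (b * b)); rewrite -{1}e1 -{1}e2 -{1}e3 -{1}e4; ring.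
- apply: (lin (- b' * a') (a' * b) (a * b') (- a * b)); rewrite -{1}e1 -{1}e2 -{1}e3 -{1}e4; ring.
- apply: (lin (- b' * a') (a * b') (a' * b) (- a * b)); rewrite -{1}e1 -{1}e2 -{1}e3 -{1}e4; ring.
- apply: (lin (a' * a') (- a' * a) (- a * a') (a * a)); rewrite -{1}e1 -{1}e2 -{1}e3 -{1}e4; ring.
Qed.

End FrameLink.

(** * Round spheres *)

Definition convex_set (R : realType) n (W : set 'rV[R]_n) :=
  forall x y (t : R), W x -> W y -> 0 <= t <= 1 -> W (x + t *: (y - x)).

Lemma ball_convex (R : realType) n (x0 : 'rV[R]_n) (r : R) : convex_set (ball x0 r).
Proof. by move=> x y t; exact: ball_segment. Qed.

Section FrameConst.
Variables (R : realType) (W : set 'rV[R]_2) (oW : open W).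
Variables (z1 z2 di : csmooth oW).
Hypothesis zz : (z1 * csm_cj z2 - csm_cj z1 * z2) * di = 1.
Local Notation A := (framed_csmooth zz).

Lemma csmooth_const (u : csmooth oW) : convex_set W -> dZ A u = 0 -> dZb A u = 0 ->
  forall x y, W x -> W y -> u x = u y.
Proof.
move=> cW Zu Zbu x y Wx Wy.
have d0 : csm_d i0 u = 0.
  transitivity (di * (csm_cj z2 * dZ A u - z2 * dZb A u)); last by rewrite Zu Zbu; ring.
  rewrite -[LHS]mul1r -zz /= /csm_Z /csm_Zb; ring.
have d1 : csm_d i1 u = 0.
  transitivity (di * (z1 * dZb A u - csm_cj z1 * dZ A u)); last by rewrite Zu Zbu; ring.
  rewrite -[LHS]mul1r -zz /= /csm_Z /csm_Zb; ring.
have d i : csm_d i u = 0 by case: (ord2 i) => ->.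
have e i z : W z -> partial i (fun x => complex.Re (u x)) z = 0 /\
    partial i (fun x => complex.Im (u x)) z = 0.
  move=> Wz; have := csm_dE i u Wz; rewrite d csmooth0// => /esym.
  by move=> /eqP; rewrite eq_complex /= => /andP[/eqP -> /eqP ->].
have dRe z : W z -> differentiable (fun x => complex.Re (u x)) z.
  by move=> Wz; exact: smooth_on_differentiable (csmooth_Re u) Wz.
have dIm z : W z -> differentiable (fun x => complex.Im (u x)) z.
  by move=> Wz; exact: smooth_on_differentiable (csmooth_Im u) Wz.
have hRe := partial0_cst dRe (fun i z Wz => (e i z Wz).1) (fun t => cW y x t Wy Wx).
have hIm := partial0_cst dIm (fun i z Wz => (e i z Wz).2) (fun t => cW y x t Wy Wx).
by move: hRe hIm; case: (u x) => a b; case: (u y) => a' b' /= -> ->.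
Qed.

Lemma csmooth_cst (u : csmooth oW) x0 : convex_set W -> W x0 -> dZ A u = 0 -> dZb A u = 0 ->
  csm_cj u = u -> u = csm_cst oW (complex.Re (u x0)).
Proof.
move=> cW W0 Zu Zbu cu; apply: csmooth_eq => x Wx.
rewrite csm_realE// (csmooth_const cW Zu Zbu Wx W0).
have := csm_cjE u W0; rewrite cu; case: (u x0) => a b /= /eqP; rewrite eq_complex /=.
rewrite eqxx /= => /eqP bb; congr Complex.
have : b + b = 0 by rewrite {1}bb addNr.
by move/eqP; rewrite -mulr2n mulrn_eq0 /= => /eqP.
Qed.

(** Isometric patches have equal frames, but their framed rings also carry proofs of independence;
    once the frames are identified, proof irrelevance identifies the rings. *)
Lemma ladder_transfer (z1' z2' di' : csmooth oW)
    (zz' : (z1' * csm_cj z2' - csm_cj z1' * z2') * di' = 1) :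
  z1 = z1' -> z2 = z2' -> di = di' ->
  (forall r, ccurv A = csm_cst oW r -> ccurv (framed_csmooth zz') = csm_cst oW r) /\
  forall (I : finType) (f : I -> csmooth oW) s l a,
    closed_ladder (A := A) s l a (ladder_seq (A := A) f) ->
    closed_ladder (A := framed_csmooth zz') s l a (ladder_seq (A := framed_csmooth zz') f).
Proof.
move=> e1 e2 e3; move: zz'; rewrite -e1 -e2 -e3 => zz'.
by rewrite (Prop_irrelevance zz' zz).
Qed.

End FrameConst.

(** A real symmetric form is determined by its values on (Z, Z) and (Z, Zb): conjugation supplies
    (Zb, Zb), and the determinant of the frame is invertible. *)
Lemma metric_pure (R : realType) (a b D : R[i]) (p q r p' q' r' : R) :
  (a * b^*%C - a^*%C * b) * D = 1 ->
  a * a * p'%:C%C + 2 * a * b * q'%:C%C + b * b * r'%:C%C = 0 ->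
  a * a^*%C * p'%:C%C + (a * b^*%C + a^*%C * b) * q'%:C%C + b * b^*%C * r'%:C%C = (2^-1)%:C%C ->
  a * (a * p%:C%C + b * q%:C%C) + b * (a * q%:C%C + b * r%:C%C) = 0 ->
  a * (a^*%C * p%:C%C + b^*%C * q%:C%C) + b * (a^*%C * q%:C%C + b^*%C * r%:C%C) = (2^-1)%:C%C ->
  [/\ p = p', q = q' & r = r'].
Proof.
move=> d d1 d2 h1 h2.
pose P := (p - p')%:C%C : R[i]; pose Q := (q - q')%:C%C : R[i]; pose S := (r - r')%:C%C : R[i].
have E1 : a * a * P + 2 * a * b * Q + b * b * S = 0.
  by rewrite /P /Q /S !realCB -[RHS](subrr (0 : R[i])) -{1}h1 -d1; ring.
have E2 : a * a^*%C * P + (a * b^*%C + a^*%C * b) * Q + b * b^*%C * S = 0.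
  by rewrite /P /Q /S !realCB -[RHS](subrr ((2^-1)%:C%C : R[i])) -{1}h2 -d2; ring.
have E3 : a^*%C * a^*%C * P + 2 * a^*%C * b^*%C * Q + b^*%C * b^*%C * S = 0.
  rewrite -[RHS](conjc0 R) -E1 /P /Q /S.
  move: (p - p') (q - q') (r - r') => {d h1 h2 d1 d2 E1 E2} x y w; case: a b => [? ?] [? ?].
  by apply/eqP; rewrite eq_complex /=; apply/andP; split; apply/eqP; ring.
have lin (u c1 c2 c3 : R[i]) : (a * b^*%C - a^*%C * b) * (a * b^*%C - a^*%C * b) * u =
   c1 * 0 + c2 * 0 + c3 * 0 -> u = 0.
  rewrite !mulr0 !addr0 => h; rewrite -[u]mul1r -[1]mulr1 -{1}d -d.
  transitivity (D * D * ((a * b^*%C - a^*%C * b) * (a * b^*%C - a^*%C * b) * u)); first by ring.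
  by rewrite h mulr0.
have z (x : R) : x%:C%C = 0 :> R[i] -> x = 0 by move=> /(congr1 (@complex.Re R)).
split; apply/eqP; rewrite -subr_eq0; apply/eqP/z.
- apply: (lin _ (b^*%C * b^*%C) (- 2 * b * b^*%C) (b * b)); rewrite -{1}E1 -{1}E2 -E3; ring.
- apply: (lin _ (- a^*%C * b^*%C) (a * b^*%C + a^*%C * b) (- a * b)); rewrite -{1}E1 -{1}E2 -E3; ring.
- apply: (lin _ (a^*%C * a^*%C) (- 2 * a * a^*%C) (a * a)); rewrite -{1}E1 -{1}E2 -E3; ring.
Qed.

Section FrameMetric.
Variables (R : realType) (m n : nat) (W : set 'rV[R]_2) (oW : open W).
Variables (X : 'rV[R]_2 -> 'rV[R]_m) (Y : 'rV[R]_2 -> 'rV[R]_n).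
Hypotheses (sX : smooth_on W X) (sY : smooth_on W Y).
Hypotheses (iX : forall x, W x -> immersive_at X x) (iY : forall x, W x -> immersive_at Y x).
Local Notation A := (frame_ring oW sX iX).
Local Notation B := (csmooth oW).
Local Notation C := (R[i]).

Lemma frame_eq : (forall x, W x -> metric X x = metric Y x) ->
  [/\ frame1 oW sX iX = frame1 oW sY iY, frame2 oW sX iX = frame2 oW sY iY &
      frame_inv oW sX iX = frame_inv oW sY iY].
Proof.
by move=> e; split; apply: csmooth_eq => x Wx; rewrite /frame1 /frame2 /frame_inv !cmkE// e.
Qed.

Lemma metric_frame_eq : dt (veth 0 (vec oW sX iX sY)) (veth 0 (vec oW sX iX sY)) = 0 ->
  dt (veth 0 (vec oW sX iX sY)) (vcj (veth 0 (vec oW sX iX sY))) = cst A 2^-1 ->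
  forall x, W x -> metric Y x = metric X x.
Proof.
set P := fun i => vec oW sX iX (smooth_on_partial i sY).
set f1 := veth 0 _; set fb1 := vcj f1.
have f1E k : f1 k = zz oW sX iX i0 * P i0 k + zz oW sX iX i1 * P i1 k by rewrite /f1 /veth eth_vec.
have fb1E k : fb1 k = cj A (zz oW sX iX i0) * P i0 k + cj A (zz oW sX iX i1) * P i1 k.
  by rewrite /fb1 /vcj f1E rmorphD !rmorphM !cj_vec.
move=> E1 E2 x Wx.
have PP i j : (dt (P i) (P j) : B) x = (metric Y x i j)%:C%C by rewrite dt_vec// mxE.
have [d1 d2] := frame_conformal oW sX iX Wx.
have {}E1 := congr1 (fun u : B => u x) E1; have {}E2 := congr1 (fun u : B => u x) E2.
move: E1; rewrite (dt_lin2 _ f1E) ![dt (P _) f1]dtC !(dt_lin2 _ f1E) [dt (P i1) (P i0)]dtC.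
rewrite csmooth0// !(csmoothD, csmoothM)// !PP.
move: E2; rewrite (dt_lin2 _ f1E) ![dt (P _) fb1]dtC !(dt_lin2 _ fb1E) [dt (P i1) (P i0)]dtC.
rewrite cstE// !(csmoothD, csmoothM)// !cjE// !PP.
have -> : (zz oW sX iX i0 : B) x = frame1 oW sX iX x by [].
have -> : (zz oW sX iX i1 : B) x = frame2 oW sX iX x by [].
have d := congr1 (fun u : B => u x) (frame_indep oW sX iX).
rewrite csmooth1// csmoothM// csmoothB// !csmoothM// !csm_cjE// in d.
move=> h2 h1.
have [q00 q01 q11] := metric_pure d d1 d2 h1 h2.
apply/matrixP => i j; case: (ord2 i) => ->; case: (ord2 j) => ->; rewrite ?(metricC _ _ i1 i0) //.
Qed.

End FrameMetric.

Lemma sum_delta (R : pzRingType) n (F : 'I_n -> R) j : \sum_k F k * (j == k)%:R = F j.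
Proof.
rewrite (bigD1 j)//= eqxx mulr1 big1 ?addr0// => k kj.
by rewrite eq_sym (negbTE kj) mulr0.
Qed.

Lemma partial_dot (R : realType) (n m : nat) (F G : 'rV[R]_n -> 'rV[R]_m) i x :
  differentiable F x -> differentiable G x ->
  partial i (fun y => dot (F y) (G y)) x = dot (partial i F x) (G x) + dot (F x) (partial i G x).
Proof.
move=> dF dG; have dc (H : 'rV[R]_n -> 'rV[R]_m) j : differentiable H x ->
    differentiable (fun y => H y 0 j) x.
  move=> dH.
  by apply: (differentiable_comp (g := fun M : 'rV[R]_m => M 0 j)) dH (differentiable_coord _ _ _).
rewrite /dot partial_sum; last by move=> j; exact: (differentiableM (dc F j dF) (dc G j dG)).
rewrite -big_split; apply: eq_bigr => j _; rewrite partialM; [|exact: dc|exact: dc].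
by rewrite !partial_coord.
Qed.

Lemma metricE (R : realType) (n m : nat) (X : 'rV[R]_n -> 'rV[R]_m) x i j :
  metric X x i j = dot (partial i X x) (partial j X x).
Proof. by rewrite mxE. Qed.

Section SpherePatch.
Variables (R : realType) (n m : nat) (X : 'rV[R]_n -> 'rV[R]_m) (W : set 'rV[R]_n).
Hypotheses (oW : open W) (sX : smooth_on W X) (im : forall x, W x -> immersive_at X x).
Variable kk : R.
Hypotheses (kk_gt0 : 0 < kk) (sph : forall x, W x -> dot (X x) (X x) = kk^-1).

Lemma partial_sphere i x : W x -> dot (partial i X x) (X x) = 0.
Proof.
move=> Wx; have e : partial i (fun x => dot (X x) (X x)) x = 0.
  rewrite -[RHS](partial_cst (n := n) (kk^-1) i x); apply: partial_near.
  by near=> y; apply: sph; near: y; exact: open_nbhs_nbhs.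
have dX := smooth_on_differentiable sX Wx.
move: e; rewrite partial_dot// [X in _ + X]dotC => /eqP; rewrite -mulr2n mulrn_eq0 /=.
by move=> /eqP.
Unshelve. all: by end_near. Qed.

Lemma imetric_sym x a b : imetric X x a b = imetric X x b a.
Proof.
suff : (imetric X x)^T = imetric X x by move=> /matrixP/(_ b a) <-; rewrite mxE.
rewrite /imetric trmx_inv; congr invmx; apply/matrixP => k l.
by rewrite mxE metricC.
Qed.

Lemma dot_imetric x i l : W x -> \sum_k imetric X x k l * metric X x i k = (i == l)%:R.
Proof.
move=> Wx; have := mulmxV (metric_unit (im Wx)) => /matrixP/(_ i l); rewrite !mxE => <-.
by apply: eq_bigr => k _; rewrite mulrC.
Qed.

Lemma normal_part_orth x v : W x ->
  dot (normal_part X x v) (X x) = 0 /\ forall j, dot (normal_part X x v) (partial j X x) = 0.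
Proof.
move=> Wx; split=> [|j].
  rewrite /normal_part !(dotDl, dotNl, dotZl) sph// invrK mulfK ?gt_eqF ?invr_gt0//.
  rewrite dot_suml big1 ?subr0 ?subrr// => k _; rewrite dot_suml big1// => l _.
  by rewrite dotZl partial_sphere// mulr0.
rewrite /normal_part !(dotDl, dotNl, dotZl) (dotC (X x) (partial j X x)) partial_sphere// mulr0 subr0.
rewrite dot_suml (eq_bigr (fun k => dot v (partial k X x) * (j == k)%:R)) => [|k _].
  by rewrite (sum_delta (fun k => dot v (partial k X x))) subrr.
rewrite dot_suml -(dot_imetric j k Wx) mulr_sumr; apply: eq_bigr => l _.
rewrite (imetric_sym x k l).
have -> : metric X x j l = dot (partial l X x) (partial j X x) by rewrite metricE; exact: dotC.
have swap (p q r : R) : p * q * r = q * (p * r) by ring.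
by rewrite dotZl swap.
Qed.

Lemma partial2_sphere i j x : W x -> dot (partial i (partial j X) x) (X x) = - metric X x i j.
Proof.
move=> Wx; have dX := smooth_on_differentiable sX Wx.
have dPX := smooth_on_differentiable (smooth_on_partial j sX) Wx.
have := partial_dot i dPX dX.
rewrite (@partial_near _ _ _ _ (fun=> 0)); last first.
  by near=> y; apply: partial_sphere; near: y; exact: open_nbhs_nbhs.
rewrite partial_cst => /esym/eqP; rewrite addr_eq0 => /eqP ->.
by rewrite metricE; congr (- _); exact: dotC.
Unshelve. all: by end_near. Qed.

End SpherePatch.

Section Hypersphere.
Variables (R : realType) (n : nat) (X : 'rV[R]_n -> 'rV[R]_n.+1) (W : set 'rV[R]_n).
Hypotheses (oW : open W) (sX : smooth_on W X) (im : forall x, W x -> immersive_at X x).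
Variable kk : R.
Hypotheses (kk_gt0 : 0 < kk) (sph : forall x, W x -> dot (X x) (X x) = kk^-1).

Lemma sphere_frame_unit x : W x ->
  (col_mx (X x) (jmx X x) : 'M[R]_(1 + n)) \in unitmx.
Proof.
move=> Wx; rewrite -row_free_unit -kermx_eq0; apply/rowV0P => v /sub_kermxP.
rewrite -[v]hsubmxK mul_row_col => e.
set b := lsubmx v in e *; set a := rsubmx v in e *.
have eb : b *m X x = b 0 0 *: X x.
  apply/rowP => k; rewrite mxE big_ord1 [RHS]mxE.
  by have -> : (ord0 : 'I_1) = 0 by [].
have ja : dot (a *m jmx X x) (X x) = 0.
  have -> : a *m jmx X x = \sum_i a 0 i *: partial i X x.
    apply/rowP => k; rewrite !mxE summxE; apply: eq_bigr => i _.
    by rewrite jmxE [RHS]mxE.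
  by rewrite dot_suml big1// => i _; rewrite dotZl (partial_sphere oW sX sph)// mulr0.
have b0 : b 0 0 = 0.
  have := congr1 (fun u => dot u (X x)) e; rewrite /= eb dotDl ja addr0 dotZl sph// dot0l.
  by move/eqP; rewrite mulf_eq0 invr_eq0 [kk == 0]gt_eqF// orbF => /eqP.
have -> : b = 0 by apply/rowP => k; rewrite (ord1 k) b0 mxE.
move: e; rewrite eb b0 scale0r add0r => e.
suff -> : a = 0 by rewrite row_mx0.
have := im Wx; rewrite immersive_jmx => rf; apply: (row_free_inj rf).
by rewrite e mul0mx.
Qed.

Lemma normal_part_sphere x v : W x -> normal_part X x v = 0.
Proof.
move=> Wx; set u := normal_part _ _ _.
have [uX uP] := normal_part_orth oW sX im kk_gt0 sph v Wx.
have uM : u *m (col_mx (X x) (jmx X x) : 'M[R]_(1 + n))^T = 0.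
  rewrite tr_col_mx mul_mx_row; apply/eqP; rewrite row_mx_eq0; apply/andP; split; apply/eqP/rowP => j.
    rewrite (ord1 j) !mxE -[RHS]uX; apply: eq_bigr => k _.
    by rewrite [(X x)^T k 0]mxE.
  rewrite !mxE -[RHS](uP j); apply: eq_bigr => k _.
  by rewrite [(jmx X x)^T k j]mxE jmxE.
have U := sphere_frame_unit Wx; rewrite -unitmx_tr in U.
by rewrite -[u](mulmxK U) uM mul0mx.
Qed.

End Hypersphere.

Section Sphere2.
Variables (R : realType) (X : 'rV[R]_2 -> 'rV[R]_3) (W : set 'rV[R]_2).
Hypotheses (oW : open W) (sX : smooth_on W X) (im : forall x, W x -> immersive_at X x).
Variable kk : R.
Hypotheses (kk_gt0 : 0 < kk) (sph : forall x, W x -> dot (X x) (X x) = kk^-1).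
Local Notation A := (frame_ring oW sX im).
Local Notation B := (csmooth oW).
Local Notation f := (vec oW sX im sX).

(** A surface in a 2-sphere has no normal directions; complex vectors are reduced to their real and
    imaginary parts. *)
Lemma np_sphere2 (u : 'I_3 -> A) k : np kk u k = 0.
Proof.
have sRe : smooth_on W (fun x => \row_k complex.Re ((u k : B) x)).
  apply/(smooth_on_coord _ oW) => j; apply: smooth_on_ext (csmooth_Re (u j)) => // x _.
  by rewrite mxE.
have sIm : smooth_on W (fun x => \row_k complex.Im ((u k : B) x)).
  apply/(smooth_on_coord _ oW) => j; apply: smooth_on_ext (csmooth_Im (u j)) => // x _.
  by rewrite mxE.
have e j : u j = 1 * vec oW sX im sRe j + ci A * vec oW sX im sIm j.
  apply: csmooth_eq => x Wx; rewrite mul1r csmoothD// csmoothM// !vecE// csm_iE// !mxE.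
  case: ((u j : B) x) => a b /=; apply/eqP; rewrite eq_complex /=.
  by apply/andP; split; apply/eqP; ring.
have z F (sF : smooth_on W F) : np kk (vec oW sX im sF) k = 0.
  apply: csmooth_eq => x Wx; rewrite np_vec// (normal_part_sphere oW sX im kk_gt0 sph)// mxE csmooth0//.
by rewrite (np_lin2 kk e) !z !mulr0 addr0.
Qed.

Local Notation L := (vethb 1 (veth 0 f)).

Lemma sphere2_laplace k : ethb 1 (eth 0 (f k)) = - cst A (kk / 2) * f k.
Proof.
have := np_laplace oW sX im sph k; rewrite np_sphere2 => /esym/eqP.
by rewrite addr_eq0 => /eqP; rewrite /vethb /veth => ->; rewrite -rmorphM mulNr.
Qed.

(** As f2 is normal it vanishes, so the commutator on f1 gives (curvature - kk / 2) f1 = 0. The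
    vector f1 cannot be cancelled directly; pairing with its conjugate replaces it by 1/2. *)
Lemma sphere2_ccurv : ccurv A = cst A (kk / 2).
Proof.
have f20 k : eth 1 (eth 0 (f k)) = 0.
  by have := np_hopf oW sX im sph k; rewrite np_sphere2 => /esym.
have e k : (ccurv A - cst A (kk / 2)) * eth 0 (f k) = 0.
  have := eth_comm (p := 2) (q := 0) (m := 1) (eth 0 (f k)) erefl erefl.
  rewrite f20 ethb0 sphere2_laplace mulNr ethN ethZ => /esym => {1}<-.
  by ring.
have := vec_isometric oW sX im; rewrite -/(vec oW sX im sX) => e2.
have : (ccurv A - cst A (kk / 2)) * dt (veth 0 f) (vcj (veth 0 f)) = 0.
  rewrite /dt mulr_sumr big1// => k _.
  by rewrite mulrA /veth e mul0r.
rewrite e2 mulrC => /cst_eq0; rewrite invr_eq0 pnatr_eq0 => /(_ isT)/eqP.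
by rewrite subr_eq0 => /eqP.
Qed.

End Sphere2.

(** * Orthogonal projections as real matrices *)

Section Projection.
Variables (R : realType) (I : finType) (P : I -> I -> R).
Hypotheses (P_sym : forall i j, P i j = P j i) (P_idem : forall i k, \sum_j P i j * P j k = P i k).

(** Each diagonal entry is the squared length of its row, so the trace is a sum of squares of all
    the entries. *)
Lemma idem_trace0 : \sum_i P i i = 0 -> forall i j, P i j = 0.
Proof.
move=> tr i j.
have row0 k : \sum_j P k j ^+ 2 = P k k.
  by rewrite -P_idem; apply: eq_bigr => l _; rewrite expr2 [P l k]P_sym.
have ge0 k : 0 <= P k k by rewrite -row0 sumr_ge0// => l _; rewrite sqr_ge0.
have : P i i = 0.
  move: tr => /eqP; rewrite psumr_eq0 => [/allP/(_ i)|k _]; last exact: ge0.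
  by rewrite mem_index_enum => /(_ isT) /implyP/(_ isT)/eqP.
rewrite -row0 => /eqP; rewrite psumr_eq0 => [/allP/(_ j)|k _]; last exact: sqr_ge0.
by rewrite mem_index_enum => /(_ isT) /implyP/(_ isT); rewrite sqrf_eq0 => /eqP.
Qed.

End Projection.

(* Gram-Schmidt: an orthogonal projection of trace [r] splits off unit vectors of its range. *)
Lemma projection_basis (R : realType) (I : finType) (r : nat) (P : I -> I -> R) :
  (forall i j, P i j = P j i) -> (forall i k, \sum_j P i j * P j k = P i k) ->
  \sum_i P i i = r%:R ->
  exists E : I -> 'I_r -> R, (forall i j, \sum_a E i a * E j a = P i j) /\
    (forall a b, \sum_i E i a * E i b = (a == b)%:R).
Proof.
elim: r P => [|r IH] P Ps Pi tr.
  exists (fun _ _ => 0); split=> [i j|[]//].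
  by rewrite big_ord0 (idem_trace0 Ps Pi tr).
have row2 i k : \sum_j P i j * P k j = P i k.
  by rewrite -Pi; apply: eq_bigr => j _; rewrite [P j k]Ps.
have [i0 Pi0] : exists i, P i i != 0.
  apply: contrapT => /forallNP h; move: tr; rewrite big1 => [/esym/eqP|i _].
    by rewrite pnatr_eq0.
  by apply/eqP/negPn/negP/h.
have Pgt0 : 0 < P i0 i0.
  rewrite lt_def Pi0 -row2 sumr_ge0// => j _.
  by rewrite -expr2 sqr_ge0.
pose q := Num.sqrt (P i0 i0); have q0 : q != 0 by rewrite gt_eqF// sqrtr_gt0.
have q2 : q * q = P i0 i0 by rewrite -expr2 sqr_sqrtr// ltW.
(* A nonzero row of [P] has squared length P_(i0,i0), so this is a unit vector of the range;
   subtracting its projection lowers the trace by one. *)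
pose u j := P i0 j / q.
have uP k : \sum_j u j * P j k = u k.
  by rewrite /u -[RHS]mulrC -Pi mulr_sumr; apply: eq_bigr => j _; ring.
have uu : \sum_j u j * u j = 1.
  rewrite -[RHS](mulfV Pi0) -{1}row2 mulr_suml; apply: eq_bigr => j _.
  by rewrite /u -q2 invfM; ring.
pose P' i j := P i j - u i * u j.
have P's i j : P' i j = P' j i by rewrite /P' Ps mulrC.
have P'u i : \sum_j P' i j * u j = 0.
  under eq_bigr do rewrite mulrBl -mulrA.
  rewrite sumrB -mulr_sumr uu mulr1 -(uP i) -sumrB big1// => j _.
  by rewrite Ps; ring.
have P'i i k : \sum_j P' i j * P' j k = P' i k.
  have e j : P' i j * P' j k = P i j * P j k - u i * (u j * P j k) - P' i j * u j * u k.
    by rewrite /P'; ring.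
  under eq_bigr do rewrite e.
  by rewrite 2!sumrB -mulr_sumr -mulr_suml P'u uP Pi mul0r subr0.
have tr' : \sum_i P' i i = r%:R by rewrite sumrB uu tr -natr1 addrK.
have [E [E1 E2]] := IH P' P's P'i tr'.
(* The columns of [E] lie in the range of [P'], which is symmetric and kills [u]. *)
have Eu b : \sum_i E i b * u i = 0.
  have e i : E i b = \sum_j P' i j * E j b.
    under eq_bigr do rewrite -E1 mulr_suml.
    rewrite exchange_big (bigD1 b)//= [X in _ + X]big1 ?addr0 => [|a ab].
      under eq_bigr do rewrite -mulrA; rewrite -mulr_sumr E2 eqxx mulr1//.
    by under eq_bigr do rewrite -mulrA; rewrite -mulr_sumr E2 (negbTE ab) mulr0.
  under eq_bigr do rewrite e mulr_suml.
  rewrite exchange_big big1// => j _.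
  under eq_bigr do rewrite mulrAC P's.
  by rewrite -mulr_suml P'u mul0r.
exists (fun i a => if unlift ord0 a is Some b then E i b else u i); split=> [i j|a b].
  rewrite big_ord_recl unlift_none; under eq_bigr do rewrite liftK.
  by rewrite E1 /P'; ring.
case: (unliftP ord0 a) => [a'|] ->; case: (unliftP ord0 b) => [b'|] ->.
- by rewrite E2 (inj_eq lift_inj).
- by rewrite Eu.
- by under eq_bigr do rewrite mulrC; rewrite Eu.
- by rewrite uu eqxx.
Qed.

(** Half of [calabi_curv], to match [ccurv], which is half of the Gaussian curvature. *)
Definition spin_curv (R : realType) (s : nat) (c : R) : R := c / (s%:R * (s%:R + 1)).

Definition spin_step (R : realType) (s : nat) (c : R) (j : nat) : R :=
  c / 2 - spin_curv s c * (j * j.+1)%:R / 2.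

Fixpoint spin_norm (R : realType) (s : nat) (c : R) (j : nat) : R :=
  if j is j'.+1 then spin_step s c j' * spin_norm s c j' else c^-1.

Section Spin.
Variables (R : realType) (s : nat) (c : R).
Hypotheses (s_gt0 : (0 < s)%N) (c_gt0 : 0 < c).

Let s0 : s%:R != 0 :> R. Proof. by rewrite pnatr_eq0 -lt0n. Qed.
Let s1 : s%:R + 1 != 0 :> R. Proof. by rewrite natr1 pnatr_eq0. Qed.

Lemma spin_curv_gt0 : 0 < spin_curv s c.
Proof. by rewrite divr_gt0// mulr_gt0// ?ltr0n// natr1 ltr0n. Qed.

Lemma spin_step_top : spin_step s c s = 0.
Proof. by rewrite /spin_step /spin_curv natrM -natr1; field; rewrite s0 s1. Qed.

Lemma spin_step_gt0 j : (j < s)%N -> 0 < spin_step s c j.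
Proof.
move=> js; rewrite -spin_step_top /spin_step ltrD2l ltrN2 ltr_pM2r ?invr_gt0//.
by rewrite ltr_pM2l ?spin_curv_gt0// ltr_nat; nia.
Qed.

Lemma spin_norm_gt0 j : (j <= s)%N -> 0 < spin_norm s c j.
Proof.
elim: j => [|j IH] js /=; first by rewrite invr_gt0.
by rewrite mulr_gt0 ?spin_step_gt0 ?IH// ltnW.
Qed.

Lemma spin_stepS j : spin_step s c j.+1 = spin_step s c j - j.+1%:R * spin_curv s c.
Proof. by rewrite /spin_step !natrM -[j.+2%:R]natr1 -[j.+1%:R]natr1; field. Qed.

Lemma spin_ladder (A : framed_ring R) (I : finType) (f : I -> A) :
  ccurv A = cst A (spin_curv s c) -> (forall i, cj A (f i) = f i) ->
  dt f f = cst A c^-1 -> (forall i, ethb 1 (eth 0 (f i)) = - cst A (c / 2) * f i) ->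
  closed_ladder s (spin_step s c) (spin_norm s c) (ladder_seq f).
Proof.
move=> curv real norm lap.
apply: (closed_ladderI spin_curv_gt0 curv) => //.
- have rec := ladder_seq_down spin_curv_gt0 curv spin_stepS; apply: rec => i.
  by rewrite lap /spin_step mul0n mulr0 mul0r subr0.
- by move=> j js; rewrite gt_eqF ?spin_norm_gt0.
- exact: spin_step_top.
Qed.

End Spin.

(** * Intertwiners over a convex domain and rigidity of spherical patches *)

Section ConstIntertwiner.
Variables (R : realType) (W : set 'rV[R]_2) (oW : open W) (cW : convex_set W).
Variables (z1 z2 di : csmooth oW).
Hypothesis zz : (z1 * csm_cj z2 - csm_cj z1 * z2) * di = 1.
Local Notation A := (framed_csmooth zz).
Variables (x0 : 'rV[R]_2) (W0 : W x0).
Variables (s : nat) (l a : nat -> R).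

Lemma intertwiner_cst (I J : finType) (f : nat -> I -> A) (g : nat -> J -> A) :
  closed_ladder s l a f -> closed_ladder s l a g ->
  exists M : I -> J -> R, forall i j, intertwiner s a f g i j = cst A (M i j).
Proof.
move=> hf hg; exists (fun i j => complex.Re ((intertwiner s a f g i j : csmooth oW) x0)) => i j.
have [d1 d2] := dZ_intertwiner hf hg i j.
apply: (csmooth_cst cW W0 d1 d2); exact: (cj_intertwiner hf hg i j).
Qed.

Lemma cst_inj : injective (cst A).
Proof.
move=> r t /(congr1 (fun u : csmooth oW => u x0)); rewrite !(csm_realE _ _ W0).
by move=> /(congr1 (@complex.Re R)).
Qed.

Lemma spin_projection (I : finType) (f : nat -> I -> A) : closed_ladder s l a f ->
  exists P : I -> I -> R, [/\ forall i j, intertwiner s a f f i j = cst A (P i j),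
    forall i j, P i j = P j i, forall i k, \sum_j P i j * P j k = P i k &
    \sum_i P i i = (2 * s).+1%:R].
Proof.
move=> hf; have [P hP] := intertwiner_cst hf hf; exists P; split=> //.
- by move=> i j; apply: cst_inj; rewrite -!hP intertwinerC.
- move=> i k; apply: cst_inj; rewrite -hP -(intertwiner_comp hf hf hf) rmorph_sum.
  by apply: eq_bigr => j _; rewrite !hP rmorphM.
- apply: cst_inj; rewrite rmorph_nat -(intertwiner_trace hf) rmorph_sum.
  by apply: eq_bigr => i _; rewrite hP.
Qed.

(** When the ambient dimension is exactly 2s + 1, the projection onto the ladder of [f] has full
    trace, so its complement is a projection of trace 0 and vanishes; the intertwiner then has
    orthonormal rows. *)
Lemma spin_transport (I J : finType) (f : nat -> I -> A) (g : nat -> J -> A) :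
  #|I| = (2 * s).+1 -> closed_ladder s l a f -> closed_ladder s l a g ->
  exists M : I -> J -> R, (forall j, \sum_i f 0%N i * cst A (M i j) = g 0%N j) /\
    forall i k, \sum_j M i j * M k j = (i == k)%:R.
Proof.
move=> cI hf hg; have [M hM] := intertwiner_cst hf hg; exists M; split=> [j|i k].
  by rewrite -(intertwiner0 g hf j); apply: eq_bigr => i _; rewrite hM.
have [P [hP Ps Pi tr]] := spin_projection hf.
have -> : \sum_j M i j * M k j = P i k.
  apply: cst_inj; rewrite -hP -(intertwiner_comp hf hg hf) rmorph_sum.
  by apply: eq_bigr => j _; rewrite rmorphM -!hM; congr (_ * _); exact: intertwinerC.
pose Q i j : R := (i == j)%:R - P i j.
suff : Q i k = 0 by move/eqP; rewrite subr_eq0 => /eqP.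
have dl (F : I -> R) i' : \sum_j (i' == j)%:R * F j = F i'.
  rewrite (bigD1 i')//= eqxx mul1r big1 ?addr0// => j ji.
  by rewrite eq_sym (negbTE ji) mul0r.
have dr (F : I -> R) i' : \sum_j F j * (j == i')%:R = F i'.
  by rewrite -[RHS](dl F i'); apply: eq_bigr => j _; rewrite mulrC eq_sym.
apply: (idem_trace0 (P := Q)) => [i' j'|i' k'|].
- by rewrite /Q Ps eq_sym.
- have e j : Q i' j * Q j k' = (i' == j)%:R * Q j k' - (P i' j * (j == k')%:R - P i' j * P j k').
    by rewrite /Q; ring.
  by under eq_bigr do rewrite e; rewrite !sumrB dl dr Pi subrr subr0.
- have -> : \sum_i Q i i = \sum_(i : I) 1 - \sum_i P i i.
    by rewrite -sumrB; apply: eq_bigr => i' _; rewrite /Q eqxx.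
  by rewrite tr sumr_const cI subrr.
Qed.

End ConstIntertwiner.

Section VecLinear.
Variables (R : realType) (m n p : nat) (W : set 'rV[R]_2) (oW : open W).
Variables (X : 'rV[R]_2 -> 'rV[R]_m) (F : 'rV[R]_2 -> 'rV[R]_n) (G : 'rV[R]_2 -> 'rV[R]_p).
Hypotheses (sX : smooth_on W X) (im : forall x, W x -> immersive_at X x).
Hypotheses (sF : smooth_on W F) (sG : smooth_on W G).
Local Notation A := (frame_ring oW sX im).
Local Notation B := (csmooth oW).

Lemma vec_lincomb (M : 'I_n -> R) j :
  \sum_i vec oW sX im sF i * cst A (M i) = vec oW sX im sG j ->
  forall x, W x -> \sum_i F x 0 i * M i = G x 0 j.
Proof.
move=> e x Wx; have := congr1 (fun u : B => complex.Re (u x)) e; cbv beta.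
rewrite (vecE oW sX im sG j Wx) => E; transitivity (complex.Re ((G x 0 j)%:C%C)) => //.
rewrite -E csmooth_sum//.
transitivity (complex.Re ((\sum_i F x 0 i * M i)%:C%C)); first by [].
rewrite realC_sum; congr complex.Re; apply: eq_bigr => i _.
by rewrite csmoothM// (vecE oW sX im sF i Wx) csm_realE// realCM.
Qed.

End VecLinear.

Section Rigidity.
Variables (R : realType) (W : set 'rV[R]_2) (oW : open W) (cW : convex_set W).
Variables (x0 : 'rV[R]_2) (W0 : W x0) (k : R) (k_gt0 : 0 < k).

(** The position vector of a spherical patch is a ladder of spin 1 in dimension 3 = 2 + 1, with
    constants depending on the curvature only. Equal metrics put both ladders in the same ring, and
    their intertwiner is the rotation. *)
Lemma sphere2_rigid (th th' : 'rV[R]_2 -> 'rV[R]_3) :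
  smooth_on W th -> smooth_on W th' ->
  (forall x, W x -> immersive_at th x) -> (forall x, W x -> immersive_at th' x) ->
  (forall x, W x -> sphere 2 k (th x)) -> (forall x, W x -> sphere 2 k (th' x)) ->
  (forall x, W x -> metric th x = metric th' x) ->
  exists2 M : 'M[R]_3, M *m M^T = 1%:M & forall x, W x -> th' x = th x *m M.
Proof.
move=> sT sT' iT iT' hT hT' e.
set A := frame_ring oW sT iT.
have ladder1 (t : 'rV[R]_2 -> 'rV[R]_3) (st : smooth_on W t) (it : forall x, W x -> immersive_at t x) :
    (forall x, W x -> sphere 2 k (t x)) ->
    closed_ladder (A := frame_ring oW st it) 1 (spin_step 1 k) (spin_norm 1 k)
      (ladder_seq (vec oW st it st)).
  move=> ht; apply: spin_ladder => //.
  - rewrite (sphere2_ccurv oW st it k_gt0 ht) /spin_curv; congr (cst _ _).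
    by rewrite mul1r.
  - by move=> i; exact: cj_vec.
  - exact: vec_norm.
  - by move=> i; apply: sphere2_laplace.
have hf := ladder1 th sT iT hT; have hg := ladder1 th' sT' iT' hT'.
have [e1 e2 e3] := frame_eq oW sT' sT iT' iT (fun x Wx => esym (e x Wx)).
have {hg} hg := (ladder_transfer (frame_indep oW sT' iT') (frame_indep oW sT iT) e1 e2 e3).2 _ _ _ _ _ hg.
set f := ladder_seq _ in hf; set g := ladder_seq _ in hg.
have [M [hM MM]] := spin_transport (s := 1) cW W0 (card_ord 3) hf hg.
exists (\matrix_(i, j) M i j).
  apply/matrixP => i k'; rewrite !mxE -MM; apply: eq_bigr => j _.
  by rewrite !mxE.
move=> x Wx; apply/rowP => j; rewrite mxE -(vec_lincomb (hM j) Wx).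
by apply: eq_bigr => i _; rewrite mxE.
Qed.

End Rigidity.

Lemma gauss_pure (R : realType) (k a b p q r t : R) :
  b - k * q * r = a - k * t * p -> a - b = k * (p * t - q * r).
Proof. by move=> e; lra. Qed.

(** * Gaussian curvature of a patch of the round 2-sphere *)

Section GaussCurvature.
Variables (R : realType) (X : 'rV[R]_2 -> 'rV[R]_3) (W : set 'rV[R]_2).
Hypotheses (oW : open W) (sX : smooth_on W X) (im : forall x, W x -> immersive_at X x).
Variable kk : R.
Hypotheses (kk_gt0 : 0 < kk) (sph : forall x, W x -> dot (X x) (X x) = kk^-1).
Local Notation P i := (partial i X).
Local Notation g i j := (fun y => metric X y i j : R).

Let dP s x : W x -> differentiable (foldr (fun i G => partial i G) X s) x.
Proof. exact: sX. Qed.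

Let near_W x : W x -> \near x, W x. Proof. by move=> Wx; exact: open_nbhs_nbhs. Qed.

Let dg i j l x : W x -> partial l (g i j) x = dot (partial l (P i) x) (P j x) + dot (P i x) (partial l (P j) x).
Proof.
move=> Wx; rewrite -partial_dot; [|exact: (dP [:: i])|exact: (dP [:: j])].
by congr (partial l _ x); apply/funext => y; rewrite mxE.
Qed.

Let PC i j x : W x -> partial i (P j) x = partial j (P i) x.
Proof. exact: partialC_row. Qed.

(** Koszul formula: differentiating the metric and using the symmetry of second derivatives isolates
    one scalar product. *)
Let koszul i j m x : W x -> \sum_k christoffel X k i j x * metric X x k m = dot (partial i (P j) x) (P m x).
Proof.
move=> Wx; pose u l := 2^-1 * (partial i (g j l) x + partial j (g i l) x - partial l (g i j) x).
have pure (a b c : R) : 2^-1 * ((a + b) + (a + c) - (c + b)) = a by field.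
have uE l : u l = dot (partial i (P j) x) (P l x).
  have e1 := dg j l i Wx; have e2 := dg i l j Wx; have e3 := dg i j l Wx.
  rewrite (PC l i Wx) (PC l j Wx) (dotC (partial i (P l) x)) in e3.
  rewrite (PC j i Wx) in e2; rewrite /u e1 e2 e3.
  by rewrite [dot (P j x) _ + _]addrC; exact: pure.
have -> : \sum_k christoffel X k i j x * metric X x k m = \sum_k (\sum_l u l * imetric X x k l) * metric X x k m.
  apply: eq_bigr => k _; congr (_ * _); rewrite /christoffel mulr_sumr.
  by apply: eq_bigr => l _; rewrite /u; ring.
under eq_bigr do rewrite mulr_suml.
rewrite exchange_big /= -uE -(sum_delta u m); apply: eq_bigr => l _.
rewrite -(dot_imetric im m l Wx) mulr_sumr; apply: eq_bigr => k _.
by rewrite mulrA (metricC X x k m).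
Qed.

Let s_g i j : smooth_on W (g i j). Proof. exact: smooth_on_metric. Qed.

Let s_chr k i j : smooth_on W (christoffel X k i j).
Proof.
have si l : smooth_on W (fun x => imetric X x k l : R).
  by apply: smooth_on_invmx => // x /im; exact: metric_unit.
apply: (smooth_onM oW); first exact: smooth_on_cst.
have sp a b c' := smooth_on_partial c' (s_g a b).
apply: (@smooth_on_sum _ _ _ W 'I_2 _ _ oW) => l; apply: (smooth_onM oW (si l)).
exact: (smooth_onB oW (smooth_onD oW (sp j l i) (sp i l j)) (sp i j l)).
Qed.

Let PX i j x : W x -> dot (partial i (P j) x) (X x) = - metric X x i j.
Proof. by move=> Wx; exact: (partial2_sphere oW sX sph i j Wx). Qed.

Let gauss i j x : W x ->
  partial i (P j) x = \sum_k christoffel X k i j x *: P k x - (kk * metric X x i j) *: X x.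
Proof.
move=> Wx; apply/eqP; rewrite -subr_eq0; apply/eqP.
set v := _ - _.
have vP m : dot v (P m x) = 0.
  rewrite /v !(dotDl, dotNl, dotZl) (dotC (X x)) (partial_sphere oW sX sph m Wx) mulr0 subr0.
  rewrite dot_suml -koszul//; apply/eqP; rewrite subr_eq0; apply/eqP; apply: eq_bigr => k _.
  by rewrite dotZl mxE.
have vX : dot v (X x) = 0.
  rewrite /v !(dotDl, dotNl, dotZl) PX// sph// dot_suml big1 ?sub0r; last first.
    by move=> k _; rewrite dotZl (partial_sphere oW sX sph)// mulr0.
  by rewrite opprK; field; rewrite gt_eqF.
have := normal_part_sphere oW sX im kk_gt0 sph v Wx; rewrite /normal_part vX mul0r scale0r subr0.
rewrite big1 ?subr0// => k _; rewrite big1// => l _.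
by rewrite vP mulr0 scale0r.
Qed.

(** The curvature terms appear when [koszul] is differentiated and [gauss] is substituted. Equating
    the two orders of derivation for (i, j) = (0, 1), k = 1 then gives the Gauss equation. *)
Let third i j k x : W x -> dot (partial i (partial j (P k)) x) (P i0 x) =
  \sum_l (partial i (christoffel X l j k) x + \sum_p christoffel X l i p x * christoffel X p j k x)
          * metric X x l i0 - kk * metric X x j k * metric X x i i0.
Proof.
move=> Wx; set G := fun l => christoffel X l j k.
have dc l : differentiable (G l) x by exact: smooth_on_differentiable (s_chr l j k) Wx.
have dgg l : differentiable (g l i0) x by exact: smooth_on_differentiable (s_g l i0) Wx.
set T := dot (partial i _ x) _.
have E1 : \sum_l (partial i (G l) x * metric X x l i0 + G l x * partial i (g l i0) x) =
    T + dot (partial j (P k) x) (partial i (P i0) x).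
  rewrite -(partial_dot i (dP [:: j; k] Wx) (dP [:: i0] Wx)).
  rewrite (@partial_near _ _ _ (fun y => dot _ _) (fun y => \sum_l G l y * g l i0 y)); last first.
    by near=> y; rewrite -koszul//; near: y; exact: near_W.
  rewrite partial_sum; last by move=> l; exact: (differentiableM (dc l) (dgg l)).
  by apply: eq_bigr => l _; rewrite (partialM _ (dc l) (dgg l)).
have E2 : dot (partial j (P k) x) (partial i (P i0) x) =
    \sum_l G l x * dot (P l x) (partial i (P i0) x) + kk * metric X x j k * metric X x i i0.
  rewrite (gauss j k Wx) dotDl dotNl dotZl dot_suml (dotC (X x)) PX// mulrN opprK; congr (_ + _).
  by apply: eq_bigr => l _; rewrite dotZl.
have E3 : \sum_l G l x * dot (partial i (P l) x) (P i0 x) =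
    \sum_l (\sum_p christoffel X l i p x * G p x) * metric X x l i0.
  transitivity (\sum_p \sum_l G p x * (christoffel X l i p x * metric X x l i0)).
    by apply: eq_bigr => p _; rewrite -mulr_sumr koszul.
  rewrite exchange_big; apply: eq_bigr => l _; rewrite mulr_suml; apply: eq_bigr => p _.
  by rewrite mulrCA mulrA.
have E4 : \sum_l (partial i (G l) x * metric X x l i0 + G l x * partial i (g l i0) x) =
    \sum_l partial i (G l) x * metric X x l i0 + \sum_l G l x * dot (partial i (P l) x) (P i0 x)
    + \sum_l G l x * dot (P l x) (partial i (P i0) x).
  rewrite -!big_split; apply: eq_bigr => l _ /=; rewrite (dg l i0 i Wx) mulrDr addrA.
  by [].
have E5 : \sum_l (partial i (G l) x + \sum_p christoffel X l i p x * G p x) * metric X x l i0 =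
    \sum_l partial i (G l) x * metric X x l i0 + \sum_l (\sum_p christoffel X l i p x * G p x) * metric X x l i0.
  by rewrite -big_split; apply: eq_bigr => l _; rewrite mulrDl.
have fin (S4 a b b' c d e T' S5 : R) :
    S4 = T' + d -> d = c + e -> b = b' -> S4 = a + b + c -> S5 = a + b' -> T' = S5 - e.
  by move=> h1 h2 h3 h4 ->; rewrite -h3; apply/eqP; rewrite eq_sym subr_eq;
     have := h1; rewrite h4 h2 addrA addrAC => /addIr/eqP.
exact: fin E1 E2 E3 E4 E5.
Unshelve. all: by end_near. Qed.

(** The curvature defined by Christoffel symbols is computed on a round patch only;
    [gauss_curv_metric] carries it to M through the local isometry. *)
Lemma gauss_curv_sphere2 x : W x -> gauss_curv X x = kk.
Proof.
move=> Wx; have d0 : \det (metric X x) != 0 by rewrite gt_eqF// metric_det_gt0//; exact: im.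
rewrite /gauss_curv; apply: (mulIf d0); rewrite divfK//.
have h01 := third i0 i1 i1 Wx; have h10 := third i1 i0 i1 Wx.
have sym : dot (partial i0 (partial i1 (P i1)) x) (P i0 x) = dot (partial i1 (partial i0 (P i1)) x) (P i0 x).
  by rewrite (partialC_row i0 i1 oW (smooth_on_partial i1 sX) Wx).
rewrite sym h10 in h01.
have -> : \sum_l riemann X l i0 i1 i1 x * metric X x l i0 =
  \sum_l (partial i0 (christoffel X l i1 i1) x + \sum_p christoffel X l i0 p x * christoffel X p i1 i1 x)
          * metric X x l i0 -
  \sum_l (partial i1 (christoffel X l i0 i1) x + \sum_p christoffel X l i1 p x * christoffel X p i0 i1 x)
          * metric X x l i0.
  rewrite -sumrB; apply: eq_bigr => l _; rewrite /riemann sumrB -mulrBl; congr (_ * _).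
  by move: (partial _ _ x) (partial _ _ x) (\sum_p _) (\sum_p _) => a b c d; ring.
by rewrite det2E; exact: gauss_pure h01.
Qed.

End GaussCurvature.

(** * The local theorem *)

(** The field [lm_perp] says that the range of [P] is no larger than the patch requires; it is what
    makes [c], [v] and [P] unique, while [th] is unique only up to an orthogonal matrix. *)
Record local_model (R : realType) (m s : nat) (X : 'rV[R]_2 -> 'rV[R]_m) (W : set 'rV[R]_2)
    (c : R) (v : 'rV[R]_m) (P : 'M[R]_m) (th : 'rV[R]_2 -> 'rV[R]_3) : Prop := LocalModel {
  lm_gt0 : 0 < c;
  lm_mean : forall x, W x -> c = 1 + mean_curv X x ^+ 2;
  lm_umbilical : s = 1%N -> forall x, W x -> umbilical_at X x;
  lm_norm : forall x, W x -> dot (X x - v) (X x - v) = c^-1;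
  lm_mean_vec : forall x, W x -> mean_curv_vec X x = X x - c *: (X x - v);
  lm_sym : P^T = P;
  lm_idem : P *m P = P;
  lm_trace : \tr P = (2 * s).+1%:R;
  lm_proj : forall x, W x -> (X x - v) *m P = X x - v;
  lm_center : v *m P = 0;
  lm_perp : forall u d, (forall x, W x -> dot (X x) u = d) -> u *m P = 0;
  lm_smooth : smooth_on W th;
  lm_sphere : forall x, W x -> sphere 2 (calabi_curv s c) (th x);
  lm_metric : forall x, W x -> metric th x = metric X x;
  lm_gauss : forall x, W x -> gauss_curv X x = calabi_curv s c
}.

Lemma gauss_curv_metric (R : realType) (m n : nat) (W : set 'rV[R]_2)
    (X : 'rV[R]_2 -> 'rV[R]_m) (Y : 'rV[R]_2 -> 'rV[R]_n) : open W ->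
  (forall x, W x -> metric X x = metric Y x) -> forall x, W x -> gauss_curv X x = gauss_curv Y x.
Proof.
move=> oW e; have near_W x : W x -> \near x, W x by move=> Wx; exact: open_nbhs_nbhs.
have ec k i j x : W x -> christoffel X k i j x = christoffel Y k i j x.
  move=> Wx; have ep a b l : partial l (fun y => metric X y a b : R) x = partial l (fun y => metric Y y a b : R) x.
    by apply: partial_near; near=> y; rewrite e//; near: y; exact: near_W.
  rewrite /christoffel; congr (_ * _); apply: eq_bigr => l _.
  by rewrite /imetric (e _ Wx) !ep.
move=> x Wx.
have ep k a b l : partial l (christoffel X k a b) x = partial l (christoffel Y k a b) x.
  by apply: partial_near; near=> y; apply: ec; near: y; exact: near_W.
have er l i j k : riemann X l i j k x = riemann Y l i j k x.
  rewrite /riemann (ep l j k i) (ep l i k j); congr (_ + _); apply: eq_bigr => p _.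
  by rewrite (ec l i p x Wx) (ec p j k x Wx) (ec l j p x Wx) (ec p i k x Wx).
rewrite /gauss_curv (e x Wx).
by rewrite (eq_bigr _ (fun l _ => congr1 (fun u => u * metric Y x l ord0) (er l i0 i1 i1))).
Unshelve. all: by end_near. Qed.

Lemma immersive_metric (R : realType) (n m : nat) (X : 'rV[R]_n -> 'rV[R]_m) x :
  metric X x \in unitmx -> immersive_at X x.
Proof.
rewrite immersive_jmx metric_jmx -row_free_unit /row_free => /eqP r.
rewrite eqn_leq rank_leq_row /= -{1}r; exact: mxrankM_maxl.
Qed.

(** Coordinates in an orthonormal basis of the range of a projection preserve products as soon as
    one factor lies in that range. *)
Lemma dt_basis (R : realType) (A : framed_ring R) (I : finType) (r : nat)
    (P : I -> I -> R) (E : I -> 'I_r -> R) (u w : I -> A) :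
  (forall i j, \sum_a E i a * E j a = P i j) ->
  (forall q, \sum_p u p * cst A (P p q) = u q) ->
  dt (fun a => \sum_p u p * cst A (E p a)) (fun a => \sum_p w p * cst A (E p a)) = dt u w.
Proof.
move=> EP uP; rewrite /dt.
transitivity (\sum_q (\sum_p u p * cst A (P p q)) * w q); last by apply: eq_bigr => q _; rewrite uP.
under eq_bigr do rewrite mulr_suml.
rewrite exchange_big /= ; under [RHS]eq_bigr do rewrite mulr_suml.
rewrite [RHS]exchange_big; apply: eq_bigr => p _ /=.
transitivity (\sum_a \sum_q u p * cst A (E p a) * (w q * cst A (E q a))).
  by apply: eq_bigr => a _; rewrite mulr_sumr.
rewrite exchange_big; apply: eq_bigr => q _ /=.
rewrite -EP rmorph_sum mulr_sumr mulr_suml; apply: eq_bigr => a _.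
by rewrite rmorphM; ring.
Qed.

Section RealPart.
Variables (R : realType) (m n : nat) (W : set 'rV[R]_2) (oW : open W) (X : 'rV[R]_2 -> 'rV[R]_m).
Hypotheses (sX : smooth_on W X) (im : forall x, W x -> immersive_at X x).
Local Notation A := (frame_ring oW sX im).
Local Notation B := (csmooth oW).

Definition row_Re (u : 'I_n -> A) (x : 'rV[R]_2) : 'rV[R]_n := \row_k complex.Re ((u k : B) x).

Lemma smooth_row_Re (u : 'I_n -> A) : smooth_on W (row_Re u).
Proof.
apply/(smooth_on_coord _ oW) => j; apply: smooth_on_ext (csmooth_Re (u j)) => // x _.
by rewrite mxE.
Qed.

Lemma vec_row_Re (u : 'I_n -> A) : (forall k, cj A (u k) = u k) ->
  vec oW sX im (smooth_row_Re u) = u.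
Proof.
move=> ur; apply/funext => k; apply: csmooth_eq => x Wx; rewrite vecE// mxE.
have := cjE (u k) Wx; rewrite ur; case: ((u k : B) x) => a b /= /eqP.
rewrite eq_complex /= eqxx /= => /eqP bb; congr Complex; apply/esym.
have : b + b = 0 by rewrite {1}bb addNr.
by move/eqP; rewrite -mulr2n mulrn_eq0 /= => /eqP.
Qed.

End RealPart.

Lemma rotation_ladder (R : realType) (A : framed_ring R) (I : finType) (s : nat) (c : R)
    (f : nat -> I -> A) : (0 < s)%N -> 0 < c -> ccurv A = cst A (spin_curv s c) ->
  closed_ladder s (spin_step s c) (spin_norm s c) f ->
  exists J : I * I -> A, closed_ladder 1 (spin_step 1 (calabi_curv s c))
    (spin_norm 1 (calabi_curv s c)) (ladder_seq J) /\ True.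
Proof.
move=> s0 c0 curv hf; have k0 := spin_curv_gt0 s0 c0.
have n0 := rotation_norm_gt0 R s0.
have kE : calabi_curv s c = 2 * spin_curv s c by rewrite /calabi_curv /spin_curv mulrA.
(* Normalization: it gives the rotation the length of the radius of a sphere of curvature
   [calabi_curv s c]. *)
pose r := Num.sqrt ((2 * spin_curv s c)^-1 / rotation_norm R s).
have r2 : r * r = (2 * spin_curv s c)^-1 / rotation_norm R s.
  by rewrite -expr2 sqr_sqrtr// divr_ge0 ?invr_ge0 ?mulr_ge0// ltW.
exists (fun p => cst A r * rotation s (spin_norm s c) f p); split=> //.
apply: spin_ladder => //.
- by rewrite kE mulr_gt0.
- have e (r' : R) : spin_curv 1 (2 * r') = r' by rewrite /spin_curv; field.
  by rewrite curv kE e.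
- by move=> p; rewrite rmorphM cj_cst cj_rotation.
- rewrite (dt_lin1 (a := cst A r) (z := rotation s (spin_norm s c) f))//.
  rewrite (dt_lin1r (a := cst A r) (z := rotation s (spin_norm s c) f))// (dt_rotation hf).
  by rewrite -!rmorphM mulrA r2 kE divfK// gt_eqF.
- move=> p; rewrite ethZ (eth_rotation s0 k0 hf) ethbZ.
  rewrite (ethb_rotation1 s0 k0 (@spin_stepS _ s c) hf) kE.
  have -> : 2 * spin_curv s c / 2 = spin_curv s c by field.
  by ring.
Qed.

Section VecConst.
Variables (R : realType) (m n : nat) (W : set 'rV[R]_2) (oW : open W).
Variables (X : 'rV[R]_2 -> 'rV[R]_m) (F G : 'rV[R]_2 -> 'rV[R]_n).
Hypotheses (sX : smooth_on W X) (im : forall x, W x -> immersive_at X x).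
Hypotheses (sF : smooth_on W F) (sG : smooth_on W G).
Local Notation A := (frame_ring oW sX im).
Local Notation B := (csmooth oW).

Lemma vec_dot_cst r : dt (vec oW sX im sF) (vec oW sX im sG) = cst A r ->
  forall x, W x -> dot (F x) (G x) = r.
Proof.
move=> e x Wx; have := congr1 (fun u : B => u x) e; cbv beta.
by rewrite dt_vec// cstE// => /(congr1 (@complex.Re R)).
Qed.

Lemma vec_sub_cst : convex_set W ->
  (forall k, dZ A (vec oW sX im sF k - vec oW sX im sG k) = 0 /\
             dZb A (vec oW sX im sF k - vec oW sX im sG k) = 0) ->
  forall x y, W x -> W y -> F x - G x = F y - G y.
Proof.
move=> cW d x y Wx Wy; apply/rowP => k; have [d1 d2] := d k.
have := csmooth_const cW d1 d2 Wx Wy; rewrite !csmoothB// !vecE// -!realCB.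
by move=> /(congr1 (@complex.Re R)) /= e; rewrite !mxE.
Qed.

Lemma vec_scaleB r (sE : smooth_on W (fun x => r *: (F x - G x))) k :
  vec oW sX im sE k = cst A r * (vec oW sX im sF k - vec oW sX im sG k).
Proof.
apply: csmooth_eq => x Wx; rewrite vecE// !mxE.
by rewrite csmoothM// csmoothB// cstE// !vecE// realCM realCB.
Qed.

End VecConst.

Section LocalTheorem.
Variables (R : realType) (m s : nat) (W : set 'rV[R]_2) (oW : open W) (cW : convex_set W).
Variables (x0 : 'rV[R]_2) (W0 : W x0) (X : 'rV[R]_2 -> 'rV[R]_m) (t : R).
Hypotheses (s_gt0 : (0 < s)%N) (sX : smooth_on W X) (im : forall x, W x -> immersive_at X x).
Hypothesis sph : forall x, W x -> dot (X x) (X x) = 1.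
Hypothesis par : forall x, W x -> parallel_mean_curv X x.
Hypothesis St : forall x, W x -> traceless_S X x = t.
Hypothesis tE : forall x, W x ->
  t = 2 * (s%:R - 1) * (s%:R + 2) / (s%:R * (s%:R + 1)) * (1 + mean_curv X x ^+ 2).
Local Notation A := (frame_ring oW sX im).
Local Notation B := (csmooth oW).

Let sph1 x : W x -> dot (X x) (X x) = 1^-1. Proof. by move=> Wx; rewrite invr1 sph. Qed.
Let sH := smooth_on_mean_curv_vec oW sX im sph1.
Local Notation f := (vec oW sX im sX).
Local Notation h := (vec oW sX im sH).
Local Notation f1 := (veth 0 f).
Local Notation half := (cst A 2^-1).

Let cst1 : cst A 1 = 1. Proof. exact: rmorph1. Qed.

Let half2 : half * 2 = 1 :> A.
Proof. by rewrite -(rmorph_nat (cst A)) -rmorphM mulVf ?pnatr_eq0// rmorph1. Qed.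

Let f_real i : cj A (f i) = f i. Proof. exact: cj_vec. Qed.
Let f_unit : dt f f = 1. Proof. by rewrite (vec_norm oW sX im sph1) invr1 rmorph1. Qed.
Let f_conformal : dt f1 f1 = 0. Proof. exact: vec_conformal. Qed.
Let f_isometric : dt f1 (vcj f1) = half. Proof. exact: vec_isometric. Qed.

Let hE i : ethb 1 (f1 i) = half * h i + - half * f i.
Proof.
rewrite (mean_curv_vec_frame oW sX im sph1) cst1 mul1r mulrDr mulrA half2 mul1r mulNr addrK.
by [].
Qed.

Let h_parallel i : eth 0 (h i) =
  2 * dt (veth 0 h) (vcj f1) * f1 i + 2 * dt (veth 0 h) f1 * (vcj f1) i + dt (veth 0 h) f * f i.
Proof.
have := np_mean_curv_vec oW sX im sph1 par i; rewrite /np cst1 mul1r => /eqP.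
by rewrite subr_eq0 subr_eq => /eqP; rewrite addrC.
Qed.

Let H2 x : W x -> mean_curv X x ^+ 2 = dot (mean_curv_vec X x) (mean_curv_vec X x).
Proof. by move=> _; rewrite /mean_curv sqr_sqrtr// dot_ge0. Qed.

Let h2 := mean_curv X x0 ^+ 2.

Let h_norm : dt h h = cst A h2.
Proof.
have [d1 d2] := dt_mean_parallel f_real f_unit f_conformal f_isometric hE h_parallel.
have dr : cj A (dt h h) = dt h h.
  by rewrite cj_dt; congr dt; apply/funext => i; exact: cj_vec.
rewrite [LHS](csmooth_cst cW W0 d1 d2 dr); congr (csm_cst oW _).
by rewrite dt_vec// -H2.
Qed.

Let c := 1 + h2.
Let c_gt0 : 0 < c. Proof. by rewrite ltr_pwDl// sqr_ge0. Qed.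

Let mean_c x : W x -> c = 1 + mean_curv X x ^+ 2.
Proof.
by move=> Wx; rewrite /c H2// (vec_dot_cst h_norm Wx).
Qed.

Local Notation f2 := (veth 1 f1).

Let f2_norm : dt f2 (vcj f2) = cst A (t / 8).
Proof.
apply: csmooth_eq => x Wx; rewrite cstE//.
have := traceless_S_frame oW sX im sph1 Wx; rewrite St// => e.
have e8 : (8 : R[i]) * (8^-1 : R)%:C%C = 1.
  by rewrite -(rmorph_nat (real_complex R) 8) -realCM mulfV ?pnatr_eq0.
rewrite realCM e mulrC mulrA [(8^-1)%:C%C * 8]mulrC e8 mul1r.
by [].
Qed.

(** The prescribed value of the traceless form enters through the Gauss equation; it is the value
    for which the ladder stops at s. *)
Let curvE : 2^-1 * (1 + h2) - 2 * (t / 8) = spin_curv s c.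
Proof.
rewrite (tE W0) -/h2 -/c /spin_curv.
have s0 : s%:R != 0 :> R by rewrite pnatr_eq0 -lt0n.
have s1 : s%:R + 1 != 0 :> R by rewrite natr1 pnatr_eq0.
by field; rewrite s0 s1.
Qed.

Let curv_gt0 : 0 < 2^-1 * (1 + h2) - 2 * (t / 8).
Proof. by rewrite curvE spin_curv_gt0. Qed.

Let curv : ccurv A = cst A (spin_curv s c).
Proof.
by rewrite (ccurvE f_real f_unit f_conformal f_isometric hE h_parallel h_norm f2_norm) curvE.
Qed.

Let Y x := c^-1 *: (X x - mean_curv_vec X x).

Let sY : smooth_on W Y.
Proof.
apply/(smooth_on_coord _ oW) => k.
apply: (@smooth_on_ext _ _ _ W (fun x => c^-1 * (X x 0 k - mean_curv_vec X x 0 k))) => //.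
  by move=> x _; rewrite !mxE.
apply: (smooth_onZ _ oW); apply: (smooth_onB oW).
  exact: ((smooth_on_coord _ oW).1 sX).
exact: ((smooth_on_coord _ oW).1 sH).
Qed.

Local Notation y := (vec oW sX im sY).

Let yE : y = ladder_base f h h2.
Proof.
by apply/funext => k; exact: vec_scaleB.
Qed.

Let spec := ladder_base_spec f_real f_unit f_conformal f_isometric hE h_parallel h_norm f2_norm curv_gt0 c_gt0.

Let y_up : veth 0 y = f1. Proof. by rewrite yE; case: spec. Qed.
Let y_norm : dt y y = cst A c^-1. Proof. by rewrite yE; case: spec. Qed.
Let y_lap i : ethb 1 (eth 0 (y i)) = - cst A (c / 2) * y i.
Proof.
have [_ _ _ e _] := spec; rewrite yE -(e i) -yE; congr (ethb 1 _).
by rewrite -y_up.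
Qed.

Let hf := spin_ladder s_gt0 c_gt0 curv (fun i => cj_vec oW sX im sY i) y_norm y_lap.

Let mean_curv_vec_orth x : W x -> dot (mean_curv_vec X x) (X x) = 0.
Proof.
move=> Wx; rewrite /mean_curv_vec dotZl dot_suml big1 ?mulr0// => i _.
rewrite dot_suml big1// => j _; rewrite dotZl.
by rewrite (normal_part_orth oW sX im ltr01 sph1 _ Wx).1 mulr0.
Qed.

Let v := X x0 - Y x0.

Let XY x : W x -> X x - v = Y x.
Proof.
move=> Wx; suff e : X x - Y x = v by rewrite -e opprB addrC subrK.
have [_ _ _ _ d] := spec; rewrite -yE in d.
exact: (vec_sub_cst cW d Wx W0).
Qed.

Let Y_norm x : W x -> dot (Y x) (Y x) = c^-1.
Proof.
exact: (vec_dot_cst y_norm).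
Qed.

(** The rotation lives among m x m matrices, but as a ladder of spin 1 it stays in a constant space
    of dimension 3; an orthonormal basis of that space turns it into a map to R^3. *)
Lemma rotation_patch : exists2 th : 'rV[R]_2 -> 'rV[R]_3, smooth_on W th &
  forall x, W x -> sphere 2 (calabi_curv s c) (th x) /\ metric th x = metric X x.
Proof.
have [J [hJ]] := rotation_ladder s_gt0 c_gt0 curv hf.
have [P [hP Ps Pi Ptr]] := spin_projection cW W0 hJ.
have [E [EP _]] := projection_basis Ps Pi Ptr.
pose u (a : 'I_3) : A := \sum_p J p * cst A (E p a).
have u_real a : cj A (u a) = u a.
  rewrite rmorph_sum; apply: eq_bigr => p _; rewrite rmorphM cj_cst; congr (_ * _).
  exact: (cl_real hJ).
have [sth thE] : exists sth : smooth_on W (row_Re u), vec oW sX im sth = u.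
  by exists (smooth_row_Re u); exact: vec_row_Re.
exists (row_Re u) => // x Wx.
have JP q : \sum_p J p * cst A (P p q) = J q.
  by rewrite -[RHS](intertwiner0 (ladder_seq J) hJ); apply: eq_bigr => p _; rewrite hP.
have u1E a : veth 0 u a = \sum_p ladder_seq J 1 p * cst A (E p a).
  rewrite /veth /u eth_sum; apply: eq_bigr => p _.
  by rewrite mulrC ethZ mulrC.
have J1P q : \sum_p ladder_seq J 1 p * cst A (P p q) = ladder_seq J 1 q.
  rewrite -[RHS](intertwinerS (ladder_seq J) hJ (ord0 : 'I_1)); apply: eq_bigr => p _.
  by rewrite hP.
have u1 : veth 0 u = fun a => \sum_p ladder_seq J 1 p * cst A (E p a) by exact/funext.
have ub1 : vcj (veth 0 u) = fun a => \sum_p vcj (ladder_seq J 1) p * cst A (E p a).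
  apply/funext => a; rewrite u1 /vcj rmorph_sum; apply: eq_bigr => p _.
  by rewrite rmorphM cj_cst.
have k0 := spin_curv_gt0 s_gt0 c_gt0.
split.
  have : dt u u = cst A (calabi_curv s c)^-1.
    rewrite (dt_basis J EP JP); have := cl_orth hJ 0 0; rewrite eqxx /= => <-.
    rewrite /dt; apply: eq_bigr => p _; congr (_ * _); apply/esym; exact: (cl_real hJ).
  by rewrite -{1 2}thE => /vec_dot_cst; exact.
have mE := metric_frame_eq (oW := oW) (sX := sX) (iX := im) (sY := sth).
rewrite thE in mE; apply: mE Wx.
  rewrite {1 2}u1 (dt_basis _ EP J1P).
  exact: (cl_iso hJ).
(* With K the curvature, the first norm of the spin-one ladder is (K / 2) K^-1 = 1/2, which is
   exactly the isometry condition. *)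
rewrite ub1 u1 (dt_basis _ EP J1P) (cl_orth hJ) /=; congr (cst A _).
rewrite /spin_step mul0n mulr0 mul0r subr0; field.
by rewrite /calabi_curv -mulrA mulf_neq0// gt_eqF.
Qed.

Lemma local_theorem : exists c v P th, local_model s X W c v P th.
Proof.
have [th sth thP] := rotation_patch.
have [P [hP Ps Pi Ptr]] := spin_projection cW W0 hf.
(* A constant product has zero derivative, so [intertwiner_perp] makes [u] orthogonal to the whole
   ladder. *)
have perp u d : (forall x, W x -> dot (Y x) u = d) -> u *m (\matrix_(i, j) P i j) = 0.
  move=> ud; have e : dt y (fun i => cst A (u 0 i)) = cst A d.
    apply: csmooth_eq => x Wx; rewrite cstE// -(ud x Wx) realC_sum csmooth_sum//.
    apply: eq_bigr => i _; rewrite csmoothM// (vecE oW sX im sY i Wx) realCM.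
    by congr (_ * _); exact: cstE.
  have de : dZ A (dt (ladder_seq y 0) (fun i => cst A (u 0 i))) = 0.
    exact: etrans (congr1 (dZ A) e) (dZ_cst A d).
  apply/rowP => j; have := intertwiner_perp (ladder_seq y) s_gt0 hf de j.
  move=> e2; rewrite [RHS]mxE mxE; apply: (cst_inj W0 (zz := frame_indep oW sX im)).
  rewrite [RHS]rmorph0 -e2 rmorph_sum; apply: eq_bigr => i _.
  by rewrite rmorphM mxE hP.
have ith x : W x -> immersive_at th x.
  by move=> Wx; apply: immersive_metric; rewrite (thP x Wx).2; exact: metric_unit (im Wx).
exists c, v, (\matrix_(i, j) P i j), th; split.
- exact: c_gt0.
- exact: mean_c.
- move=> s1 x Wx; have um := umbilical_frame sph1 Wx; apply: um.
  have t0 : t = 0 by rewrite (tE W0) s1 subrr mulr0 !mul0r.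
  apply: dt_pos; rewrite f2_norm t0 mul0r; exact: rmorph0.
- by move=> x Wx; rewrite XY// Y_norm.
- move=> x Wx; rewrite XY// /Y scalerA mulfV ?gt_eqF// scale1r opprB addrCA subrr addr0.
  by [].
- by apply/matrixP => i j; rewrite !mxE Ps.
- by apply/matrixP => i j; rewrite mxE [RHS]mxE -Pi; apply: eq_bigr => l _; rewrite !mxE.
- by rewrite -Ptr; apply: eq_bigr => i _; rewrite mxE.
- move=> x Wx; rewrite XY//.
  apply/rowP => j.
  have e : \sum_i y i * cst A (P i j) = y j.
    by rewrite -[RHS](intertwiner0 (ladder_seq y) hf); apply: eq_bigr => i _; rewrite hP.
  rewrite mxE -(vec_lincomb e Wx); apply: eq_bigr => i _; congr (_ * _).
  by rewrite mxE.
(* Since H is orthogonal to X, both <Y, X> and <Y, Y> equal 1 / c, so v = X - Y is orthogonal to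
   Y. *)
- apply: (perp v 0) => x Wx.
  have YX : dot (Y x) (X x) = c^-1.
    by rewrite /Y dotZl dotDl dotNl sph// mean_curv_vec_orth// subr0 mulr1.
  have -> : v = X x - Y x by rewrite -(XY Wx) opprB addrC subrK.
  by rewrite dotDr dotNr YX Y_norm// subrr.
- move=> u d ud; apply: perp => x Wx; rewrite -(XY Wx) dotDl ud// dotNl; exact: erefl.
- exact: sth.
- by move=> x /thP[].
- by move=> x /thP[].
- move=> x Wx; rewrite (gauss_curv_metric oW (fun x Wx => esym (thP x Wx).2) Wx).
  apply: (gauss_curv_sphere2 oW sth ith _ (fun x Wx => (thP x Wx).1)) Wx.
  by rewrite /calabi_curv -mulrA mulr_gt0// spin_curv_gt0.
Qed.

End LocalTheorem.

(** * Reparametrizations and affine images *)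

Section NormalMatrix.
Variables (R : realType) (n m : nat) (X : 'rV[R]_n -> 'rV[R]_m).

(** The normal projection as a matrix: its invariance under reparametrization and its dependence on
    the germ alone become rewriting. *)
Definition normal_mx x : 'M[R]_m :=
  1%:M - (jmx X x)^T *m imetric X x *m jmx X x - (dot (X x) (X x))^-1 *: ((X x)^T *m X x).

Lemma normal_partE x v : normal_part X x v = v *m normal_mx x.
Proof.
rewrite /normal_part /normal_mx !mulmxBr mulmx1; congr (_ - _ - _).
  apply/rowP => c; rewrite summxE !mulmxA [RHS]mxE.
  transitivity (\sum_k \sum_l imetric X x k l * dot v (partial k X x) * partial l X x 0 c).
    by apply: eq_bigr => k _; rewrite summxE; apply: eq_bigr => l _; rewrite mxE.
  rewrite exchange_big; apply: eq_bigr => l _; rewrite mxE mulr_suml; apply: eq_bigr => k _.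
  rewrite jmxE; congr (_ * _); rewrite mulrC mxE; congr (_ * _).
  by rewrite /dot; apply: eq_bigr => a _; rewrite [(jmx X x)^T a k]mxE jmxE.
rewrite -scalemxAr mulmxA; apply/rowP => c; rewrite mxE [RHS]mxE mxE big_ord1 mulrA.
congr (_ * _); rewrite mulrC mxE; congr (_ * _).
by rewrite /dot; apply: eq_bigr => a _; rewrite [(X x)^T a _]mxE.
Qed.

Lemma normal_part_partial_gen (W : set 'rV[R]_n) (kk : R) : open W -> smooth_on W X ->
  forall x, immersive_at X x -> (forall y, W y -> dot (X y) (X y) = kk^-1) -> W x ->
  forall i, normal_part X x (partial i X x) = 0.
Proof.
move=> oW sX x iX sph Wx i.
rewrite /normal_part (partial_sphere oW sX sph)// mul0r scale0r subr0.
apply/eqP; rewrite subr_eq0; apply/eqP; rewrite exchange_big /=.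
have e l : \sum_k imetric X x k l * dot (partial i X x) (partial k X x) = (i == l)%:R.
  have := mulmxV (metric_unit iX) => /matrixP/(_ i l); rewrite !mxE => <-.
  by apply: eq_bigr => k _; rewrite metricE mulrC.
under eq_bigr do rewrite -scaler_suml e.
rewrite (bigD1 i)//= eqxx scale1r big1 ?addr0// => l li.
by rewrite eq_sym (negbTE li) scale0r.
Qed.

End NormalMatrix.

Lemma quad_change (R : comPzRingType) (V : lmodType R) n (J M M' : 'M[R]_n) (S : 'I_n -> 'I_n -> V) :
  J^T *m M' *m J = M ->
  \sum_i \sum_j M' i j *: (\sum_k \sum_l (J j k * J i l) *: S l k) =
  \sum_l \sum_k M l k *: S l k.
Proof.
move=> <-; pose F i j k l := (M' i j * (J j k * J i l)) *: S l k.
transitivity (\sum_i \sum_j \sum_k \sum_l F i j k l).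
  apply: eq_bigr => i _; apply: eq_bigr => j _; rewrite scaler_sumr; apply: eq_bigr => k _.
  by rewrite scaler_sumr; apply: eq_bigr => l _; rewrite scalerA.
transitivity (\sum_l \sum_k \sum_j \sum_i F i j k l); last first.
  apply: eq_bigr => l _; apply: eq_bigr => k _; rewrite mxE scaler_suml; apply: eq_bigr => j _.
  rewrite mxE mulr_suml scaler_suml; apply: eq_bigr => i _; rewrite mxE /F.
  by congr (_ *: _); ring.
transitivity (\sum_i \sum_l \sum_j \sum_k F i j k l).
  apply: eq_bigr => i _; rewrite [RHS]exchange_big; apply: eq_bigr => j _; exact: exchange_big.
rewrite exchange_big; apply: eq_bigr => l _ /=.
transitivity (\sum_i \sum_k \sum_j F i j k l); first by apply: eq_bigr => i _; exact: exchange_big.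
by rewrite exchange_big; apply: eq_bigr => k _; exact: exchange_big.
Qed.

Section Reparametrization.
Variables (R : realType) (n m : nat) (X : 'rV[R]_n -> 'rV[R]_m) (tau : 'rV[R]_n -> 'rV[R]_n).
Variables (U W : set 'rV[R]_n).
Hypotheses (oU : open U) (oW : open W) (tUW : forall x, U x -> W (tau x)).
Hypotheses (st : smooth_on U tau) (sX : smooth_on W X).
Local Notation XT := (X \o tau).
Local Notation J := (jmx tau).

Lemma smooth_on_reparam : smooth_on U XT.
Proof. exact: smooth_on_comp sX. Qed.

Lemma partial_reparam i x : U x -> partial i XT x = \sum_k J x i k *: partial k X (tau x).
Proof.
move=> Ux; rewrite differentiable_comp_partial.
- by apply: eq_bigr => k _; rewrite jmxE.
- exact: smooth_on_differentiable st Ux.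
- exact: smooth_on_differentiable sX (tUW Ux).
Qed.

Lemma jmx_reparam x : U x -> jmx XT x = J x *m jmx X (tau x).
Proof.
move=> Ux; apply/matrixP => i j; rewrite jmxE partial_reparam// summxE mxE.
by apply: eq_bigr => k _; rewrite [LHS]mxE [in RHS](jmxE X).
Qed.

Lemma metric_reparam x : U x -> metric XT x = J x *m metric X (tau x) *m (J x)^T.
Proof. by move=> Ux; rewrite !metric_jmx jmx_reparam// trmx_mul !mulmxA. Qed.

Lemma reparam_unit x : U x -> immersive_at XT x -> J x \in unitmx.
Proof.
move=> Ux; rewrite immersive_jmx jmx_reparam// -row_free_unit /row_free => /eqP e.
by rewrite eqn_leq rank_leq_row -{1}e mxrankM_maxl.
Qed.

Section At.
Variable x : 'rV[R]_n.
Hypotheses (Ux : U x) (uJ : J x \in unitmx) (iX : immersive_at X (tau x)).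

Lemma imetric_reparam : (J x)^T *m imetric XT x *m J x = imetric X (tau x).
Proof.
have ug := metric_unit iX; have uJT : (J x)^T \in unitmx by rewrite unitmx_tr.
rewrite /imetric metric_reparam//; set g := metric X (tau x) in ug *.
set Q := J x *m g *m (J x)^T; have uQ : Q \in unitmx by rewrite !unitmx_mul uJ ug.
have e : (J x)^T *m invmx Q *m J x *m g = 1%:M.
  have -> : (J x)^T *m invmx Q *m J x *m g = (J x)^T *m (invmx Q *m Q) *m invmx (J x)^T.
    by rewrite /Q !mulmxA mulmxK.
  by rewrite mulVmx// mulmx1 mulmxV.
by rewrite -[LHS]mulmx1 -(mulmxV ug) mulmxA e mul1mx.
Qed.

Lemma normal_part_reparam v : normal_part XT x v = normal_part X (tau x) v.
Proof.
rewrite !normal_partE /normal_mx jmx_reparam// trmx_mul -imetric_reparam.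
by rewrite !mulmxA.
Qed.

Variable kk : R.
Hypothesis sph : forall y, W y -> dot (X y) (X y) = kk^-1.

Let partial2_reparam i j : partial i (partial j XT) x =
  \sum_k partial i (fun y => J y j k) x *: partial k X (tau x) +
  \sum_k \sum_l (J x j k * J x i l) *: partial l (partial k X) (tau x).
Proof.
apply/rowP => c; have sT := smooth_on_reparam.
rewrite -partial_coord; last exact: smooth_on_differentiable (smooth_on_partial j sT) Ux.
pose Xk k y := partial k X y 0 c.
have sXk k : smooth_on W (Xk k) by exact: (smooth_on_coord _ oW).1 (smooth_on_partial k sX) c.
have dJ k : differentiable (fun y => J y j k) x.
  exact: smooth_on_differentiable (smooth_on_jmx j k oU st) Ux.
have dXk k : differentiable (Xk k) (tau x) by exact: smooth_on_differentiable (sXk k) (tUW Ux).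
have dt_ := smooth_on_differentiable st Ux.
have dXkt k : differentiable (Xk k \o tau) x by exact: differentiable_comp.
rewrite (@partial_near _ _ _ _ (fun y => \sum_k J y j k * (Xk k \o tau) y)); last first.
  near=> y; have Uy : U y by near: y; exact: open_nbhs_nbhs.
  by rewrite partial_reparam// summxE; apply: eq_bigr => k _; rewrite mxE.
rewrite partial_sum; last by move=> k; exact: (differentiableM (dJ k) (dXkt k)).
rewrite mxE !summxE -big_split; apply: eq_bigr => k _.
rewrite (partialM i (dJ k) (dXkt k)) [X in _ = X + _]mxE; congr (_ + _).
rewrite differentiable_comp_partial// mulr_sumr summxE; apply: eq_bigr => l _.
rewrite [RHS]mxE (jmxE tau x i l) -mulrA; congr (_ * (_ * _)).
by rewrite /Xk partial_coord//; exact: smooth_on_differentiable (smooth_on_partial k sX) (tUW Ux).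
Unshelve. all: by end_near. Qed.

(** The second derivatives of [tau] multiply first derivatives of X only, and the normal part kills
    those. *)
Lemma sff_reparam i j :
  sff XT x i j = \sum_k \sum_l (J x j k * J x i l) *: sff X (tau x) l k.
Proof.
rewrite /sff normal_part_reparam partial2_reparam !normal_partE mulmxDl !mulmx_suml.
rewrite big1 ?add0r => [|k _].
  apply: eq_bigr => k _; rewrite mulmx_suml; apply: eq_bigr => l _.
  by rewrite -scalemxAl normal_partE.
by rewrite -scalemxAl -normal_partE (normal_part_partial_gen oW sX iX sph (tUW Ux)) scaler0.
Qed.

Lemma mean_curv_vec_reparam : mean_curv_vec XT x = mean_curv_vec X (tau x).
Proof.
apply: (congr1 (fun u => n%:R^-1 *: u)).
apply: etrans _ (quad_change (fun l k => sff X (tau x) l k) imetric_reparam).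
by apply: eq_bigr => i _; apply: eq_bigr => j _; rewrite sff_reparam.
Qed.

End At.
End Reparametrization.

Section Affine.
Variables (R : realType) (n m p : nat) (X : 'rV[R]_n -> 'rV[R]_m) (B : 'M[R]_(m, p)) (b : 'rV[R]_p).
Variables (W : set 'rV[R]_n).
Hypotheses (oW : open W) (sX : smooth_on W X).
Local Notation Z := (fun x => X x *m B + b).

Lemma smooth_on_affine : smooth_on W Z.
Proof.
apply/(smooth_on_coord _ oW) => k.
apply: (@smooth_on_ext _ _ _ W (fun x => \sum_j B j k * X x 0 j + b 0 k)) => //.
  by move=> x _; rewrite mxE mxE; congr (_ + _); apply: eq_bigr => j _; rewrite mulrC.
apply: (smooth_onD oW); last exact: smooth_on_cst.
apply: (smooth_on_sum _ oW) => j; apply: (smooth_onZ _ oW).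
exact: (smooth_on_coord _ oW).1 sX j.
Qed.

Lemma partial_affine i x : W x -> partial i Z x = partial i X x *m B.
Proof.
move=> Wx; have dX j : differentiable (fun y => X y 0 j) x.
  exact: smooth_on_differentiable ((smooth_on_coord _ oW).1 sX j) Wx.
apply/rowP => k; rewrite -partial_coord; last exact: smooth_on_differentiable smooth_on_affine Wx.
have dXB j : differentiable (fun y => X y 0 j * B j k) x.
  by apply: differentiableM; [exact: dX|exact: differentiable_cst].
rewrite (@partial_near _ _ _ _ (fun y => \sum_j X y 0 j * B j k + b 0 k)); last first.
  by near=> y; rewrite mxE mxE.
rewrite partialD; [|exact: differentiable_bigsum|exact: differentiable_cst].
rewrite partial_cst addr0 partial_sum// mxE; apply: eq_bigr => j _.
rewrite partialM; [|exact: dX|exact: differentiable_cst].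
rewrite partial_cst mulr0 addr0 partial_coord//.
exact: smooth_on_differentiable sX Wx.
Unshelve. all: by end_near. Qed.

End Affine.

Section AffineImage.
Variables (R : realType) (n m p : nat) (X : 'rV[R]_n -> 'rV[R]_m) (B : 'M[R]_(m, p)) (b : 'rV[R]_p).
Variables (W : set 'rV[R]_n).
Hypotheses (oW : open W) (sX : smooth_on W X) (im : forall x, W x -> immersive_at X x).
Local Notation Z := (fun x => X x *m B + b).
Hypothesis BX : forall i x, W x -> partial i X x *m (B *m B^T) = partial i X x.

Lemma dot_affine w i x : W x -> dot (w *m B) (partial i Z x) = dot w (partial i X x).
Proof. by move=> Wx; rewrite (partial_affine B b oW sX)// dot_mulmx -mulmxA BX. Qed.

Lemma metric_affine x : W x -> metric Z x = metric X x.
Proof.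
move=> Wx; apply/matrixP => i j; rewrite !metricE -(dot_affine _ j Wx).
by rewrite [partial i Z x](partial_affine B b oW sX).
Qed.

Lemma normal_part_affine w x : W x -> normal_part Z x (w *m B) =
  (normal_part X x w + (dot w (X x) / dot (X x) (X x)) *: X x) *m B
  - (dot (w *m B) (Z x) / dot (Z x) (Z x)) *: Z x.
Proof.
move=> Wx; rewrite /normal_part subrK mulmxBl; congr (_ - _ - _).
rewrite mulmx_suml; apply: eq_bigr => k _; rewrite mulmx_suml; apply: eq_bigr => l _.
by rewrite /imetric metric_affine// dot_affine// (partial_affine B b oW sX)// scalemxAl.
Qed.

Lemma sff_affine i j x : W x -> sff Z x i j =
  (sff X x i j + (dot (partial i (partial j X) x) (X x) / dot (X x) (X x)) *: X x) *m B
  - (dot (partial i (partial j Z) x) (Z x) / dot (Z x) (Z x)) *: Z x.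
Proof.
move=> Wx; have e : partial i (partial j Z) x = partial i (partial j X) x *m B.
  rewrite -[RHS](partial_affine B 0 oW (smooth_on_partial j sX))//; apply: partial_near.
  by near=> y; rewrite addr0 (partial_affine B b oW sX)//; near: y; exact: open_nbhs_nbhs.
by rewrite /sff e normal_part_affine.
Unshelve. all: by end_near. Qed.

Lemma trace_imetric x : W x -> \sum_i \sum_j imetric X x i j * metric X x i j = n%:R.
Proof.
move=> Wx; have e i : \sum_j imetric X x i j * metric X x i j = 1.
  have <- : (imetric X x *m metric X x) i i = 1.
    by rewrite mulVmx ?mxE ?eqxx//; exact: metric_unit (im Wx).
  by rewrite mxE; apply: eq_bigr => j _; rewrite [in RHS]metricC.
by under eq_bigr do rewrite e; rewrite sumr_const card_ord.
Qed.

Variables (k k' : R).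
Hypotheses (k_gt0 : 0 < k) (k'_gt0 : 0 < k').
Hypotheses (sphX : forall x, W x -> dot (X x) (X x) = k^-1).
Hypotheses (sphZ : forall x, W x -> dot (Z x) (Z x) = k'^-1).

(** Both spheres contribute radial corrections, and by [partial2_sphere] both are multiples of the
    metric. The map need only be isometric on tangent vectors. *)
Lemma sff_affine_sphere i j x : W x -> sff Z x i j =
  sff X x i j *m B + metric X x i j *: (k' *: Z x - k *: (X x *m B)).
Proof.
move=> Wx; rewrite sff_affine// sphX// sphZ// (partial2_sphere oW sX sphX)//.
have sZ := smooth_on_affine B b oW sX.
rewrite (partial2_sphere oW sZ sphZ)// metric_affine// !invrK mulmxDl -scalemxAl.
by rewrite !mulNr !scaleNr opprK scalerBr !scalerA -addrA [- _ + _]addrC.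
Qed.

Lemma mean_curv_vec_affine x : (0 < n)%N -> W x -> mean_curv_vec Z x =
  mean_curv_vec X x *m B + (k' *: Z x - k *: (X x *m B)).
Proof.
move=> n0 Wx; rewrite /mean_curv_vec; set u := k' *: Z x - _.
have n1 : n%:R != 0 :> R by rewrite pnatr_eq0 -lt0n.
have -> : u = n%:R^-1 *: (n%:R *: u) by rewrite scalerA mulVf// scale1r.
rewrite -scalemxAl -scalerDr; congr (_ *: _).
rewrite -{1}(trace_imetric Wx) mulmx_suml scaler_suml -big_split; apply: eq_bigr => i _ /=.
rewrite mulmx_suml scaler_suml -big_split; apply: eq_bigr => j _ /=.
by rewrite sff_affine_sphere// scalerDr scalerA -scalemxAl /imetric metric_affine.
Qed.

End AffineImage.

(** The patch fills its sphere and has no normal part there, so the second fundamental form of the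
    image reduces to the radial correction, a multiple of the metric. *)
Lemma umbilical_affine (R : realType) (n p : nat) (X : 'rV[R]_n -> 'rV[R]_n.+1)
    (B : 'M[R]_(n.+1, p)) (b : 'rV[R]_p) (W : set 'rV[R]_n) (k k' : R) :
  (0 < n)%N -> open W -> smooth_on W X -> (forall x, W x -> immersive_at X x) ->
  B *m B^T = 1%:M -> 0 < k -> 0 < k' ->
  (forall x, W x -> dot (X x) (X x) = k^-1) ->
  (forall x, W x -> dot (X x *m B + b) (X x *m B + b) = k'^-1) ->
  forall x, W x -> umbilical_at (fun x => X x *m B + b) x.
Proof.
move=> n0 oW sX im BB k0 k'0 sphX sphZ x Wx i j.
have BX i' y : W y -> partial i' X y *m (B *m B^T) = partial i' X y by rewrite BB mulmx1.
have np v : normal_part X x v = 0 by exact: (normal_part_sphere oW sX im k0 sphX).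
rewrite /traceless_sff (mean_curv_vec_affine oW sX im BX sphX sphZ)//.
rewrite (sff_affine_sphere oW sX BX sphX sphZ)// (metric_affine b oW sX BX)//.
have -> : mean_curv_vec X x = 0.
  rewrite /mean_curv_vec big1 ?scaler0// => i' _; rewrite big1// => j' _.
  by rewrite /sff np scaler0.
by rewrite /sff np mul0mx !add0r subrr.
Qed.

(** * From the local to the global model *)

Section Carried.
Variables (R : realType) (m r : nat) (E : set 'rV[R]_m).
Implicit Types (c : R) (v : 'rV[R]_m) (P : 'M[R]_m).

(** What a local model says about a set of points of the image, without domain or parametrization,
    so that models in different charts can be compared. *)
Definition carried c v P : Prop :=
  [/\ P^T = P, P *m P = P, \tr P = r%:R, v *m P = 0 &
      forall y, E y -> dot (y - v) (y - v) = c^-1 /\ (y - v) *m P = y - v].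

(** On E the vector y (1 - P) is the constant v, so the rows of 1 - P have constant product with E
    and fullness of P' gives P P' = P'. Then P - P' is a projection of trace 0. *)
Lemma carried_unique c v P c' v' P' : E !=set0 -> carried c v P -> carried c' v' P' ->
  (forall u d, (forall y, E y -> dot y u = d) -> u *m P' = 0) ->
  [/\ c = c', v = v' & P = P'].
Proof.
move=> [y0 Ey0] [Ps Pi Pt vP EP] [Ps' Pi' Pt' vP' EP'] full.
have yP y : E y -> y *m (1%:M - P) = v.
  move=> /EP[_ e]; rewrite mulmxBr mulmx1 -{2}[y](subrK v) mulmxDl e vP addr0.
  by rewrite opprB addrC subrK.
have yP' y : E y -> y *m (1%:M - P') = v'.
  move=> /EP'[_ e]; rewrite mulmxBr mulmx1 -{2}[y](subrK v') mulmxDl e vP' addr0.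
  by rewrite opprB addrC subrK.
have s1 : (1%:M - P)^T = 1%:M - P by rewrite linearB /= trmx1 Ps.
have PP' : P *m P' = P'.
  apply/row_matrixP => i.
  have e : row i (1%:M - P) *m P' = row i P' - row i (P *m P').
    by rewrite -row_mul mulmxBl mul1mx linearB.
  apply/eqP; rewrite eq_sym -subr_eq0 -e; apply/eqP.
  apply: (full _ (dot v (delta_mx 0 i))) => y Ey.
  by rewrite -(yP y Ey) dot_mulmx s1 -rowE.
have P'P : P' *m P = P' by rewrite -[RHS]Ps' -{2}PP' trmx_mul Ps Ps'.
have PE : P = P'.
  apply/matrixP => i j; apply/eqP; rewrite -subr_eq0; apply/eqP.
  pose Q i j : R := P i j - P' i j.
  apply: (idem_trace0 (P := Q)) => [a b|a b|].
  - by rewrite /Q -[in LHS]Ps -[in LHS]Ps' !mxE.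
  - transitivity (((P - P') *m (P - P')) a b).
      by rewrite mxE; apply: eq_bigr => k _; rewrite !mxE.
    by rewrite mulmxBl !mulmxBr Pi Pi' PP' P'P subrr subr0 !mxE.
  - transitivity (\tr (P - P')); first by apply: eq_bigr => a _; rewrite !mxE.
    by rewrite linearB /= Pt Pt' subrr.
have ve : v = v' by rewrite -(yP y0 Ey0) -(yP' y0 Ey0) PE.
split=> //; apply: invr_inj; rewrite -(EP _ Ey0).1 -(EP' _ Ey0).1 ve.
by [].
Qed.

End Carried.

Lemma local_model_carried (R : realType) (m s : nat) (X : 'rV[R]_2 -> 'rV[R]_m) W c v P th
    (E : set 'rV[R]_m) : local_model s X W c v P th -> E `<=` X @` W ->
  carried (2 * s).+1 E c v P.
Proof.
move=> h EW; split; [exact: lm_sym h|exact: lm_idem h|exact: lm_trace h|exact: lm_center h|].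
by move=> y /EW[x Wx <-]; split; [exact: lm_norm h _ Wx|exact: lm_proj h _ Wx].
Qed.

Section SurfaceTopology.
Variables (R : realType) (M : closed_surface R).

Lemma surface_ind (Q : M -> Prop) : (exists p, Q p) ->
  (forall p, Q p -> \forall q \near p, Q q) -> (forall p, ~ Q p -> \forall q \near p, ~ Q q) ->
  forall p, Q p.
Proof.
move=> [p0 Qp0] oQ cQ p; have := @surface_connected R M [set q | Q q].
move=> h; suff : [set q | Q q] = [set: M] by move=> /seteqP[_ /(_ p I)].
apply: h; first by exists p0.
- exists [set q | Q q]; last by rewrite setTI.
  by rewrite openE => q Qq; exact: oQ.
- exists [set q | Q q]; last by rewrite setTI.
  rewrite -[X in closed X]setCK; apply: open_closedC; rewrite openE => q nQq.
  exact: cQ.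
Qed.

Lemma near_chart (a : chart R M) p (W : set 'rV[R]_2) : open W -> chart_dom a p -> W (coord a p) ->
  \forall q \near p, chart_dom a q /\ W (coord a q).
Proof.
move=> oW ap Wp; have := @coord_continuous _ _ a.
rewrite continuous_open_subspace; last exact: chart_dom_open.
move=> /(_ p (mem_set ap)) ca.
have h : \forall q \near p, W (coord a q) by apply: ca; exact: open_nbhs_nbhs.
have h2 : \forall q \near p, chart_dom a q.
  by apply: open_nbhs_nbhs; split => //; exact: chart_dom_open.
by near=> q; split; near: q.
Unshelve. all: by end_near. Qed.

Lemma near_param (a : chart R M) x (V : set M) : chart_img a x -> nbhs (param a x) V ->
  \forall y \near x, chart_img a y /\ V (param a y).
Proof.
move=> ax Vx; have := @param_continuous _ _ a.
rewrite continuous_open_subspace; last exact: chart_img_open.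
move=> /(_ x (mem_set ax)) ca.
have h : \forall y \near x, V (param a y) by exact: ca.
have h2 : \forall y \near x, chart_img a y.
  by apply: open_nbhs_nbhs; split => //; exact: chart_img_open.
by near=> y; split; near: y.
Unshelve. all: by end_near. Qed.

Lemma open_overlap (a b : chart R M) : open (overlap a b).
Proof.
rewrite openE => x [ax bx]; apply: near_param => //.
by apply: open_nbhs_nbhs; split => //; exact: chart_dom_open.
Qed.

Lemma overlapP (a b : chart R M) p : chart_dom a p -> chart_dom b p -> overlap a b (coord a p).
Proof. by move=> ap bp; split; [exact: coord_img|rewrite /preimage /= coordK]. Qed.

End SurfaceTopology.

Section GlobalModel.
Variables (R : realType) (N : nat) (M : closed_surface R) (f : M -> 'rV[R]_N.+1).
Hypothesis f_immersion : sphere_immersion f.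
Hypothesis f_parallel : everywhere f (fun X x => parallel_mean_curv X x).
Variables (s : nat) (s_ge1 : (1 <= s)%N) (t : R).
Hypothesis S_constant : everywhere f (fun X x => traceless_S X x = t).
Hypothesis S_value : everywhere f (fun X x =>
  t = 2 * (s%:R - 1) * (s%:R + 2) / (s%:R * (s%:R + 1)) * (1 + mean_curv X x ^+ 2)).

Lemma local_model_ball (a : chart R M) x r : atlas a -> 0 < r -> ball x r `<=` chart_img a ->
  exists c v P th, local_model s (f \o param a) (ball x r) c v P th.
Proof.
move=> aa r0 sub; have [sph sf im] := f_immersion.
have oB : open (ball x r) by exact: ball_open.
have Bx : ball x r x by exact: ballxx.
apply: (local_theorem (t := t) oB (@ball_convex _ _ _ _) Bx s_ge1).
- exact: smooth_on_sub sub (sf a aa).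
- by move=> y /sub; exact: im.
- by move=> y _; have := sph (param a y); rewrite /sphere /= invr1.
- by move=> y /sub; exact: f_parallel.
- by move=> y /sub; exact: S_constant.
- by move=> y /sub; exact: S_value.
Qed.

Definition model_at c v P (a : chart R M) x := exists r th,
  [/\ 0 < r, ball x r `<=` chart_img a & local_model s (f \o param a) (ball x r) c v P th].

Lemma ball_sub_open (U : set 'rV[R]_2) x : open U -> U x -> exists2 r, 0 < r & ball x r `<=` U.
Proof.
move=> oU Ux; have : nbhs x U by exact: open_nbhs_nbhs.
by rewrite -nbhs_ballE => -[r /= r0 h]; exists r.
Qed.

Lemma model_at_ex a x : atlas a -> chart_img a x -> exists c v P, model_at c v P a x.
Proof.
move=> aa ax; have [r r0 sub] := ball_sub_open (@chart_img_open _ _ a) ax.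
have [c [v [P [th h]]]] := local_model_ball aa r0 sub.
by exists c, v, P, r, th.
Qed.

(** Fullness of a model concerns its whole patch and is lost by restriction. Hence neither model is
    compared with the other directly: both are compared with a fresh model on a small common
    ball. *)
Lemma local_model_unique (a b : chart R M) p (W W' : set 'rV[R]_2) c v P th c' v' P' th' :
  atlas a -> chart_dom a p -> chart_dom b p -> open W -> open W' -> W (coord a p) -> W' (coord b p) ->
  local_model s (f \o param a) W c v P th -> local_model s (f \o param b) W' c' v' P' th' ->
  [/\ c = c', v = v' & P = P'].
Proof.
move=> aa ap bp oW oW' Wp Wp' h h'; set x := coord a p.
have ax : chart_img a x by exact: coord_img.
have nV : nbhs (param a x) [set q | chart_dom b q /\ W' (coord b q)].
  by rewrite /x coordK//; exact: near_chart.
have nO : \forall z \near x, [/\ chart_img a z, W z, chart_dom b (param a z) & W' (coord b (param a z))].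
  have nW : \forall z \near x, W z by exact: open_nbhs_nbhs.
  have nP := near_param ax nV.
  near=> z; have Wz : W z by near: z.
  by have [az [bz Wz']] : chart_img a z /\ [set q | chart_dom b q /\ W' (coord b q)] (param a z) by near: z.
have /nbhs_ballP[r /= r0 sub] := nO.
have subO : ball x r `<=` chart_img a by move=> z /sub[].
have [c1 [v1 [P1 [th1 h1]]]] := local_model_ball aa r0 subO.
pose E := (f \o param a) @` ball x r.
have E0 : E !=set0 by exists (f (param a x)); exists x => //; exact: ballxx.
have k1 : carried (2 * s).+1 E c1 v1 P1 by exact: local_model_carried h1 _.
have k : carried (2 * s).+1 E c v P.
  by apply: local_model_carried h _ => _ [z /sub[_ Wz _ _] <-]; exists z.
have k' : carried (2 * s).+1 E c' v' P'.
  apply: local_model_carried h' _ => _ [z /sub[_ _ bz Wz] <-]; exists (coord b (param a z)) => //.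
  by rewrite /= coordK.
have full u d : (forall y, E y -> dot y u = d) -> u *m P1 = 0.
  by move=> hu; apply: (lm_perp h1) => z Bz; apply: hu; exists z.
have [-> -> ->] := carried_unique E0 k k1 full.
have [<- <- <-] := carried_unique E0 k' k1 full.
by [].
Unshelve. all: by end_near. Qed.

Lemma global_model : exists c v P, forall a x, atlas a -> chart_img a x -> model_at c v P a x.
Proof.
have [p0 _] := @surface_nonempty R M.
have [a0 aa0 ap0] := @atlas_cover R M p0.
have [c [v [P h0]]] := model_at_ex aa0 (coord_img ap0).
exists c, v, P.
pose Q p := exists a, [/\ atlas a, chart_dom a p & model_at c v P a (coord a p)].
have nearQ p a c' v' P' : atlas a -> chart_dom a p -> model_at c' v' P' a (coord a p) ->
    \forall q \near p, chart_dom a q /\ exists r x th, [/\ 0 < r, ball x r (coord a q),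
      ball x r `<=` chart_img a & local_model s (f \o param a) (ball x r) c' v' P' th].
  move=> aa ap [r [th [r_gt0 sub lm]]].
  have : \forall q \near p, chart_dom a q /\ ball (coord a p) r (coord a q).
    by apply: near_chart => //; [exact: ball_open|exact: ballxx].
  by apply: filterS => q [aq Bq]; split=> //; exists r, (coord a p), th.
have key p a c' v' P' : atlas a -> chart_dom a p -> model_at c' v' P' a (coord a p) ->
  forall b r x th c'' v'' P'', 0 < r -> chart_dom b p -> ball x r (coord b p) ->
    local_model s (f \o param b) (ball x r) c'' v'' P'' th -> [/\ c' = c'', v' = v'' & P' = P''].
  move=> aa ap [r [th [r_gt0 sub lm]]] b r' x th' c'' v'' P'' r'0 bp Bp lm'.
  apply: (local_model_unique aa ap bp _ _ _ Bp lm lm'); [exact: ball_open|exact: ball_open|].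
  exact: ballxx.
have model_ap p a : atlas a -> chart_dom a p -> exists c' v' P', model_at c' v' P' a (coord a p).
  by move=> aa ap; exact: model_at_ex aa (coord_img ap).
have QE p a c' v' P' : atlas a -> chart_dom a p -> model_at c' v' P' a (coord a p) ->
    Q p <-> [/\ c' = c, v' = v & P' = P].
  move=> aa ap m; split=> [[b [bb bp [r [th [r_gt0 sub lm]]]]]|[ec ev eP]].
    by apply: (key _ _ _ _ _ aa ap m b r (coord b p) th c v P r_gt0 bp _ lm); exact: ballxx.
  by exists a; rewrite -ec -ev -eP.
have allQ : forall p, Q p.
  (* The constants found at [p] are also those found nearby, so [Q] and its negation are both open
     conditions. *)
  have cl p a c' v' P' : atlas a -> chart_dom a p -> model_at c' v' P' a (coord a p) ->
      \forall q \near p, Q q <-> [/\ c' = c, v' = v & P' = P].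
    move=> aa ap m; apply: filterS (nearQ p a c' v' P' aa ap m) => q [aq [r [x [th [r0 Bq sub lm]]]]].
    have [c1 [v1 [P1 m1]]] := model_ap q a aa aq.
    have [e1 e2 e3] := key _ _ _ _ _ aa aq m1 a r x th c' v' P' r0 aq Bq lm.
    by have := QE q a c1 v1 P1 aa aq m1; rewrite e1 e2 e3.
  apply: surface_ind; first by exists p0, a0; split.
  - move=> p; have [a aa ap] := @atlas_cover R M p.
    have [c' [v' [P' m]]] := model_ap p a aa ap => Qp.
    by apply: filterS (cl p a c' v' P' aa ap m) => q ->; apply/(QE p a c' v' P' aa ap m).
  - move=> p; have [a aa ap] := @atlas_cover R M p.
    have [c' [v' [P' m]]] := model_ap p a aa ap => nQp.
    by apply: filterS (cl p a c' v' P' aa ap m) => q ->; rewrite -(QE p a c' v' P' aa ap m).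
move=> a x aa ax; have [c' [v' [P' m]]] := model_at_ex aa ax.
have ap : chart_dom a (param a x) by exact: param_dom.
have m' : model_at c' v' P' a (coord a (param a x)) by rewrite paramK.
have [ec ev eP] := (QE _ _ _ _ _ aa ap m').1 (allQ (param a x)).
by rewrite -ec -ev -eP.
Qed.

End GlobalModel.

(** * Development of the sphere on the surface *)

Section Piece.
Variables (R : realType) (m : nat) (M : closed_surface R) (f : M -> 'rV[R]_m).
Hypothesis f_smooth : smooth_into f.
Hypothesis f_immersive : everywhere f (fun X x => immersive_at X x).
Variables (k : R) (k_gt0 : 0 < k).
Local Notation S2 := (sphere 2 k : set 'rV[R]_3).

(* A local isometry [th] of [M] into the sphere, read in the chart [a], with local inverse [psi]. *)
Record piece (a : chart R M) (W : set 'rV[R]_2) (V : set 'rV[R]_3)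
    (th : 'rV[R]_2 -> 'rV[R]_3) (psi : 'rV[R]_3 -> 'rV[R]_2) : Prop := Piece {
  pc_atlas : atlas a;
  pc_openW : open W;
  pc_img : W `<=` chart_img a;
  pc_openV : open V;
  pc_smooth : smooth_on W th;
  pc_inv_smooth : smooth_on V psi;
  pc_th : forall x, W x -> [/\ S2 (th x), V (th x) & psi (th x) = x];
  pc_psi : forall y, S2 y -> V y -> W (psi y) /\ th (psi y) = y;
  pc_metric : forall x, W x -> metric th x = metric (f \o param a) x
}.

Lemma metric_immersive n (X : 'rV[R]_2 -> 'rV[R]_n) n' (Y : 'rV[R]_2 -> 'rV[R]_n') x :
  metric X x = metric Y x -> immersive_at Y x -> immersive_at X x.
Proof. by move=> e im; apply: immersive_metric; rewrite e; exact: metric_unit. Qed.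

Definition plane (z : 'rV[R]_(1 + 2)) : 'rV[R]_2 := rsubmx z.

Lemma smooth_on_plane (W : set 'rV[R]_(1 + 2)) : open W -> smooth_on W plane.
Proof.
move=> oW; apply/(smooth_on_coord _ oW) => j.
apply: smooth_on_ext (smooth_on_id (rshift 1 j) oW) => // z _.
by rewrite mxE.
Qed.

Lemma continuous_smooth n n' (W : set 'rV[R]_n) (F : 'rV[R]_n -> 'rV[R]_n') x :
  smooth_on W F -> W x -> {for x, continuous F}.
Proof. by move=> sF Wx; apply: differentiable_continuous; exact: smooth_on_differentiable sF Wx. Qed.

Lemma near_smooth n n' (W : set 'rV[R]_n) (F : 'rV[R]_n -> 'rV[R]_n') x (V : set 'rV[R]_n') :
  smooth_on W F -> W x -> open V -> V (F x) -> \forall y \near x, V (F y).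
Proof.
by move=> sF Wx oV Vx; apply: (continuous_smooth sF Wx); exact: open_nbhs_nbhs.
Qed.

Lemma open_smooth_preimage n n' (W : set 'rV[R]_n) (F : 'rV[R]_n -> 'rV[R]_n') (V : set 'rV[R]_n') :
  open W -> smooth_on W F -> open V -> open [set x | W x /\ V (F x)].
Proof.
move=> oW sF oV; rewrite openE => x [Wx Vx].
have nW : \forall y \near x, W y by exact: open_nbhs_nbhs.
have nV := near_smooth sF Wx oV Vx.
by near=> y; split; near: y.
Unshelve. all: by end_near. Qed.

(* The cone over a spherical patch is a map between spaces of the same dimension, to which the inverse
   function theorem applies. *)
Lemma cone_jmx (th : 'rV[R]_2 -> 'rV[R]_3) (W : set 'rV[R]_2) x : open W -> smooth_on W th -> W x ->
  jmx (fun z : 'rV[R]_(1 + 2) => z 0 0 *: th (plane z)) (row_mx 1%:M x) =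
  col_mx (th x) (jmx th x).
Proof.
move=> oW sth Wx; set z := row_mx 1%:M x.
have zx : plane z = x by rewrite /plane row_mxKr.
have z0 : z 0 0 = 1.
  have -> : (0 : 'I_(1 + 2)) = lshift 2 0 by exact: val_inj.
  by rewrite row_mxEl mxE eqxx.
have dr : differentiable plane z.
  by apply: smooth_on_differentiable (smooth_on_plane openT) _.
have dth : differentiable th (plane z) by rewrite zx; exact: smooth_on_differentiable sth Wx.
have dc : differentiable (th \o plane) z by exact: differentiable_comp.
have d0 : differentiable (fun z : 'rV[R]_(1 + 2) => z 0 0) z by exact: differentiable_coord.
apply/matrixP => i j; rewrite jmxE -partial_coord; last first.
  apply: differentiable_row => c.
  apply: (@differentiable_near _ _ _ (fun z : 'rV[R]_(1 + 2) => z 0 0 * (th (plane z)) 0 c)).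
    by near=> w; rewrite mxE.
  apply: differentiableM => //.
  by apply: (differentiable_comp (g := fun M : 'rV[R]_3 => M 0 c)) dc (differentiable_coord _ _ _).
rewrite (@partial_near _ _ _ _ (fun z : 'rV[R]_(1 + 2) => z 0 0 * (th \o plane) z 0 j)); last first.
  by near=> w; rewrite mxE.
rewrite partialM//; last first.
  by apply: (differentiable_comp (g := fun M : 'rV[R]_3 => M 0 j)) dc (differentiable_coord _ _ _).
rewrite z0 mul1r (@partial_coord _ _ _ (th \o plane))// (differentiable_comp_partial i dr dth) zx.
have pr l : partial i plane z 0 l = (i == rshift 1 l)%:R.
  rewrite -partial_coord//.
  rewrite (@partial_near _ _ _ _ (fun z : 'rV[R]_(1 + 2) => z 0 (rshift 1 l))); last first.
    by near=> w; rewrite mxE.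
  by rewrite partial_id.
rewrite summxE.
under eq_bigr do rewrite mxE pr.
rewrite partial_id /= zx.
case: (splitP i) => i' ei.
  have -> : i = lshift 2 i' by exact: val_inj.
  rewrite col_mxEu (ord1 i'); have -> : (lshift 2 0 == 0 :> 'I_(1 + 2)) by [].
  by rewrite mul1r big1 ?addr0// => l _; rewrite eq_lrshift mul0r.
have -> : i = rshift 1 i' by exact: val_inj.
rewrite col_mxEd jmxE; have -> : (rshift 1 i' == 0 :> 'I_(1 + 2)) = false by [].
rewrite mul0r add0r (bigD1 i')//= eqxx mul1r big1 ?addr0// => l li.
by rewrite (inj_eq (@rshift_inj _ _)) eq_sym (negbTE li) mul0r.
Unshelve. all: by end_near. Qed.

Lemma piece_exists (a : chart R M) (W : set 'rV[R]_2) th x : atlas a -> open W ->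
  W `<=` chart_img a -> smooth_on W th ->
  (forall y, W y -> S2 (th y) /\ metric th y = metric (f \o param a) y) -> W x ->
  exists W' V psi, piece a W' V th psi /\ W' x.
Proof.
move=> aa oW sub sth hth Wx.
pose D := [set z : 'rV[R]_(1 + 2) | W (plane z) /\ 0 < z 0 0].
have oD : open D.
  have o1 : open [set z : 'rV[R]_(1 + 2) | setT z /\ W (plane z)].
    by apply: open_smooth_preimage => //; [exact: openT|exact: smooth_on_plane openT].
  have o2 : open [set z : 'rV[R]_(1 + 2) | 0 < z 0 0].
    apply: (@open_comp _ _ (fun z : 'rV[R]_(1 + 2) => z 0 0) [set r | 0 < r]) => //.
      by move=> z _; apply: differentiable_continuous; exact: differentiable_coord.
  rewrite (_ : D = [set z : 'rV[R]_(1 + 2) | setT z /\ W (plane z)] `&` [set z : 'rV[R]_(1 + 2) | 0 < z 0 0]).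
    exact: openI.
  by apply/seteqP; split=> [z [? ?]|z [[_ ?] ?]].
pose Phi (z : 'rV[R]_(1 + 2)) := z 0 0 *: th (plane z).
pose z0 : 'rV[R]_(1 + 2) := row_mx 1%:M x.
have e00 (w : 'rV[R]_2) : (row_mx 1%:M w : 'rV[R]_(1 + 2)) 0 0 = 1.
  have -> : (0 : 'I_(1 + 2)) = lshift 2 0 by exact: val_inj.
  by rewrite row_mxEl mxE eqxx.
have Dz0 : D z0 by split; rewrite /plane ?row_mxKr// e00 ltr01.
have sPhi : smooth_on D Phi.
  apply/(smooth_on_coord _ oD) => j.
  apply: (@smooth_on_ext _ _ _ D (fun z => z 0 0 * (th \o plane) z 0 j)) => //.
    by move=> z _; rewrite mxE.
  apply: (smooth_onM oD); first exact: smooth_on_id.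
  apply: (smooth_on_coord _ oD).1; apply: (smooth_on_comp oD oW) sth.
    by move=> z [].
  exact: smooth_on_plane.
have iW y : W y -> immersive_at th y.
  by move=> Wy; apply: metric_immersive (hth _ Wy).2 _; apply: f_immersive => //; exact: sub.
have u0 : jmx Phi z0 \in unitmx.
  rewrite /Phi (cone_jmx oW sth Wx).
  exact: (sphere_frame_unit oW sth iW k_gt0 (fun y Wy => (hth y Wy).1) Wx).
have [U [V [psi [oU oV Uz0 Vz0 [UD h1 h2 spsi]]]]] := inverse_function oD Dz0 sPhi u0.
pose W' := [set w | W w /\ U (row_mx 1%:M w)].
have srow : smooth_on W (fun w : 'rV[R]_2 => row_mx 1%:M w : 'rV[R]_(1 + 2)).
  apply/(smooth_on_coord _ oW) => j; case: (splitP j) => j' ej.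
    apply: (@smooth_on_ext _ _ _ W (fun=> (1%:M : 'M[R]_1) 0 j')) => //; last exact: smooth_on_cst.
    by move=> w _; rewrite (_ : j = lshift 2 j') ?row_mxEl//; exact: val_inj.
  apply: (@smooth_on_ext _ _ _ W (fun w => w 0 j')) => //; last exact: smooth_on_id.
  by move=> w _; rewrite (_ : j = rshift 1 j') ?row_mxEr//; exact: val_inj.
exists W', V, (plane \o psi); split; last by split.
have Phi1 w : Phi (row_mx 1%:M w) = th w by rewrite /Phi e00 scale1r /plane row_mxKr.
split=> //.
- exact: open_smooth_preimage.
- by move=> w [/sub].
- by apply: smooth_on_sub sth => w [].
- apply: (@smooth_on_comp _ _ _ _ _ setT psi plane) => //; first exact: openT.
  exact: smooth_on_plane openT.
- move=> w [Ww Uw]; have [Vw e] := h1 _ Uw; rewrite Phi1 in Vw e.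
  by split; rewrite /= ?e /plane ?row_mxKr//; exact: (hth w Ww).1.
- move=> y Sy Vy; have [Uy ey] := h2 _ Vy; have [Wy y0] := UD _ Uy.
  (* Both [y] and the spherical patch have the same length, so the positive factor of the cone is 1;
     positivity is the reason for the second condition in [D]. *)
  have p1 : psi y 0 0 = 1.
    have : dot (Phi (psi y)) (Phi (psi y)) = k^-1 by rewrite ey; exact: Sy.
    rewrite dotZl dotZr (hth _ Wy).1 mulrA => /eqP.
    rewrite -subr_eq0 -[X in _ - X]mul1r -mulrBl mulf_eq0 invr_eq0 [k == 0]gt_eqF// orbF subr_eq0.
    by rewrite -expr2 -[X in _ == X](expr1n _ 2) eqrXn2 ?ltW// => /eqP.
  have epsi : psi y = row_mx 1%:M (plane (psi y)).
    rewrite -{1}[psi y](@hsubmxK _ 1 1 2); congr row_mx; apply/rowP => j.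
    by rewrite (ord1 j) mxE mxE eqxx -p1; congr (psi y _ _); exact: val_inj.
  by split; [split=> //; rewrite -epsi|rewrite -[RHS]ey /Phi p1 scale1r].
- by move=> w [/hth[]].
Qed.

Lemma smooth_transition (a b : chart R M) : atlas a -> atlas b ->
  smooth_on (overlap a b) (coord b \o param a).
Proof. by move=> aa ab; exact: (atlas_compatible aa ab).1. Qed.

Lemma near_eq_smooth n n' (F G : 'rV[R]_n -> 'rV[R]_n') x :
  (\forall y \near x, F y = G y) -> metric F x = metric G x.
Proof.
move=> e; apply/matrixP => i j; rewrite !metricE.
by rewrite (partial_near i e) (partial_near j e).
Qed.

Lemma transition_metric (a b : chart R M) x : atlas a -> atlas b -> overlap a b x ->
  metric (f \o param a) x =
  jmx (coord b \o param a) x *m metric (f \o param b) (coord b (param a x)) *m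
  (jmx (coord b \o param a) x)^T.
Proof.
move=> aa ab abx; have oo := @open_overlap R M a b.
rewrite -(metric_reparam _ (smooth_transition aa ab) (f_smooth ab) abx).
  apply: near_eq_smooth.
  have : \forall y \near x, overlap a b y by exact: open_nbhs_nbhs.
  by apply: filterS => y [ay by_]; rewrite /= coordK.
by move=> y [ay by_]; exact: coord_img.
Qed.

Lemma isometry_transfer (a b : chart R M) (W : set 'rV[R]_2) (th : 'rV[R]_2 -> 'rV[R]_3) :
  atlas a -> atlas b -> open W -> W `<=` chart_img b -> smooth_on W th ->
  (forall y, W y -> metric th y = metric (f \o param b) y) ->
  let U := [set x | overlap a b x /\ W (coord b (param a x))] in
  [/\ open U, smooth_on U (th \o (coord b \o param a)) &
    forall x, U x -> metric (th \o (coord b \o param a)) x = metric (f \o param a) x].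
Proof.
move=> aa ab oW sub sth e U; have oo := @open_overlap R M a b; have st := smooth_transition aa ab.
have oU : open U by exact: (open_smooth_preimage oo st oW).
have sU : smooth_on U (coord b \o param a) by apply: smooth_on_sub st => x [].
have UW x : U x -> W ((coord b \o param a) x) by case.
split=> //; first exact: (smooth_on_comp oU oW UW sU sth).
move=> x Ux; rewrite (metric_reparam UW sU sth Ux) e; last exact: UW.
by rewrite [RHS](transition_metric aa ab Ux.1).
Qed.

Definition orth (A : 'M[R]_3) := A *m A^T = 1%:M.

Lemma orth_tr A : orth A -> A^T *m A = 1%:M. Proof. exact: mulmx1C. Qed.

Lemma orthV A : orth A -> orth A^T.
Proof. by move=> oA; rewrite /orth trmxK orth_tr. Qed.

Lemma dot_orth A (u w : 'rV[R]_3) : orth A -> dot (u *m A) (w *m A) = dot u w.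
Proof. by move=> oA; rewrite dot_mulmx -mulmxA oA mulmx1. Qed.

Lemma sphere_orth A (y : 'rV[R]_3) : orth A -> S2 y -> S2 (y *m A).
Proof. by move=> oA; rewrite /sphere /= dot_orth. Qed.

Lemma piece_immersive a W V th psi x : piece a W V th psi -> W x -> immersive_at th x.
Proof.
move=> p Wx; apply: metric_immersive (pc_metric p Wx) _.
by apply: f_immersive; [exact: pc_atlas p|exact: pc_img p _ Wx].
Qed.

(** Two local isometries into the same round sphere, read in one chart on a small ball, are patches
    with equal metrics, so [sphere2_rigid] applies. *)
Lemma piece_rigid a W V th psi a' W' V' th' psi' p :
  piece a W V th psi -> piece a' W' V' th' psi' ->
  chart_dom a p -> chart_dom a' p -> W (coord a p) -> W' (coord a' p) ->
  exists2 A, orth A & \forall q \near p, [/\ chart_dom a q, chart_dom a' q, W (coord a q),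
     W' (coord a' q) & th' (coord a' q) = th (coord a q) *m A].
Proof.
move=> pc pc' ap ap' Wp Wp'; have aa := pc_atlas pc; have aa' := pc_atlas pc'.
have [oU sU eU] := isometry_transfer aa aa' (pc_openW pc') (pc_img pc') (pc_smooth pc') (pc_metric pc').
set U := [set x | _ /\ _] in oU sU eU; set tau := _ \o param a in sU eU.
have oUW : open (U `&` W) by apply: openI => //; exact: pc_openW pc.
have Ux : (U `&` W) (coord a p).
  by split=> //; split; [exact: overlapP|rewrite coordK].
have [r r0 sub] := ball_sub_open oUW Ux.
have oB : open (ball (coord a p) r) by exact: ball_open.
have [A oA eA] : exists2 A, orth A & forall x, ball (coord a p) r x -> (th' \o tau) x = th x *m A.
  apply: (sphere2_rigid oB (@ball_convex _ _ _ _) (ballxx _ r0) k_gt0).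
  - by apply: smooth_on_sub (pc_smooth pc) => x /sub[].
  - by apply: smooth_on_sub sU => x /sub[].
  - by move=> x /sub[_ Wx]; exact: piece_immersive pc Wx.
  - move=> x /sub[Ux' Wx]; apply: metric_immersive (eU _ Ux') _.
    by apply: f_immersive => //; exact: pc_img pc _ Wx.
  - by move=> x /sub[_ /(pc_th pc)[]].
  - by move=> x /sub[[_ Wx'] _]; have [] := pc_th pc' Wx'.
  - by move=> x /sub[Ux' Wx]; rewrite (eU _ Ux') (pc_metric pc).
exists A => //; have : \forall q \near p, chart_dom a q /\ ball (coord a p) r (coord a q).
  by apply: near_chart => //; exact: ballxx.
apply: filterS => q [aq Bq]; have [[[_ bq] Wq'] Wq] := sub _ Bq.
rewrite /preimage /= coordK// in bq; rewrite coordK// in Wq'.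
by split=> //; rewrite -(eA _ Bq) /tau /= coordK.
Qed.

Lemma piece_rotate a W V th psi A : orth A -> piece a W V th psi ->
  piece a W [set y | V (y *m A^T)] (fun x => th x *m A) (fun y => psi (y *m A^T)).
Proof.
move=> oA pc; have oAT := orth_tr oA.
have sm n (B : 'M[R]_3) (U : set 'rV[R]_n) (F : 'rV[R]_n -> 'rV[R]_3) :
    open U -> smooth_on U F -> smooth_on U (fun x => F x *m B).
  move=> oU sF; have := smooth_on_affine B 0 oU sF.
  by apply: smooth_on_ext => // x _; rewrite addr0.
have oV : open [set y | V (y *m A^T)].
  have := open_smooth_preimage openT (sm _ A^T _ _ openT (smooth_on_idfun openT)) (pc_openV pc).
  by congr open; apply/seteqP; split=> [y []|y].
have aA u : u *m A *m A^T = u by rewrite -mulmxA oA mulmx1.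
have Aa u : u *m A^T *m A = u by rewrite -mulmxA oAT mulmx1.
split=> //; first exact: pc_atlas pc.
- exact: pc_openW pc.
- exact: pc_img pc.
- by apply: sm; [exact: pc_openW pc|exact: pc_smooth pc].
- apply: (@smooth_on_comp _ _ _ _ _ _ (fun y => y *m A^T) psi oV (pc_openV pc)) => //.
    by apply: sm => //; exact: smooth_on_idfun.
  exact: pc_inv_smooth pc.
- move=> x /(pc_th pc)[Sx Vx ex]; rewrite /= aA; split=> //.
  exact: sphere_orth.
- move=> y Sy Vy; have [Wy ey] := pc_psi pc (sphere_orth (orthV oA) Sy) Vy.
  by split=> //; rewrite ey Aa.
- move=> x Wx; rewrite -(pc_metric pc Wx).
  have BX i y : W y -> partial i th y *m (A *m A^T) = partial i th y by rewrite oA mulmx1.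
  rewrite -[RHS](metric_affine 0 (pc_openW pc) (pc_smooth pc) BX Wx); apply: near_eq_smooth.
  by near=> y; rewrite addr0.
Unshelve. all: by end_near. Qed.

Lemma piece_restrict a W V th psi (V' : set 'rV[R]_3) : open V' -> piece a W V th psi ->
  piece a [set x | W x /\ V' (th x)] (V `&` V') th psi.
Proof.
move=> oV' pc; split.
- exact: pc_atlas pc.
- exact: open_smooth_preimage (pc_openW pc) (pc_smooth pc) oV'.
- by move=> x [/(pc_img pc)].
- by apply: openI => //; exact: pc_openV pc.
- by apply: smooth_on_sub (pc_smooth pc) => x [].
- by apply: smooth_on_sub (pc_inv_smooth pc) => y [].
- by move=> x [/(pc_th pc)[? ? ?] ?].
- by move=> y Sy [Vy V'y]; have [? e] := pc_psi pc Sy Vy; rewrite /= e.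
- by move=> x [/(pc_metric pc)].
Qed.

(** The inverse local isometry, from the sphere to M. *)
Definition sect (a : chart R M) (psi : 'rV[R]_3 -> 'rV[R]_2) : 'rV[R]_3 -> M := param a \o psi.

Lemma sectP a W V th psi y : piece a W V th psi -> S2 y -> V y ->
  [/\ chart_dom a (sect a psi y), W (coord a (sect a psi y)) & th (coord a (sect a psi y)) = y].
Proof.
move=> pc Sy Vy; have [Wy e] := pc_psi pc Sy Vy; have ay := pc_img pc Wy.
by rewrite /sect /= paramK//; split=> //; exact: param_dom.
Qed.

Lemma sect_th a W V th psi q : piece a W V th psi -> chart_dom a q -> W (coord a q) ->
  sect a psi (th (coord a q)) = q.
Proof. by move=> pc aq Wq; rewrite /sect /=; have [_ _ ->] := pc_th pc Wq; rewrite coordK. Qed.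

Lemma near_sect a W V th psi y (O : set M) : piece a W V th psi -> S2 y -> V y ->
  nbhs (sect a psi y) O -> \forall y' \near y, S2 y' -> O (sect a psi y').
Proof.
move=> pc Sy Vy nO; have [Wy _] := pc_psi pc Sy Vy; have ay := pc_img pc Wy.
have h := near_param ay nO; move: h; rewrite /prop_near1 => h.
have c : {for y, continuous psi} by exact: continuous_smooth (pc_inv_smooth pc) Vy.
have h2 : \forall y' \near y, chart_img a (psi y') /\ O (param a (psi y')) by exact: c _ h.
by apply: filterS h2 => y' [].
Qed.

Hypothesis locally_isometric : forall p, exists a W V th psi,
  [/\ piece a W V th psi, chart_dom a p & W (coord a p)].

(** Euclidean, because the radius of extension must be invariant under rotations and the sup norm is
    not. *)
Definition sqdist (y y' : 'rV[R]_3) : R := dot (y' - y) (y' - y).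

Lemma sqdist_ball (y y' : 'rV[R]_3) (r : R) : 0 < r -> sqdist y y' < r ^+ 2 -> ball y r y'.
Proof.
move=> r0 h; rewrite -ball_normE /= ; apply: (le_lt_trans (@norm_le_coord _ _ _ (Num.sqrt (sqdist y y')) _ _)).
- exact: sqrtr_ge0.
- move=> j; rewrite -sqrtr_sqr ler_wsqrtr// /sqdist /dot (bigD1 j)//= -expr2 !mxE.
  rewrite -[X in X <= _]addr0 lerD//; first by rewrite -[X in X <= _]sqrrN opprB.
  by rewrite sumr_ge0// => i _; rewrite -expr2 sqr_ge0.
- by rewrite -(ger0_norm (ltW r0)) -(sqrtr_sqr r) ltr_sqrt ?exprn_gt0.
Qed.

Lemma sqdist_orth A y y' : orth A -> sqdist (y *m A) (y' *m A) = sqdist y y'.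
Proof. by move=> oA; rewrite /sqdist -mulmxBl dot_orth. Qed.

(** A Lebesgue number argument: near each point a single piece serves all neighbours with a fixed
    margin, and compactness makes the margin uniform. *)
Lemma uniform_piece : exists2 e, 0 < e & forall q, exists a W V th psi,
  [/\ piece a W V th psi, chart_dom a q, W (coord a q) &
      forall y, S2 y -> sqdist (th (coord a q)) y < e -> V y].
Proof.
have := @surface_compact R M; rewrite compact_near_coveringP => cov.
pose P (e : R) (q : M) := exists a W V th psi,
  [/\ piece a W V th psi, chart_dom a q, W (coord a q) &
      forall y, S2 y -> sqdist (th (coord a q)) y < e -> V y].
have h : \forall e \near 0^'+, [set: M] `<=` P e.
  apply: cov => p _; have [a [W [V [th [psi [pc ap Wp]]]]]] := locally_isometric p.
  have [Sp Vp _] := pc_th pc Wp.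
  have : nbhs (th (coord a p)) V by apply: open_nbhs_nbhs; split => //; exact: pc_openV pc.
  move=> /nbhs_ballP[r /= r0 sub].
  have oU : open [set x | W x /\ ball (th (coord a p)) (r / 4) (th x)].
    apply: (open_smooth_preimage (pc_openW pc) (pc_smooth pc)); exact: ball_open.
  have r4 : 0 < r / 4 by rewrite divr_gt0.
  have Up : [set x | W x /\ ball (th (coord a p)) (r / 4) (th x)] (coord a p).
    by split=> //; exact: ballxx.
  have nq := near_chart oU ap Up.
  have ne : \forall e \near (0 : R)^'+, e < (r / 4) ^+ 2.
    by apply: nbhs_right_lt; rewrite exprn_gt0.
  near=> q e; have he : e < (r / 4) ^+ 2 by near: e.
  exists a, W, V, th, psi.
  have [aq [Wq Bq]] : chart_dom a q /\ [set x | W x /\ ball (th (coord a p)) (r / 4) (th x)] (coord a q).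
    by near: q.
  split=> // y Sy hy; apply: sub; apply: (@le_ball _ _ _ (r / 4 + r / 4)).
    by lra.
  by apply: (ball_triangle Bq); apply: sqdist_ball => //; exact: (lt_trans hy).
have [e [e0 he]] : exists e, 0 < e /\ [set: M] `<=` P e.
  have : \forall e \near (0 : R)^'+, 0 < e /\ [set: M] `<=` P e.
    have e0 : \forall e \near (0 : R)^'+, 0 < e by exact: nbhs_right_gt.
    by near=> e; split; near: e.
  by move=> /filter_ex[e ?]; exists e.
by exists e => // q; exact: he.
Unshelve. all: by end_near. Qed.

(** The uniform piece at the image point is rotated so that it agrees with the given germ; rotations
    preserve its margin. *)
Lemma uniform_extension : exists2 e, 0 < e & forall a0 W0 V0 th0 psi0 y,
  piece a0 W0 V0 th0 psi0 -> S2 y -> V0 y -> exists a W V th psi,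
  [/\ piece a W V th psi, forall y', S2 y' -> sqdist y y' < e -> V y' &
      \forall y' \near y, S2 y' -> sect a psi y' = sect a0 psi0 y'].
Proof.
have [e e0 he] := uniform_piece; exists e => // a0 W0 V0 th0 psi0 y pc0 Sy Vy.
have [aq Wq thq] := sectP pc0 Sy Vy; set q := sect a0 psi0 y in aq Wq thq.
have [a [W [V [th [psi [pc ap Wp hV]]]]]] := he q.
have [A oA nA] := piece_rigid pc pc0 ap aq Wp Wq.
have pcA := piece_rotate oA pc.
exists a, W, [set y | V (y *m A^T)], (fun x => th x *m A), (fun y => psi (y *m A^T)); split=> //.
  move=> y' Sy' hy'; apply: hV; first exact: sphere_orth (orthV oA) Sy'.
  have -> : th (coord a q) = y *m A^T.
    have [_ _ _ _] := nbhs_singleton nA; rewrite thq => ->.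
    by rewrite -mulmxA oA mulmx1.
  by rewrite sqdist_orth//; exact: orthV.
have ny := near_sect pc0 Sy Vy nA.
have nV : \forall y' \near y, V0 y' by apply: open_nbhs_nbhs; split => //; exact: pc_openV pc0.
apply: filterS2 ny nV => y' h Vy' Sy'; have [ap' aq' Wp' Wq' e'] := h Sy'.
have [_ _ e2] := sectP pc0 Sy' Vy'.
by rewrite -[RHS](sect_th pcA ap' Wp') /= -e' e2.
Unshelve. all: by end_near. Qed.

(** * Continuation of inverse local isometries over the plane *)

Section Develop.
Variable phi : 'rV[R]_2 -> 'rV[R]_3.
Hypothesis phi_sphere : forall z, S2 (phi z).
Hypothesis phi_smooth : smooth_on setT phi.
Hypothesis phi_immersive : forall z, immersive_at phi z.
Variables (K : R) (K_gt0 : 0 < K).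
Hypothesis phi_lip : forall z z', sqdist (phi z) (phi z') <= K * `|z - z'| ^+ 2.
Implicit Types (z : 'rV[R]_2) (sg : 'rV[R]_2 -> M).

(** Near [z], the map [sg] is an inverse local isometry read through the parametrization [phi]. *)
Definition good sg z := exists a W V th psi, [/\ piece a W V th psi, V (phi z) &
  \forall z' \near z, sg z' = sect a psi (phi z')].

Lemma phi_near z (V : set 'rV[R]_3) : nbhs (phi z) V -> \forall z' \near z, V (phi z').
Proof. by move=> nV; have /(_ _ nV) := continuous_smooth phi_smooth (I : setT z). Qed.

(** The position and the two derivatives form a basis, so any germ of the patch spans the space. *)
Lemma phi_span z (B : 'M[R]_3) : (\forall z' \near z, phi z' *m B = 0) -> B = 0.
Proof.
move=> nB; have p i : partial i phi z *m B = 0.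
  rewrite -(partial_affine B 0 openT phi_smooth i (I : setT z)).
  rewrite (@partial_near _ _ _ _ (fun=> 0 : 'rV[R]_3)) ?partial_cst//.
  by apply: filterS nB => z' ->; rewrite addr0.
have u := sphere_frame_unit openT phi_smooth (fun z _ => phi_immersive z) k_gt0
  (fun z _ => phi_sphere z) (I : setT z).
have e : (col_mx (phi z) (jmx phi z) : 'M[R]_(1 + 2)) *m B = 0.
  rewrite mul_col_mx (nbhs_singleton nB); apply/eqP; rewrite col_mx_eq0 eqxx /=; apply/eqP/row_matrixP => i.
  rewrite row_mul row0 -(p i); congr (_ *m _); apply/rowP => j.
  by rewrite mxE jmxE.
by rewrite -(mulKmx u B) e mulmx0.
Qed.

Lemma good_ext sg sg' z : good sg z -> (\forall z' \near z, sg z' = sg' z') -> good sg' z.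
Proof.
move=> [a [W [V [th [psi [pc Vz e]]]]]] e'; exists a, W, V, th, psi; split=> //.
by near=> z'; rewrite -(near e' z')//; near: z'.
Unshelve. all: by end_near. Qed.

(* The two germs differ by a rotation, which fixes a nonempty open set of the sphere pointwise. *)
Lemma agree_step sg sg' z : good sg z -> good sg' z ->
  (forall U, nbhs z U -> exists z', U z' /\ \forall w \near z', sg w = sg' w) ->
  \forall w \near z, sg w = sg' w.
Proof.
move=> [a [W [V [th [psi [pc Vz e]]]]]] [a' [W' [V' [th' [psi' [pc' Vz' e']]]]]] acc.
set q := sect a psi (phi z); set q' := sect a' psi' (phi z).
have ns O : nbhs q O -> \forall w \near z, O (sg w).
  move=> nO; have h := phi_near (near_sect pc (phi_sphere z) Vz nO).
  by apply: filterS2 h e => w h ->; exact: h (phi_sphere w).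
have ns' O : nbhs q' O -> \forall w \near z, O (sg' w).
  move=> nO; have h := phi_near (near_sect pc' (phi_sphere z) Vz' nO).
  by apply: filterS2 h e' => w h ->; exact: h (phi_sphere w).
(* The two maps agree at points accumulating at [z], so their limits cannot be separated. *)
have qq : q = q'.
  apply: (@surface_hausdorff R M) => A B nA nB.
  have nAB : \forall w \near z, A (sg w) /\ B (sg' w).
    by near=> w; split; near: w; [exact: ns|exact: ns'].
  have [w [[Aw Bw] ew]] := acc _ nAB.
  by exists (sg w); split=> //; rewrite (nbhs_singleton ew).
have [aq Wq thq] := sectP pc (phi_sphere z) Vz; have [aq' Wq' thq'] := sectP pc' (phi_sphere z) Vz'.
rewrite -/q in aq Wq thq; rewrite -/q' -qq in aq' Wq' thq'.
have [A oA nA] := piece_rigid pc pc' aq aq' Wq Wq'.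
have nV : \forall w \near z, V (phi w) /\ V' (phi w).
  have h1 : \forall w \near z, V (phi w).
    by apply: phi_near; apply: open_nbhs_nbhs; split => //; exact: pc_openV pc.
  have h2 : \forall w \near z, V' (phi w).
    by apply: phi_near; apply: open_nbhs_nbhs; split => //; exact: pc_openV pc'.
  by near=> w; split; near: w.
have key : \forall w \near z, [/\ sg w = sect a psi (phi w), sg' w = sect a' psi' (phi w),
    V (phi w), V' (phi w) & [/\ chart_dom a (sg w), chart_dom a' (sg w), W (coord a (sg w)),
     W' (coord a' (sg w)) & th' (coord a' (sg w)) = th (coord a (sg w)) *m A]].
  have h := ns _ nA.
  near=> w; have [Vw Vw'] : V (phi w) /\ V' (phi w) by near: w.
  by split=> //; near: w.
have A1 : A = 1%:M.
  have [w [kw ew]] := acc _ (near_join key).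
  apply/eqP; rewrite -subr_eq0; apply/eqP; apply: (@phi_span w).
  have both : \forall w' \near w, sg w' = sg' w' /\ [/\ sg w' = sect a psi (phi w'),
    sg' w' = sect a' psi' (phi w'), V (phi w'), V' (phi w') & [/\ chart_dom a (sg w'),
    chart_dom a' (sg w'), W (coord a (sg w')), W' (coord a' (sg w')) &
    th' (coord a' (sg w')) = th (coord a (sg w')) *m A]] by near=> w'; split; near: w'.
  apply: filterS both => w' [es [e1 e2 Vw Vw' [_ _ _ _ eA]]].
  have [_ _ t1] := sectP pc (phi_sphere w') Vw; have [_ _ t2] := sectP pc' (phi_sphere w') Vw'.
  by move: eA; rewrite {1}es e1 e2 t1 t2 mulmxBr mulmx1 => <-; rewrite subrr.
apply: filterS key => w [e1 e2 Vw Vw' [_ aw' _ Ww' eA]].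
have [_ _ t1] := sectP pc (phi_sphere w) Vw.
rewrite e2 -[LHS](sect_th pc' aw' Ww') eA A1 mulmx1 e1 t1.
by [].
Unshelve. all: by end_near. Qed.

(** The set where the germs agree is open by definition and closed in D by [agree_step]. *)
Lemma agree_connected (D : set 'rV[R]_2) sg sg' z0 : connected D ->
  (forall z, D z -> good sg z /\ good sg' z) -> D z0 -> (\forall w \near z0, sg w = sg' w) ->
  forall z, D z -> \forall w \near z, sg w = sg' w.
Proof.
move=> cD gD D0 e0; pose C : set 'rV[R]_2 := [set z : 'rV[R]_2 | \forall w \near z, sg w = sg' w].
suff h : D `&` C = D by move=> z; rewrite -h => -[].
apply: cD; first by exists z0.
  exists C => //; rewrite openE => z nz; exact: near_join nz.
exists (closure C); first exact: closed_closure.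
apply/seteqP; split=> z [Dz Cz]; split=> //; first exact: subset_closure.
have [g g'] := gD _ Dz; apply: (agree_step g g') => U /Cz[z' [Cz' Uz']].
by exists z'.
Qed.

Lemma segment_set_connected (z0 z1 : 'rV[R]_2) :
  connected [set z0 + t *: (z1 - z0) | t in `[0, 1]%classic].
Proof.
apply: connected_continuous_connected; first exact: segment_connected.
apply: continuous_subspaceT => t.
by apply: cvgD; [exact: cvg_cst|apply: cvgZl; exact: cvg_id].
Qed.

Lemma agree_segment sg sg' z0 z1 :
  (forall t, 0 <= t <= 1 -> good sg (z0 + t *: (z1 - z0)) /\ good sg' (z0 + t *: (z1 - z0))) ->
  (\forall w \near z0, sg w = sg' w) -> \forall w \near z1, sg w = sg' w.
Proof.
move=> g e0.
apply: (@agree_connected [set z0 + t *: (z1 - z0) | t in `[0, 1]%classic] sg sg' z0) => //.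
- exact: segment_set_connected.
- by move=> w [t /= h <-]; apply: g; rewrite in_itv in h.
- by exists 0; rewrite ?scale0r ?addr0//= in_itv /= lexx ler01.
- by exists 1; rewrite ?scale1r 1?addrC ?subrK//= in_itv /= lexx ler01.
Qed.

Lemma agree_convex (D : set 'rV[R]_2) sg sg' z0 : convex_set D ->
  (forall z, D z -> good sg z /\ good sg' z) -> D z0 -> (\forall w \near z0, sg w = sg' w) ->
  forall z, D z -> \forall w \near z, sg w = sg' w.
Proof.
move=> cD gD D0 e0 z Dz; apply: (agree_segment (z0 := z0)) => // t t01.
exact: gD (cD _ _ _ D0 Dz t01).
Qed.

Lemma convex_setI (D D' : set 'rV[R]_2) : convex_set D -> convex_set D' -> convex_set (D `&` D').
Proof. by move=> cD cD' x y t [Dx D'x] [Dy D'y] t01; split; [exact: cD|exact: cD']. Qed.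

Lemma local_extension : exists2 d, 0 < d & forall sg w, good sg w -> exists tau,
  (forall z, ball w d z -> good tau z) /\ \forall z \near w, tau z = sg z.
Proof.
have [e e0 he] := uniform_extension.
(* By [phi_lip], parameters closer than this have images at squared distance less than e. *)
exists (Num.sqrt (e / K)); first by rewrite sqrtr_gt0 divr_gt0.
move=> sg w [a0 [W0 [V0 [th0 [psi0 [pc0 Vw ew]]]]]].
have [a [W [V [th [psi [pc hV nV]]]]]] := he _ _ _ _ _ _ pc0 (phi_sphere w) Vw.
exists (sect a psi \o phi); split.
  move=> z Bz; exists a, W, V, th, psi; split=> //; last by near=> z'.
  apply: hV; first exact: phi_sphere.
  apply: (le_lt_trans (phi_lip _ _)); rewrite mulrC -ltr_pdivlMr//.
  rewrite -[X in _ < X]sqr_sqrtr ?divr_ge0 ?ltW//.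
  move: Bz; rewrite -ball_normE /= => Bz.
  by rewrite ltr_pXn2r// ?nnegrE ?sqrtr_ge0// -normrN opprB distrC.
apply: filterS2 (phi_near nV) ew => z h ->; exact: h (phi_sphere z).
Unshelve. all: by end_near. Qed.

(* The value at [z] of the larger section is that of the local extension centred at a point [c z]
   obtained by shrinking [z] towards [e]. *)
Lemma growth d sg e r : 0 < d ->
  (forall sg w, good sg w -> exists tau,
    (forall z, ball w d z -> good tau z) /\ \forall z \near w, tau z = sg z) ->
  d <= r -> (forall z, ball e r z -> good sg z) ->
  exists sg', (forall z, ball e (r + d / 2) z -> good sg' z) /\ \forall z \near e, sg' z = sg z.
Proof.
move=> d0 ext dr gsg; have r0 : 0 < r := lt_le_trans d0 dr.
have /choice[tau htau] w : exists tau, good sg w ->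
    (forall z, ball w d z -> good tau z) /\ \forall z \near w, tau z = sg z.
  case: (pselect (good sg w)) => [/ext[t ht]|ng]; first by exists t.
  by exists sg => /ng.
(* Shrinking by [lam] maps the ball of radius r + d/2 into that of radius r - d/4 and moves its
   points by less than 3d/4, so each [z] stays within reach d of its centre [c z]. *)
pose lam := (r - d / 4) / (r + d / 2); have l0 : 0 < lam by rewrite /lam divr_gt0; lra.
have l1 : lam < 1 by rewrite /lam ltr_pdivrMr; lra.
have lr : lam * (r + d / 2) = r - d / 4 by rewrite /lam divfK//; apply/eqP; lra.
pose c (z : 'rV[R]_2) := e + lam *: (z - e).
have cB z : ball e (r + d / 2) z -> ball e r (c z).
  rewrite -!ball_normE /= /c opprD addrA subrr add0r normrN normrZ gtr0_norm// distrC => h.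
  apply: (@lt_trans _ _ (lam * (r + d / 2))); first by rewrite ltr_pM2l.
  by rewrite lr; lra.
have cz z : ball e (r + d / 2) z -> ball (c z) d z.
  have -> : ball (c z) d z = (`|c z - z| < d) :> Prop by rewrite -ball_normE.
  have -> : c z - z = (1 - lam) *: (e - z).
    by rewrite /c scalerBl scale1r -(opprB z e) scalerN opprK opprB addrAC.
  rewrite -ball_normE /= normrZ gtr0_norm ?subr_gt0// => h.
  apply: (@lt_trans _ _ ((1 - lam) * (r + d / 2))); first by rewrite ltr_pM2l ?subr_gt0.
  by rewrite mulrBl mul1r lr; lra.
have cc z z' : `|c z - c z'| <= `|z - z'|.
  have -> : c z - c z' = lam *: (z - z').
    by rewrite /c opprD addrACA subrr add0r -scalerBr opprB addrA subrK.
  by rewrite normrZ gtr0_norm// ler_piMl// ltW.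
have agree z : ball e (r + d / 2) z -> forall w, ball (c z) d w -> ball e r w ->
    \forall z' \near w, tau (c z) z' = sg z'.
  move=> Bz w B1 B2; have gc := gsg _ (cB _ Bz); have [g1 e1] := htau _ gc.
  apply: (agree_convex (D := ball (c z) d `&` ball e r) _ _ _ e1) => //.
  - by apply: convex_setI; exact: ball_convex.
  - by move=> w' [/g1 ? /gsg].
  - by split; [exact: ballxx|exact: cB].
(* The extensions centred at two nearby points agree: both match [sg] at [c z'], and agreement
   spreads over the convex intersection of their balls. *)
have agree2 z z' : ball e (r + d / 2) z -> ball e (r + d / 2) z' -> `|z - z'| < d ->
    ball (c z) d z' -> tau (c z') z' = tau (c z) z'.
  move=> Bz Bz' zz' cz'.
  suff h' : \forall w \near z', tau (c z') w = tau (c z) w by exact: nbhs_singleton h'.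
  have gz := (htau _ (gsg _ (cB _ Bz))).1; have gz' := (htau _ (gsg _ (cB _ Bz'))).1.
  have Bc : ball (c z) d (c z').
    by rewrite -ball_normE /=; exact: le_lt_trans (cc _ _) zz'.
  apply: (agree_convex (D := ball (c z') d `&` ball (c z) d) (z0 := c z')).
  - by apply: convex_setI; exact: ball_convex.
  - by move=> w [/gz' ? /gz].
  - by split=> //; exact: ballxx.
  - have h1 := agree _ Bz' (c z') (ballxx _ d0) (cB _ Bz').
    have h2 := agree _ Bz _ Bc (cB _ Bz').
    by apply: filterS2 h1 h2 => w -> ->.
  - by split=> //; exact: cz.
exists (fun z => tau (c z) z); split.
  move=> z Bz; have [g1 _] := htau _ (gsg _ (cB _ Bz)).
  apply: good_ext (g1 _ (cz _ Bz)) _.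
  have n1 : \forall z' \near z, ball e (r + d / 2) z'.
    by apply: open_nbhs_nbhs; split => //; exact: ball_open.
  have n2 : \forall z' \near z, ball (c z) d z'.
    by apply: open_nbhs_nbhs; split; [exact: ball_open|exact: cz].
  have n3 : \forall z' \near z, ball z d z' by exact: nbhsx_ballx.
  have n4 : \forall z' \near z, `|z - z'| < d by apply: filterS n3 => z'; rewrite -ball_normE.
  by near=> z'; rewrite [RHS](agree2 z z')//; near: z'.
have ce : c e = e by rewrite /c subrr scaler0 addr0.
have Be : ball e (r + d / 2) e by apply: ballxx; lra.
have n1 : \forall z \near e, [/\ ball e (r + d / 2) z, ball e r z & ball e d z].
  have h1 : \forall z \near e, ball e (r + d / 2) z by apply: nbhsx_ballx; lra.
  have h2 : \forall z \near e, ball e r z by exact: nbhsx_ballx.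
  have h3 : \forall z \near e, ball e d z by exact: nbhsx_ballx.
  by near=> z; split; near: z.
apply: filterS n1 => z [B1 B2 B3].
by apply: (nbhs_singleton (agree z B1 z _ B2)); exact: cz.
Unshelve. all: by end_near. Qed.

(** Each step of [growth] adds the same d/2, so the balls exhaust the plane; the sections on them
    agree by convexity and are glued. *)
Lemma develop sg0 e : good sg0 e -> exists sg, (forall z, good sg z) /\ \forall z \near e, sg z = sg0 z.
Proof.
move=> g0; have [d d0 ext] := local_extension.
have h n : exists sg, (forall z, ball e (d + n%:R * (d / 2)) z -> good sg z) /\ \forall z \near e, sg z = sg0 z.
  elim: n => [|n [sg [gs es]]].
    by have [sg hs] := ext _ _ g0; exists sg; rewrite mul0r addr0.
  have [|sg' [gs' es']] := growth d0 ext _ gs.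
    by rewrite lerDl mulr_ge0// divr_ge0// ltW.
  exists sg'; split; last by apply: filterS2 es es' => z <- ->.
  by move=> z; rewrite -natr1 mulrDl mul1r addrA => /gs'.
have [S hS] := choice h.
have arch z : exists n : nat, ball e (d + n%:R * (d / 2)) z.
  exists (Num.bound (`|e - z| / (d / 2))).
  rewrite -ball_normE /=; apply: (@lt_trans _ _ ((Num.bound (`|e - z| / (d / 2)))%:R * (d / 2))); last by rewrite ltrDr.
  by rewrite -ltr_pdivrMr ?divr_gt0// archi_boundP// divr_ge0// divr_ge0// ltW.
have [N hN] := choice arch.
have SS n n' z : ball e (d + n%:R * (d / 2)) z -> ball e (d + n'%:R * (d / 2)) z -> S n z = S n' z.
  move=> B1 B2; have [g1 e1] := hS n; have [g2 e2] := hS n'.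
  have r0 (j : nat) : 0 < d + j%:R * (d / 2) by rewrite ltr_pwDl// mulr_ge0// divr_ge0// ltW.
  suff h' : \forall w \near z, S n w = S n' w by exact: nbhs_singleton h'.
  apply: (agree_convex (D := ball e (d + n%:R * (d / 2)) `&` ball e (d + n'%:R * (d / 2))) (z0 := e)) => //.
  - by apply: convex_setI; exact: ball_convex.
  - by move=> w [/g1 ? /g2].
  - by split; exact: ballxx.
  - by apply: filterS2 e1 e2 => w -> ->.
have nS n z : ball e (d + n%:R * (d / 2)) z -> \forall z' \near z, S n z' = S (N z') z'.
  move=> Bz; have : \forall z' \near z, ball e (d + n%:R * (d / 2)) z'.
    by apply: open_nbhs_nbhs; split => //; exact: ball_open.
  by apply: filterS => z' Bz'; exact: SS.
exists (fun z => S (N z) z); split.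
  by move=> z; apply: good_ext ((hS (N z)).1 _ (hN z)) _; exact: nS.
have [_ e1] := hS (N e); apply: filterS2 e1 (nS _ _ (hN e)) => z <- //.
Qed.

End Develop.

(** * Stereographic coordinates on the sphere of radius [rho] *)

Local Notation rho := (Num.sqrt k^-1 : R).

Let rho_gt0 : 0 < rho. Proof. by rewrite sqrtr_gt0 invr_gt0. Qed.

Let rho2 : rho * rho = k^-1. Proof. by rewrite -expr2 sqr_sqrtr// invr_ge0 ltW. Qed.

Definition height (y : 'rV[R]_3) : R := y 0 ord_max.
Definition hproj (y : 'rV[R]_3) : 'rV[R]_2 := @lsubmx R 1 2 1 y.
Definition hpoint (u : 'rV[R]_2) (h : R) : 'rV[R]_3 := @row_mx R 1 2 1 u h%:M.

Lemma hproj_hpoint u h : hproj (hpoint u h) = u.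
Proof. exact: (@row_mxKl R 1 2 1). Qed.

Lemma height_hpoint u h : height (hpoint u h) = h.
Proof.
rewrite /height /hpoint (_ : ord_max = rshift 2 (0 : 'I_1) :> 'I_(2 + 1)); last exact: val_inj.
by rewrite (@row_mxEr R 1 2 1) mxE eqxx mulr1n.
Qed.

Lemma hpointK y : hpoint (hproj y) (height y) = y.
Proof.
rewrite -[RHS](@hsubmxK R 1 2 1); congr (@row_mx R 1 2 1 _ _); apply/rowP => j.
by rewrite (ord1 j) !mxE eqxx mulr1n; congr (y _ _); exact: val_inj.
Qed.

Lemma dot_hpoint y y' : dot y y' = dot (hproj y) (hproj y') + height y * height y'.
Proof.
rewrite /dot (@big_split_ord _ _ _ 2 1) /= big_ord1; congr (_ + _ * _).
- by apply: eq_bigr => i _; rewrite !mxE.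
- by congr (y _ _); exact: val_inj.
- by congr (y' _ _); exact: val_inj.
Qed.

(** Inverse stereographic projection from the pole of height rho; [shadow] is the projection
    itself. *)
Definition stereo (z : 'rV[R]_2) : 'rV[R]_3 :=
  hpoint ((rho / (1 + dot z z) * 2) *: z) (rho / (1 + dot z z) * (dot z z - 1)).

Definition shadow (y : 'rV[R]_3) : 'rV[R]_2 := (rho - height y)^-1 *: hproj y.

Let q0 (z : 'rV[R]_2) : 0 < 1 + dot z z. Proof. by rewrite ltr_pwDl// dot_ge0. Qed.

Let qn0 (z : 'rV[R]_2) : 1 + dot z z != 0. Proof. by rewrite gt_eqF. Qed.

Let stereo_id (r a b c : R) : 1 + a != 0 -> 1 + b != 0 ->
  (r / (1 + a) * 2) * ((r / (1 + b) * 2) * c) + (r / (1 + a) * (a - 1)) * (r / (1 + b) * (b - 1)) =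
  (r * r) * (1 - 2 * (a - 2 * c + b) / ((1 + a) * (1 + b))).
Proof. by move=> a0 b0; field; rewrite a0 b0. Qed.

Lemma dot_stereo z z' : dot (stereo z) (stereo z') =
  k^-1 * (1 - 2 * (dot z z - 2 * dot z z' + dot z' z') / ((1 + dot z z) * (1 + dot z' z'))).
Proof.
by rewrite dot_hpoint !hproj_hpoint !height_hpoint dotZl dotZr stereo_id ?qn0// rho2.
Qed.

Lemma stereo_sphere z : S2 (stereo z).
Proof.
rewrite /sphere /= dot_stereo (_ : dot z z - 2 * dot z z + dot z z = 0) ?mulr0 ?mul0r ?subr0 ?mulr1//.
by move: (dot z z) => a; ring.
Qed.

(** The squared chord is 4 k^-1 times the squared Euclidean distance, divided by (1 + |z|^2)(1 +
    |z'|^2) >= 1; the remaining factor 2 compares the Euclidean and sup norms of the plane. *)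
Lemma stereo_lip z z' : sqdist (stereo z) (stereo z') <= 8 * k^-1 * `|z - z'| ^+ 2.
Proof.
have e0 : dot (z - z') (z - z') = dot z z - 2 * dot z z' + dot z' z'.
  rewrite !(dotDl, dotDr, dotNl, dotNr) (dotC z' z); move: (dot z z) (dot z z') (dot z' z') => a b c; ring.
have l0 : dot (z - z') (z - z') <= 2 * `|z - z'| ^+ 2.
  rewrite /dot; apply: (@le_trans _ _ (\sum_(i < 2) `|z - z'| ^+ 2)); last by rewrite sumr_const card_ord mulr_natl.
  apply: ler_sum => i _; rewrite -expr2 -[X in X <= _]real_normK ?num_real//.
  by rewrite lerXn2r// ?nnegrE// coord_norm_le.
have ek := stereo_sphere z; have ek' := stereo_sphere z'.
rewrite /sphere /= in ek ek'.
rewrite /sqdist !(dotDl, dotDr, dotNl, dotNr) ek ek' (dotC (stereo z')) dot_stereo -e0.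
move: l0 (q0 z) (q0 z') (dot_ge0 (z - z')) (dot_ge0 z) (dot_ge0 z').
move: (dot (z - z') (z - z')) (dot z z) (dot z' z') (`|z - z'| ^+ 2) => d a b n dn a0 b0 d0 a1 b1.
have k0 : 0 < k^-1 by rewrite invr_gt0.
have -> : k^-1 - k^-1 * (1 - 2 * d / ((1 + a) * (1 + b))) +
  (- (k^-1 * (1 - 2 * d / ((1 + a) * (1 + b)))) - - k^-1) = k^-1 * (4 * d * ((1 + a) * (1 + b))^-1).
  by move: k^-1 (((1 + a) * (1 + b))^-1) => u w; ring.
have -> : 8 / k * n = k^-1 * (8 * n) by move: k^-1 => u; ring.
rewrite ler_pM2l//; apply: (@le_trans _ _ (4 * d)); last by lra.
rewrite ler_piMr ?mulr_ge0// invf_le1 ?mulr_gt0//.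
by rewrite -[X in X <= _]mulr1 ler_pM// lerDl.
Qed.

Lemma height_stereo z : rho - height (stereo z) = rho / (1 + dot z z) * 2.
Proof.
by rewrite height_hpoint; move: (qn0 z); move: (dot z z) => a a0; field.
Qed.

Lemma shadowK z : shadow (stereo z) = z.
Proof.
rewrite /shadow height_stereo hproj_hpoint scalerA mulVf ?scale1r//.
by rewrite mulf_neq0// gt_eqF// divr_gt0.
Qed.

Lemma stereo_shadow y : S2 y -> height y != rho -> stereo (shadow y) = y.
Proof.
move=> Sy hy; have ey := esym (hpointK y); set u := hproj y in ey; set h := height y in ey hy.
have duu : dot u u = rho * rho - h * h.
  by move: Sy; rewrite /sphere /= dot_hpoint rho2 => <-; rewrite addrK.
have d0 : rho - h != 0 by rewrite subr_eq0 eq_sym.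
have r0 : rho != 0 by rewrite gt_eqF.
have es : dot (shadow y) (shadow y) = (rho + h) / (rho - h).
  rewrite /shadow dotZl dotZr -/u -/h duu; move: d0; move: rho (h) => r h' d0; field.
  by rewrite d0.
have e1 : 1 + dot (shadow y) (shadow y) = 2 * rho / (rho - h).
  by rewrite es; move: d0; move: rho (h) => r h' d0; field.
rewrite /stereo e1 es [RHS]ey; congr hpoint.
  rewrite /shadow scalerA -/h -/u -[RHS]scale1r; congr (_ *: _).
  by move: r0 d0; move: rho (h) => r h' r0 d0; field; rewrite r0 d0.
by move: r0 d0; move: rho (h) => r h' r0 d0; field; rewrite r0 d0.
Qed.

Lemma smooth_on_dot n (W : set 'rV[R]_n) n' (F G : 'rV[R]_n -> 'rV[R]_n') : open W ->
  smooth_on W F -> smooth_on W G -> smooth_on W (fun x => dot (F x) (G x)).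
Proof.
move=> oW sF sG; apply: smooth_on_sum => // i.
by apply: smooth_onM => //; exact: (smooth_on_coord _ oW).1.
Qed.

Lemma stereo_smooth : smooth_on setT stereo.
Proof.
have oT : open [set: 'rV[R]_2] by exact: openT.
have sd : smooth_on setT (fun z : 'rV[R]_2 => dot z z).
  by apply: smooth_on_dot => //; exact: smooth_on_idfun.
have sq : smooth_on setT (fun z : 'rV[R]_2 => rho / (1 + dot z z)).
  apply: smooth_onZ => //; apply: smooth_on_inv => //.
  by apply: smooth_onD => //; exact: smooth_on_cst.
apply/(smooth_on_coord _ oT) => j; case: (@splitP 2 1 j) => j' ej.
  apply: (@smooth_on_ext _ _ _ setT (fun z => rho / (1 + dot z z) * 2 * z 0 j')) => //.
    move=> z _; rewrite /stereo (_ : j = lshift 1 j'); last exact: val_inj.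
    by rewrite (@row_mxEl R 1 2 1) mxE.
  apply: smooth_onM => //; last exact: smooth_on_id.
  by apply: smooth_onM => //; exact: smooth_on_cst.
apply: (@smooth_on_ext _ _ _ setT (fun z => rho / (1 + dot z z) * (dot z z - 1))) => //.
  move=> z _; rewrite /stereo (_ : j = rshift 2 j'); last exact: val_inj.
  by rewrite (@row_mxEr R 1 2 1) (ord1 j') mxE eqxx mulr1n.
apply: smooth_onM => //; apply: smooth_onB => //; exact: smooth_on_cst.
Qed.

Lemma open_height (t : R) : open [set y : 'rV[R]_3 | height y != t].
Proof.
have := @open_smooth_preimage 3 1 setT (fun y => (height y)%:M) [set v | v 0 0 != t].
move=> h; have : open [set x : 'rV[R]_3 | setT x /\ [set v : 'rV[R]_1 | v 0 0 != t] ((height x)%:M)].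
  apply: h; first exact: openT.
    apply/(smooth_on_coord _ openT) => j.
    apply: (@smooth_on_ext _ _ _ setT (fun y => y 0 ord_max)); first exact: openT.
      by move=> y _; rewrite (ord1 j) mxE eqxx mulr1n.
    by apply: smooth_on_id; exact: openT.
  rewrite openE => v /= vt; have c : {for v, continuous (fun v : 'rV[R]_1 => v 0 0)}.
    by apply: differentiable_continuous; exact: differentiable_coord.
  have : nbhs (v 0 0) [set r | r != t].
    by apply: open_nbhs_nbhs; split => //; exact: open_neq.
  by move=> /c.
by congr open; apply/seteqP; split => y; rewrite /= mxE eqxx mulr1n => // -[].
Qed.

Lemma shadow_smooth : smooth_on [set y : 'rV[R]_3 | height y != rho] shadow.
Proof.
have oh := @open_height rho.
apply/(smooth_on_coord _ oh) => j.
apply: (@smooth_on_ext _ _ _ _ (fun y => (rho - y 0 ord_max)^-1 * y 0 (lshift 1 j))) => //.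
  by move=> y _; rewrite /shadow !mxE.
apply: smooth_onM => //; last exact: smooth_on_id.
apply: smooth_on_inv => // [y hy|]; first by rewrite subr_eq0 eq_sym.
by apply: smooth_onB => //; [exact: smooth_on_cst|exact: smooth_on_id].
Qed.

Lemma height_stereo_neq z : height (stereo z) != rho.
Proof. by rewrite eq_sym -subr_eq0 height_stereo mulf_neq0// gt_eqF// divr_gt0. Qed.

Lemma stereo_immersive z : immersive_at stereo z.
Proof.
have ds : differentiable stereo z by exact: smooth_on_differentiable stereo_smooth I.
have dp : differentiable shadow (stereo z).
  by apply: smooth_on_differentiable shadow_smooth _; exact: height_stereo_neq.
rewrite immersive_jmx; apply/row_freeP; exists (jmx shadow (stereo z)).
apply/row_matrixP => i; rewrite row_mul row1.
transitivity (partial i (shadow \o stereo) z); last first.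
  rewrite (@partial_near _ _ _ _ id); last by near=> w; rewrite /= shadowK.
  by apply/rowP => j; rewrite -partial_coord// partial_id mxE eqxx /= eq_sym.
rewrite (differentiable_comp_partial i ds dp).
apply/rowP => j; rewrite summxE mxE; apply: eq_bigr => l _.
by rewrite !mxE.
Unshelve. all: by end_near. Qed.

Definition flip : 'M[R]_3 := @block_mx R 2 1 2 1 1%:M 0 0 (- 1%:M).

Lemma hpoint_flip u h : hpoint u h *m flip = hpoint u (- h).
Proof.
rewrite /hpoint /flip (@mul_row_block R 1 2 1 2 1) mulmx0 mulmx0 addr0 add0r mulmx1.
congr (@row_mx R 1 2 1 _ _); rewrite mulmxN mulmx1.
by apply/matrixP => i j; rewrite !mxE mulNrn.
Qed.

Lemma flipK (y : 'rV[R]_3) : y *m flip *m flip = y.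
Proof. by rewrite -[y in LHS]hpointK !hpoint_flip opprK hpointK. Qed.

Lemma orth_flip : orth flip.
Proof.
have e : flip^T = flip.
  by rewrite /flip (@tr_block_mx R 2 1 2 1) trmx1 !trmx0 linearN /= trmx1.
rewrite /orth e; apply/row_matrixP => i.
by rewrite rowE mulmxA flipK row1.
Qed.

Lemma height_flip y : height (y *m flip) = - height y.
Proof. by rewrite -{1}[y]hpointK hpoint_flip height_hpoint. Qed.

(* The stereographic parametrizations from the two poles. *)
Definition patch (b : bool) (z : 'rV[R]_2) : 'rV[R]_3 := if b then stereo z else stereo z *m flip.
Definition pole (b : bool) : R := if b then rho else - rho.
Definition unpatch (b : bool) (y : 'rV[R]_3) : 'rV[R]_2 := if b then shadow y else shadow (y *m flip).

Lemma patch_sphere b z : S2 (patch b z).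
Proof. by case: b; [exact: stereo_sphere|apply: sphere_orth orth_flip _; exact: stereo_sphere]. Qed.

Lemma smooth_on_mulmx n (B : 'M[R]_3) (U : set 'rV[R]_n) (F : 'rV[R]_n -> 'rV[R]_3) :
  open U -> smooth_on U F -> smooth_on U (fun x => F x *m B).
Proof.
move=> oU sF; have := smooth_on_affine B 0 oU sF.
by apply: smooth_on_ext => // x _; rewrite addr0.
Qed.

Lemma patch_smooth b : smooth_on setT (patch b).
Proof.
case: b; first exact: stereo_smooth.
by apply: smooth_on_mulmx; [exact: openT|exact: stereo_smooth].
Qed.

Lemma metric_orth (U : set 'rV[R]_2) (F : 'rV[R]_2 -> 'rV[R]_3) A x : orth A -> open U -> smooth_on U F ->
  U x -> metric (fun x => F x *m A) x = metric F x.
Proof.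
move=> oA oU sF Ux.
have BX i y : U y -> partial i F y *m (A *m A^T) = partial i F y by rewrite oA mulmx1.
rewrite -[RHS](metric_affine 0 oU sF BX Ux); apply: near_eq_smooth.
by near=> y; rewrite addr0.
Unshelve. all: by end_near. Qed.

Lemma patch_immersive b z : immersive_at (patch b) z.
Proof.
case: b; first exact: stereo_immersive.
apply: metric_immersive (metric_orth orth_flip openT stereo_smooth I) _.
exact: stereo_immersive.
Qed.

Lemma patch_lip b z z' : sqdist (patch b z) (patch b z') <= 8 * k^-1 * `|z - z'| ^+ 2.
Proof. by case: b; [|rewrite /patch sqdist_orth; last exact: orth_flip]; exact: stereo_lip. Qed.

Lemma lip_gt0 : 0 < 8 * k^-1. Proof. by rewrite mulr_gt0// invr_gt0. Qed.

Lemma patchK b z : unpatch b (patch b z) = z.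
Proof. by case: b; rewrite /unpatch /patch /= ?flipK shadowK. Qed.

Lemma unpatchK b y : S2 y -> height y != pole b -> patch b (unpatch b y) = y.
Proof.
case: b => Sy hy; rewrite /patch /unpatch; first exact: stereo_shadow.
rewrite stereo_shadow ?flipK//; last by rewrite height_flip eqr_oppLR.
exact: sphere_orth orth_flip Sy.
Qed.

Lemma unpatch_near b y (P : set 'rV[R]_2) : height y != pole b -> nbhs (unpatch b y) P ->
  \forall y' \near y, P (unpatch b y') /\ height y' != pole b.
Proof.
move=> hy nP; have n1 : \forall y' \near y, height y' != pole b.
  by apply: (open_nbhs_nbhs (A := [set y' | height y' != pole b])); split => //; exact: open_height.
suff c : {for y, continuous (unpatch b)}.
  have n2 : \forall y' \near y, P (unpatch b y') by exact: c _ nP.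
  by near=> w; split; near: w.
case: b hy {nP n1} => hy; first exact: continuous_smooth shadow_smooth hy.
have s2 : smooth_on [set y | setT y /\ height (y *m flip) != rho] (unpatch false).
  have sm : smooth_on setT (fun y : 'rV[R]_3 => y *m flip).
    by apply: smooth_on_mulmx; [exact: openT|exact: smooth_on_idfun openT].
  have o1 := open_smooth_preimage openT sm (@open_height rho).
  apply: (smooth_on_comp o1 (@open_height rho) _ (smooth_on_sub _ sm) shadow_smooth) => //.
  by move=> w [].
by apply: (continuous_smooth s2); split; rewrite // height_flip eqr_oppLR.
Unshelve. all: by end_near.
Qed.

(** The transition between the two stereographic patches, meaningful away from 0. *)
Definition inversion (z : 'rV[R]_2) : 'rV[R]_2 := (dot z z)^-1 *: z.

Lemma patch_inversion b z : z != 0 -> patch (~~ b) z = patch b (inversion z).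
Proof.
move=> z0; have h : stereo z *m flip = stereo (inversion z); last first.
  by case: b; rewrite /patch /= -?h ?flipK.
have d0 : dot z z != 0 by rewrite dot_eq0.
rewrite /stereo hpoint_flip /inversion !(dotZl, dotZr) mulVf// mulr1 scalerA.
move: d0 (qn0 z); move: (dot z z) => d d0 d1.
have d2 : 1 + d^-1 != 0.
  by apply: contra d1 => /eqP e; rewrite -(mulfV d0) -[X in _ + X]mulr1 -mulrDr [_^-1 + _]addrC e mulr0.
congr hpoint; first congr (_ *: _).
  by move: rho => r; field; rewrite d0 addrC d1.
by move: rho => r; field; rewrite d0 addrC d1.
Qed.

Lemma continuous_dot n (z : 'rV[R]_n) : {for z, continuous (fun z : 'rV[R]_n => dot z z : R)}.
Proof.
apply: differentiable_continuous.
have s : smooth_on setT (fun z : 'rV[R]_n => dot z z).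
  by apply: smooth_on_dot; [exact: openT| |]; exact: smooth_on_idfun openT.
exact: smooth_on_differentiable s I.
Qed.

Lemma continuous_inversion z : z != 0 -> {for z, continuous inversion}.
Proof.
move=> z0; apply: (@cvgZ _ _ _ (nbhs z) _ (fun z : 'rV[R]_2 => (dot z z)^-1) id); last exact: cvg_id.
apply: (@cvgV _ _ (nbhs z) _ (fun z : 'rV[R]_2 => dot z z)); first by rewrite dot_eq0.
exact: continuous_dot.
Qed.

Lemma near_neq0 (z : 'rV[R]_2) : z != 0 -> \forall w \near z, w != 0.
Proof.
move=> z0; have : \forall r \near dot z z, r != 0.
  by apply: open_nbhs_nbhs; split; [exact: open_neq|rewrite /= dot_eq0].
move=> h; have n : \forall w \near z, dot w w != 0 by exact: continuous_dot h.
by apply: filterS n => w; apply: contra => /eqP ->; rewrite dot0l.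
Qed.

(** A base point on the equator: it is fixed by the inversion, so both patches take the same value
    there. *)
Definition pt0 : 'rV[R]_2 := delta_mx 0 i0.

Lemma pt0_neq0 : pt0 != 0.
Proof. by apply/eqP => /rowP/(_ i0); rewrite !mxE !eqxx => /eqP; rewrite oner_eq0. Qed.

Lemma inversion_pt0 : inversion pt0 = pt0.
Proof.
rewrite /inversion (_ : dot pt0 pt0 = 1) ?invr1 ?scale1r//.
by rewrite /dot (bigD1 i0)//= big1 ?addr0 ?mxE ?eqxx ?mulr1// => j j0; rewrite !mxE (negbTE j0) mul0r.
Qed.

(** The punctured plane is not convex, but every point is reached from [pt0] by a segment avoiding
    0, or by two segments through [pt1] when it lies on the axis of [pt0]. *)
Lemma punctured_agree b sg sg' :
  (forall z, z != 0 -> good (patch b) sg z /\ good (patch b) sg' z) ->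
  (\forall w \near pt0, sg w = sg' w) -> forall z : 'rV[R]_2, z != 0 -> \forall w \near z, sg w = sg' w.
Proof.
move=> g e0 z z0.
have seg := @agree_segment _ (patch_sphere b) (patch_smooth b) (patch_immersive b) sg sg'.
  have main (z1 z2 : 'rV[R]_2) : (forall t : R, z1 + t *: (z2 - z1) != 0) -> (\forall w \near z1, sg w = sg' w) ->
    \forall w \near z2, sg w = sg' w.
  by move=> h; apply: seg => t _; exact: g.
have c (u v : 'rV[R]_2) t i : (u + t *: (v - u)) 0 i = u 0 i + t * (v 0 i - u 0 i) by rewrite !mxE.
pose pt1 : 'rV[R]_2 := delta_mx 0 i1.
have [p00 p01 p10 p11] : [/\ pt0 0 i0 = 1, pt0 0 i1 = 0, pt1 0 i0 = 0 & pt1 0 i1 = 1] by rewrite !mxE.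
have [z1|z1] := eqVneq (z 0 i1) 0.
  have zi0 : z 0 i0 != 0.
    by apply: contra z0 => /eqP h; apply/eqP/rowP => j; rewrite mxE; case: (ord2 j) => ->.
  apply: (main pt1); last apply: (main pt0) => //.
    move=> t; apply/eqP => /rowP h; have := h i0; have := h i1; rewrite !c z1 p10 p11 [RHS]mxE.
    rewrite sub0r mulrN1 => /eqP; rewrite subr_eq0 => /eqP <-.
    by rewrite subr0 mul1r add0r mxE => /eqP; rewrite (negbTE zi0).
  move=> t; apply/eqP => /rowP h; have := h i0; have := h i1; rewrite !c p00 p01 p10 p11 !mxE.
  rewrite subr0 mulr1 add0r => ->; rewrite mul0r addr0 => /eqP; by rewrite oner_eq0.
apply: (main pt0) => // t; apply/eqP => /rowP h; have := h i0; have := h i1; rewrite !c p00 p01 !mxE.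
rewrite subr0 add0r => /eqP; rewrite mulf_eq0 (negbTE z1) orbF => /eqP ->.
by rewrite mul0r addr0 => /eqP; rewrite oner_eq0.
Qed.

(** The Householder reflection along y - y'. *)
Lemma reflection (y y' : 'rV[R]_3) : dot y y = dot y' y' -> exists2 A, orth A & y *m A = y'.
Proof.
move=> e; pose v := y - y'; have [v0|v0] := eqVneq v 0.
  exists 1%:M; first by rewrite /orth trmx1 mulmx1.
  by rewrite mulmx1; apply/eqP; rewrite -subr_eq0; apply/eqP.
have d0 : dot v v != 0 by rewrite dot_eq0.
pose A : 'M[R]_3 := 1%:M - (2 / dot v v) *: (v^T *m v).
have uA (u : 'rV[R]_3) : u *m A = u - (2 / dot v v * dot u v) *: v.
  rewrite mulmxBr mulmx1 -scalemxAr mulmxA; congr (_ - _).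
  have -> : u *m v^T = (dot u v)%:M.
    apply/matrixP => i j; rewrite !ord1 [RHS]mxE eqxx mulr1n mxE.
    by apply: eq_bigr => l _; rewrite [in LHS]mxE.
  by rewrite mul_scalar_mx scalerA.
have tA : A^T = A by rewrite linearB /= trmx1 linearZ /= trmx_mul trmxK.
exists A.
  rewrite /orth tA; apply/row_matrixP => i; rewrite rowE mulmxA row1.
  move: (delta_mx 0 i : 'rV[R]_3) => u; rewrite !uA dotDl dotNl dotZl -[RHS]subr0 -addrA; congr (_ + _).
  rewrite -opprD -scalerDl; apply/eqP; rewrite eqr_opp scaler_eq0; apply/orP; left; apply/eqP.
  by move: d0; move: (dot v v) (dot u v) => a c a0; field.
rewrite uA; have -> : 2 / dot v v * dot y v = 1.
  have -> : dot v v = 2 * dot y v.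
    rewrite /v !(dotDl, dotDr, dotNl, dotNr) (dotC y' y) -e.
    by move: (dot y y) (dot y y') => a c; ring.
  have d1 : dot y v != 0.
    apply: contra d0 => /eqP h.
    have -> : dot v v = 2 * dot y v.
      rewrite /v !(dotDl, dotDr, dotNl, dotNr) (dotC y' y) -e.
      by move: (dot y y) (dot y y') => a c; ring.
    by rewrite h mulr0.
  by move: d1; move: (dot y v) => c c0; field.
by rewrite scale1r opprB addrC subrK.
Qed.

Definition sgood (s : 'rV[R]_3 -> M) y := exists a W V th psi, [/\ piece a W V th psi, V y &
  \forall y' \near y, S2 y' -> s y' = sect a psi y'].

Lemma sgood_good s b z : sgood s (patch b z) -> good (patch b) (s \o patch b) z.
Proof.
move=> [a [W [V [th [psi [pc Vz e]]]]]]; exists a, W, V, th, psi; split=> //.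
apply: filterS (phi_near (patch_smooth b) e) => w; apply; exact: patch_sphere.
Qed.

Lemma good_transport b sg z : z != 0 -> good (patch b) sg (inversion z) ->
  good (patch (~~ b)) (sg \o inversion) z.
Proof.
move=> z0 [a [W [V [th [psi [pc Vz e]]]]]]; exists a, W, V, th, psi.
split=> //; first by rewrite patch_inversion.
have n1 : \forall w \near z, sg (inversion w) = sect a psi (patch b (inversion w)).
  exact: continuous_inversion z0 _ e.
by apply: filterS2 n1 (near_neq0 z0) => w h w0; rewrite patch_inversion.
Qed.

Lemma patch_cover y : S2 y -> height y != pole true \/ height y != pole false.
Proof.
move=> _; have [e|] := eqVneq (height y) (pole true); last by left.
right; rewrite e /pole -subr_eq0 opprK -mulr2n mulrn_eq0 /=; by rewrite gt_eqF.
Qed.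

Lemma height_pt0 b : height (patch b pt0) = 0.
Proof.
have h : height (stereo pt0) = 0.
  have := congr1 height (patch_inversion true pt0_neq0).
  rewrite inversion_pt0 /patch /= height_flip => /eqP.
  by rewrite eq_sym -subr_eq0 opprK -mulr2n mulrn_eq0 /= => /eqP.
by case: b; rewrite /patch ?height_flip h ?oppr0.
Qed.

(** Agreement spreads over one stereographic patch; for the pole it misses, the other patch is
    started from an equatorial point where agreement is already known. *)
Lemma sgood_unique s s' y0 : (forall y, S2 y -> sgood s y) -> (forall y, S2 y -> sgood s' y) ->
  S2 y0 -> (\forall y \near y0, S2 y -> s y = s' y) -> forall y, S2 y -> s y = s' y.
Proof.
move=> gs gs' S0 e0.
have pat b z0 : (\forall y \near patch b z0, S2 y -> s y = s' y) ->
    forall y, S2 y -> height y != pole b -> s y = s' y.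
  move=> e y Sy hy; rewrite -(unpatchK Sy hy).
  have : \forall w \near unpatch b y, s (patch b w) = s' (patch b w).
    apply: (@agree_convex _ (patch_sphere b) (patch_smooth b) (patch_immersive b) setT (s \o patch b) (s' \o patch b) z0) => //.
      by move=> z _; split; apply: sgood_good; [apply: gs|apply: gs']; exact: patch_sphere.
    apply: filterS (phi_near (patch_smooth b) e) => w; apply; exact: patch_sphere.
  by move=> /nbhs_singleton.
have r0 : rho != 0 by rewrite gt_eqF.
have key b : height y0 != pole b -> forall y, S2 y -> s y = s' y.
  move=> h0; rewrite -(unpatchK S0 h0) in e0; have h1 := pat _ _ e0.
  move=> y Sy; have [e|/(h1 _ Sy)//] := eqVneq (height y) (pole b).
  apply: (pat (~~ b) pt0) => //; last first.
    by rewrite e; case: {h0 e0 h1 e} b; rewrite /pole /= -subr_eq0 ?opprK -?opprD ?oppr_eq0 -mulr2n mulrn_eq0.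
  have : \forall y' \near patch (~~ b) pt0, height y' != pole b.
    apply: (open_nbhs_nbhs (A := [set y' | height y' != pole b])); split; first exact: open_height.
    by rewrite /= height_pt0 /pole eq_sym; case: (b); rewrite ?oppr_eq0.
  by apply: filterS => y' h Sy'; exact: h1.
by case: (patch_cover S0) => /key.
Qed.

(** One germ is developed from the common base point in both stereographic patches; the two
    developments correspond under the inversion and glue. *)
Lemma global_section : exists s, forall y, S2 y -> sgood s y.
Proof.
have [p0 _] := @surface_nonempty R M.
have [a0 [W0 [V0 [th0 [psi0 [pc0 ap0 Wp0]]]]]] := locally_isometric p0.
have [S0 V00 _] := pc_th pc0 Wp0.
(* The initial germ is moved to the common base point of the two patches. *)
have [A oA eA] := reflection (etrans S0 (esym (patch_sphere true pt0))).
have pc := piece_rotate oA pc0.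
have pb b : patch b pt0 = patch true pt0.
  by case: b => //; rewrite (patch_inversion true) ?pt0_neq0// inversion_pt0.
have VA b : [set y | V0 (y *m A^T)] (patch b pt0) by rewrite /= pb -eA -mulmxA oA mulmx1.
set psi := (fun y => psi0 (y *m A^T)) in pc.
have g0 b : good (patch b) (sect a0 psi \o patch b) pt0.
  by exists a0, W0, [set y | V0 (y *m A^T)], (fun x => th0 x *m A), psi; split=> //; near=> z.
have ex b := develop (patch_sphere b) (patch_smooth b) (patch_immersive b) lip_gt0 (patch_lip b) (g0 b).
have [sg [gsg esg]] := ex true; have [tau [gtau etau]] := ex false.
have agr : forall z : 'rV[R]_2, z != 0 -> \forall w \near z, (sg \o inversion) w = tau w.
  apply: (punctured_agree (b := false)) => [z z0|].
    by split=> //; exact: (good_transport (b := true)).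
  have n1 : \forall z \near pt0, sg (inversion z) = sect a0 psi (patch true (inversion z)).
    have h := esg; rewrite -{1}inversion_pt0 in h.
    exact: continuous_inversion pt0_neq0 _ h.
  have n2 := near_neq0 pt0_neq0.
  near=> z; rewrite /= (near n1 z)// (near etau z)// -(patch_inversion true)//.
  by near: z.
(* The second development is needed only at the pole which the first patch misses. *)
exists (fun y => if height y == rho then tau (unpatch false y) else sg (unpatch true y)).
move=> y Sy; have [hy|hy] := eqVneq (height y) (pole true).
  have hy' : height y != pole false.
    by rewrite hy /pole -subr_eq0 opprK -mulr2n mulrn_eq0 /= gt_eqF.
  have [a [W [V [th [psi' [pc' Vz e]]]]]] := gtau (unpatch false y).
  rewrite (unpatchK Sy hy') in Vz; exists a, W, V, th, psi'; split=> //.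
  apply: filterS (unpatch_near hy' e) => w [ew hw] Sw.
  rewrite unpatchK// in ew; case: ifPn => // hw2.
  set z := unpatch false w in ew *; have ez : patch false z = w by exact: unpatchK.
  have z0 : z != 0.
    apply: contra hw2 => /eqP h; rewrite -ez h /patch height_flip /stereo height_hpoint.
    by rewrite dot0l addr0 sub0r divr1 mulrN1 opprK.
  have e2 : patch false z = patch true (inversion z) := patch_inversion true z0.
  have -> : unpatch true w = inversion z by rewrite -[w]ez e2 patchK.
  by rewrite -ew; exact: nbhs_singleton (agr z z0).
have [a [W [V [th [psi' [pc' Vz e]]]]]] := gsg (unpatch true y).
rewrite (unpatchK Sy hy) in Vz; exists a, W, V, th, psi'; split=> //.
apply: filterS (unpatch_near hy e) => w [ew hw] Sw.
by rewrite ifN// ew unpatchK.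
Unshelve. all: by end_near. Qed.

Lemma sphere_compact : compact S2.
Proof.
apply: (@bounded_closed_compact R 3).
  exists rho; split; first exact: num_real.
  move=> x rx y Sy; apply: norm_le_coord => [|j]; first by apply: le_trans (ltW rx); exact: ltW.
  apply: le_trans (ltW rx); rewrite -sqrtr_sqr ler_wsqrtr// -Sy /dot (bigD1 j)//= -expr2 lerDl.
  by rewrite sumr_ge0// => i _; rewrite -expr2 sqr_ge0.
apply: (@closed_comp _ _ (fun y : 'rV[R]_3 => dot y y) [set k^-1]).
  by move=> y _; exact: continuous_dot.
exact: closed_eq.
Qed.

(** * The global section as a covering and its deck transformations *)

Section Global.
Variable s : 'rV[R]_3 -> M.
Hypothesis gs : forall y, S2 y -> sgood s y.

Lemma section_near y (O : set M) : S2 y -> nbhs (s y) O -> \forall y' \near y, S2 y' -> O (s y').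
Proof.
move=> Sy nO; have [a [W [V [th [psi [pc Vy e]]]]]] := gs Sy.
rewrite (nbhs_singleton e Sy) in nO.
have n := near_sect pc Sy Vy nO.
by apply: filterS2 e n => w e1 e2 Sw; rewrite e1//; exact: e2.
Qed.

Lemma section_continuous : {within S2, continuous s}.
Proof. by apply/subspace_continuousP => y Sy O nO; exact: section_near. Qed.

Lemma section_image_closed : closed [set s y | y in S2].
Proof.
apply: compact_closed; first exact: (@surface_hausdorff R M).
exact: continuous_compact section_continuous sphere_compact.
Qed.

Lemma sect_surj_near y : S2 y -> \forall q \near s y, exists2 y', S2 y' & s y' = q.
Proof.
move=> Sy; have [a [W [V [th [psi [pc Vy e]]]]]] := gs Sy.
have [aq Wq eq_] := sectP pc Sy Vy.
rewrite (nbhs_singleton e Sy); set q := sect a psi y in aq Wq eq_ *.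
move/nbhs_ballP: e => [r /= r0 sub].
have oB : open (ball y r) by exact: ball_open.
have o := open_smooth_preimage (pc_openW pc) (pc_smooth pc) oB.
have n : \forall p \near q, chart_dom a p /\ [set x | W x /\ ball y r (th x)] (coord a p).
  by apply: near_chart => //; split=> //; rewrite eq_; exact: ballxx.
apply: filterS n => p [ap [Wp Bp]]; have [Sp _ _] := pc_th pc Wp.
by exists (th (coord a p)) => //; rewrite sub// (sect_th pc).
Qed.

(** The image is open because [s] is locally invertible, closed because the sphere is compact, and M
    is connected. *)
Lemma section_surj p : exists2 y, S2 y & s y = p.
Proof.
apply: (surface_ind (Q := fun p => exists2 y, S2 y & s y = p)).
- by exists (s (patch true pt0)), (patch true pt0) => //; exact: patch_sphere.
- by move=> q [y Sy <-]; exact: sect_surj_near.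
- move=> q nq; have o : open (~` [set s y | y in S2]) by apply: closed_openC; exact: section_image_closed.
  have : nbhs q (~` [set s y | y in S2]) by apply: open_nbhs_nbhs; split => // -[y Sy e]; apply: nq; exists y.
  by apply: filterS => w nw [y Sy e]; apply: nw; exists y.
Qed.

Lemma section_rotate A : orth A -> forall y, S2 y -> sgood (fun y => s (y *m A)) y.
Proof.
move=> oA y Sy; have [a [W [V [th [psi [pc Vy e]]]]]] := gs (sphere_orth oA Sy).
have := piece_rotate (orthV oA) pc; rewrite trmxK => pc'.
exists a, W, [set y | V (y *m A)], (fun x => th x *m A^T), (fun y => psi (y *m A)); split=> //.
have sm : smooth_on setT (fun y : 'rV[R]_3 => y *m A).
  by apply: smooth_on_mulmx; [exact: openT|exact: smooth_on_idfun openT].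
have n : \forall w \near y, S2 (w *m A) -> s (w *m A) = sect a psi (w *m A).
  exact: (continuous_smooth sm (I : setT y)) e.
by apply: filterS n => w h Sw; rewrite h//; exact: sphere_orth.
Qed.

Definition deck A := orth A /\ forall y, S2 y -> s (y *m A) = s y.

Lemma deckM A B : deck A -> deck B -> deck (A *m B).
Proof.
move=> [oA dA] [oB dB]; split; first by rewrite /orth trmx_mul mulmxA -(mulmxA A) oB mulmx1.
by move=> y Sy; rewrite mulmxA dB ?dA//; exact: sphere_orth.
Qed.

(** The pieces at y and y' are local isometries at the same point of M, so they differ by an
    orthogonal matrix A; then s after A agrees with s near y, hence everywhere by [sgood_unique]. *)
Lemma section_deck y y' : S2 y -> S2 y' -> s y = s y' -> exists2 A, deck A & y *m A = y'.
Proof.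
move=> Sy Sy' ss; have [a [W [V [th [psi [pc Vy e]]]]]] := gs Sy.
have [a' [W' [V' [th' [psi' [pc' Vy' e']]]]]] := gs Sy'.
have [aq Wq thq] := sectP pc Sy Vy; have [aq' Wq' thq'] := sectP pc' Sy' Vy'.
have es := nbhs_singleton e Sy; have es' := nbhs_singleton e' Sy'.
rewrite -es in aq Wq thq; rewrite -es' -ss in aq' Wq' thq'.
have [A oA nA] := piece_rigid pc pc' aq aq' Wq Wq'.
have yA : y *m A = y' by have [_ _ _ _] := nbhs_singleton nA; rewrite thq thq'.
exists A => //; split=> //; apply: (sgood_unique (section_rotate oA) gs Sy).
have sm : smooth_on setT (fun y : 'rV[R]_3 => y *m A).
  by apply: smooth_on_mulmx; [exact: openT|exact: smooth_on_idfun openT].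
have n1 : \forall w \near y, S2 (w *m A) -> s (w *m A) = sect a' psi' (w *m A).
  by rewrite -yA in e'; exact: (continuous_smooth sm (I : setT y)) e'.
have n2 := section_near Sy nA.
have n3 : \forall w \near y, V w by apply: open_nbhs_nbhs; split => //; exact: pc_openV pc.
have n4 : \forall w \near y, V w /\ (S2 w -> s w = sect a psi w) by exact: filterI n3 e.
apply: filterS3 n1 n2 n4 => w h1 h2 [Vw ew] Sw.
have SA := sphere_orth oA Sw.
have [bw bw' Ww Ww' eA] := h2 Sw; have [_ _ tw] := sectP pc Sw Vw.
rewrite -(ew Sw) in tw; rewrite tw in eA.
by rewrite h1// -eA (sect_th pc').
Qed.

(** Near a fixed point [s] is injective, so A fixes an open piece of the sphere pointwise, and such
    a piece spans the space. *)
Lemma deck_fixed A y : deck A -> S2 y -> y *m A = y -> A = 1%:M.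
Proof.
move=> [oA dA] Sy yA; have [a [W [V [th [psi [pc Vy e]]]]]] := gs Sy.
have sm : smooth_on setT (fun y : 'rV[R]_3 => y *m A).
  by apply: smooth_on_mulmx; [exact: openT|exact: smooth_on_idfun openT].
have n3 : \forall w \near y, V w by apply: open_nbhs_nbhs; split => //; exact: pc_openV pc.
have n1 : \forall w \near y, V w /\ (S2 w -> s w = sect a psi w) by exact: filterI n3 e.
have n2 : \forall w \near y, V (w *m A) /\ (S2 (w *m A) -> s (w *m A) = sect a psi (w *m A)).
  by have h := n1; rewrite -{1}yA in h; exact: (continuous_smooth sm (I : setT y)) h.
have n : \forall w \near y, S2 w -> w *m A = w.
  apply: filterS2 n1 n2 => w [Vw ew] [VA eA] Sw; have SA := sphere_orth oA Sw.
  have [_ _ t1] := sectP pc Sw Vw; have [_ _ t2] := sectP pc SA VA.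
  by rewrite -t2 -eA// dA// ew.
have [b hb] : exists b, height y != pole b by case: (patch_cover Sy); [exists true|exists false].
rewrite -(unpatchK Sy hb) in n; apply/eqP; rewrite -subr_eq0; apply/eqP.
apply: (phi_span (patch_sphere b) (patch_smooth b) (patch_immersive b) (z := unpatch b y)).
apply: filterS (phi_near (patch_smooth b) n) => w h.
by rewrite mulmxBr mulmx1 h ?subrr//; exact: patch_sphere.
Qed.

(** An eigenvector for the eigenvalue 1, rescaled to the sphere, is a fixed point. *)
Lemma deck_eigen A : deck A -> \det (A - 1%:M) = 0 -> A = 1%:M.
Proof.
move=> dA /eqP/det0P[v v0 vA]; have d0 : dot v v != 0 by rewrite dot_eq0.
have dp : 0 < dot v v by rewrite lt_neqAle eq_sym d0 dot_ge0.
apply: (deck_fixed (y := (rho / Num.sqrt (dot v v)) *: v) dA).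
  have sv : Num.sqrt (dot v v) * Num.sqrt (dot v v) = dot v v by rewrite -expr2 sqr_sqrtr// ltW.
  by rewrite /sphere /= dotZl dotZr mulrA mulrACA rho2 -mulrA -invfM sv mulVf// mulr1.
rewrite -scalemxAl; congr (_ *: _); apply/eqP; rewrite -subr_eq0; apply/eqP.
by rewrite -vA mulmxBr mulmx1.
Qed.

(** The square of A has determinant 1 in odd dimension, hence the eigenvalue 1, hence is the
    identity. If A - 1 is invertible, then (A - 1)(A + 1) = 0 leaves A = -1. *)
Lemma deck_pm A : deck A -> A = 1%:M \/ A = - 1%:M.
Proof.
move=> dA; have dAA := deckM dA dA; have oA := dA.1.
have AA : A *m A = 1%:M.
  apply: deck_eigen => //; set B := A *m A in dAA *; have oB := dAA.1.
  have dB : \det B = 1.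
    rewrite /B det_mulmx; have := congr1 determinant oA.
    by rewrite det_mulmx det_tr det1.
  have e : \det (B - 1%:M) = - \det (B - 1%:M).
    have e0 : B - 1%:M = - (B *m (B - 1%:M)^T).
      by rewrite linearB /= trmx1 mulmxBr mulmx1 oB opprB.
    by rewrite {1}e0 -scaleN1r detZ det_mulmx det_tr dB mul1r -signr_odd /= expr1 mulN1r.
  by move: e; move: (\det _) => x e; lra.
case: (eqVneq (\det (A - 1%:M)) 0) => [/(deck_eigen dA)|d0]; first by left.
right; have u : A - 1%:M \in unitmx by rewrite unitmxE unitfE.
apply/eqP; rewrite -subr_eq0 opprK -(mulKmx u (A + 1%:M)) mulmxDr mulmx1 mulmxBl mul1mx AA.
by rewrite addrA subrK subrr mulmx0.
Qed.

Lemma section_dichotomy : {in S2 &, injective s} \/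
  (forall y, S2 y -> s (- y) = s y) /\
  (forall y y', S2 y -> S2 y' -> s y = s y' -> y' = y \/ y' = - y).
Proof.
case: (pselect (deck (- 1%:M))) => [[_ d]|nd].
  right; split=> [y Sy|y y' Sy Sy' e]; first by rewrite -[- y]mulmx1 mulNmx -mulmxN d.
  have [A /deck_pm[]-> <-] := section_deck Sy Sy' e; first by left; rewrite mulmx1.
  by right; rewrite mulmxN mulmx1.
left=> y y' /set_mem Sy /set_mem Sy' e; have [A dA <-] := section_deck Sy Sy' e.
have [e1|e1] := deck_pm dA; first by rewrite e1 mulmx1.
by rewrite e1 in dA.
Qed.

End Global.
End Piece.

(** * Orientation *)

Section Germs.
Variables (R : realType) (n m : nat).
Implicit Types (F G : 'rV[R]_n -> 'rV[R]_m) (x : 'rV[R]_n).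

Lemma jmx_near F G x : (\forall y \near x, F y = G y) -> jmx F x = jmx G x.
Proof. by move=> e; apply/matrixP => i j; rewrite !jmxE (partial_near i e). Qed.

Lemma sff_near F G x i j : (\forall y \near x, F y = G y) -> sff F x i j = sff G x i j.
Proof.
move=> e; have eJ := jmx_near e.
have e2 : partial i (partial j F) x = partial i (partial j G) x.
  apply: partial_near; apply: filterS (near_join e) => y; exact: partial_near.
by rewrite /sff !normal_partE /normal_mx e2 eJ (nbhs_singleton e) /imetric (near_eq_smooth e).
Qed.

Lemma mean_curv_vec_near F G x : (\forall y \near x, F y = G y) -> mean_curv_vec F x = mean_curv_vec G x.
Proof.
move=> e; rewrite /mean_curv_vec /imetric (near_eq_smooth e); congr (_ *: _).
by apply: eq_bigr => i _; apply: eq_bigr => j _; rewrite (sff_near i j e).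
Qed.

Lemma mean_curv_near F G x : (\forall y \near x, F y = G y) -> mean_curv F x = mean_curv G x.
Proof. by move=> e; rewrite /mean_curv (mean_curv_vec_near e). Qed.

Lemma umbilical_near F G x : (\forall y \near x, F y = G y) -> umbilical_at F x -> umbilical_at G x.
Proof.
move=> e h i j; rewrite -[RHS](h i j) /traceless_sff (sff_near i j e) (mean_curv_vec_near e).
by rewrite (near_eq_smooth e).
Qed.

Lemma immersive_near F G x : (\forall y \near x, F y = G y) -> immersive_at F x -> immersive_at G x.
Proof. by move=> e; rewrite !immersive_jmx (jmx_near e). Qed.

End Germs.

Lemma gauss_curv_near (R : realType) m (F G : 'rV[R]_2 -> 'rV[R]_m) x :
  (\forall y \near x, F y = G y) -> gauss_curv F x = gauss_curv G x.
Proof.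
move=> e; have /nbhs_ballP[r /= r0 h] := near_join e.
apply: (@gauss_curv_metric _ _ _ (ball x r)); [exact: ball_open| |exact: ballxx].
by move=> y /h; exact: near_eq_smooth.
Qed.

Section Frame3.
Variable R : realType.
Implicit Types (F : 'rV[R]_2 -> 'rV[R]_3) (tau : 'rV[R]_2 -> 'rV[R]_2) (x : 'rV[R]_2).

(** For a spherical patch the position vector is the outer normal, so the sign tells whether the
    parametrization is oriented. *)
Definition frame3 F x : R := \det (col_mx (F x) (jmx F x) : 'M[R]_(1 + 2)).

Lemma frame3_near F F' x : (\forall y \near x, F y = F' y) -> frame3 F x = frame3 F' x.
Proof. by move=> e; rewrite /frame3 (jmx_near e) (nbhs_singleton e). Qed.

Lemma jmx_comp n p q (tau : 'rV[R]_n -> 'rV[R]_p) (F : 'rV[R]_p -> 'rV[R]_q) (x : 'rV[R]_n) :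
  differentiable tau x -> differentiable F (tau x) -> jmx (F \o tau) x = jmx tau x *m jmx F (tau x).
Proof.
move=> dt dF; apply/matrixP => i j; rewrite jmxE (differentiable_comp_partial i dt dF) summxE mxE.
by apply: eq_bigr => l _; rewrite mxE !jmxE.
Qed.

Lemma frame3_comp F tau x : differentiable tau x -> differentiable F (tau x) ->
  frame3 (F \o tau) x = \det (jmx tau x) * frame3 F (tau x).
Proof.
move=> dt dF; rewrite /frame3 (jmx_comp dt dF).
have -> : col_mx ((F \o tau) x) (jmx tau x *m jmx F (tau x)) =
    (block_mx 1%:M 0 0 (jmx tau x) : 'M[R]_(1 + 2)) *m col_mx (F (tau x)) (jmx F (tau x)).
  by rewrite mul_block_col !mul0mx mul1mx addr0 add0r.
by rewrite det_mulmx det_ublock det1 mul1r.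
Qed.

Lemma jmxN F x : differentiable F x -> jmx (fun y => - F y) x = - jmx F x.
Proof. by move=> dF; apply/matrixP => i j; rewrite [RHS]mxE !jmxE partialN// mxE. Qed.

Lemma frame3N F x : differentiable F x -> frame3 (fun y => - F y) x = - frame3 F x.
Proof.
move=> dF; rewrite /frame3 jmxN// -opp_col_mx -scaleN1r detZ.
by rewrite -signr_odd /= expr1 mulN1r.
Qed.

Lemma smooth_on_frame3 (W : set 'rV[R]_2) F : open W -> smooth_on W F -> smooth_on W (frame3 F).
Proof.
move=> oW sF; apply: smooth_on_det => // i j; case: (@splitP 1 2 i) => i' ei.
  apply: (@smooth_on_ext _ _ _ W (fun x => F x 0 j)) => //; last exact: (smooth_on_coord _ oW).1.
  move=> x _; have -> : i = lshift 2 i' by exact: val_inj.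
  by rewrite col_mxEu (ord1 i').
apply: (@smooth_on_ext _ _ _ W (fun x => partial i' F x 0 j)) => //.
  move=> x _; have -> : i = rshift 1 i' by exact: val_inj.
  by rewrite col_mxEd jmxE.
exact: (smooth_on_coord _ oW).1 (smooth_on_partial i' sF) j.
Qed.

Lemma near_pos n (u : 'rV[R]_n -> R) (x : 'rV[R]_n) : differentiable u x -> 0 < u x -> \forall y \near x, 0 < u y.
Proof.
move=> du ux; have c := differentiable_continuous du.
have pr : \forall r \near u x, 0 < r by apply: open_nbhs_nbhs; split; [exact: open_gt|].
exact: c pr.
Qed.

Lemma open_pos n (W : set 'rV[R]_n) (u : 'rV[R]_n -> R) : open W -> smooth_on W u ->
  open [set x | W x /\ 0 < u x].
Proof.
move=> oW su; rewrite openE => x [Wx ux].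
have n1 : \forall y \near x, W y by exact: open_nbhs_nbhs.
have n2 := near_pos (smooth_on_differentiable su Wx) ux.
by near=> y; split; near: y.
Unshelve. all: by end_near. Qed.

Lemma jacobian_jmx n m (F : 'rV[R]_n.+1 -> 'rV[R]_m.+1) (x : 'rV[R]_n.+1) : differentiable F x -> jacobian F x = jmx F x.
Proof. by move=> dF; apply/matrixP => i j; rewrite jmxE mxE partialE. Qed.

Lemma jmx_mulmx n m (B : 'M[R]_(n, m)) (x : 'rV[R]_n) : jmx (fun z : 'rV[R]_n => z *m B) x = B.
Proof.
have oT : open [set: 'rV[R]_n] by exact: openT.
have e : \forall z \near x, z *m B = id z *m B + 0 by apply: filterE => z; rewrite addr0.
rewrite (jmx_near e); apply/row_matrixP => i; rewrite rowK.
rewrite (partial_affine B 0 oT (smooth_on_idfun oT))// rowE; congr (_ *m _); apply/rowP => j.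
by rewrite -partial_coord// partial_id mxE eqxx /= eq_sym.
Qed.

End Frame3.

(* Restriction of a chart to [U], followed by a linear involution: the identity or a reflection. *)
Section ChartTwist.
Variables (R : realType) (M : topologicalType) (a : chart R M) (U : set 'rV[R]_2) (B : 'M[R]_2).
Hypotheses (oU : open U) (BB : B *m B = 1%:M).

Lemma chart_coord_continuous (b : chart R M) p : chart_dom b p -> {for p, continuous (coord b)}.
Proof.
move=> bp; have := @coord_continuous _ _ b.
by rewrite continuous_open_subspace; [move=> /(_ p (mem_set bp))|exact: chart_dom_open].
Qed.

Lemma chart_param_continuous (b : chart R M) x : chart_img b x -> {for x, continuous (param b)}.
Proof.
move=> bx; have := @param_continuous _ _ b.
by rewrite continuous_open_subspace; [move=> /(_ x (mem_set bx))|exact: chart_img_open].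
Qed.

Let mulB_continuous x : {for x, continuous (fun z : 'rV[R]_2 => z *m B)}.
Proof.
have oT : open [set: 'rV[R]_2] by exact: openT.
have sB : smooth_on setT (fun z : 'rV[R]_2 => z *m B).
  apply: smooth_on_ext (smooth_on_affine B 0 oT (smooth_on_idfun oT)) => // z _.
  by rewrite addr0.
exact: continuous_smooth sB I.
Qed.

Let mulBB (z : 'rV[R]_2) : z *m B *m B = z. Proof. by rewrite -mulmxA BB mulmx1. Qed.

Let dom := [set p | chart_dom a p /\ U (coord a p)].
Let img := [set z | chart_img a (z *m B) /\ U (z *m B)].

Let dom_open : open dom.
Proof.
rewrite openE => p [ap Up]; have n1 : \forall q \near p, chart_dom a q.
  by apply: open_nbhs_nbhs; split; [exact: chart_dom_open|].
have n2 : \forall q \near p, U (coord a q).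
  have h : \forall x \near coord a p, U x by exact: open_nbhs_nbhs.
  exact: chart_coord_continuous ap _ h.
by near=> q; split; near: q.
Unshelve. all: by end_near. Qed.

Let img_open : open img.
Proof.
rewrite openE => z [az Uz].
have n : \forall w \near z *m B, chart_img a w /\ U w.
  have n1 : \forall w \near z *m B, chart_img a w.
    by apply: open_nbhs_nbhs; split; [exact: chart_img_open|].
  have n2 : \forall w \near z *m B, U w by exact: open_nbhs_nbhs.
  by near=> w; split; near: w.
exact: mulB_continuous n.
Unshelve. all: by end_near. Qed.

Let coord_img' p : dom p -> img (coord a p *m B).
Proof. by move=> [ap Up]; rewrite /img /= mulBB; split=> //; exact: coord_img. Qed.

Let param_dom' z : img z -> dom (param a (z *m B)).
Proof. by move=> [az Uz]; rewrite /dom /= paramK//; split=> //; exact: param_dom. Qed.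

Let coordK' p : dom p -> param a (coord a p *m B *m B) = p.
Proof. by move=> [ap _]; rewrite mulBB coordK. Qed.

Let paramK' z : img z -> coord a (param a (z *m B)) *m B = z.
Proof. by move=> [az _]; rewrite paramK// mulBB. Qed.

Let coord_continuous' : {within dom, continuous (fun p => coord a p *m B)}.
Proof.
rewrite continuous_open_subspace// => p /set_mem[ap _].
exact: (continuous_comp (chart_coord_continuous ap) (@mulB_continuous _)).
Qed.

Let param_continuous' : {within img, continuous (fun z => param a (z *m B))}.
Proof.
rewrite continuous_open_subspace// => z /set_mem[az _].
exact: (continuous_comp (@mulB_continuous z) (chart_param_continuous az)).
Qed.

Definition twist : chart R M := Chart dom_open img_open coord_img' param_dom' coordK' paramK'
  coord_continuous' param_continuous'.

Lemma smooth_mulB n (W : set 'rV[R]_n) (F : 'rV[R]_n -> 'rV[R]_2) :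
  open W -> smooth_on W F -> smooth_on W (fun x => F x *m B).
Proof.
move=> oW sF; have := smooth_on_affine B 0 oW sF.
by apply: smooth_on_ext => // x _; rewrite addr0.
Qed.

Lemma twist_compatible (b : chart R M) : open (overlap b a) -> open (overlap a b) ->
  compatible b a -> compatible b twist.
Proof.
move=> oba oab [sba sab]; split.
  apply: (@smooth_on_sub _ _ _ (overlap b a)); first by move=> x [bx [ax _]].
  exact: smooth_mulB.
have oI : open (overlap twist b).
  rewrite openE => z [[az Uz] bz].
  have n1 : \forall w \near z, img w.
    by apply: open_nbhs_nbhs; split; [exact: img_open|split].
  have n2 : \forall w \near z *m B, overlap a b w by apply: open_nbhs_nbhs; split; [|split].
  have n3 := mulB_continuous n2.
  by apply: filterS2 n1 n3 => w ? [].
apply: (smooth_on_comp oI oab _ _ sab); first by move=> z [[az Uz] bz]; split.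
by apply: smooth_mulB => //; exact: smooth_on_idfun.
Qed.

End ChartTwist.

Section Orient.
Variables (R : realType) (M : closed_surface R) (theta : M -> 'rV[R]_3).
Hypothesis theta_smooth : smooth_into theta.
Hypothesis theta_frame : forall a, atlas a -> forall x, chart_img a x -> frame3 (theta \o param a) x != 0.

Let oriented : set (chart R M) := [set b | (forall a, atlas a -> compatible a b) /\
  smooth_on (chart_img b) (theta \o param b) /\
  forall x, chart_img b x -> 0 < frame3 (theta \o param b) x].

(** Neither chart need belong to the atlas; the transition is factored through an atlas chart around
    the point. *)
Lemma compatible_transition (b b' : chart R M) x :
  (forall a, @atlas R M a -> compatible a b) -> (forall a, @atlas R M a -> compatible a b') ->
  overlap b b' x -> differentiable (coord b' \o param b) x.
Proof.
move=> cb cb' bx; have [a aa ap] := @atlas_cover R M (param b x).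
have x1 : overlap b a x by split=> //; case: bx.
have nba : \forall y \near x, overlap b a y by apply: open_nbhs_nbhs; split => //; exact: open_overlap.
have d1 := smooth_on_differentiable (cb _ aa).2 x1.
have x2 : overlap a b' ((coord a \o param b) x) by apply: overlapP => //; case: bx.
have d2 := smooth_on_differentiable (cb' _ aa).1 x2.
apply: differentiable_near (differentiable_comp d1 d2).
by apply: filterS nba => y [_ ay]; rewrite /= coordK.
Qed.

(** Charts of positive [frame3] are coherent, because a transition multiplies it by the Jacobian.
    Around a point of negative sign an atlas chart is composed with a reflection. *)
Lemma frame_orientable : orientable M.
Proof.
exists oriented; split=> [p|a b aa [cb _]|b b' [cb [sb fb]] [cb' [sb' fb']] x bx]; last 2 first.
- exact: cb.
- have dt := compatible_transition cb cb' bx.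
  have b'x : chart_img b' ((coord b' \o param b) x) by apply: coord_img; case: bx.
  have nbb : \forall y \near x, overlap b b' y by apply: open_nbhs_nbhs; split => //; exact: open_overlap.
  have e : \forall y \near x, (theta \o param b) y = ((theta \o param b') \o (coord b' \o param b)) y.
    by apply: filterS nbb => y [_ b'y]; rewrite /= coordK.
  have := fb _ bx.1; rewrite (frame3_near e) (frame3_comp dt (smooth_on_differentiable sb' b'x)).
  by rewrite (jacobian_jmx dt) pmulr_lgt0// fb'.
have [a aa ap] := @atlas_cover R M p; have ax := coord_img ap.
have sa := theta_smooth aa; have oa := @chart_img_open _ _ a.
have sfr := smooth_on_frame3 oa sa.
have main (B : 'M[R]_2) : B *m B = 1%:M ->
    (0 < \det B * frame3 (theta \o param a) (coord a p)) -> exists2 b, oriented b & chart_dom b p.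
  (* A chart image need not be connected, so the chart is restricted to where the sign is right. *)
  move=> BB pos; pose U := [set x | chart_img a x /\ 0 < \det B * frame3 (theta \o param a) x].
  have oU : open U.
    by apply: open_pos => //; apply: smooth_onM => //; exact: smooth_on_cst.
  have oI : open [set z | chart_img a (z *m B) /\ U (z *m B)] by exact: (@chart_img_open _ _ (twist a oU BB)).
  have smB : smooth_on [set z | chart_img a (z *m B) /\ U (z *m B)] (fun z : 'rV[R]_2 => z *m B).
    by apply: smooth_mulB => //; exact: smooth_on_idfun.
  have sth : smooth_on [set z | chart_img a (z *m B) /\ U (z *m B)] ((theta \o param a) \o (fun z => z *m B)).
    by apply: (smooth_on_comp oI oa _ smB sa) => z [].
  exists (twist a oU BB); last by split.
  split; [|split].
  - move=> a' aa'; apply: twist_compatible; [exact: open_overlap|exact: open_overlap|].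
    exact: atlas_compatible.
  - exact: sth.
  - move=> z [az [_ Uz]].
    rewrite (_ : theta \o _ = (theta \o param a) \o (fun z => z *m B))//.
    rewrite frame3_comp ?jmx_mulmx//; first exact: smooth_on_differentiable smB _.
    exact: smooth_on_differentiable sa az.
have [h|h] := ltP 0 (frame3 (theta \o param a) (coord a p)).
  by apply: (main 1%:M); rewrite ?mulmx1 ?det1 ?mul1r.
pose B : 'M[R]_2 := @block_mx R 1 1 1 1 1%:M 0 0 (- 1%:M).
have dB : \det B = -1 by rewrite (@det_ublock R 1 1) det1 mul1r det_mx11 !mxE eqxx.
apply: (main B).
  rewrite /B (@mulmx_block R 1 1 1 1 1 1) !(mulmx0, mul0mx, mulmx1, mul1mx, addr0, add0r).
  by rewrite mulmxN mulmx1 opprK -(@scalar_mx_block R 1 1).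
by rewrite dB mulN1r oppr_gt0 lt_neqAle h andbT; exact: theta_frame.
Qed.

End Orient.

(** * The classification *)

Section Calabi.
Variables (R : realType) (N l : nat) (M : closed_surface R) (f : M -> 'rV[R]_N.+1).
Hypotheses (f_immersion : sphere_immersion f) (l_ge1 : (1 <= l)%N).
Variables (c : R) (v : 'rV[R]_N.+1) (P : 'M[R]_N.+1).
Hypothesis model : forall a x, atlas a -> chart_img a x -> model_at f l c v P a x.
Local Notation k := (calabi_curv l c).
Local Notation S2 := (sphere 2 k : set 'rV[R]_3).

Let f_smooth : smooth_into f. Proof. by case: f_immersion. Qed.
Let f_immersive : everywhere f (fun X x => immersive_at X x). Proof. by case: f_immersion. Qed.

Lemma model_gt0 : 0 < c.
Proof.
have [p0 _] := @surface_nonempty R M; have [a aa ap] := @atlas_cover R M p0.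
by have [r [th [_ _ /lm_gt0]]] := model aa (coord_img ap).
Qed.

Lemma calabi_curv_gt0 : 0 < k.
Proof.
have l0 : 0 < l%:R :> R by rewrite ltr0n.
by rewrite /calabi_curv divr_gt0 ?mulr_gt0 ?model_gt0// addr_gt0.
Qed.

Let k_gt0 := calabi_curv_gt0.

Lemma model_locally_isometric p : exists a W V th psi,
  [/\ piece f k a W V th psi, chart_dom a p & W (coord a p)].
Proof.
have [a aa ap] := @atlas_cover R M p.
have [r [th [r0 sub lm]]] := model aa (coord_img ap).
have oB : open (ball (coord a p) r) by exact: ball_open.
have [W [V [psi [pc Wp]]]] := piece_exists f_immersive k_gt0 aa oB sub (lm_smooth lm)
  (fun y By => conj (lm_sphere lm By) (lm_metric lm By)) (ballxx _ r0).
by exists a, W, V, th, psi.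
Qed.

Variable sec : 'rV[R]_3 -> M.
Hypothesis gs : forall y, S2 y -> sgood f k sec y.

Lemma section_piece y (U : set 'rV[R]_3) : S2 y -> open U -> U y -> exists a W V th psi,
  [/\ piece f k a W V th psi, V y, V `<=` U & forall x, W x -> sec (th x) = param a x].
Proof.
move=> Sy oU Uy; have [a [W [V [th [psi [pc Vy e]]]]]] := gs Sy.
move/nbhs_ballP: e => [r /= r0 sub].
have oB : open (ball y r `&` U) by apply: openI => //; exact: ball_open.
exists a, [set x | W x /\ (ball y r `&` U) (th x)], (V `&` (ball y r `&` U)), th, psi; split.
- exact: piece_restrict.
- by split=> //; split=> //; exact: ballxx.
- by move=> w [_ []].
- move=> x [Wx [Bx _]]; have [Sx _ e] := pc_th pc Wx.
  by rewrite sub// /sect /= e.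
Qed.

Lemma patch_lift (U : set 'rV[R]_2) X x0 : sphere_patch k U X -> U x0 -> exists a W V th psi U',
  [/\ piece f k a W V th psi, open U', U' x0, U' `<=` U &
    [/\ forall x, U' x -> W ((psi \o X) x), smooth_on U' (psi \o X),
      forall x, U' x -> (th \o (psi \o X)) x = X x &
      forall x, U' x -> sec (X x) = param a ((psi \o X) x)]].
Proof.
move=> [oU sX SX] Ux; have [S0 _] := SX _ Ux.
have [a [W [V [th [psi [pc Vy _ e]]]]]] := section_piece S0 openT I.
have oU' := open_smooth_preimage oU sX (pc_openV pc).
exists a, W, V, th, psi, [set x | U x /\ V (X x)]; split=> //; first by move=> x [].
split.
- by move=> x [/SX[Sx _] Vx]; have [] := pc_psi pc Sx Vx.
- apply: (smooth_on_comp oU' (pc_openV pc) _ _ (pc_inv_smooth pc)); first by move=> x [].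
  by apply: smooth_on_sub sX => x [].
- by move=> x [/SX[Sx _] Vx]; have [_] := pc_psi pc Sx Vx.
- move=> x [/SX[Sx _] Vx]; have [Wx ex] := pc_psi pc Sx Vx.
  by rewrite -{1}ex e.
Qed.

Local Notation g := (f \o sec).

Lemma lift_isometric (U : set 'rV[R]_2) X : sphere_patch k U X ->
  smooth_on U (g \o X) /\ forall x, U x -> metric (g \o X) x = metric X x.
Proof.
move=> hX; have lift x0 : U x0 -> exists U', [/\ open U', U' x0, smooth_on U' (g \o X) &
    metric (g \o X) x0 = metric X x0].
  move=> Ux; have [a [W [V [th [psi [U' [pc oU' U'x sub [h1 h2 h3 h4]]]]]]]] := patch_lift hX Ux.
  have sfa := smooth_on_sub (pc_img pc) (f_smooth (pc_atlas pc)).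
  exists U'; split=> //.
    apply: smooth_on_ext (smooth_on_comp oU' (pc_openW pc) h1 h2 sfa) => // x U'x' /=.
    by rewrite h4.
  have nU : \forall x \near x0, U' x by exact: open_nbhs_nbhs.
  have n1 : \forall x \near x0, (g \o X) x = ((f \o param a) \o (psi \o X)) x.
    by apply: filterS nU => x /h4 /= ->.
  have n2 : \forall x \near x0, (th \o (psi \o X)) x = X x by apply: filterS nU => x /h3.
  rewrite (near_eq_smooth n1) -(near_eq_smooth n2).
  rewrite (metric_reparam h1 h2 sfa U'x) (metric_reparam h1 h2 (pc_smooth pc) U'x).
  by rewrite (pc_metric pc (h1 _ U'x)).
split=> [|x /lift[U' []]//].
by apply: smooth_on_local => x /lift[U' [oU' Ux sU _]]; exists U'.
Qed.

Lemma lift_immersive (U : set 'rV[R]_2) X x : sphere_patch k U X -> U x -> immersive_at (g \o X) x.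
Proof.
move=> hX Ux; apply: metric_immersive ((lift_isometric hX).2 _ Ux) _.
by case: hX => _ _ /(_ _ Ux)[].
Qed.

(** The mean curvature vector is invariant under reparametrization, so the formula of the local
    model passes to patches of the sphere. *)
Lemma lift_mean_curv (U : set 'rV[R]_2) X x0 : sphere_patch k U X -> U x0 ->
  mean_curv_vec (g \o X) x0 = (g \o X) x0 - c *: ((g \o X) x0 - v).
Proof.
move=> hX Ux; have [a [W [V [th [psi [U' [pc oU' U'x sub [h1 h2 h3 h4]]]]]]]] := patch_lift hX Ux.
have sfa := smooth_on_sub (pc_img pc) (f_smooth (pc_atlas pc)).
have nU : \forall x \near x0, U' x by exact: open_nbhs_nbhs.
have n1 : \forall x \near x0, (g \o X) x = ((f \o param a) \o (psi \o X)) x.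
  by apply: filterS nU => x /h4 /= ->.
have Wx := h1 _ U'x; have ax := pc_img pc Wx.
rewrite (mean_curv_vec_near n1) (nbhs_singleton n1).
have im := immersive_near n1 (lift_immersive hX Ux).
have uJ := reparam_unit h1 h2 sfa U'x im.
have iX : immersive_at (f \o param a) ((psi \o X) x0) by apply: f_immersive => //; exact: pc_atlas pc.
have sph y : W y -> dot ((f \o param a) y) ((f \o param a) y) = 1^-1.
  by move=> _; have [h _ _] := f_immersion; exact: h.
rewrite (mean_curv_vec_reparam oU' (pc_openW pc) h1 h2 sfa U'x uJ iX sph).
have [r [th' [r0 _ lm]]] := model (pc_atlas pc) ax.
by rewrite (lm_mean_vec lm (ballxx _ r0)).
Qed.

Lemma model_point p : [/\ dot (f p) (f p) = 1, dot (f p - v) (f p - v) = c^-1 & (f p - v) *m P = f p - v].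
Proof.
have [a aa ap] := @atlas_cover R M p; have [h _ _] := f_immersion.
have [r [th [r0 _ lm]]] := model aa (coord_img ap).
have B := ballxx (coord a p) r0; split; first by have := h p; rewrite /sphere /= invr1.
- by have := lm_norm lm B; rewrite /= coordK.
- by have := lm_proj lm B; rewrite /= coordK.
Qed.

Lemma model_projection : [/\ P^T = P, P *m P = P, \tr P = (2 * l).+1%:R, v *m P = 0 &
  forall u d, (forall y, S2 y -> dot (g y) u = d) -> u *m P = 0].
Proof.
have [p0 _] := @surface_nonempty R M; have [a aa ap] := @atlas_cover R M p0.
have [r [th [_ _ lm]]] := model aa (coord_img ap); case: (lm) => _ _ _ _ _ Ps Pi Pt _ vP perp _ _ _ _.
split=> // u d h; apply: (perp u d) => x _.
by have [y Sy e] := section_surj k_gt0 gs (param a x); rewrite /= -e; exact: h.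
Qed.

Lemma model_basis : exists Q : 'M[R]_(N.+1, (2 * l).+1), Q *m Q^T = P /\ Q^T *m Q = 1%:M.
Proof.
have [Ps Pi Pt _ _] := model_projection.
have [|i j||E [E1 E2]] := @projection_basis R _ (2 * l).+1 (fun i j => P i j).
- by move=> i j; rewrite -[in LHS]Ps mxE.
- by rewrite -[in RHS]Pi mxE.
- exact: Pt.
exists (\matrix_(i, j) E i j); split; apply/matrixP => i j; rewrite !mxE.
  by rewrite -E1; apply: eq_bigr => a _; rewrite !mxE.
by rewrite -E2; apply: eq_bigr => a _; rewrite !mxE.
Qed.

Lemma model_germ a x : atlas a -> chart_img a x -> let X := f \o param a in
  [/\ c = 1 + mean_curv X x ^+ 2, gauss_curv X x = k & l = 1%N -> umbilical_at X x].
Proof.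
move=> aa ax X; have [r [th [r0 _ lm]]] := model aa ax; have B := ballxx x r0.
split; [exact: lm_mean lm _ B|exact: lm_gauss lm _ B|move=> l1; exact: lm_umbilical lm l1 _ B].
Qed.

(** * Factorization through Calabi's map *)

Section Factorization.
Variable Q : 'M[R]_(N.+1, (2 * l).+1).
Hypotheses (QP : Q *m Q^T = P) (Q1 : Q^T *m Q = 1%:M).
Let Psi y := g y *m Q + - (v *m Q).
Let iota z := z *m Q^T + v.

Let PsiE y : Psi y = (g y - v) *m Q. Proof. by rewrite mulmxBl. Qed.

Let Psi_sphere y : S2 y -> dot (Psi y) (Psi y) = c^-1.
Proof.
by move=> _; have [_ e1 e2] := model_point (sec y); rewrite PsiE dot_mulmx -mulmxA QP e2.
Qed.

Let Psi_partial (U : set 'rV[R]_2) X i x : sphere_patch k U X -> U x ->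
  partial i (g \o X) x *m (Q *m Q^T) = partial i (g \o X) x.
Proof.
move=> hX Ux; have [sg _] := lift_isometric hX; have [oU _ _] := hX.
have [_ _ _ vP _] := model_projection.
rewrite QP -(partial_affine P v oU sg i Ux); apply: partial_near.
apply: filterE => y; have [_ _ e] := model_point (sec (X y)).
have e' : (g \o X) y *m P = (g \o X) y - v by rewrite -[RHS]e mulmxBl vP subr0.
by rewrite e' subrK.
Qed.

Lemma Psi_calabi : @calabi_sphere R l c Psi.
Proof.
split.
- split; first exact: Psi_sphere.
  move=> U X hX; have [sg mg] := lift_isometric hX; have [oU _ _] := hX.
  split; first exact: smooth_on_affine.
  move=> x Ux; rewrite -(mg _ Ux).
  exact: (metric_affine _ oU sg (fun i x Ux => Psi_partial i hX Ux) Ux).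
- move=> U X hX x Ux; have [sg mg] := lift_isometric hX; have [oU _ SX] := hX.
  have s1 y : U y -> dot ((g \o X) y) ((g \o X) y) = 1^-1.
    by move=> _; rewrite invr1; have [] := model_point (sec (X y)).
  have s2 y : U y -> dot ((g \o X) y *m Q + - (v *m Q)) ((g \o X) y *m Q + - (v *m Q)) = c^-1.
    by move=> /SX[Sy _]; exact: Psi_sphere.
  have := mean_curv_vec_affine oU sg (fun x Ux => lift_immersive hX Ux)
    (fun i x Ux => Psi_partial i hX Ux) s1 s2 (isT : (0 < 2)%N) Ux.
  (* Minimality: the mean curvature in the unit sphere is g - c (g - v), and the radial correction
     for passing to the sphere of curvature c cancels it exactly. *)
  move=> e; apply: etrans e _; rewrite (lift_mean_curv hX Ux) scale1r.
  rewrite mulmxBl -scalemxAl mulmxBl; move: ((g \o X) x *m Q) (v *m Q) => a b.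
  by rewrite addrA subrK subrr.
(* A hyperplane containing the image would give a vector of the range of [P] with constant product
   with f, which fullness excludes. *)
- move=> u d u0 h; have [_ _ _ _ perp] := model_projection.
  have : u *m Q^T *m P = 0.
    apply: (perp _ (d + dot (v *m Q) u)) => y Sy.
    by rewrite -(h _ Sy) PsiE mulmxBl dotDl dotNl subrK dot_mulmx.
  rewrite -QP mulmxA -(mulmxA u) Q1 mulmx1 => e; move/eqP: u0; apply.
  by rewrite -[u]mulmx1 -Q1 mulmxA e mul0mx.
Qed.

Let dot_center z : dot (z *m Q^T) v = 0.
Proof.
have [Ps _ _ vP _] := model_projection.
have -> : z *m Q^T = z *m Q^T *m P by rewrite -QP -!mulmxA (mulmxA Q^T) Q1 mul1mx.
by rewrite dot_mulmx Ps vP dotC dot0l.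
Qed.

Let norm_center : dot v v = 1 - c^-1.
Proof.
have [Ps _ _ vP _] := model_projection; have [p _] := @surface_nonempty R M.
have [e1 e2 e3] := model_point p.
have o : dot (f p - v) v = 0 by rewrite -e3 dot_mulmx Ps vP dotC dot0l.
move: e1; rewrite -{1 2}[f p](subrK v); move: (f p - v) e2 o => w e2 o.
by rewrite dotDl !dotDr e2 o (dotC v) o add0r addr0 => <-; rewrite [c^-1 + _]addrC addrK.
Qed.

Lemma iota_sphere z : dot z z = c^-1 -> dot (iota z) (iota z) = 1^-1.
Proof.
move=> dz; have o := dot_center z; have n := norm_center; rewrite /iota.
have e : dot (z *m Q^T) (z *m Q^T) = c^-1 by rewrite dot_mulmx trmxK -mulmxA Q1 mulmx1.
move: (z *m Q^T) o e => w o e.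
by rewrite dotDl !dotDr e o (dotC v) o n add0r addr0 addrC subrK invr1.
Qed.

Lemma iota_umbilical : umbilical_inclusion c iota.
Proof.
have QQ : Q^T *m Q^T^T = 1%:M by rewrite trmxK.
split.
- split; first by move=> y Sy; exact: iota_sphere.
  move=> U X [oU sX SX]; split; first exact: smooth_on_affine.
  move=> x Ux; apply: (metric_affine v oU sX _ Ux) => i y _; by rewrite QQ mulmx1.
- move=> U X [oU sX SX] x Ux.
  have s2 y : U y -> dot (X y *m Q^T + v) (X y *m Q^T + v) = 1^-1.
    by move=> /SX[Sy _]; exact: iota_sphere.
  apply: (umbilical_affine _ oU sX (fun y Uy => (SX y Uy).2) QQ model_gt0 ltr01 _ s2 Ux) => //.
    by rewrite muln_gt0.
  by move=> y /SX[].
- by move=> z z' _ _ /addIr e; rewrite -[z]mulmx1 -[z']mulmx1 -Q1 !mulmxA e.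
Qed.

Lemma factorization y : g y = iota (Psi y) *m 1%:M.
Proof. by rewrite mulmx1 /iota PsiE -mulmxA QP; have [_ _ ->] := model_point (sec y); rewrite subrK. Qed.

End Factorization.

Lemma sphere_classified (M1 : closed_surface R) (f1 : M1 -> 'rV[R]_N.+1) (theta : M1 -> 'rV[R]_3) :
  isometry_onto_sphere f1 k theta -> (forall p, f1 p = g (theta p)) ->
  everywhere f1 (fun X x => [/\ c = 1 + mean_curv X x ^+ 2, gauss_curv X x = k &
    l = 1%N -> umbilical_at X x]) -> classified f1.
Proof.
move=> iso e germ; have [l1|l1] := eqVneq l 1%N.
  left=> a aa x ax; have [hc hk /(_ l1) hu] := germ a aa x ax; split=> //.
  by rewrite hk -hc /calabi_curv l1 mul1r mulrAC divff ?mul1r// pnatr_eq0.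
have [Q [QP Q1]] := model_basis.
right; exists l, c; split.
- by rewrite ltn_neqAle eq_sym l1.
- by move=> a aa x ax; have [] := germ a aa x ax.
- by move=> a aa x ax; have [hc hk _] := germ a aa x ax; rewrite hk -hc.
exists theta, (fun y => g y *m Q + - (v *m Q)), (fun z => z *m Q^T + v), 1%:M; split=> //.
- exact: Psi_calabi.
- exact: iota_umbilical.
- by rewrite trmx1 mulmx1.
- by move=> p; rewrite e; exact: factorization.
Qed.

(** * Orientability and the antipodal map *)

Lemma plane_connected : connected [set: 'rV[R]_2].
Proof.
have -> : [set: 'rV[R]_2] = \bigcup_(z in setT) [set 0 + t *: (z - 0) | t in `[0, 1]%classic].
  apply/seteqP; split=> // z _; exists z => //; exists 1; last by rewrite subr0 scale1r add0r.
  by rewrite /= in_itv /= lexx ler01.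
apply: bigcup_connected => [|z _]; last exact: segment_set_connected.
exists 0 => z _; exists 0; last by rewrite scale0r addr0.
by rewrite /= in_itv /= lexx ler01.
Qed.

Lemma plane_ind (Q : 'rV[R]_2 -> Prop) z0 : Q z0 -> (forall z, Q z -> \forall w \near z, Q w) ->
  (forall z, ~ Q z -> \forall w \near z, ~ Q w) -> forall z, Q z.
Proof.
move=> Q0 oQ cQ z; suff : [set w | Q w] = [set: 'rV[R]_2] by move=> /seteqP[_ /(_ z I)].
apply: plane_connected; first by exists z0.
- exists [set w | Q w]; last by rewrite setTI.
  by rewrite openE => w Qw; exact: oQ.
- exists [set w | Q w]; last by rewrite setTI.
  rewrite -[X in closed X]setCK; apply: open_closedC; rewrite openE => w nQw.
  exact: cQ.
Qed.

Local Notation F := (patch k true).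

Lemma stereo_opp z : stereo k (- z) = hpoint (- hproj (stereo k z)) (height (stereo k z)).
Proof. by rewrite /stereo hproj_hpoint height_hpoint dotNl dotNr opprK scalerN. Qed.

Lemma opp_hpoint (u : 'rV[R]_2) h : - hpoint u h = hpoint (- u) (- h).
Proof.
rewrite /hpoint (@opp_row_mx R 1 2 1); congr (@row_mx R 1 2 1 _ _).
by apply/matrixP => i j; rewrite !mxE mulNrn.
Qed.

Lemma opp_patch z : z != 0 -> - F z = F (inversion (- z)).
Proof.
move=> z0; have nz0 : - z != 0 by rewrite oppr_eq0.
rewrite -(patch_inversion k true nz0) /patch /= stereo_opp hpoint_flip -opp_hpoint.
by rewrite hpointK.
Qed.

Lemma patch_sphere_patch : sphere_patch k setT F.
Proof.
split; [exact: openT|exact: patch_smooth|].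
by move=> z _; split; [exact: patch_sphere|exact: patch_immersive].
Qed.

Lemma patch_frame_neq0 z : frame3 F z != 0.
Proof.
have := sphere_frame_unit openT (patch_smooth k true) (fun z _ => patch_immersive k_gt0 true z) k_gt0
  (fun z _ => patch_sphere k_gt0 true z) (I : setT z).
by rewrite unitmxE unitfE.
Qed.

Lemma smooth_on_jacobian (U : set 'rV[R]_2) (tau : 'rV[R]_2 -> 'rV[R]_2) : open U -> smooth_on U tau ->
  smooth_on U (fun x => \det (jmx tau x)).
Proof.
move=> oU st; apply: smooth_on_det => // i j.
apply: (@smooth_on_ext _ _ _ U (fun x => partial i tau x 0 j)) => //; first by move=> x _; rewrite jmxE.
exact: (smooth_on_coord _ oU).1 (smooth_on_partial i st) j.
Qed.

(** Charts of an orientation are only compatible with the atlas, so the coordinate expression passes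
    through an atlas chart; the Jacobians of the lift and of the transition are both invertible. *)
Lemma section_coord (b : chart R M) z : (forall a, @atlas R M a -> compatible a b) ->
  chart_dom b (sec (F z)) -> exists U, [/\ open U, U z, smooth_on U (coord b \o (sec \o F)),
    forall w, U w -> chart_dom b (sec (F w)) & \det (jmx (coord b \o (sec \o F)) z) != 0].
Proof.
move=> cb bz; have hF := patch_sphere_patch.
have [a [W [V [th [psi [U' [pc oU' U'z _ [h1 h2 h3 h4]]]]]]]] := patch_lift hF (I : setT z).
have aa := pc_atlas pc; have sab := (cb _ aa).1; have oab := @open_overlap R M a b.
set tau := psi \o F in h1 h2 h3 h4.
have oU := open_smooth_preimage oU' h2 oab.
have Uz : U' z /\ overlap a b (tau z).
  split=> //; split; first exact: pc_img pc _ (h1 _ U'z).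
  by rewrite /preimage /= -[param a (tau z)]h4.
have e w : U' w /\ overlap a b (tau w) -> ((coord b \o param a) \o tau) w = (coord b \o (sec \o F)) w.
  by move=> [U'w _]; rewrite /= -[sec (F w)]/(sec (F w)) h4.
have st : smooth_on [set w | U' w /\ overlap a b (tau w)] tau by apply: smooth_on_sub h2 => w [].
exists [set w | U' w /\ overlap a b (tau w)]; split=> //.
- apply: smooth_on_ext (smooth_on_comp oU oab _ st sab) => // w [].
  by [].
- by move=> w [U'w [_]]; rewrite /preimage /= h4.
have nU : \forall w \near z, U' w /\ overlap a b (tau w) by apply: open_nbhs_nbhs.
have ne : \forall w \near z, (coord b \o (sec \o F)) w = ((coord b \o param a) \o tau) w.
  by apply: filterS nU => w /e.
rewrite (jmx_near ne); have dt := smooth_on_differentiable st Uz.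
have dab := smooth_on_differentiable sab Uz.2.
rewrite (jmx_comp dt dab) det_mulmx mulf_neq0//.
  rewrite -unitfE -unitmxE.
  have sfa := smooth_on_sub (pc_img pc) (f_smooth aa).
  apply: (reparam_unit h1 h2 sfa U'z); apply: immersive_near (lift_immersive hF (I : setT z)).
  have nU' : \forall w \near z, U' w by exact: open_nbhs_nbhs.
  by apply: filterS nU' => w U'w; rewrite /= h4.
have bx : overlap b a ((coord b \o param a) (tau z)).
  by apply: overlapP; [case: Uz.2|apply: param_dom; case: Uz.2].
have dba := smooth_on_differentiable (cb _ aa).2 bx.
have nab : \forall x \near tau z, overlap a b x by apply: open_nbhs_nbhs; split => //; exact: Uz.2.
have eid : \forall x \near tau z, ((coord a \o param b) \o (coord b \o param a)) x = x *m 1%:M.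
  by apply: filterS nab => x [ax bx']; rewrite /= coordK// paramK// mulmx1.
have := jmx_near eid; rewrite (jmx_comp dab dba) jmx_mulmx => /(congr1 determinant).
rewrite det_mulmx det1 => e1; apply/eqP => e0; move: e1; rewrite e0 mul0r => /eqP.
by rewrite eq_sym oner_eq0.
Qed.

Lemma smooth_inversion : smooth_on [set z : 'rV[R]_2 | z != 0] (@inversion R).
Proof.
have o0 : open [set z : 'rV[R]_2 | z != 0] by rewrite openE => z; exact: near_neq0.
apply/(smooth_on_coord _ o0) => j.
apply: (@smooth_on_ext _ _ _ _ (fun z => (dot z z)^-1 * z 0 j)) => //; first by move=> z _; rewrite mxE.
apply: smooth_onM => //; last exact: smooth_on_id.
apply: smooth_on_inv => // [z z0|]; first by rewrite dot_eq0.
by apply: smooth_on_dot => //; exact: smooth_on_idfun.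
Qed.

Let reversal_mul (d a b p q : R) : a = d * b -> - p = d * q -> a * p = - (d ^+ 2 * (b * q)).
Proof. by move=> -> e; rewrite -[p]opprK e; ring. Qed.

Let reversal_pos (d x y : R) : x = - (d ^+ 2 * y) -> 0 < x -> 0 < y -> False.
Proof. by move=> -> h y0; move: h; rewrite oppr_gt0 ltNge mulr_ge0 ?sqr_ge0// ltW. Qed.

Let reversal_neg (d x y : R) : x = - (d ^+ 2 * y) -> 0 < - x -> 0 < - y -> False.
Proof.
move=> -> h y0; move: h; rewrite opprK ltNge mulr_ge0_le0 ?sqr_ge0// ltW// -oppr_gt0.
by [].
Qed.

(* In stereographic coordinates the antipodal map is [kappa z = - z / |z|^2]. For an oriented atlas, the
   sign of [u], which compares the orientation of M with that of the sphere through [sec], would be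
   constant on the plane, but [kappa] reverses it. *)
Lemma antipodal_nonorientable : (forall y, S2 y -> sec (- y) = sec y) -> ~ orientable M.
Proof.
move=> anti [B [covB compB jacB]].
have cB b : B b -> forall a, @atlas R M a -> compatible a b by move=> Bb a aa; exact: compB.
pose G (b : chart R M) := coord b \o (sec \o F).
pose u (b : chart R M) z := \det (jmx (G b) z) * frame3 F z.
have un b z : B b -> chart_dom b (sec (F z)) -> u b z != 0.
  move=> Bb bz; have [U [_ _ _ _ h]] := section_coord (cB _ Bb) bz.
  by rewrite mulf_neq0// patch_frame_neq0.
have un_near b z : B b -> chart_dom b (sec (F z)) ->
    [/\ differentiable (u b) z & \forall w \near z, chart_dom b (sec (F w))].
  move=> Bb bz; have [U [oU Uz sU hU h]] := section_coord (cB _ Bb) bz; split.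
    apply: (@smooth_on_differentiable _ _ _ U) => //; apply: smooth_onM => //.
      exact: smooth_on_jacobian.
    by apply: smooth_on_frame3 => //; apply: smooth_on_sub (patch_smooth k true).
  have nU : \forall w \near z, U w by exact: open_nbhs_nbhs.
  exact: filterS nU.
(* Changing the oriented chart multiplies [u] by a positive Jacobian, so its sign depends on [z]
   alone. *)
have indep b b' z : B b -> B b' -> chart_dom b (sec (F z)) -> chart_dom b' (sec (F z)) ->
    0 < u b z -> 0 < u b' z.
  move=> Bb Bb' bz b'z; have [U [oU Uz sU hU _]] := section_coord (cB _ Bb) bz.
  have ob : overlap b b' (G b z) by exact: overlapP.
  have dt := compatible_transition (cB _ Bb) (cB _ Bb') ob.
  have nU : \forall w \near z, U w by exact: open_nbhs_nbhs.
  have e : \forall w \near z, G b' w = ((coord b' \o param b) \o G b) w.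
    by apply: filterS nU => w /hU bw; rewrite /G /= coordK.
  have J0 := jacB _ _ Bb Bb' _ ob; rewrite (jacobian_jmx dt) in J0.
  have dG := smooth_on_differentiable sU Uz.
  rewrite /u (jmx_near e) (jmx_comp dG dt) det_mulmx.
  by move=> h; rewrite mulrAC pmulr_lgt0.
pose Q z := exists b, [/\ B b, chart_dom b (sec (F z)) & 0 < u b z].
have QN b z : B b -> chart_dom b (sec (F z)) -> ~ Q z -> 0 < - u b z.
  move=> Bb bz nQ; rewrite oppr_gt0 lt_neqAle un//= leNgt; apply/negP => h.
  by apply: nQ; exists b.
have oQ z : Q z -> \forall w \near z, Q w.
  move=> [b [Bb bz h]]; have [du nb] := un_near _ _ Bb bz.
  have np := near_pos du h.
  by apply: filterS2 nb np => w bw hw; exists b.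
have cQ z : ~ Q z -> \forall w \near z, ~ Q w.
  move=> nQ; have [b Bb bz] := covB (sec (F z)); have [du nb] := un_near _ _ Bb bz.
  have dNu : differentiable (fun w => - u b w) z by exact: differentiableN.
  have np := near_pos dNu (QN _ _ Bb bz nQ).
  apply: filterS2 nb np => w bw hw [b' [Bb' b'w hw']].
  have := indep _ _ _ Bb' Bb b'w bw hw'; rewrite oppr_gt0 in hw.
  by rewrite ltNge (ltW hw).
pose kappa (z : 'rV[R]_2) := inversion (- z).
pose w := kappa (pt0 R).
have n0 := near_neq0 (pt0_neq0 R).
have ek : \forall z \near pt0 R, sec (F (kappa z)) = sec (F z).
  by apply: filterS n0 => z z0; rewrite -opp_patch// anti//; exact: patch_sphere.
have [b Bb bz] := covB (sec (F (pt0 R))).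
have bw : chart_dom b (sec (F w)) by rewrite (nbhs_singleton ek).
have dk : differentiable kappa (pt0 R).
  have dN : differentiable (fun z : 'rV[R]_2 => - z) (pt0 R) by exact: differentiableN.
  apply: (differentiable_comp (g := @inversion R)) => //.
  by apply: smooth_on_differentiable smooth_inversion _; rewrite /= oppr_eq0 pt0_neq0.
have [U [_ Uw sU _ _]] := section_coord (cB _ Bb) bw.
have dGw : differentiable (G b) (kappa (pt0 R)) := smooth_on_differentiable sU Uw.
have dF z : differentiable F z by exact: smooth_on_differentiable (patch_smooth k true) I.
have e1 : \det (jmx (G b) (pt0 R)) = \det (jmx kappa (pt0 R)) * \det (jmx (G b) w).
  have e : \forall z \near pt0 R, G b z = (G b \o kappa) z by apply: filterS ek => z; rewrite /G /= => ->.
  by rewrite (jmx_near e) (jmx_comp dk dGw) det_mulmx.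
have e2 : - frame3 F (pt0 R) = \det (jmx kappa (pt0 R)) * frame3 F w.
  have e : \forall z \near pt0 R, - F z = (F \o kappa) z by apply: filterS n0 => z; exact: opp_patch.
  by rewrite -frame3N// (frame3_near e) frame3_comp.
(* Both factors of [u] acquire the Jacobian of [kappa], and the position vector changes sign
   once. *)
have e3 : u b (pt0 R) = - (\det (jmx kappa (pt0 R)) ^+ 2 * u b w).
  exact: reversal_mul e1 e2.
case: (pselect (Q (pt0 R))) => [Q0|nQ0].
  have [b' [Bb' b'w uw]] := plane_ind Q0 oQ cQ w.
  have [b2 [Bb2 b2z u2]] := Q0.
  have h1 := indep _ _ _ Bb' Bb b'w bw uw; have h2 := indep _ _ _ Bb2 Bb b2z bz u2.
  exact: reversal_pos e3 h2 h1.
have nQw : ~ Q w.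
  move=> Qw; apply: nQ0; exact: (plane_ind Qw oQ cQ).
have h1 := QN _ _ Bb bz nQ0; have h2 := QN _ _ Bb bw nQw.
exact: reversal_neg e3 h1 h2.
Qed.

Lemma isometry_orientable (M1 : closed_surface R) (f1 : M1 -> 'rV[R]_N.+1) (theta : M1 -> 'rV[R]_3) :
  everywhere f1 (fun X x => immersive_at X x) -> isometry_onto_sphere f1 k theta -> orientable M1.
Proof.
move=> im [[th0 _ _] sth mth]; apply: (frame_orientable sth) => a aa x ax.
have imt y : chart_img a y -> immersive_at (theta \o param a) y.
  by move=> ay; apply: metric_immersive (mth a aa y ay) _; exact: im.
have := sphere_frame_unit (@chart_img_open _ _ a) (sth a aa) imt k_gt0 (fun y _ => th0 _ I) ax.
by rewrite unitmxE unitfE.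
Qed.

Lemma injective_case : {in S2 &, injective sec} -> orientable M /\ classified f.
Proof.
move=> inj; have /choice[theta hth] : forall p, exists y, S2 y /\ sec y = p.
  by move=> p; have [y Sy e] := section_surj k_gt0 gs p; exists y.
have injS y y' : S2 y -> S2 y' -> sec y = sec y' -> y = y'.
  by move=> Sy Sy'; apply: inj; exact: mem_set.
(* The inverse of [sec] is chosen pointwise; injectivity forces it to coincide locally with a piece,
   hence to be smooth and isometric. *)
have lift a x : atlas a -> chart_img a x -> exists U, [/\ open U, U x, smooth_on U (theta \o param a) &
    metric (theta \o param a) x = metric (f \o param a) x].
  move=> aa ax; have [Sy ey] := hth (param a x).
  have [a0 [W0 [V0 [th0 [psi0 [pc Vy _ e0]]]]]] := section_piece Sy openT I.
  have [oU sU mU] := isometry_transfer f_smooth aa (pc_atlas pc) (pc_openW pc) (pc_img pc) (pc_smooth pc) (pc_metric pc).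
  set U := [set x | _ /\ _] in oU sU mU.
  have [Wy ty] := pc_psi pc Sy Vy.
  have ep : param a0 (psi0 (theta (param a x))) = param a x by rewrite -e0// ty.
  have Ux : U x.
    split; first by split=> //; rewrite /preimage /= -ep; apply: param_dom; exact: pc_img pc _ Wy.
    by rewrite -ep paramK//; exact: pc_img pc _ Wy.
  have e w : U w -> (th0 \o (coord a0 \o param a)) w = (theta \o param a) w.
    move=> [[_ a0w] Ww]; have [Sw _ _] := pc_th pc Ww; have [Sw' ew] := hth (param a w).
    by apply: injS => //; rewrite /= ew e0// coordK.
  exists U; split=> //; first exact: smooth_on_ext sU.
  rewrite -(mU _ Ux); apply: near_eq_smooth.
  have nU : \forall w \near x, U w by exact: open_nbhs_nbhs.
  by apply: filterS nU => w /e.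
have iso : isometry_onto_sphere f k theta.
  split.
  - split=> [p _|p p' _ _ e|y Sy]; first by have [] := hth p.
      by have [_ <-] := hth p; have [_ <-] := hth p'; rewrite e.
    by exists (sec y) => //; apply: injS => //; have [] := hth (sec y).
  - by move=> a aa; apply: smooth_on_local => x /(lift a x aa)[U [oU Ux sU _]]; exists U.
  - by move=> a aa x /(lift a x aa)[U []].
split; first exact: isometry_orientable iso.
apply: (sphere_classified iso); last by move=> a aa x ax; exact: model_germ.
by move=> p; have [_ e] := hth p; rewrite /= e.
Qed.

(** * The two-sheeted cover by the sphere *)

Local Notation T := (set_type (sphere 2 k : set 'rV[R]_3)).

(** A total map into the subtype, with a default value off the sphere, so that charts are written
    without carrying membership proofs. *)
Definition lift_pt (y : 'rV[R]_3) : T :=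
  if pselect (S2 y) is left h then SigSub (mem_set h)
  else SigSub (mem_set (patch_sphere k_gt0 true (pt0 R))).

Lemma val_lift y : S2 y -> \val (lift_pt y) = y.
Proof. by move=> Sy; rewrite /lift_pt; case: pselect. Qed.

Lemma sphere_val (p : T) : S2 (\val p).
Proof. by apply/set_mem; exact: valP. Qed.

Lemma lift_val (p : T) : lift_pt (\val p) = p.
Proof. by apply: val_inj; rewrite val_lift//; exact: sphere_val. Qed.

Lemma val_continuous : continuous (\val : T -> 'rV[R]_3).
Proof. exact: initial_continuous. Qed.

Lemma lift_near (X : topologicalType) (h : X -> 'rV[R]_3) x : {for x, continuous h} ->
  (\forall w \near x, S2 (h w)) -> {for x, continuous (lift_pt \o h)}.
Proof.
move=> ch Sh U [B [[W oW eB] Bx sub]]; rewrite -eB in Bx sub.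
have Sx := nbhs_singleton Sh.
have Wx : W (h x) by move: Bx; rewrite /preimage /= [set_val _]val_lift.
have n1 : \forall w \near x, W (h w) by apply: ch; exact: open_nbhs_nbhs.
apply: filterS2 Sh n1 => w Sw Ww; apply: sub.
by rewrite /preimage /= [set_val _]val_lift.
Qed.

Section CoverChart.
Variables (a : chart R M) (W : set 'rV[R]_2) (V : set 'rV[R]_3).
Variables (th : 'rV[R]_2 -> 'rV[R]_3) (psi : 'rV[R]_3 -> 'rV[R]_2).
Hypothesis pc : piece f k a W V th psi.

Let dom := [set p : T | V (\val p)].

Let dom_open : open dom.
Proof. by apply: open_comp (pc_openV pc) => p _; exact: val_continuous. Qed.

Let coord_img' p : dom p -> W (psi (\val p)).
Proof. by move=> Vp; have [] := pc_psi pc (sphere_val p) Vp. Qed.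

Let param_dom' x : W x -> dom (lift_pt (th x)).
Proof. by move=> Wx; have [Sx Vx _] := pc_th pc Wx; rewrite /dom /= val_lift. Qed.

Let coordK' p : dom p -> lift_pt (th (psi (\val p))) = p.
Proof. by move=> Vp; have [_ ->] := pc_psi pc (sphere_val p) Vp; rewrite lift_val. Qed.

Let paramK' x : W x -> psi (\val (lift_pt (th x))) = x.
Proof. by move=> Wx; have [Sx Vx e] := pc_th pc Wx; rewrite val_lift. Qed.

Let coord_continuous' : {within dom, continuous (fun p => psi (\val p))}.
Proof.
rewrite continuous_open_subspace// => p /set_mem Vp.
apply: (@continuous_comp T 'rV[R]_3 'rV[R]_2 \val psi p); first exact: val_continuous.
exact: continuous_smooth (pc_inv_smooth pc) Vp.
Qed.

Let param_continuous' : {within W, continuous (fun x => lift_pt (th x))}.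
Proof.
rewrite continuous_open_subspace; last exact: pc_openW pc.
move=> x /set_mem Wx; apply: lift_near; first exact: continuous_smooth (pc_smooth pc) Wx.
have nW : \forall w \near x, W w by apply: open_nbhs_nbhs; split; [exact: pc_openW pc|].
by apply: filterS nW => w /(pc_th pc)[].
Qed.

Definition cover_chart : chart R T := Chart dom_open (pc_openW pc) coord_img' param_dom' coordK' paramK'
  coord_continuous' param_continuous'.

End CoverChart.

Definition cover_atlas : set (chart R T) := [set b | exists a W V th psi (pc : piece f k a W V th psi),
  (forall x, W x -> sec (th x) = param a x) /\ b = cover_chart pc].

Lemma cover_nonempty : [set: T] !=set0.
Proof. by exists (lift_pt 0). Qed.

Lemma cover_hausdorff : hausdorff_space T.
Proof.
move=> p q h; apply: val_inj; apply: (@norm_hausdorff _ 'rV[R]_3) => A B nA nB.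
have nA' : nbhs p (\val @^-1` A) by exact: val_continuous.
have nB' : nbhs q (\val @^-1` B) by exact: val_continuous.
by have [w [Aw Bw]] := h _ _ nA' nB'; exists (\val w).
Qed.

Lemma cover_compact : compact [set: T].
Proof.
have -> : [set: T] = lift_pt @` S2.
  apply/seteqP; split=> // p _; exists (\val p); [exact: sphere_val|exact: lift_val].
apply: continuous_compact (sphere_compact k_gt0).
apply/subspace_continuousP => y Sy U [B [[W oW eB] By sub]]; rewrite -eB in By sub.
have Wy : W y by move: By; rewrite /preimage /= [set_val _]val_lift.
have n1 : \forall w \near y, W w by exact: open_nbhs_nbhs.
apply: filterS n1 => w Ww Sw; apply: sub.
by rewrite /preimage /= [set_val _]val_lift.
Qed.

Lemma cover_connected : connected [set: T].
Proof.
have e : [set: T] = \bigcup_(b in [set: bool]) [set lift_pt (patch k b z) | z in [set: 'rV[R]_2]].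
  apply/seteqP; split=> // p _; have Sp := sphere_val p.
  have [b hb] : exists b, height (\val p) != pole k b.
    by case: (patch_cover k_gt0 Sp); [exists true|exists false].
  exists b => //; exists (unpatch k b (\val p)) => //.
  by rewrite (unpatchK k_gt0)// lift_val.
rewrite e; apply: bigcup_connected => [|b _].
  exists (lift_pt (patch k true (pt0 R))) => -[] _; exists (pt0 R) => //.
  by rewrite -(inversion_pt0 R) -(patch_inversion k true (pt0_neq0 R)) inversion_pt0.
apply: connected_continuous_connected; first exact: plane_connected.
apply: continuous_subspaceT => z; apply: lift_near.
  exact: continuous_smooth (patch_smooth k b) I.
by apply: filterE => w; exact: patch_sphere.
Qed.

Lemma cover_atlas_cover p : exists2 b, cover_atlas b & chart_dom b p.
Proof.
have [a [W [V [th [psi [pc Vp _ e]]]]]] := section_piece (sphere_val p) openT I.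
by exists (cover_chart pc) => //; exists a, W, V, th, psi, pc.
Qed.

Lemma cover_atlas_compatible b b' : cover_atlas b -> cover_atlas b' -> compatible b b'.
Proof.
have h a W V th psi (pc : piece f k a W V th psi) a' W' V' th' psi' (pc' : piece f k a' W' V' th' psi') :
    smooth_on (overlap (cover_chart pc) (cover_chart pc')) (coord (cover_chart pc') \o param (cover_chart pc)).
  have oU := open_smooth_preimage (pc_openW pc) (pc_smooth pc) (pc_openV pc').
  have e x : W x -> \val (lift_pt (th x)) = th x by move=> /(pc_th pc)[Sx _ _]; rewrite val_lift.
  have s : smooth_on [set x | W x /\ V' (th x)] (psi' \o th).
    apply: (smooth_on_comp oU (pc_openV pc') _ _ (pc_inv_smooth pc')); first by move=> x [].
    by apply: smooth_on_sub (pc_smooth pc) => x [].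
  apply: (@smooth_on_sub _ _ _ [set x | W x /\ V' (th x)]).
    by move=> x [Wx]; rewrite /preimage /= e.
  by apply: smooth_on_ext s => // x [Wx _]; rewrite /= e.
move=> [a [W [V [th [psi [pc [_ ->]]]]]]] [a' [W' [V' [th' [psi' [pc' [_ ->]]]]]]].
by split; exact: h.
Qed.

Definition cover : closed_surface R := ClosedSurface cover_nonempty cover_hausdorff cover_compact
  cover_connected cover_atlas_cover cover_atlas_compatible.

Definition cover_map : cover -> M := sec \o \val.

Lemma cover_chart_map a W V th psi (pc : piece f k a W V th psi) x :
  (forall x, W x -> sec (th x) = param a x) -> W x -> cover_map (param (cover_chart pc) x) = param a x.
Proof. by move=> e Wx; have [Sx _ _] := pc_th pc Wx; rewrite /cover_map /= val_lift// e. Qed.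

Lemma cover_isometry : isometry_onto_sphere (f \o cover_map) k (\val : cover -> 'rV[R]_3).
Proof.
split.
- split=> [p _|p q _ _|y Sy]; [exact: sphere_val|exact: val_inj|].
  by exists (lift_pt y) => //; rewrite val_lift.
- move=> b [a [W [V [th [psi [pc [e ->]]]]]]].
  apply: smooth_on_ext (pc_smooth pc); first exact: pc_openW pc.
  by move=> x /(pc_th pc)[Sx _ _]; rewrite /= val_lift.
- move=> b [a [W [V [th [psi [pc [e ->]]]]]]] x Wx.
  have nW : \forall w \near x, W w by apply: open_nbhs_nbhs; split; [exact: pc_openW pc|].
  rewrite (@near_eq_smooth _ _ _ _ th); last first.
    by apply: filterS nW => w /(pc_th pc)[Sw _ _]; rewrite /= val_lift.
  rewrite (pc_metric pc Wx); apply: near_eq_smooth.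
  by apply: filterS nW => w Ww; rewrite -[LHS]/(f (param a w)) -(cover_chart_map pc e Ww).
Qed.

Lemma cover_near b x : cover_atlas b -> chart_img b x -> exists a, [/\ atlas a, chart_img a x &
  \forall w \near x, (f \o cover_map \o param b) w = (f \o param a) w].
Proof.
move=> [a [W [V [th [psi [pc [e ->]]]]]]] Wx; exists a; split.
- exact: pc_atlas pc.
- exact: pc_img pc _ Wx.
- have nW : \forall w \near x, W w by apply: open_nbhs_nbhs; split; [exact: pc_openW pc|].
  by apply: filterS nW => w Ww; rewrite -[RHS]/(f (param a w)) -(cover_chart_map pc e Ww).
Qed.

Lemma cover_orientable : orientable cover.
Proof.
apply: (isometry_orientable (f1 := f \o cover_map) _ cover_isometry) => b bb x bx.
have [a [aa ax e]] := cover_near bb bx.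
have e' : \forall w \near x, (f \o param a) w = (f \o cover_map \o param b) w by apply: filterS e => w ->.
by apply: immersive_near e' _; exact: f_immersive.
Qed.

Lemma cover_classified : classified (f \o cover_map).
Proof.
apply: (sphere_classified cover_isometry) => // b bb x bx.
have [a [aa ax e]] := cover_near bb bx; have [h1 h2 h3] := model_germ aa ax.
split; [by rewrite (mean_curv_near e)|by rewrite (gauss_curv_near e)|move=> /h3].
by apply: umbilical_near; apply: filterS e => w ->.
Qed.

Lemma cover_map_continuous : continuous cover_map.
Proof.
move=> p U nU; have n := section_near gs (sphere_val p) nU.
have h : \forall q \near p, S2 (\val q) -> U (sec (\val q)) by exact: (@val_continuous p) n.
by apply: filterS h => q; apply; exact: sphere_val.
Qed.

Lemma cover_map_smooth : smooth_map_on [set: cover] cover_map.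
Proof.
split; first by apply: continuous_subspaceT; exact: cover_map_continuous.
move=> b a' [a [W [V [th [psi [pc [e ->]]]]]]] aa'.
have oab := @open_overlap R M a a'.
have sab := smooth_transition (pc_atlas pc) aa'.
have E x : (chart_img (cover_chart pc) `&` param (cover_chart pc) @^-1` (setT `&` cover_map @^-1` chart_dom a')) x ->
    W x /\ overlap a a' x.
  move=> [Wx [_]]; rewrite /preimage /= => h; split=> //; split; first exact: pc_img pc _ Wx.
  by rewrite /preimage /= -(cover_chart_map pc e Wx).
have oWo : open (W `&` overlap a a') by apply: openI => //; exact: pc_openW pc.
apply: (@smooth_on_sub _ _ _ (W `&` overlap a a')); first by move=> x /E[].
apply: (@smooth_on_ext _ _ _ _ (coord a' \o param a)) => //.
  by move=> x [Wx _]; rewrite -[RHS]/(coord a' (cover_map (param (cover_chart pc) x))) (cover_chart_map pc e Wx).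
by apply: smooth_on_sub sab => x [].
Qed.

Lemma smooth_on_opp n (U : set 'rV[R]_n) (F : 'rV[R]_n -> 'rV[R]_3) : open U -> smooth_on U F ->
  smooth_on U (fun x => - F x).
Proof.
move=> oU sF; apply: smooth_on_ext (smooth_on_mulmx (- 1%:M) oU sF) => // x _.
by rewrite mulmxN mulmx1.
Qed.

(** Over a small open set of M the two sheets are a local inverse of [sec] and its antipode, and the
    fibres contain nothing else. *)
Lemma cover_double_covering :
  (forall y, S2 y -> sec (- y) = sec y) ->
  (forall y y', S2 y -> S2 y' -> sec y = sec y' -> y' = y \/ y' = - y) -> double_covering cover_map.
Proof.
move=> anti fib; split; first exact: cover_map_smooth.
move=> p; have [y Sy ey] := section_surj k_gt0 gs p.
(* Confining the piece to the open half-space around [y] makes the two antipodal sheets disjoint. *)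
pose H := [set w : 'rV[R]_3 | 0 < dot y w].
have oH : open H.
  have sd : smooth_on setT (fun w : 'rV[R]_3 => dot y w).
    by apply: smooth_on_dot; [exact: openT|apply: smooth_on_cst|apply: smooth_on_idfun]; exact: openT.
  by have := open_pos openT sd; congr open; apply/seteqP; split=> [w []|w].
have Hy : H y by rewrite /H /= Sy invr_gt0.
have [a [W [V [th [psi [pc Vy VH e]]]]]] := section_piece Sy oH Hy.
have aa := pc_atlas pc; have oW := pc_openW pc.
pose O := [set q | chart_dom a q /\ W (coord a q)].
pose sg (b : bool) q : cover := lift_pt (if b then th (coord a q) else - th (coord a q)).
have SN w : S2 w -> S2 (- w) by rewrite /sphere /= dotNl dotNr opprK.
have Oth q : O q -> [/\ S2 (th (coord a q)), V (th (coord a q)), psi (th (coord a q)) = coord a q &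
    sec (th (coord a q)) = q].
  move=> [aq Wq]; have [Sq Vq eq_] := pc_th pc Wq; split=> //.
  by rewrite e// coordK.
have val_sg b q : O q -> \val (sg b q) = if b then th (coord a q) else - th (coord a q).
  by move=> /Oth[Sq _ _ _]; rewrite /sg val_lift//; case: b => //; exact: SN.
have oO : open O.
  rewrite openE => q [aq Wq]; exact: near_chart.
have sec_sg b q : O q -> cover_map (sg b q) = q.
  move=> Oq; have [Sq _ _ eq_] := Oth _ Oq; rewrite /cover_map /= val_sg//.
  by case: b => //; rewrite anti.
have Oy : O p.
  have [Wy ty] := pc_psi pc Sy Vy; have ay := pc_img pc Wy.
  have ep : p = param a (psi y) by rewrite -e// ty ey.
  by rewrite ep; split; [exact: param_dom|rewrite paramK].
have img_sg b : sg b @` O = [set q : cover | V (if b then \val q else - \val q)].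
  apply/seteqP; split=> [_ [q Oq <-]|q Vq] /=.
    by rewrite val_sg//; have [_ Vq _ _] := Oth _ Oq; case: b => //; rewrite opprK.
  set w := if b then \val q else - \val q in Vq.
  have Sw : S2 w by rewrite /w; case: (b); [|apply: SN]; exact: sphere_val.
  have [Ww tw] := pc_psi pc Sw Vq; have aw := pc_img pc Ww.
  exists (param a (psi w)); first by split; [exact: param_dom|rewrite paramK].
  apply: val_inj; rewrite val_sg; last by split; [exact: param_dom|rewrite paramK].
  by rewrite paramK// tw /w; case: (b); rewrite ?opprK.
exists O, sg; split=> //.
- move=> b; split; last by move=> q; exact: sec_sg.
    rewrite img_sg; case: b.
      by apply: open_comp (pc_openV pc) => q _; exact: val_continuous.
    apply: (@open_comp _ _ (fun q : T => - \val q)) (pc_openV pc) => q _.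
    by apply: continuousN; exact: val_continuous.
  split.
    rewrite continuous_open_subspace// => q /set_mem Oq.
    have cth : {for q, continuous (th \o coord a)}.
      have [aq Wq] := Oq; apply: continuous_comp; first exact: chart_coord_continuous.
      exact: continuous_smooth (pc_smooth pc) Wq.
    have nO : \forall w \near q, O w by exact: open_nbhs_nbhs.
    apply: (@lift_near M (fun q => if b then th (coord a q) else - th (coord a q))).
      have cN : {for q, continuous ((fun y : 'rV[R]_3 => - y) \o (th \o coord a))}.
        apply: continuous_comp cth _.
        have s := smooth_on_opp openT (@smooth_on_idfun R 3 setT openT).
        exact: continuous_smooth s I.
      case: (b); [exact: cth|exact: cN].
    by apply: filterS nO => w /Oth[Sw _ _ _]; case: (b) => //; exact: SN.
  move=> a' b' aa' [a1 [W1 [V1 [th1 [psi1 [pc1 [e1 ->]]]]]]].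
  have oI := @isometry_transfer R _ M f f_smooth a' a W th aa' aa oW (pc_img pc) (pc_smooth pc) (pc_metric pc).
  have [oU sU _] := oI; set U := [set x | _ /\ _] in oU sU.
  pose G x := if b then (th \o (coord a \o param a')) x else - (th \o (coord a \o param a')) x.
  have sG : smooth_on U G by rewrite /G; case: (b) => //; exact: smooth_on_opp.
  have oUV := open_smooth_preimage oU sG (pc_openV pc1).
  have E x : (chart_img a' `&` param a' @^-1` (O `&` sg b @^-1` chart_dom (cover_chart pc1))) x ->
      U x /\ V1 (G x).
    move=> [a'x [Ox V1x]]; split; first by case: (Ox).
    by move: V1x; rewrite /preimage /= val_sg.
  apply: (@smooth_on_sub _ _ _ [set x | U x /\ V1 (G x)]); first by move=> x /E.
  apply: (@smooth_on_ext _ _ _ _ (psi1 \o G)) => //.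
    move=> x [[a'x Wx] _]; have Ox : O (param a' x) by split=> //; case: a'x.
    by rewrite /= val_sg.
  apply: (smooth_on_comp oUV (pc_openV pc1) _ _ (pc_inv_smooth pc1)); first by move=> x [].
  by apply: smooth_on_sub sG => x [].
- apply/seteqP; split=> q.
    move=> Oq; have [Sq Vq _ eq_] := Oth _ Oq.
    have Sv := sphere_val q; have [h|h] := fib _ _ Sq Sv eq_.
      by left; rewrite img_sg /= h.
    by right; rewrite img_sg /= h opprK.
  by move=> [[w Ow <-]|[w Ow <-]]; rewrite /preimage /= sec_sg.
- apply/seteqP; split=> // q; rewrite !img_sg => -[/= /VH h1 /VH h2].
  by move: h1 h2; rewrite /H /= dotNr oppr_gt0 => h1 /(lt_trans h1); rewrite ltxx.
Qed.

End Calabi.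

Theorem proposition1p1 (R : realType) (N : nat) (M : closed_surface R)
    (f : M -> 'rV[R]_N.+1)
    (f_immersion : sphere_immersion f)
    (f_parallel : everywhere f (fun X x => parallel_mean_curv X x))
    (s : nat) (s_ge1 : (1 <= s)%N) (t : R)
    (S_constant : everywhere f (fun X x => traceless_S X x = t))
    (S_value : everywhere f (fun X x =>
       t = 2 * (s%:R - 1) * (s%:R + 2) / (s%:R * (s%:R + 1))
           * (1 + mean_curv X x ^+ 2))) :
  (orientable M /\ classified f) \/
  (~ orientable M /\
   exists (M' : closed_surface R) (pi : M' -> M),
     [/\ double_covering pi, orientable M' & classified (f \o pi)]).
Proof.
have [c [v [P model]]] := global_model f_immersion f_parallel s_ge1 S_constant S_value.
have [_ f_smooth f_immersive] := f_immersion.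
have k_gt0 := calabi_curv_gt0 s_ge1 model.
have [sec gs] := global_section f_smooth f_immersive k_gt0
  (model_locally_isometric f_immersion s_ge1 model).
have [inj|[anti fib]] := section_dichotomy f_smooth f_immersive k_gt0 gs.
  by left; exact: (injective_case f_immersion s_ge1 model gs inj).
right; split; first exact: (antipodal_nonorientable f_immersion s_ge1 model gs anti).
exists (cover s_ge1 model gs), (cover_map (gs := gs)).
split.
- exact: cover_double_covering.
- exact: cover_orientable.
- exact: cover_classified.
Qed.
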